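(* Assume Hypothesis B (stated in the context) holds. For all sufficiently large $r$, the extremal matroids of rank $r$ of $\mathcal{SL}_4$ and of $\mathcal{AF}_4$ are (up to isomorphism) exactly $T_r^2$ and $G_r$. Consequently $h_{\mathcal{SL}_4}(r)=h_{\mathcal{AF}_4}(r)=\binom{r+3}{2}-5$ for all sufficiently large $r$.
   Context: $\mathcal{AF}_4$ is the class of matroids representable over every field with at least $4$ elements. $\mathcal{SL}_4$ is the class of $\mathrm{GF}(4)$-representable matroids $M$ for which there is a prime power $q$ such that $M$ is representable over every field with at least $q$ elements. For a minor-closed class $\mathcal{M}$, $h_{\mathcal{M}}(r)$ is the maximum number of elements of a simple matroid in $\mathcal{M}$ of rank at most $r$; an extremal matroid of $\mathcal{M}$ is a simple rank-$r$ matroid in $\mathcal{M}$ with $h_{\mathcal{M}}(r)$ rank-one flats. Over $\mathrm{GF}(4)$ let $\alpha^2=\alpha+1$. $D_n$ is the $n\times\binom n2$ matrix whose columns are all distinct with exactly two nonzero entries, the first $1$ and the second $-1$. $\bar c$ is a constant row vector of entries $c$. $T_r^2$ is the column matroid of $\big[I_r \mid \binom{\bar 0}{D_{r-1}}\mid\binom{\bar 1}{I_{r-1}}\mid\binom{\bar\alpha}{I_{r-1}}\mid\binom{\bar{\alpha^2}}{I_{r-1}}\big]$ (one top row, $r-1$ lower rows). $G_r$ is the column matroid of $\big[I_r\mid (\bar0;\bar0;D_{r-2})\mid(\bar1;\bar0;I_{r-2})\mid(\bar0;\bar1;I_{r-2})\mid(\bar\alpha;\bar0;I_{r-2})\mid(\bar0;\bar\alpha;I_{r-2})\mid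 c_1\mid c_2\mid c_3\big]$ (two top rows, $r-2$ lower rows), where $c_1,c_2,c_3$ have top entries $(1,1),(1,\alpha),(1,\alpha^2)$ and zeros below. Represented matroids: for a field $\mathbb{F}$, an $\mathbb{F}$-represented matroid is a pair $(E,U)$, $U$ a subspace of $\mathbb{F}^E$, represented by any matrix $A$ with row space $U$ ($M(A)$); dual $(E,U^\perp)$; $M|X=(X,U|X)$, $M\backslash X=M|(E-X)$, $M/X=(M^*\backslash X)^*$; simplicity, connectivity, minors come from the abstract column matroid. $\mathbb{F}_p$ is the prime subfield. A matroid is vertically $k$-connected if for every $X\subseteq E$ with $r(X)+r(E-X)-r(M)<k$, $X$ or $E-X$ is spanning; cyclically $k$-connected if its dual is vertically $k$-connected. Frame templates: for $\Gamma\le\mathbb{F}^\times$, a $\Gamma$-frame matrix has at most two nonzero entries per column, each nonzero column contains a $1$, and a second nonzero entry (if any) equals $-\gamma$, $\gamma\in\Gamma$. A frame template over $\mathbb{F}$ is $\Phi=(\Gamma,C,X,Y_0,Y_1,A_1,\Delta,\Lambda)$ with $\Gamma\le\mathbb{F}^\times$; $C,X,Y_0,Y_1$ pairwise disjoint finite sets; $A_1\in\mathbb{F}^{X\times(C\cup Y_0\cup Y_1)}$; $\Lambda\le\mathbb{F}^X$, $\Delta\le\mathbb{F}^{C\cup Y_0\cup Y_1}$ additive subgroups closed under scaling by $\Gamma$. $A'\in\mathbb{F}^{B\times E}$ respects $\Phi$ if $X\subseteq B$, $C,Y_0,Y_1\subseteq E$, $A'[X,C\cup Y_0\cup Y_1]=A_1$,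 and there is $Z\subseteq E-(C\cup Y_0\cup Y_1)$ with $A'[X,Z]=0$, columns of $A'[B-X,Z]$ unit vectors, $A'[B-X,E-(C\cup Y_0\cup Y_1\cup Z)]$ a $\Gamma$-frame matrix, columns of $A'[X,E-(C\cup Y_0\cup Y_1\cup Z)]$ in $\Lambda$, rows of $A'[B-X,C\cup Y_0\cup Y_1]$ in $\Delta$. $A$ conforms to $\Phi$ if for some such $A',Z$: $A[B,E-Z]=A'[B,E-Z]$ and each column $i\in Z$ of $A$ is the sum of columns $i$ and some $j\in Y_1$ of $A'$. An $\mathbb{F}$-represented matroid conforms to $\Phi$ if isomorphic to $M(A)/C\backslash Y_1$ for some conforming $A$; $\mathcal{M}(\Phi)$ is the set of these. Hypothesis B: for every finite field $\mathbb{F}$, positive integer $m$, and minor-closed class $\mathcal{M}$ of $\mathbb{F}$-represented matroids, there exist $k,n\in\mathbb{Z}_+$ and frame templates $\Phi_1,\dots,\Phi_s,\Psi_1,\dots,\Psi_t$ over $\mathbb{F}$ with (1) $\mathcal{M}\supseteq\mathcal{M}(\Phi_i)$; (2) $\mathcal{M}$ contains duals of members of each $\mathcal{M}(\Psi_j)$; (3) every simple vertically $k$-connected $M\in\mathcal{M}$ with an $M(K_n)$-minor but no $\mathrm{PG}(m-1,\mathbb{F}_p)$-minor lies in some $\mathcal{M}(\Phi_i)$; (4) for every cosimple cyclically $k$-connected $M\in\mathcal{M}$ with an $M^*(K_n)$-minor but no $\mathrm{PG}(m-1,\mathbb{F}_p)$-minor, $M^*$ lies in some $\mathcal{M}(\Psi_j)$.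 *)

(* Defs.v *)
From HB Require Import structures.
From mathcomp Require Import all_boot all_order all_fingroup all_algebra.
From mathcomp Require Import zify.

Set Implicit Arguments.
Unset Strict Implicit.
Unset Printing Implicit Defensive.

Import GRing.Theory.
Local Open Scope ring_scope.

Record matroid := Matroid {
  ground :> finType;
  rk : {set ground} -> nat;
  rk_le_card : forall X, (rk X <= #|X|)%N;
  rkS : forall X Y : {set ground}, X \subset Y -> (rk X <= rk Y)%N;
  rk_submod : forall X Y : {set ground},
    (rk (X :|: Y) + rk (X :&: Y) <= rk X + rk Y)%N
}.

Definition rank (M : matroid) : nat := rk [set: M].

Definition isomorphic (M N : matroid) : Prop :=
  exists2 f : M -> N, bijective f & forall X : {set M}, rk (f @: X) = rk X.

(* no loops and no parallel pairs *)
Definition simple (M : matroid) : Prop :=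
  forall X : {set M}, (#|X| <= 2)%N -> rk X = #|X|.

Definition flat (M : matroid) (X : {set M}) : bool :=
  [forall x, (x \notin X) ==> (rk X < rk (x |: X))%N].

Definition num_rank1_flats (M : matroid) : nat :=
  #|[set X : {set M} | flat X && (rk X == 1%N)]|.

Definition vertically_connected (k : nat) (M : matroid) : Prop :=
  forall X : {set M}, (rk X + rk (~: X) - rank M < k)%N ->
    rk X = rank M \/ rk (~: X) = rank M.

Section Dual.
Variable M : matroid.
Implicit Types X Y : {set M}.

Definition dual_rk X : nat := (#|X| + rk (~: X) - rank M)%N.

Lemma rank_le_compl X : (rank M <= #|X| + rk (~: X))%N.
Proof.
have := rk_submod X (~: X); rewrite setUCr -/(rank M).
by have := rk_le_card X; lia.
Qed.

Lemma dual_rk_le_card X : (dual_rk X <= #|X|)%N.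
Proof. by rewrite /dual_rk; have := rkS (subsetT (~: X)); rewrite -/(rank M); lia. Qed.

Lemma dual_rkS X Y : X \subset Y -> (dual_rk X <= dual_rk Y)%N.
Proof.
move=> sXY; rewrite /dual_rk.
have := rk_submod (Y :\: X) (~: Y).
have -> : (Y :\: X) :|: ~: Y = ~: X.
  apply/setP=> x; rewrite !inE; case xX: (x \in X) => //=; last by case: (x \in Y).
  by rewrite (subsetP sXY _ xX).
have := rk_le_card (Y :\: X); have := cardsID X Y.
by rewrite (setIidPr sXY); lia.
Qed.

Lemma dual_rk_submod X Y :
  (dual_rk (X :|: Y) + dual_rk (X :&: Y) <= dual_rk X + dual_rk Y)%N.
Proof.
rewrite /dual_rk setCU setCI.
have := rk_submod (~: X) (~: Y); have := cardsUI X Y.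
have := rank_le_compl X; have := rank_le_compl Y.
have := rank_le_compl (X :|: Y); have := rank_le_compl (X :&: Y).
by rewrite setCU setCI; lia.
Qed.

Definition dual : matroid := Matroid dual_rk_le_card dual_rkS dual_rk_submod.

End Dual.

Section Minor.
Variables (M : matroid) (C D : {set M}).
Let G : finType := {x : M | x \notin C :|: D}.
Implicit Types X Y : {set G}.

Definition minor_rk X : nat := (rk ((val @: X) :|: C) - rk C)%N.

Let rkC X : (rk C <= rk ((val @: X) :|: C))%N.
Proof. exact/rkS/subsetUr. Qed.

Lemma minor_rk_le_card X : (minor_rk X <= #|X|)%N.
Proof.
have h1 := rk_submod (val @: X) C.
have h2 : (rk (val @: X) <= #|X|)%N.
  by rewrite -(card_imset (mem X) val_inj) rk_le_card.
rewrite /minor_rk leq_subLR; apply: leq_trans (leq_addr _ _) _.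
by apply: leq_trans h1 _; rewrite addnC leq_add2l.
Qed.

Lemma minor_rkS X Y : X \subset Y -> (minor_rk X <= minor_rk Y)%N.
Proof. by move=> sXY; apply/leq_sub2r/rkS/setSU/imsetS. Qed.

Lemma minor_rk_submod X Y :
  (minor_rk (X :|: Y) + minor_rk (X :&: Y) <= minor_rk X + minor_rk Y)%N.
Proof.
have arith a b c d e : (e <= a -> e <= b -> e <= c -> e <= d -> a + b <= c + d ->
  a - e + (b - e) <= c - e + (d - e))%N by lia.
apply: arith; rewrite ?rkC //.
rewrite imsetU (imsetI (in2W val_inj)) setUUl setUIl.
exact: rk_submod.
Qed.

(* M / C \ D *)
Definition minor : matroid :=
  Matroid minor_rk_le_card minor_rkS minor_rk_submod.

End Minor.

Definition has_minor (M N : matroid) : Prop :=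
  exists C D : {set M}, [disjoint C & D] /\ isomorphic (minor C D) N.

Section Columns.
Variables (F : fieldType) (B E : finType) (A : B -> E -> F).
Implicit Types X Y : {set E}.

Definition column (e : E) : {ffun B -> F^o} := [ffun b => A b e].

Definition column_span X : {vspace {ffun B -> F^o}} := <<[seq column e | e in X]>>%VS.

Definition column_rk X : nat := \dim (column_span X).

Lemma column_rk_le_card X : (column_rk X <= #|X|)%N.
Proof. by rewrite (leq_trans (dim_span _)) ?size_map -?cardE. Qed.

Lemma column_spanS X Y : X \subset Y -> (column_span X <= column_span Y)%VS.
Proof.
move=> sXY; apply: sub_span => _ /imageP[e eX ->].
by apply: image_f; apply: (subsetP sXY).
Qed.

Lemma column_rkS X Y : X \subset Y -> (column_rk X <= column_rk Y)%N.
Proof. by move=> sXY; apply/dimvS/column_spanS. Qed.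

Lemma column_rk_submod X Y :
  (column_rk (X :|: Y) + column_rk (X :&: Y) <= column_rk X + column_rk Y)%N.
Proof.
rewrite /column_rk -(dimv_sum_cap (column_span X)); apply: leq_add; apply: dimvS.
  apply/span_subvP=> _ /imageP[e + ->]; rewrite inE => /orP[] eX.
    by apply: subvP (addvSl _ _) _ (memv_span (image_f _ eX)).
  by apply: subvP (addvSr _ _) _ (memv_span (image_f _ eX)).
by rewrite subv_cap !column_spanS ?subsetIl ?subsetIr.
Qed.

Definition column_matroid : matroid :=
  Matroid column_rk_le_card column_rkS column_rk_submod.

End Columns.

Definition representable (F : fieldType) (M : matroid) : Prop :=
  exists (B : finType) (A : B -> M -> F),
    forall X : {set M}, rk X = column_rk A X.

Definition at_least (q : nat) (F : eqType) : Prop :=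
  exists s : seq F, uniq s /\ size s = q.

Definition prime_power (q : nat) : Prop :=
  exists p k : nat, [/\ prime p, (0 < k)%N & q = (p ^ k)%N].

Definition AF4 (M : matroid) : Prop :=
  forall F : fieldType, at_least 4 F -> representable F M.

(* F4 stands for GF(4) *)
Definition SL4 (F4 : fieldType) (M : matroid) : Prop :=
  representable F4 M /\
  exists2 q : nat, prime_power q &
    forall F : fieldType, at_least q F -> representable F M.

(* h_P(r) = n *)
Definition is_h (P : matroid -> Prop) (r n : nat) : Prop :=
  (exists M : matroid, [/\ P M, simple M, (rank M <= r)%N & #|M| = n]) /\
  (forall M : matroid, P M -> simple M -> (rank M <= r)%N -> (#|M| <= n)%N).

Definition extremal (P : matroid -> Prop) (r : nat) (M : matroid) : Prop :=
  [/\ P M, simple M, rank M = r & is_h P r (num_rank1_flats M)].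

Definition hcat (F B E1 E2 : Type) (A1 : B -> E1 -> F) (A2 : B -> E2 -> F) :
    B -> E1 + E2 -> F :=
  fun b e => match e with inl e1 => A1 b e1 | inr e2 => A2 b e2 end.

Definition vcat (F B1 B2 E : Type) (A1 : B1 -> E -> F) (A2 : B2 -> E -> F) :
    B1 + B2 -> E -> F :=
  fun b e => match b with inl b1 => A1 b1 e | inr b2 => A2 b2 e end.

Definition cst (F B E : Type) (c : F) : B -> E -> F := fun _ _ => c.

Definition ident_mat (F : fieldType) (B : finType) : B -> B -> F :=
  fun b c => (b == c)%:R.

Definition edge (n : nat) : finType := {p : 'I_n * 'I_n | (p.1 < p.2)%N}.

Definition Dmx (F : fieldType) (n : nat) : 'I_n -> edge n -> F :=
  fun i e => if i == (val e).1 then 1 else if i == (val e).2 then -1 else 0.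

(* only meaningful for r >= 1 *)
Definition T2mx (F : fieldType) (a : F) (r : nat) :=
  let top c := cst c : 'I_1 -> 'I_(r - 1) -> F in
  let I := @ident_mat F 'I_(r - 1) in
  hcat (@ident_mat F ('I_1 + 'I_(r - 1))%type)
  (hcat (vcat (cst 0) (@Dmx F (r - 1)))
  (hcat (vcat (top 1) I)
  (hcat (vcat (top a) I)
        (vcat (top (a ^+ 2)) I)))).

Definition T2 (F : fieldType) (a : F) (r : nat) : matroid :=
  column_matroid (@T2mx F a r).

(* only meaningful for r >= 2 *)
Definition Gmx (F : fieldType) (a : F) (r : nat) :=
  let top c := cst c : 'I_1 -> 'I_(r - 2) -> F in
  let I := @ident_mat F 'I_(r - 2) in
  let c_ x y : 'I_1 + ('I_1 + 'I_(r - 2)) -> 'I_1 -> F :=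
    vcat (cst x) (vcat (cst y) (cst 0)) in
  hcat (@ident_mat F ('I_1 + ('I_1 + 'I_(r - 2)))%type)
  (hcat (vcat (cst 0) (vcat (cst 0) (@Dmx F (r - 2))))
  (hcat (vcat (top 1) (vcat (top 0) I))
  (hcat (vcat (top 0) (vcat (top 1) I))
  (hcat (vcat (top a) (vcat (top 0) I))
  (hcat (vcat (top 0) (vcat (top a) I))
  (hcat (c_ 1 1) (hcat (c_ 1 a) (c_ 1 (a ^+ 2))))))))).

Definition Gr (F : fieldType) (a : F) (r : nat) : matroid :=
  column_matroid (@Gmx F a r).

Section CycleMatroid.
Variable n : nat.
Implicit Types (X Y : {set edge n}) (e : edge n).

Definition adj X : rel 'I_n :=
  fun i j => [exists e in X, (val e == (i, j)) || (val e == (j, i))].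

Definition component X (i : 'I_n) : {set 'I_n} := [set j | connect (adj X) i j].

Definition components X : {set {set 'I_n}} := [set component X i | i : 'I_n].

Definition cycle_rk X : nat := (n - #|components X|)%N.

Let joined X e := connect (adj X) (val e).1 (val e).2.

Let adj_sym X : symmetric (adj X).
Proof. by move=> i j; apply: eq_existsb => e; rewrite orbC. Qed.

Let conn_sym X : connect_sym (adj X).
Proof. exact/sym_connect_sym/adj_sym. Qed.

Let conn_sub X Y : X \subset Y -> subrel (connect (adj X)) (connect (adj Y)).
Proof.
move=> sXY; apply: connect_sub => i j /exists_inP[e eX h]; apply: connect1.
by apply/exists_inP; exists e => //; apply: (subsetP sXY).
Qed.

Let componentP X i j :
  reflect (component X i = component X j) (connect (adj X) i j).
Proof.
apply: (iffP idP) => [cij | eqC].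
  by apply/setP=> k; rewrite !inE (same_connect (conn_sym X) cij).
have : j \in component X j by rewrite inE connect0.
by rewrite -eqC inE.
Qed.

Let conn_add X e i j : connect (adj (e |: X)) i j =
  [|| connect (adj X) i j,
      connect (adj X) i (val e).1 && connect (adj X) (val e).2 j |
      connect (adj X) i (val e).2 && connect (adj X) (val e).1 j].
Proof.
have sub : subrel (connect (adj X)) (connect (adj (e |: X))).
  exact/conn_sub/subsetUr.
have ce : connect (adj (e |: X)) (val e).1 (val e).2.
  apply/connect1/exists_inP; exists e; first exact: setU11.
  by rewrite -surjective_pairing eqxx.
have ce' : connect (adj (e |: X)) (val e).2 (val e).1 by rewrite conn_sym.
apply/idP/idP; last first.
  case/or3P=> [/sub//|/andP[/sub h1 /sub h2]|/andP[/sub h1 /sub h2]].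
    exact: connect_trans h1 (connect_trans ce h2).
  exact: connect_trans h1 (connect_trans ce' h2).
case/connectP=> p + ->; elim: p i => [|k p IH] i /=; first by rewrite connect0.
case/andP=> aik /IH {IH}; move: (last k p) => l; set a := (val e).1; set b := (val e).2.
move: aik => /exists_inP[e']; rewrite in_setU1 => /orP[/eqP -> | e'X] he'.
  have [[-> ->]|[-> ->]] : (i = a /\ k = b) \/ (i = b /\ k = a).
    by rewrite /a /b; case/orP: he' => /eqP ->; [left|right].
    rewrite !connect0 /= => /or3P[->|/andP[_ ->]|->]; rewrite ?orbT //.
  rewrite !connect0 /= => /or3P[->|->|/andP[_ ->]]; rewrite ?orbT //.
have cik : connect (adj X) i k by apply/connect1/exists_inP; exists e'.
by rewrite !(same_connect (conn_sym X) cik).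
Qed.

Let components0 : #|components set0| = n.
Proof.
rewrite card_imset ?card_ord // => i j /componentP/connectP[[|k p] //=].
by case/andP=> /exists_inP[e]; rewrite inE.
Qed.

Let components_joined X e : joined X e -> components (e |: X) = components X.
Proof.
move=> je; have eqc : component (e |: X) =1 component X.
  move=> i; apply/setP=> j; rewrite !inE conn_add.
  rewrite (conn_sym X i (val e).1) (conn_sym X i (val e).2).
  rewrite !(same_connect (conn_sym X) je).
  rewrite orbb; apply: orb_idr => /andP[h1 h2].
  by apply: connect_trans h2; rewrite conn_sym.
exact: eq_imset.
Qed.

Let components_new X e :
  ~~ joined X e -> #|components X| = #|components (e |: X)|.+1.
Proof.
move=> nje; set a := (val e).1; set b := (val e).2.
set Ca := component X a; set Cb := component X b.
have CaX : Ca \in components X by apply: imset_f.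
rewrite (cardsD1 Ca) CaX add1n; congr _.+1; apply/esym.
pose g (S : {set 'I_n}) := if (S == Ca) || (S == Cb) then Ca :|: Cb else S.
have gE i : g (component X i) = component (e |: X) i.
  rewrite /g.
  have EC c : (component X i == component X c) = connect (adj X) i c.
    by apply/eqP/idP=> /componentP.
  rewrite /Ca /Cb !EC; apply/setP=> j; rewrite [RHS]inE conn_add -/a -/b.
  case ia: (connect (adj X) i a).
    rewrite !inE /= -(same_connect (conn_sym X) ia).
    case ib: (connect (adj X) i b) => //=; last by rewrite orbF.
    by move: nje; rewrite /joined -/a -/b -(same_connect (conn_sym X) ia) ib.
  case ib: (connect (adj X) i b); last by rewrite /= !inE !orbF.
  by rewrite !inE /= -(same_connect (conn_sym X) ib) orbC.
have neCab : Cb != Ca by apply: contra nje => /eqP/esym/componentP.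
have -> : components (e |: X) = g @: (components X :\ Ca).
  apply/setP=> S; apply/imsetP/imsetP=> [[i _ ->] | [T]].
    case: (eqVneq (component X i) Ca) => [iCa | iCa].
      exists Cb; first by rewrite !inE neCab imset_f.
      by rewrite -gE iCa /g !eqxx orbT.
    by exists (component X i); rewrite ?gE // !inE iCa imset_f.
  by rewrite !inE => /andP[_ /imsetP[i _ ->]] ->; exists i.
rewrite card_in_imset // => S T.
rewrite !inE => /andP[SCa /imsetP[i _ Si]] /andP[TCa /imsetP[j _ Tj]].
rewrite /g (negPf SCa) (negPf TCa) /=.
have sub k : component X k = Ca :|: Cb -> component X k = Ca.
  move=> kE; apply/componentP; have : a \in component X k.
    by rewrite kE !inE connect0.
  by rewrite inE.
case: eqP => [->|_]; case: eqP => [->|_] // E.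
  by move: TCa; rewrite Tj (sub j) ?eqxx // -Tj.
by move: SCa; rewrite Si (sub i) ?eqxx // -Si.
Qed.

Let components_le X : (#|components X| <= n)%N.
Proof. by rewrite (leq_trans (leq_imset_card _ _)) ?card_ord. Qed.

Let cycle_rkU1 X e : cycle_rk (e |: X) = (cycle_rk X + ~~ joined X e)%N.
Proof.
rewrite /cycle_rk; case: (boolP (joined X e)) => [/components_joined -> | h].
  by rewrite addn0.
by have := components_new h; have := components_le X; lia.
Qed.

Let joinedS X Y e : X \subset Y -> joined X e -> joined Y e.
Proof. by move=> sXY; apply: conn_sub. Qed.

Let set_ind1 (P : {set edge n} -> Prop) :
  P set0 -> (forall X e, P X -> P (e |: X)) -> forall X, P X.
Proof.
move=> P0 PU X; have [k] := ubnP #|X|; elim: k X => // k IH X leX.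
case: (set_0Vmem X) => [-> // | [e eX]]; rewrite -(setD1K eX).
by apply/PU/IH; move: leX; rewrite (cardsD1 e) eX; lia.
Qed.

Lemma cycle_rk_le_card X : (cycle_rk X <= #|X|)%N.
Proof.
have [k] := ubnP #|X|; elim: k X => // k IH X leX.
case: (set_0Vmem X) => [-> | [e eX]]; first by rewrite /cycle_rk components0 subnn.
rewrite -[X in cycle_rk X](setD1K eX) cycle_rkU1 (cardsD1 e X) eX addnC.
apply: leq_add; first exact: leq_b1.
by apply: IH; move: leX; rewrite (cardsD1 e) eX; lia.
Qed.

Let cycle_rk_exch (A B Y : {set edge n}) : A \subset B ->
  (cycle_rk (Y :|: B) + cycle_rk A <= cycle_rk (Y :|: A) + cycle_rk B)%N.
Proof.
move=> sAB; elim/set_ind1: Y => [|Y e IH]; first by rewrite !set0U addnC.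
rewrite -!setUA !cycle_rkU1.
have : (~~ joined (Y :|: B) e <= ~~ joined (Y :|: A) e)%N.
  case j: (joined (Y :|: A) e); last by case: joined.
  by rewrite (joinedS _ j) // setUS.
lia.
Qed.

Lemma cycle_rkS X Y : X \subset Y -> (cycle_rk X <= cycle_rk Y)%N.
Proof.
move=> sXY; rewrite -(setUidPl sXY); elim/set_ind1: (Y) => [|Z e IH].
  by rewrite set0U.
by rewrite -setUA cycle_rkU1; lia.
Qed.

Lemma cycle_rk_submod X Y :
  (cycle_rk (X :|: Y) + cycle_rk (X :&: Y) <= cycle_rk X + cycle_rk Y)%N.
Proof.
have := cycle_rk_exch Y (subsetIl X Y).
by rewrite setUC (setUidPl (subsetIr X Y)) addnC [X in (_ <= X)%N]addnC addnC.
Qed.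

(* the cycle matroid M(K_n), through its rank function: n minus the number of
   connected components of the graph on 'I_n with edge set X *)
Definition MK : matroid :=
  Matroid cycle_rk_le_card cycle_rkS cycle_rk_submod.

End CycleMatroid.

(* One vector for each point of the projective space: the representative whose
   first nonzero coordinate is 1. *)
Definition pg_point (q : finFieldType) (m : nat) (v : 'rV[q]_m) : bool :=
  [exists i, (v 0 i == 1) && [forall j : 'I_m, (j < i)%N ==> (v 0 j == 0)]].

(* PG(m-1, q) *)
Definition PG (q : finFieldType) (m : nat) : matroid :=
  column_matroid
    (fun (i : 'I_m) (v : {v : 'rV[q]_m | pg_point v}) => val v 0 i).

Record rmatroid (F : fieldType) := RMatroid {
  rground : finType;
  rspace : {vspace {ffun rground -> F^o}}
}.

(* M(A) *)
Definition rmat (F : fieldType) (B E : finType) (A : B -> E -> F) : rmatroid F :=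
  RMatroid <<[seq ([ffun e => A b e] : {ffun E -> F^o}) | b <- enum B]>>%VS.

(* The abstract column matroid does not depend on the choice of a matrix with
   the given row space; we take the one whose rows are the chosen basis. *)
Definition abs (F : fieldType) (M : rmatroid F) : matroid :=
  column_matroid
    (fun (i : 'I_(\dim (rspace M))) (e : rground M) => tnth (vbasis (rspace M)) i e).

Section Orthogonal.
Variables (F : fieldType) (E : finType).
Implicit Types u v : {ffun E -> F^o}.

Definition dot u v : F^o := \sum_e (u e : F) * (v e : F).

Fact dot_is_linear u : linear (dot u).
Proof.
move=> a v w; rewrite /dot scaler_sumr -big_split; apply: eq_bigr => e _.
by rewrite !ffunE mulrDr /= [in LHS]/GRing.scale /= mulrCA.
Qed.
HB.instance Definition _ u :=
  GRing.isLinear.Build F {ffun E -> F^o} F^o *:%R (dot u) (dot_is_linear u).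

Definition orth (U : {vspace {ffun E -> F^o}}) : {vspace {ffun E -> F^o}} :=
  (\bigcap_(i < \dim U) lker (linfun (dot (tnth (vbasis U) i))))%VS.

Lemma orthP (U : {vspace {ffun E -> F^o}}) v : reflect (forall u, u \in U -> dot u v = 0) (v \in orth U).
Proof.
apply: (iffP idP) => [vU u /coord_vbasis -> | h].
  rewrite /dot.
  under eq_bigr => e _ do rewrite sum_ffunE mulr_suml.
  rewrite exchange_big big1 // => i _.
  under eq_bigr => e _ do rewrite ffunE -mulrA.
  rewrite -mulr_sumr.
  have /subv_bigcapP/(_ i isT) : (<[v]> <= orth U)%VS by rewrite -memvE.
  rewrite -memvE memv_ker lfunE /= /dot (tnth_nth 0) => /eqP ->.
  by rewrite mulr0.
rewrite memvE; apply/subv_bigcapP => i _.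
by rewrite -memvE memv_ker lfunE /= h // vbasis_mem ?mem_tnth.
Qed.

Variable X : {set E}.

Definition restr u : {ffun {x : E | x \in X} -> F^o} := [ffun x => u (val x)].

Fact restr_is_linear : linear restr.
Proof. by move=> a u v; apply/ffunP=> x; rewrite !ffunE. Qed.
HB.instance Definition _ :=
  GRing.isLinear.Build F {ffun E -> F^o} {ffun {x : E | x \in X} -> F^o}
    *:%R restr restr_is_linear.

End Orthogonal.

Section RepresentedOps.
Variable F : fieldType.
Implicit Types M N : rmatroid F.

Definition rdual M : rmatroid F := RMatroid (orth (rspace M)).

Definition rrestr M (X : {set rground M}) : rmatroid F :=
  RMatroid (linfun (restr X) @: rspace M)%VS.

Definition rdelete M (X : {set rground M}) : rmatroid F := rrestr (~: X).

Definition rcontract M (X : {set rground M}) : rmatroid F :=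
  rdual (@rdelete (rdual M) X).

(* Represented matroids are identified up to relabelling the ground set and
   projective equivalence, i.e. scaling coordinates by nonzero elements of F. *)
Definition risomorphic M N : Prop :=
  exists (f : rground M -> rground N) (s : rground M -> F),
    [/\ bijective f, forall e, s e != 0 &
      forall u : {ffun rground N -> F^o},
        (u \in rspace N) = ([ffun e => s e * u (f e)] \in rspace M)].

Definition minor_closed (P : rmatroid F -> Prop) : Prop :=
  [/\ forall M N, risomorphic M N -> P M -> P N,
      forall M (X : {set rground M}), P M -> P (rdelete X) &
      forall M (X : {set rground M}), P M -> P (rcontract X)].

End RepresentedOps.

Section FrameTemplates.
Variable F : finFieldType.

(* The pairwise disjoint sets C, Y0, Y1 are the summands of tC + tY0 + tY1. *)
Record template := Template {
  tG : {group {unit F}};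
  tC : finType;
  tX : finType;
  tY0 : finType;
  tY1 : finType;
  tA1 : tX -> tC + tY0 + tY1 -> F;
  tDelta : {set {ffun tC + tY0 + tY1 -> F}};
  tLambda : {set {ffun tX -> F}};
  tDelta_add : zmod_closed tDelta;
  tLambda_add : zmod_closed tLambda;
  tDelta_scale : forall g v, g \in tG -> v \in tDelta ->
    [ffun c => val g * v c] \in tDelta;
  tLambda_scale : forall g v, g \in tG -> v \in tLambda ->
    [ffun x => val g * v x] \in tLambda
}.

Definition frame_column (G : {group {unit F}}) (B : finType) (v : B -> F) : Prop :=
  (#|[set b | v b != 0%R]| <= 2)%N /\
  ((exists b, v b != 0) ->
   exists2 b, v b = 1 & forall b', b' != b -> v b' != 0 ->
     exists2 g, g \in G & v b' = - val g).

Variable Phi : template.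
Let K : finType := (tC Phi + tY0 Phi + tY1 Phi)%type.

(* A' has rows B = X + B' and columns E = (C + Y0 + Y1) + E'. *)
Record respects (B' E' : finType) (A' : tX Phi + B' -> K + E' -> F) (Z : {set E'}) :
    Prop := Respects {
  resp_A1 : forall x c, A' (inl x) (inl c) = tA1 x c;
  resp_Z0 : forall x z, z \in Z -> A' (inl x) (inr z) = 0;
  resp_Zunit : forall z, z \in Z ->
    exists b, forall b', A' (inr b') (inr z) = (b' == b)%:R;
  resp_frame : forall e, e \notin Z ->
    frame_column (tG Phi) (fun b => A' (inr b) (inr e));
  resp_Lambda : forall e, e \notin Z ->
    [ffun x => A' (inl x) (inr e)] \in tLambda Phi;
  resp_Delta : forall b, [ffun c => A' (inr b) (inl c)] \in tDelta Phi
}.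

Definition matrix_conforms (B' E' : finType) (A : tX Phi + B' -> K + E' -> F) : Prop :=
  exists (A' : tX Phi + B' -> K + E' -> F) (Z : {set E'}),
    [/\ respects A' Z,
        forall i c, A i (inl c) = A' i (inl c),
        forall i e, e \notin Z -> A i (inr e) = A' i (inr e) &
        forall z, z \in Z -> exists y : tY1 Phi, forall i,
          A i (inr z) = A' i (inr z) + A' i (inl (inr y))].

Definition Cset (E' : finType) : {set (K + E')%type} :=
  [set inl (inl (inl c)) | c : tC Phi].

Definition Y1set (E' : finType) : {set (K + E')%type} :=
  [set inl (inr y) | y : tY1 Phi].

(* membership in M(Phi) *)
Definition conforms (M : rmatroid F) : Prop :=
  exists (B' E' : finType) (A : tX Phi + B' -> K + E' -> F),
    matrix_conforms A /\
    let N := @rcontract F (rmat A) (Cset E') in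
    risomorphic M (@rdelete F N [set x | val x \in Y1set E']).

End FrameTemplates.

Definition HypothesisB : Prop :=
  forall (F : finFieldType) (p : nat), p \in [pchar F] ->
  forall m : nat, (0 < m)%N ->
  forall P : rmatroid F -> Prop, minor_closed P ->
  exists (k n : nat) (s t : nat) (Phi : 'I_s -> template F) (Psi : 'I_t -> template F),
    (0 < k)%N /\ (0 < n)%N /\
    [/\ forall i M, conforms (Phi i) M -> P M,
        forall j M, conforms (Psi j) M -> P (rdual M),
        forall M, P M -> simple (abs M) -> vertically_connected k (abs M) ->
          has_minor (abs M) (MK n) -> ~ has_minor (abs M) (PG 'F_p m) ->
          exists i, conforms (Phi i) M &
        forall M, P M -> simple (dual (abs M)) ->
          vertically_connected k (dual (abs M)) ->
          has_minor (abs M) (dual (MK n)) -> ~ has_minor (abs M) (PG 'F_p m) ->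
          exists j, conforms (Psi j) (rdual M)].

(* Main.v *)
Require Import Defs.
From HB Require Import structures.
From mathcomp Require Import all_boot all_order all_fingroup all_algebra.
From mathcomp Require Import ssrAC finfield zify ring lra.

Set Implicit Arguments.
Unset Strict Implicit.
Unset Printing Implicit Defensive.

Import Order.TTheory GRing.Theory Num.Theory.
Local Open Scope ring_scope.

(** Every member of SL_4 is representable over GF(4) and over the rationals, and
    the GF(4)-represented matroids with a rational representation form a
    minor-closed class without PG(2,2).  In this class a simple matroid of rank r
    with at least r^2 / 3 + O(1) elements has an M(K_n)-minor, so by Hypothesis B
    the large highly connected members conform to one of finitely many frame
    templates all of whose members are rational.

    In such a template rationality trivialises the group (an element of order
    three would give a rational cube root of unity), so all but boundedly many
    elements are differences phi p - phi q of points of a finite set.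
    Rationality also forbids most affine configurations of these points: at most
    d + 3 of them have differences spanning a space of dimension d, and equality
    forces either four points on a line with coordinates 0, 1, alpha, alpha^2
    or two lines meeting in a point o, each carrying two further points with
    coordinates 1, alpha.  The matroids of all differences of such point sets are
    T_r^2 and G_r.

    A matroid of rank r with a low order vertical separation is covered by two
    smaller members and loses at least linearly many elements against the
    quadratic bound, so for large rank the extremal matroids are vertically
    connected.  Conversely T_r^2 and G_r are representable over every field with
    at least four elements, since the coordinates 0, 1, a, b (respectively 0, 1, a
    with a not in {0, 1, -1}) can be chosen so that linear functionals on them
    separate the same points as over GF(4). *)


(** * Spans, kernels and annihilators *)

(** The factor one third arises because vectors are counted instead of points: the nonzero scalars
    of GF(4) triple the number, and a set of r^2 + O(1) vectors can afford to lose 2r - 1 of them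
    when the rank drops by one. The extremal number is about r^2 / 2, so crude constants suffice
    there, and of rationality that argument keeps only the absence of Fano minors. Later the Fano
    plane alone is too weak and genuinely rational equations enter: every forbidden affine
    configuration leads to 2 = 0, x^2 - x + 1 = 0 or x^2 + x - 1 = 0. None of these holds over the
    rationals, all can hold over GF(4). The configurations on four base points are settled by
    evaluation, and higher dimension is reduced to them by identifying base points. The obstacle
    with templates is that a conforming matrix need not contain the difference of two given points,
    for instance of two [Y1] columns. Adjoining rows with zero [Delta] part and contracting some of
    the new columns produces all differences at once, so that one rational point configuration
    serves them all. *)

Section Kil.
Variables (F : fieldType) (V : vectType F).
Implicit Types (U A : {vspace V}) (x y : V) (s c : seq V).

(** Contraction of a set spanning [U] becomes composition with this endomorphism, whose kernel is
    exactly [U]; the vectors stay in the same ambient space. *)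
Definition kil U : 'End(V) := (\1 - projv U)%VF.

Lemma kilE U x : kil U x = x - projv U x.
Proof. by rewrite !lfunE /= !lfunE. Qed.

Lemma kil_eq0 U x : (kil U x == 0) = (x \in U).
Proof.
rewrite kilE subr_eq0; apply/eqP/idP => [->|xU]; first exact: memv_proj.
by rewrite projv_id.
Qed.

Lemma lker_kil U : lker (kil U) = U.
Proof. by apply/vspaceP => x; rewrite memv_ker kil_eq0. Qed.

Lemma mem_img_ker (V' : vectType F) (f : 'Hom(V, V')) A x :
  (f x \in (f @: A)%VS) = (x \in (A + lker f)%VS).
Proof.
apply/memv_imgP/memv_addP => [[a aA fxa]|[a aA [b bk ->]]].
  exists a => //; exists (x - a); last by rewrite addrC subrK.
  by rewrite memv_ker linearB /= fxa subrr.
by exists a => //; rewrite linearD /=; move: bk; rewrite memv_ker => /eqP ->; rewrite addr0.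
Qed.

(** Spans after a contraction are spans before it with the contracted vectors [c] adjoined. This is
    how minors are computed with throughout. *)
Lemma mem_span_ker (V' : vectType F) (f : 'Hom(V, V')) s c x : lker f = <<c>>%VS ->
  (f x \in <<map f s>>%VS) = (x \in <<s ++ c>>%VS).
Proof. by move=> kf; rewrite -limg_span mem_img_ker kf span_cat. Qed.

Lemma dim_span_cons x s : \dim <<x :: s>> = ((x \notin <<s>>%VS) + \dim <<s>>)%N.
Proof.
rewrite span_cons; case: (boolP (x \in <<s>>%VS)) => xs /=.
  by congr (\dim _); apply/addv_idPr; rewrite -memvE.
rewrite dimv_disjoint_sum ?dim_vline.
  by case: eqP xs => [->|//]; rewrite mem0v.
apply/eqP; rewrite -subv0; apply/subvP => y; rewrite memv_cap memv0.
case/andP => /vlineP[k ->] h; case: (eqVneq k 0) => [->|k0]; first by rewrite scale0r.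
by case/negP: xs; rewrite -[x]scale1r -(mulVf k0) -scalerA memvZ.
Qed.

Lemma eq_span s1 s2 : s1 =i s2 -> <<s1>>%VS = <<s2>>%VS :> {vspace V}.
Proof. exact: eq_span. Qed.

(** Linearity is asked of a bare function, so that functionals given by sums and coordinates need no
    packed linear structure. *)
Definition functional (f : V -> F) := forall a x y, f (a *: x + y) = a * f x + f y.

Lemma functional0 f : functional f -> f 0 = 0.
Proof. by move=> h; have := h (-1) 0 0; rewrite scaler0 addr0 mulN1r addNr. Qed.

Lemma functionalZ f a x : functional f -> f (a *: x) = a * f x.
Proof. by move=> h; rewrite -[a *: x]addr0 h functional0 ?addr0. Qed.

Lemma functionalD f x y : functional f -> f (x + y) = f x + f y.
Proof. by move=> h; rewrite -[x]scale1r h mul1r scale1r. Qed.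

Lemma functional_sum f (I : Type) (r : seq I) (P : pred I) (G : I -> V) : functional f ->
  f (\sum_(i <- r | P i) G i) = \sum_(i <- r | P i) f (G i).
Proof.
by move=> h; apply: (big_morph f) => [x y|]; rewrite ?functionalD ?functional0.
Qed.

Lemma ann_sep U x : x \notin U ->
  exists f : V -> F, [/\ functional f, forall u, u \in U -> f u = 0 & f x != 0].
Proof.
rewrite -kil_eq0 => nz.
have [i ci] : exists i, coord (vbasis {:V}) i (kil U x) != 0.
  apply/existsP; apply: contraR nz => /existsPn h.
  rewrite (coord_vbasis (memvf (kil U x))) big1 // => i _.
  by have := h i; rewrite negbK => /eqP ->; rewrite scale0r.
exists (fun y => coord (vbasis {:V}) i (kil U y)); split=> //.
  by move=> a y z; rewrite !linearP.
by move=> u; rewrite -kil_eq0 => /eqP ->; rewrite linear0.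
Qed.

Lemma functional_span f s x : functional f -> (forall u, u \in s -> f u = 0) ->
  x \in <<s>>%VS -> f x = 0.
Proof.
move=> hf fs /(@coord_span _ _ _ (in_tuple s)) ->.
rewrite functional_sum // big1 // => i _; rewrite functionalZ // fs ?mulr0 //.
by rewrite mem_nth.
Qed.

Lemma span_annP s x :
  reflect (forall f, functional f -> (forall u, u \in s -> f u = 0) -> f x = 0)
          (x \in <<s>>%VS).
Proof.
apply: (iffP idP) => [xs f hf fs|h]; first exact: functional_span xs.
apply/negPn/negP => /ann_sep[f [hf fU fx]].
by case/eqP: fx; apply: h => // u us; apply: fU; apply: memv_span.
Qed.

End Kil.

(** * Twin families *)

(** The two families represent the same matroid, possibly over different fields. Span membership
    over lists, instead of ranks of sets, makes reindexing and contraction immediate. *)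
Definition twin (F K : fieldType) (V : vectType F) (W : vectType K) (E : Type)
  (v : E -> V) (w : E -> W) : Prop :=
  forall e s, (v e \in <<map v s>>%VS) = (w e \in <<map w s>>%VS).

Section Twin.
Variables (F K : fieldType) (V : vectType F) (W : vectType K).

Lemma twin_sub (E E' : Type) (f : E' -> E) (v : E -> V) (w : E -> W) :
  twin v w -> twin (v \o f) (w \o f).
Proof. by move=> t e s; rewrite !(map_comp _ f) /=; apply: t. Qed.

Lemma twin_contract (V' : vectType F) (W' : vectType K) (E : Type) (v : E -> V) (w : E -> W)
   (c : seq E) (f : 'Hom(V, V')) (g : 'Hom(W, W')) :
  twin v w -> lker f = <<map v c>>%VS -> lker g = <<map w c>>%VS ->
  twin (f \o v) (g \o w).
Proof.
move=> t kf kg e s; rewrite (map_comp f) (map_comp g) /= (mem_span_ker _ _ kf) (mem_span_ker _ _ kg).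
by rewrite -!map_cat t.
Qed.

Lemma twin_contract_kil (V' : vectType F) (E : Type) (v : E -> V) (w : E -> W)
   (c : seq E) (f : 'Hom(V, V')) :
  twin v w -> lker f = <<map v c>>%VS -> twin (f \o v) (kil <<map w c>> \o w).
Proof. by move=> t kf; apply: (twin_contract t kf); rewrite lker_kil. Qed.

Lemma span_scale_sub (L : fieldType) (U : vectType L) (E : Type) (v v' : E -> U) s :
  (forall e, exists2 a, a != 0 & v' e = a *: v e) ->
  (<<map v' s>> <= <<map v s>>)%VS.
Proof.
move=> h; elim: s => [|e s IH] /=; first by rewrite span_nil sub0v.
rewrite !span_cons addvS // -memvE; case: (h e) => a _ ->.
by rewrite memvZ ?memv_line.
Qed.

Lemma span_scale (L : fieldType) (U : vectType L) (E : Type) (v v' : E -> U) s :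
  (forall e, exists2 a, a != 0 & v' e = a *: v e) ->
  <<map v' s>>%VS = <<map v s>>%VS.
Proof.
move=> h; apply/eqP; rewrite eqEsubv !span_scale_sub // => e.
case: (h e) => a a0 ->; exists a^-1; first by rewrite invr_eq0.
by rewrite scalerA mulVf ?scale1r.
Qed.

Lemma memvZeq (L : fieldType) (U : vectType L) (A : {vspace U}) a x :
  a != 0 -> (a *: x \in A) = (x \in A).
Proof.
move=> a0; apply/idP/idP => [|xA]; last exact: memvZ.
by move/(memvZ a^-1); rewrite scalerA mulVf ?scale1r.
Qed.

Lemma twin_scaleE (E : Type) (v v' : E -> V) (w w' : E -> W) :
  (forall e, exists2 a, a != 0 & v' e = a *: v e) ->
  (forall e, exists2 a, a != 0 & w' e = a *: w e) ->
  twin v w -> twin v' w'.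
Proof.
move=> hv hw t e s; rewrite (span_scale _ hv) (span_scale _ hw).
by case: (hv e) => a a0 ->; case: (hw e) => b b0 ->; rewrite !memvZeq.
Qed.

Lemma scale1P (L : fieldType) (U : vectType L) (x : U) : exists2 a : L, a != 0 & x = a *: x.
Proof. by exists 1; rewrite ?oner_eq0 ?scale1r. Qed.

Lemma twin_dim (E : Type) (v : E -> V) (w : E -> W) s : twin v w ->
  \dim <<map v s>> = \dim <<map w s>>.
Proof.
move=> t; elim: s => [|e s IH] /=; first by rewrite !span_nil !dimv0.
by rewrite !dim_span_cons IH t.
Qed.

Lemma twin0 (E : Type) (v : E -> V) (w : E -> W) e : twin v w -> (v e == 0) = (w e == 0).
Proof. by move=> t; have := t e [::]; rewrite /= !span_nil !memv0. Qed.

Lemma twin_free (E : Type) (v : E -> V) (w : E -> W) s : twin v w ->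
  free (map v s) = free (map w s).
Proof. by move=> t; rewrite /free !size_map (twin_dim _ t). Qed.

Lemma twin_of_dim (E : finType) (v : E -> V) (w : E -> W) :
  (forall X : {set E}, \dim <<[seq v e | e in X]>> = \dim <<[seq w e | e in X]>>) ->
  twin v w.
Proof.
move=> h e s.
have aux (L : fieldType) (U : vectType L) (u : E -> U) (s' : seq E) :
    <<[seq u e | e in [set x in s']]>>%VS = <<map u s'>>%VS.
  apply: eq_span => x; apply/mapP/mapP => -[y ys ->]; exists y => //.
    by move: ys; rewrite mem_enum inE.
  by rewrite mem_enum inE.
have d (s' : seq E) : \dim <<map v s'>> = \dim <<map w s'>> by rewrite -(aux _ _ v s') -(aux _ _ w s') h.
have := d (e :: s); rewrite /= !dim_span_cons d => /eqP; rewrite eqn_add2r.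
by case: (v e \in _); case: (w e \in _).
Qed.

End Twin.

(** * The field with four elements *)

Section GF4.
Variables (F : finFieldType) (hF : #|F| = 4%N) (a : F) (ha : a ^+ 2 = a + 1).

Lemma f4_a0 : a != 0.
Proof.
apply: contra_eq_neq ha => ->.
by rewrite expr0n add0r eq_sym oner_eq0.
Qed.

Lemma f4_two : (2%:R : F) = 0.
Proof.
(* The equation for [a] turns a^4 into 3a + 2, so a^4 = a leaves 2a + 2 = 2a^2 = 0. *)
have h : a ^+ 4 = a by have := expf_card a; rewrite hF.
have e4 : a ^+ 4 = 3%:R * a + 2%:R.
  by rewrite (_ : 4 = (2 * 2))%N // exprM ha sqrrD ha; ring.
have : 2%:R * (a ^+ 2) = 0 :> F.
  by rewrite ha (_ : 2%:R * (a + 1) = 3%:R * a + 2%:R - a); [rewrite -e4 h subrr | ring].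
by move/eqP; rewrite mulf_eq0 sqrf_eq0 (negPf f4_a0) orbF => /eqP.
Qed.

Lemma f4_add x : x + x = 0 :> F.
Proof. by rewrite -mulr2n -mulr_natl f4_two mul0r. Qed.

Lemma f4_opp x : - x = x :> F.
Proof. by apply/eqP; rewrite eq_sym -addr_eq0 f4_add. Qed.

Let b := a ^+ 2.

Lemma f4_a1 : a != 1.
Proof.
apply: contra_eq_neq ha => ->; rewrite expr1n f4_add.
exact: oner_neq0.
Qed.

Lemma f4_b0 : b != 0. Proof. by rewrite sqrf_eq0 f4_a0. Qed.
Lemma f4_b1 : b != 1.
Proof. by rewrite /b ha -subr_eq0 addrK f4_a0. Qed.
Lemma f4_ab : (a == b) = false.
Proof. by apply/negP; rewrite /b ha -subr_eq0 opprD addNKr oppr_eq0 oner_eq0. Qed.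

Lemma f4_case (x : F) : [\/ x = 0, x = 1, x = a | x = b].
Proof.
have u : uniq [:: 0; 1; a; b].
  rewrite /= !inE !negb_or eq_sym oner_eq0 eq_sym f4_a0 eq_sym f4_b0.
  by rewrite eq_sym f4_a1 eq_sym f4_b1 f4_ab.
have : x \in [:: 0; 1; a; b].
  have /subset_leq_card/(_ : _ -> _) := subset_predT [set y in [:: 0; 1; a; b]].
  have c : #|[set y in [:: 0; 1; a; b]]| = 4%N by rewrite cardsE; move/card_uniqP: u => ->.
  have : [set y in [:: 0; 1; a; b]] = setT.
    by apply/eqP; rewrite eqEcard subsetT cardsT hF c.
  by move/setP/(_ x); rewrite !inE.
rewrite !inE => /or4P[] /eqP ->; by [constructor 1|constructor 2|constructor 3|constructor 4].
Qed.

Lemma f4_aa : a * a = b. Proof. by rewrite /b expr2. Qed.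
Lemma f4_ab1 : a * b = 1.
Proof. by rewrite /b ha mulrDr mulr1 -expr2 ha addrAC f4_add add0r. Qed.
Lemma f4_ba1 : b * a = 1. Proof. by rewrite mulrC f4_ab1. Qed.
Lemma f4_bb : b * b = a.
Proof. by rewrite -{2}f4_aa mulrA f4_ba1 mul1r. Qed.
Lemma f4_1a : 1 + a = b. Proof. by rewrite /b ha addrC. Qed.
Lemma f4_a1' : a + 1 = b. Proof. by rewrite /b ha. Qed.
Lemma f4_1b : 1 + b = a. Proof. by rewrite -f4_1a addrA f4_add add0r. Qed.
Lemma f4_b1' : b + 1 = a. Proof. by rewrite addrC f4_1b. Qed.
Lemma f4_aDb : a + b = 1. Proof. by rewrite -f4_1a addrCA f4_add addr0. Qed.
Lemma f4_bDa : b + a = 1. Proof. by rewrite addrC f4_aDb. Qed.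
Lemma f4_Va : a^-1 = b. Proof. by rewrite -[LHS]mulr1 -f4_ab1 mulrA mulVf ?mul1r ?f4_a0. Qed.
Lemma f4_Vb : b^-1 = a. Proof. by rewrite -f4_Va invrK. Qed.

Definition f4E := (f4_opp, f4_add, f4_aa, f4_ab1, f4_ba1, f4_bb, f4_1a, f4_a1', f4_1b, f4_b1',
  f4_aDb, f4_bDa, f4_Va, f4_Vb, mulr0, mul0r, addr0, add0r, mulr1, mul1r, invr1, invr0).

Definition f4N := (negPf f4_a0, negPf f4_a1, negPf f4_b0, negPf f4_b1, f4_ab,
  eq_sym b a, eq_sym 0 a, eq_sym 0 b, eq_sym 1 a, eq_sym 1 b, oner_eq0 F, eq_sym 0 (1 : F), eqxx).

(** [{0, x}] is an additive subgroup of index two and [y] lies outside it, so one of [s], [s + y]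
    lies inside. *)
Lemma f4_coset (s x y : F) : x != 0 -> y != 0 -> y != x ->
  (s == 0) || (s == x) \/ (s + y == 0) || (s + y == x).
Proof.
by case: (f4_case s) => ->; case: (f4_case x) => ->; case: (f4_case y) => ->;
  rewrite ?f4E ?f4N; auto.
Qed.

Section Vect.
Variable V : vectType F.
Lemma f4_addv (x : V) : x + x = 0.
Proof. by rewrite -mulr2n -scaler_nat f4_two scale0r. Qed.
Lemma f4_oppv (x : V) : - x = x.
Proof. by apply/eqP; rewrite eq_sym -addr_eq0 f4_addv. Qed.
End Vect.

End GF4.

(** * Vector configurations *)

Section Config.
Variables (F : finFieldType) (d : nat).
Local Notation V := 'rV[F]_d.
Implicit Types (N : {set V}) (s t T : seq V) (e x y : V).

Definition spn N : {vspace V} := <<enum N>>%VS.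

Definition scl N := forall c x, c != 0 -> x \in N -> c *: x \in N.

(** No Fano minor, in vector form: modulo the contracted set [T], the vectors [e], [x1], [x2] are
    independent, [x3] is the negative of [x1 + x2], and each [y] is the matching [x] shifted by [e].
    In characteristic two these are the seven points of a Fano plane. *)
Definition FFree N := forall T e x1 y1 x2 y2 x3 y3, {subset T <= N} ->
  e \in N -> x1 \in N -> y1 \in N -> x2 \in N -> y2 \in N -> x3 \in N -> y3 \in N ->
  x1 + e - y1 \in <<T>>%VS -> x2 + e - y2 \in <<T>>%VS -> x3 + e - y3 \in <<T>>%VS ->
  x1 + x2 + x3 \in <<T>>%VS ->
  e \notin <<T>>%VS -> x1 \notin <<e :: T>>%VS -> x2 \notin <<x1 :: e :: T>>%VS -> False.

(** The differences of independent vectors represent the cycle matroid of a complete graph, so this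
    is an [M(K_n)]-minor obtained by contracting [s]. *)
Definition Kminor n N := exists (f : 'End(V)) s (b : 'I_n -> V),
  [/\ {subset s <= N}, lker f = <<s>>%VS, free (map b (enum 'I_n)) &
      forall i j, i != j -> exists2 u, u \in N & f u = b i - b j].

Lemma mem_spn N x : x \in N -> x \in spn N.
Proof. by move=> h; rewrite memv_span ?mem_enum. Qed.

Lemma spn_sub N (U : {vspace V}) : {subset N <= U} -> (spn N <= U)%VS.
Proof. by move=> h; apply/span_subvP => x; rewrite mem_enum; apply: h. Qed.

Lemma spnS N N' : N \subset N' -> (spn N <= spn N')%VS.
Proof. by move=> /subsetP h; apply: spn_sub => x /h /mem_spn. Qed.

Lemma spn_img (f : 'End(V)) N : spn (f @: N) = (f @: spn N)%VS.
Proof.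
rewrite limg_span; apply: eq_span => x; rewrite mem_enum.
by apply/imsetP/mapP => -[u uN ->]; exists u => //; rewrite ?mem_enum // -mem_enum.
Qed.

Lemma pick_out N (U : {vspace V}) : (\dim U < \dim (spn N))%N -> exists2 x, x \in N & x \notin U.
Proof.
move=> h; case: (boolP [exists x in N, x \notin U]) => [/exists_inP //|/exists_inPn hn].
move: h; rewrite ltnNge dimvS // spn_sub // => x /hn; by rewrite negbK.
Qed.

Lemma lift_seq (f : V -> V) N T : {subset T <= f @: N} ->
  exists2 T', {subset T' <= N} & T = map f T'.
Proof.
elim: T => [|x T IH] h; first by exists [::].
have /imsetP[u uN ->] := h x (mem_head _ _).
have [|T' hT' ->] := IH; first by move=> y yT; apply: h; rewrite inE yT orbT.
by exists (u :: T') => // y; rewrite inE => /orP[/eqP -> //|/hT'].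
Qed.

Lemma scl_img (f : 'End(V)) N : scl N -> scl (f @: N).
Proof. by move=> h c _ c0 /imsetP[u uN ->]; rewrite -linearZ imset_f ?h. Qed.

Lemma ker_comp (f g : 'End(V)) s t : lker g = <<s>>%VS -> lker f = <<map g t>>%VS ->
  lker (f \o g)%VF = <<t ++ s>>%VS.
Proof.
move=> kg kf; apply/vspaceP => x.
by rewrite memv_ker comp_lfunE -memv_ker kf (mem_span_ker _ _ kg).
Qed.

Lemma Kminor_img n (f : 'End(V)) N s : {subset s <= N} -> lker f = <<s>>%VS ->
  Kminor n (f @: N) -> Kminor n N.
Proof.
move=> sN kf [g [t [b [tN kg fb h]]]]; have [t' t'N tE] := lift_seq tN.
exists (g \o f)%VF, (t' ++ s), b; split => //.
- by move=> x; rewrite mem_cat => /orP[/t'N|/sN].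
- by apply: ker_comp => //; rewrite -tE.
move=> i j /h[_ /imsetP[u uN ->] e]; exists u => //; by rewrite comp_lfunE.
Qed.

Lemma FFree_img (f : 'End(V)) N s : {subset s <= N} -> lker f = <<s>>%VS ->
  FFree N -> FFree (f @: N).
Proof.
move=> sN kf ff _ _ _ _ _ _ _ _ /lift_seq[T TN ->] /imsetP[e eN ->]
  /imsetP[x1 x1N ->] /imsetP[y1 y1N ->] /imsetP[x2 x2N ->] /imsetP[y2 y2N ->]
  /imsetP[x3 x3N ->] /imsetP[y3 y3N ->].
have fE z t : (f z \in <<map f t>>%VS) = (z \in <<t ++ s>>%VS) by apply: mem_span_ker.
rewrite -!linearD -!linearB /= => h1 h2 h3 h4 h5 h6 h7.
apply: (ff (T ++ s) e x1 y1 x2 y2 x3 y3) => //; rewrite -?fE //.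
- by move=> x; rewrite mem_cat => /orP[/TN|/sN].
- by rewrite -cat_cons -fE.
by rewrite -2!cat_cons -fE.
Qed.

Lemma FFreeS N N' : N' \subset N -> FFree N -> FFree N'.
Proof.
move=> /subsetP h ff T e x1 y1 x2 y2 x3 y3 TN *.
by apply: (ff T e x1 y1 x2 y2 x3 y3) => //; try apply: h => //; move=> z /TN/h.
Qed.

Lemma card_span s : (#|[set x | x \in <<s>>%VS]| <= #|F| ^ size s)%N.
Proof.
pose g (k : {ffun 'I_(size s) -> F}) := \sum_i k i *: s`_i.
have -> : (#|F| ^ size s = #|{ffun 'I_(size s) -> F}|)%N by rewrite card_ffun card_ord.
apply: leq_trans (leq_imset_card g _); apply: subset_leq_card.
apply/subsetP => x; rewrite inE => /(@coord_span _ _ _ (in_tuple s)) ->.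
apply/imsetP; exists [ffun i => coord (in_tuple s) i x] => //.
by apply: eq_bigr => i _; rewrite ffunE.
Qed.

Lemma card_vs (U : {vspace V}) : (#|[set x | x \in U]| <= #|F| ^ \dim U)%N.
Proof.
rewrite -{1}(span_basis (vbasisP U)).
by have := card_span (vbasis U); rewrite size_tuple.
Qed.

Lemma free_size_dim s (U : {vspace V}) : (U <= <<s>>)%VS -> (size s <= \dim U)%N -> free s.
Proof.
move=> h1 h2; rewrite /free eqn_leq dim_span /=.
exact: leq_trans h2 (dimvS h1).
Qed.

End Config.

(** * In a Fano-free set the number of legs at a point is linear in the dimension *)

Section Sparse.
Variables (F : finFieldType) (hF : #|F| = 4%N) (al : F) (hal : al ^+ 2 = al + 1).

Let two0 : (2%:R : F) = 0 := f4_two hF hal.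
Let addvv := f4_addv hF hal.
Let oppvv := f4_oppv hF hal.

Section Dim.
Variable d : nat.
Local Notation V := 'rV[F]_d.
Implicit Types (N : {set V}) (s : seq V) (e x y : V).

Lemma mem_solve (U : {vspace V}) x c y : c != 0 -> x \in U -> x + c *: y \in U -> y \in U.
Proof. by move=> c0 xU h; rewrite -(memvZeq _ _ c0) -[c *: y](addKr x) memvD ?memvN. Qed.

(** Contract the whole circuit except [i], [j], [k]. The three remaining vectors, scaled by [mu],
    sum to zero and are all shifted by the same [c *: e] inside [N], which is a Fano plane. The
    bound on the dimension says that the circuit is the only relation, so nothing else collapses. *)
Lemma circuit_fano N e (I : finType) (z : I -> V) (mu : I -> F) i j k gi gj gk (c : F) :
  scl N -> FFree N -> e \in N -> (forall l, z l \in N) -> (forall l, mu l != 0) ->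
  \sum_l mu l *: z l = 0 -> i != j -> i != k -> j != k -> c != 0 ->
  z i + gi *: e \in N -> z j + gj *: e \in N -> z k + gk *: e \in N ->
  mu i * gi = c -> mu j * gj = c -> mu k * gk = c ->
  (#|I| <= \dim <<e :: map z (enum I)>>)%N -> False.
Proof.
move=> sN ff eN zN mu0 sum0 ij ik jk c0 hi hj hk ci cj ck hdim.
pose S := [set i; j; k]; pose T := map z (enum (~: S)).
have cS : #|S| = 3%N by rewrite /S setUC cardsU1 cards2 !inE (eq_sym k) (eq_sym k) negb_or ik jk ij.
have sT : (size T + 3 = #|I|)%N by rewrite size_map -cardE -cS addnC cardsC.
have zT l : l \notin S -> z l \in T by move=> lS; apply: map_f; rewrite mem_enum inE.
pose s := mu j *: z j :: mu i *: z i :: c *: e :: T.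
have ins x : x \in T -> x \in <<s>>%VS by move=> xT; rewrite memv_span // !inE xT !orbT.
have es : e \in <<s>>%VS.
  by rewrite -(memvZeq _ _ c0) memv_span // !inE eqxx !orbT.
have is_ : z i \in <<s>>%VS by rewrite -(memvZeq _ _ (mu0 i)) memv_span // !inE eqxx !orbT.
have js : z j \in <<s>>%VS by rewrite -(memvZeq _ _ (mu0 j)) memv_span // !inE eqxx.
have nk l : l != k -> z l \in <<s>>%VS.
  move=> lk; case: (boolP (l \in S)) => [|/zT/ins //].
  by rewrite !inE (negPf lk) orbF => /orP[] /eqP ->.
have ks : z k \in <<s>>%VS.
  rewrite -(memvZeq _ _ (mu0 k)); move/eqP: sum0; rewrite (bigD1 k) //= addr_eq0 => /eqP ->.
  by rewrite memvN memv_suml // => l lk; rewrite memvZ // nk.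
have fs : free s.
  apply: (free_size_dim (U := <<e :: map z (enum I)>>)).
    apply/span_subvP => x; rewrite inE => /orP[/eqP -> //|/mapP[l _ ->]].
    by case: (eqVneq l k) => [-> //|/nk].
  by rewrite /= -addn3 sT.
move: fs; rewrite !free_cons => /and4P[f2 f1 f0 _].
have ceN : c *: e \in N by apply: sN.
have aux l g : z l + g *: e \in N -> mu l * g = c -> mu l *: z l + c *: e \in N.
  by move=> h <-; rewrite -scalerA -scalerDr; apply: sN.
apply: (ff T (c *: e) (mu i *: z i) (mu i *: z i + c *: e) (mu j *: z j) (mu j *: z j + c *: e)
   (mu k *: z k) (mu k *: z k + c *: e)) => //; rewrite ?subrr ?mem0v //; try exact: sN;
   try exact: aux.
- by move=> x /mapP[l _ ->].
- exact: aux hi ci.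
- exact: aux hj cj.
- exact: aux hk ck.
suff -> : mu i *: z i + mu j *: z j + mu k *: z k = - \sum_(l in ~: S) mu l *: z l.
  by rewrite memvN memv_suml // => l; rewrite inE => lS; rewrite memvZ // memv_span // zT.
apply/eqP; rewrite -addr_eq0; apply/eqP; apply: etrans _ sum0; rewrite [RHS](bigD1 i) //=.
rewrite [in RHS](bigD1 j) /=; last by rewrite eq_sym.
rewrite [in RHS](bigD1 k) /=; last by rewrite eq_sym ik eq_sym jk.
rewrite !addrA; congr (_ + _).
by apply: eq_bigl => l; rewrite !inE !negb_or -andbA.
Qed.

(** The points that contracting [e] identifies with another point of [N]. In [nleg] the shift is
    normalised to [e] itself, which costs only a scaling. *)
Definition legs N e := [set u in N | (u \notin <[e]>%VS) && [exists c, (c != 0) && (u + c *: e \in N)]].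
Definition nleg N e := [set u in N | (u \notin <[e]>%VS) && (u + e \in N)].
(** The label [tau] records the two scalars by which [y] combines with [x], and then with [e],
    inside [N]. There are 16 labels, few enough for pigeonholing. *)
Definition Eg N e x (tau : F * F) := [set y in nleg N e |
  [&& tau.1 != 0, tau.2 != 0, y + tau.1 *: x \in N & y + tau.1 *: x + tau.2 *: e \in N]].
Definition Eall N e x := \bigcup_tau Eg N e x tau.

Lemma cover_dim (I : finType) (X : {set V}) (Y : I -> {set V}) k :
  X \subset \bigcup_i Y i -> (0 < k)%N -> (0 < #|I|)%N -> (#|I| * k <= \dim (spn X))%N ->
  exists i, (k <= \dim (spn (Y i)))%N.
Proof.
move=> /subsetP XY k0 I0 h; case: (boolP [exists i, (k <= \dim (spn (Y i)))%N]) => [/existsP //|].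
rewrite negb_exists => /forallP hn.
have h1 : (spn X <= \sum_i spn (Y i))%VS.
  apply: spn_sub => x /XY /bigcupP[i _ xi].
  by apply: subvP (sumv_sup i _ (subvv _)) _ (mem_spn xi).
have h2 : (\dim (\sum_i spn (Y i)) <= \sum_i \dim (spn (Y i)))%N by apply: dimv_leq_sum.
have h3 : (\sum_i \dim (spn (Y i)) <= #|I| * k.-1)%N.
  rewrite -sum_nat_const; apply: leq_sum => i _; have := hn i; lia.
have h4 := leq_trans h (leq_trans (dimvS h1) (leq_trans h2 h3)).
by move: h4; rewrite leq_mul2l => /orP[]; lia.
Qed.

Lemma EgP N e x tau y : y \in Eg N e x tau ->
  [/\ y \in nleg N e, y \in N, y + e \in N, tau.1 != 0 /\ tau.2 != 0 &
      y + tau.1 *: x \in N /\ y + tau.1 *: x + tau.2 *: e \in N].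
Proof.
rewrite inE => /andP[h /and4P[h1 h2 h3 h4]]; split=> //; by move: h; rewrite inE => /and3P[].
Qed.

Lemma card_F2 : #|{: F * F}| = 16%N. Proof. by rewrite card_prod hF. Qed.

(** Two chains [x], [u], [v], [w] with the same three labels are chosen so that all their vectors
    are independent. Their edges form an even circuit of eight elements to which [circuit_fano]
    applies. Each of the three labels costs a factor 16, and 9 exceeds the eight vectors that have
    to be avoided or made independent. *)
Lemma robust_contra N e x : scl N -> FFree N -> e \in N -> e != 0 -> x \in nleg N e ->
  (forall y, y \in nleg N e -> (#|{: F * F}| * (#|{: F * F}| * (#|{: F * F}| * 9)) <= \dim (spn (Eall N e y)))%N) ->
  False.
Proof.
move=> sN ff eN e0 xL H.
have c16 : (0 < #|{: F * F}|)%N by rewrite card_F2.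
have R1 y : y \in nleg N e -> exists tau,
    (#|{: F * F}| * (#|{: F * F}| * 9) <= \dim (spn (Eg N e y tau)))%N.
  by move=> /H h; apply: (cover_dim (X := Eall N e y)) => //; rewrite ?muln_gt0 ?c16.
have R1' y : y \in nleg N e -> exists tau, (9 <= \dim (spn (Eg N e y tau)))%N.
  by move=> /R1[tau ht]; exists tau; rewrite card_F2 in ht; lia.
pose A2 y t2 t3 := [set v in Eg N e y t2 | (9 <= \dim (spn (Eg N e v t3)))%N].
have R2 y : y \in nleg N e -> exists t2 t3, (9 <= \dim (spn (A2 y t2 t3)))%N.
  move=> /R1[t2 h]; exists t2; apply: (cover_dim (X := Eg N e y t2)) => //.
    apply/subsetP => v vE; have [vL _ _ _ _] := EgP vE; have [t3 h3] := R1' _ vL.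
    by apply/bigcupP; exists t3 => //; rewrite inE vE.
  by move: h; rewrite card_F2; lia.
have [t1 [[t2 t3] hx]] : exists t1 (t : (F * F) * (F * F)),
    (9 <= \dim (spn [set u in Eg N e x t1 | (9 <= \dim (spn (A2 u t.1 t.2)))%N]))%N.
  have [t1 h1] := R1 _ xL; exists t1; apply: (cover_dim (X := Eg N e x t1)) => //.
  - apply/subsetP => v vE; have [vL _ _ _ _] := EgP vE; have [t2 [t3 h3]] := R2 _ vL.
    by apply/bigcupP; exists (t2, t3) => //; rewrite inE vE.
  - by rewrite card_prod muln_gt0 c16.
  by move: h1; rewrite !card_prod hF; lia.
move: hx => /= hx.
have br s : (size s <= 6)%N -> exists u v w,
   [/\ u \in Eg N e x t1, v \in Eg N e u t2, w \in Eg N e v t3 &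
       [/\ u \notin <<s>>%VS, v \notin <<u :: s>>%VS & w \notin <<v :: u :: s>>%VS]].
  move=> ss; have d9 s' : (size s' <= 8)%N -> (\dim <<s'>> < 9)%N.
    by move=> h; rewrite ltnS (leq_trans (dim_span s') h).
  have s1 : (size s <= 8)%N by lia.
  have s2 : ((size s).+1 <= 8)%N by lia.
  have [u] := pick_out (leq_trans (d9 s s1) hx).
  rewrite inE => /andP[uE hu] us.
  have [v] := pick_out (leq_trans (d9 (u :: s) s2) hu).
  rewrite inE => /andP[vE hv] vs.
  have [w wE ws] := pick_out (leq_trans (d9 (v :: u :: s) ss) hv).
  by exists u, v, w.
have [u1 [v1 [w1 [u1E v1E w1E [u1n v1n w1n]]]]] := br [:: x; e] isT.
have [u2 [v2 [w2 [u2E v2E w2E [u2n v2n w2n]]]]] := br [:: w1; v1; u1; x; e] isT.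
have xe : x \notin <[e]>%VS by move: xL; rewrite inE => /and3P[].
have fL : free [:: w2; v2; u2; w1; v1; u1; x; e].
  by rewrite !free_cons w2n v2n u2n w1n v1n u1n span_seq1 xe span_nil memv0 e0 nil_free.
move: t1 t2 t3 {hx br A2 R1 R1' R2 u1n v1n w1n u2n v2n w2n H c16} u1E v1E w1E u2E v2E w2E
  => [c1 g1] [c2 g2] [c3 g3].
move=> /EgP[_ u1N u1e /= [c10 g10] [a1 a1e]] /EgP[_ v1N v1e /= [c20 g20] [a2 a2e]]
  /EgP[_ w1N w1e /= [c30 g30] [a3 a3e]] /EgP[_ u2N u2e /= _ [b1 b1e]]
  /EgP[_ v2N v2e /= _ [b2 b2e]] /EgP[_ w2N w2e /= _ [b3 b3e]].
(* With the weights [mu] the four vectors of one chain sum to c1 c2 c3 [x]. Equal labels give both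
   chains the same sum, so the total vanishes in characteristic two. *)
pose z (p : bool * 'I_4) : V := nth 0 (if p.1 then [:: w2; w2 + c3 *: v2; v2 + c2 *: u2; u2 + c1 *: x]
   else [:: w1; w1 + c3 *: v1; v1 + c2 *: u1; u1 + c1 *: x]) p.2.
pose mu (k : nat) : F := nth 0 [:: 1; 1; c3; c3 * c2] k.
pose ga (k : nat) : F := nth 0 [:: 1; g3; g2; g1] k.
have mu0 (k : 'I_4) : mu k != 0.
  by case: k => [[|[|[|[|]]]] hk] //; rewrite /mu /= ?oner_eq0 ?mulf_neq0.
have ga0 (k : 'I_4) : ga k != 0 by case: k => [[|[|[|[|]]]] hk] //; rewrite /ga /= ?oner_eq0.
have zN p : z p \in N.
  by case: p => b [[|[|[|[|]]]] hk] //; rewrite /z /=; case: b.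
have zg p : z p + ga p.2 *: e \in N.
  by case: p => b [[|[|[|[|]]]] hk] //; rewrite /z /ga /= ?scale1r; case: b.
have sum0 : \sum_(p : bool * 'I_4) mu p.2 *: z p = 0.
  rewrite -(pair_bigA _ (fun b (k : 'I_4) => mu k *: z (b, k))) /= big_bool !big_ord_recl !big_ord0.
  rewrite /mu /z /= !scale1r.
  apply/rowP => j; rewrite !mxE.
  set r := (X in X = 0); suff : exists q, r = 2%:R * q by case=> q ->; rewrite two0 mul0r.
  by rewrite /r; eexists (w2 0 j + c3 * v2 0 j + c3 * c2 * u2 0 j + w1 0 j + c3 * v1 0 j + c3 * c2 * u1 0 j
     + c3 * c2 * c1 * x 0 j); ring.
have hd : (#|{: bool * 'I_4}| <= \dim <<e :: map z (enum {: bool * 'I_4})>>)%N.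
  rewrite card_prod card_bool card_ord.
  have <- : \dim <<[:: w2; v2; u2; w1; v1; u1; x; e]>> = (2 * 4)%N by apply/eqP.
  apply: dimvS; set U := <<e :: map z _>>%VS.
  have zU p : z p \in U by rewrite memv_span // inE map_f ?mem_enum ?orbT.
  have eU : e \in U by rewrite memv_span // mem_head.
  have W2 : w2 \in U by have := zU (true, ord0).
  have W1 : w1 \in U by have := zU (false, ord0).
  have V2 : v2 \in U by apply: (mem_solve c30 W2); have := zU (true, inord 1); rewrite /z /= inordK.
  have V1 : v1 \in U by apply: (mem_solve c30 W1); have := zU (false, inord 1); rewrite /z /= inordK.
  have U2 : u2 \in U by apply: (mem_solve c20 V2); have := zU (true, inord 2); rewrite /z /= inordK.
  have U1 : u1 \in U by apply: (mem_solve c20 V1); have := zU (false, inord 2); rewrite /z /= inordK.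
  have X : x \in U by apply: (mem_solve c10 U1); have := zU (false, inord 3); rewrite /z /= inordK.
  by apply/span_subvP => y; rewrite !inE => /or4P[/eqP->|/eqP->|/eqP->|] //;
     move=> /or4P[/eqP->|/eqP->|/eqP->|/orP[]/eqP->].
(* Four positions but only three nonzero scalars: two positions of a chain have the same product,
   and the second chain repeats it at position [k]. That makes three equal shifts. *)
have [k [k' [kk vk]]] : exists k k' : 'I_4, k != k' /\ mu k * ga k = mu k' * ga k'.
  have : ~~ injectiveb (fun k : 'I_4 => mu k * ga k).
    apply/negP => /injectiveP inj.
    have : (#|'I_4| <= #|[set~ (0%R : F)]|)%N.
      rewrite -(card_imset _ inj); apply: subset_leq_card; apply/subsetP => y /imsetP[k _ ->].
      by rewrite !inE mulf_neq0.
    by rewrite card_ord cardsC1 hF.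
  case/injectivePn => k [k' kk vk]; exists k, k'; split=> //; by rewrite eq_sym in kk *.
apply: (@circuit_fano N e _ z (fun p : bool * 'I_4 => mu p.2) (false, k) (false, k') (true, k)
  (ga k) (ga k') (ga k) (mu k * ga k)) => //=; rewrite ?mulf_neq0 //;
  first [exact: (zg (false, k)) | exact: (zg (false, k')) | exact: (zg (true, k))].
Qed.

Lemma legs_nleg N e u : scl N -> u \in legs N e -> exists2 c, c != 0 & c *: u \in nleg N e.
Proof.
move=> sN; rewrite inE => /and3P[uN ue /existsP[c /andP[c0 h]]].
exists c^-1; first by rewrite invr_eq0.
rewrite inE sN ?invr_eq0 //= memvZeq ?invr_eq0 // ue /=.
by rewrite -[X in _ + X](scale1r) -(mulVf c0) -scalerA -scalerDr sN ?invr_eq0.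
Qed.

End Dim.

Lemma card_F4 (d : nat) (U : {vspace 'rV[F]_d}) k : (\dim U <= k)%N -> (#|[set x | x \in U]| <= 4 ^ k)%N.
Proof. by move=> h; apply: leq_trans (card_vs U) _; rewrite hF leq_exp2l. Qed.

(** Induction on the dimension. By [robust_contra] some normalised leg [x] has a small set
    [Eall N e x]; contracting [x] merges or destroys only boundedly many legs, which gives a
    constant loss for each dimension. *)
Lemma sparse_dim D : (#|{: F * F}| * (#|{: F * F}| * (#|{: F * F}| * 9)) <= D)%N ->
  forall d (N : {set 'rV[F]_d}) e, scl N -> FFree N -> e \in N -> e != 0 ->
  (#|legs N e| <= (4 ^ D + 16) * \dim (spn N))%N.
Proof.
move=> hD d N e; have [n] := ubnP (\dim (spn N)); elim: n N e => // n IH N e hn sN ff eN e0.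
case: (set_0Vmem (legs N e)) => [->|[u0 u0L]]; first by rewrite cards0.
have [x xL hx] : exists2 x, x \in nleg N e & (\dim (spn (Eall N e x)) <= D)%N.
  case: (boolP [exists x in nleg N e, (\dim (spn (Eall N e x)) <= D)%N]) => [/exists_inP//|/exists_inPn h].
  have [c _ xL] := legs_nleg sN u0L; case: (robust_contra sN ff eN e0 xL) => y yL.
  by have := h _ yL; rewrite -ltnNge => /ltnW; apply: leq_trans.
have xN : x \in N by move: xL; rewrite inE => /and3P[].
have xe : x \notin <[e]>%VS by move: xL; rewrite inE => /and3P[].
pose f := kil <[x]>; have kf : lker f = <<[:: x]>>%VS by rewrite lker_kil span_seq1.
have x0 : x != 0 by apply: contra xe => /eqP ->; rewrite mem0v.
have fe0 : f e != 0.
  rewrite kil_eq0; apply: contra xe => /vlineP[c ec].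
  have c0 : c != 0 by apply: contra e0 => /eqP c0; rewrite ec c0 scale0r.
  by rewrite -(memvZeq _ _ c0) -ec memv_line.
have subx : {subset [:: x] <= N} by move=> y; rewrite inE => /eqP ->.
have hdim : (\dim (spn (f @: N)) < \dim (spn N))%N.
  rewrite spn_img -(limg_ker_dim f (spn N)) -addn1 addnC leq_add2r.
  have d1 : \dim <[x]> = 1%N by rewrite dim_vline x0.
  rewrite kf span_seq1; apply: leq_trans (_ : \dim <[x]> <= _)%N; first by rewrite d1.
  by apply: dimvS; rewrite subv_cap subvv andbT -memvE mem_spn.
have IH' := IH (f @: N) (f e) (leq_trans hdim (ltnSE hn)) (@scl_img _ _ f N sN) (FFree_img subx kf ff)
   (imset_f f eN) fe0.
(* The legs that another leg may be identified with when [x] is contracted; up to scaling they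
   belong to [Eall N e x]. *)
pose Q := [set u in legs N e | [exists c, (c != 0) && (u + c *: x \in legs N e)]].
pose P := [set u | u \in <<[:: x; e]>>%VS].
have cP : (#|P| <= 16)%N by apply: leq_trans (card_span _) _; rewrite hF.
have cQ : (#|Q| <= 4 ^ D)%N.
  apply: leq_trans (card_F4 hx); apply: subset_leq_card; apply/subsetP => u.
  rewrite inE => /andP[uL /existsP[c /andP[c0 uc]]]; rewrite inE.
  have [b b0 bL] := legs_nleg sN uL; rewrite -(memvZeq _ _ b0); apply: mem_spn.
  move: uc; rewrite inE => /and3P[ucN _ /existsP[g /andP[g0 ug]]].
  apply/bigcupP; exists (b * c, b * g) => //; rewrite inE bL /= !mulf_neq0 //=.
  by rewrite -!scalerA -!scalerDr !sN.
have sub : f @: (legs N e :\: (P :|: Q)) \subset legs (f @: N) (f e).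
  apply/subsetP => _ /imsetP[u + ->]; rewrite in_setD in_setU negb_or => /andP[/andP[uP _] uL].
  move: (uL); rewrite inE => /and3P[uN ue /existsP[c /andP[c0 uc]]].
  rewrite inE imset_f //=; apply/andP; split; last first.
    by apply/existsP; exists c; rewrite c0 /= -linearZ -linearD imset_f.
  move: uP; rewrite inE; apply: contra; rewrite -span_seq1 -[[:: f e]]/(map f [:: e]).
  by rewrite (mem_span_ker _ _ kf) => h; rewrite (eq_span (s2 := [:: e; x])) // => y; rewrite !inE orbC.
have inj : {in legs N e :\: (P :|: Q) &, injective f}.
  move=> u u'; rewrite in_setD in_setU negb_or => /andP[/andP[_ uQ] uL] /setDP[u'L _] /eqP.
  rewrite -subr_eq0 -linearB /= kil_eq0 => /vlineP[c h].
  have u'E : u' = u - c *: x by rewrite -h opprB addrC subrK.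
  case: (eqVneq c 0) => [c0|c0]; first by rewrite u'E c0 scale0r subr0.
  case/negP: uQ; rewrite inE uL; apply/existsP; exists (- c).
  by rewrite oppr_eq0 c0 scaleNr -u'E.
have := subset_leq_card sub; rewrite card_in_imset // => h1.
have h2 : (#|legs N e| <= #|legs N e :\: (P :|: Q)| + #|P :|: Q|)%N.
  by rewrite -(cardsID (P :|: Q) (legs N e)) addnC leq_add2l subset_leq_card ?subsetIr.
have h3 : (#|P :|: Q| <= #|P| + #|Q|)%N by rewrite cardsU leq_subr.
move: (4 ^ D)%N cQ IH' => M cQ IH'.
have : ((M + 16) * (\dim (spn (f @: N)) + 1) <= (M + 16) * \dim (spn N))%N.
  by rewrite leq_mul2l addn1 hdim orbT.
rewrite mulnDr muln1.
move: (leq_trans h1 IH') h2 h3 cP cQ.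
move: #|legs N e :\: _| #|legs N e| #|P :|: Q| #|P| #|Q| ((M + 16) * \dim (spn [set f x | x in N]))%N
  ((M + 16) * \dim (spn N))%N => *; lia.
Qed.

Definition Ul d (N : {set 'rV[F]_d}) e := (<[e]> + spn (legs N e))%VS.

(** All legs of [e] and their partners lie in [Ul N e], so [sparse_dim] may be applied to the part
    of [N] in that subspace; the bound then involves its dimension only. *)
Lemma sparse : exists2 C, (0 < C)%N & forall d (N : {set 'rV[F]_d}) e, scl N -> FFree N ->
  e \in N -> e != 0 -> (#|legs N e| <= C * \dim (Ul N e))%N.
Proof.
have [D hD] : exists D, (#|{: F * F}| * (#|{: F * F}| * (#|{: F * F}| * 9)) <= D)%N by eexists.
exists (4 ^ D + 16)%N; first by lia.
move=> d N e sN ff eN e0; pose N' := [set u in N | u \in Ul N e].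
have eU : e \in Ul N e by apply: subvP (addvSl _ _) _ (memv_line e).
have sub : legs N e \subset legs N' e.
  apply/subsetP => u uL; move: (uL); rewrite inE => /and3P[uN ue /existsP[c /andP[c0 h]]].
  have uU : u \in Ul N e by apply: subvP (addvSr _ _) _ (mem_spn uL).
  rewrite inE inE uN uU ue /=; apply/existsP; exists c; rewrite c0 inE h /=.
  by rewrite memvD // memvZ.
apply: leq_trans (subset_leq_card sub) _.
apply: leq_trans (sparse_dim hD _ _ _ e0) _.
- by move=> c x c0; rewrite !inE => /andP[xN xU]; rewrite sN // memvZ.
- by apply: FFreeS ff; apply/subsetP => x; rewrite inE => /andP[].
- by rewrite inE eN.
by rewrite leq_mul2l dimvS ?orbT // spn_sub // => x; rewrite inE => /andP[].
Qed.

End Sparse.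

(** * Pigeonhole lemmas *)

Lemma inj_of_card (T : finType) (A : {set T}) n : (n <= #|A|)%N ->
  exists2 f : 'I_n -> T, injective f & forall i, f i \in A.
Proof.
move=> h; exists (fun i => enum_val (widen_ord h i)); last by move=> i; apply: enum_valP.
by move=> i j /enum_val_inj /(congr1 val) /= ij; apply: val_inj.
Qed.

Lemma fiber_card (T K : finType) (A : {set T}) (f : T -> K) n :
  (#|K| * n < #|A|)%N -> exists y, (n < #|[set x in A | f x == y]|)%N.
Proof.
move=> h; case: (boolP [exists y, (n < #|[set x in A | f x == y]|)%N]) => [/existsP //|].
rewrite negb_exists => /forallP hn; move: h; rewrite ltnNge.
rewrite -sum1_card (partition_big f xpredT) //= -sum_nat_const.
case/negP; apply: leq_sum => y _; rewrite sum1dep_card; have := hn y; rewrite -leqNgt.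
by congr (_ <= _)%N; apply: eq_card => x; rewrite !inE.
Qed.

(** A dense relation contains a complete bipartite pattern whose labels depend on one side only: fix
    boundedly many vertices of high degree, keep the vertices with at least [k] neighbours among
    them, and pigeonhole on the full pattern of adjacencies and labels. *)
Lemma bipartite_pigeon (K : finType) n k R : (0 < R)%N -> (0 < k)%N -> exists q0, forall q, (q0 <= q)%N ->
  forall (nb : 'I_q -> {set 'I_q}) (g : 'I_q -> 'I_q -> K),
  (q * q <= R * \sum_l #|nb l|)%N ->
  exists (t : 'I_k -> 'I_q) (s : 'I_n -> 'I_q) (ga : 'I_k -> K),
  [/\ injective t, injective s, forall i j, s i != t j &
      forall i j, s i \in nb (t j) /\ g (t j) (s i) = ga j].
Proof.
move=> R0 k0; pose m1 := (4 * R * k)%N.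
pose KF := {ffun 'I_m1 -> option K}.
exists (4 * R * (#|{: KF}| * n + m1 + 1))%N => q hq nb g hs.
have q0 : (0 < q)%N by apply: leq_trans hq; rewrite !muln_gt0 R0 addn1.
pose H := [set l | (q <= 2 * R * #|nb l|)%N].
have cH : (q <= 2 * R * #|H|)%N.
  have h1 : (2 * R * \sum_l #|nb l| <= q * q + #|H| * (2 * R * q))%N.
    rewrite big_distrr /= (bigID (mem H)) /= addnC.
    have a1 : (\sum_(l | l \notin H) 2 * R * #|nb l| <= q * q)%N.
      apply: leq_trans (_ : \sum_(l : 'I_q | l \notin H) q <= _)%N.
        by apply: leq_sum => l; rewrite inE -ltnNge => /ltnW.
      rewrite sum_nat_const; apply: leq_mul => //; by rewrite -[X in (_ <= X)%N](card_ord q) max_card.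
    have a2 : (\sum_(l in H) 2 * R * #|nb l| <= #|H| * (2 * R * q))%N.
      rewrite -sum_nat_const; apply: leq_sum => l _.
      by rewrite leq_mul2l -[X in (_ <= X)%N](card_ord q) max_card orbT.
    exact: leq_add.
  have h2 : (2 * (q * q) <= q * q + #|H| * (2 * R * q))%N.
    by apply: leq_trans h1; rewrite -mulnA leq_mul2l.
  have : (q * q <= (2 * R * #|H|) * q)%N by nia.
  by rewrite leq_mul2r => /orP[/eqP|]; lia.
have [t0 t0i t0H] : exists2 f : 'I_m1 -> 'I_q, injective f & forall i, f i \in H.
  apply: inj_of_card.
  have : (2 * R * m1 <= 2 * R * #|H|)%N by apply: leq_trans cH; apply: leq_trans hq; nia.
  by rewrite leq_mul2l => /orP[|//]; lia.
pose dg i := #|[set j | i \in nb (t0 j)]|.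
pose X := [set i | (k <= dg i)%N].
have sdg : (\sum_i dg i = \sum_j #|nb (t0 j)|)%N.
  rewrite (eq_bigr (fun i => \sum_(j | i \in nb (t0 j)) 1)%N); last first.
    by move=> i _; rewrite sum1dep_card.
  rewrite (exchange_big_dep xpredT) //=; apply: eq_bigr => j _; rewrite sum1dep_card.
  by apply: eq_card => i; rewrite inE.
have cX : (q <= 4 * R * #|X|)%N.
  have h1 : (m1 * q <= 2 * R * \sum_i dg i)%N.
    rewrite sdg big_distrr /= -{1}(card_ord m1) -sum_nat_const; apply: leq_sum => j _.
    by have := t0H j; rewrite inE.
  have h2 : (\sum_i dg i <= #|X| * m1 + q * k)%N.
    rewrite (bigID (mem X)) /=; apply: leq_add.
      rewrite -sum_nat_const; apply: leq_sum => i _.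
      by rewrite /dg -[X in (_ <= X)%N](card_ord m1) max_card.
    apply: leq_trans (_ : \sum_(i : 'I_q | i \notin X) k <= _)%N.
      by apply: leq_sum => i; rewrite inE -ltnNge => /ltnW.
    rewrite sum_nat_const; apply: leq_mul => //; by rewrite -[X in (_ <= X)%N](card_ord q) max_card.
  have h3 : (m1 * q <= 2 * R * (#|X| * m1 + q * k))%N.
    by apply: leq_trans h1 _; rewrite leq_mul2l h2 orbT.
  have h4 : (2 * R * k * q <= 2 * R * k * (4 * R * #|X|))%N by rewrite /m1 in h3; nia.
  by move: h4; rewrite leq_mul2l !muln_eq0 => /orP[|//]; lia.
pose X' := X :\: [set t0 j | j : 'I_m1].
have cX' : (#|{: KF}| * n < #|X'|)%N.
  have c1 : (#|X| <= #|X'| + m1)%N.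
    rewrite -(cardsID [set t0 j | j : 'I_m1] X) addnC leq_add2l.
    apply: leq_trans (subset_leq_card (subsetIr _ _)) _.
    by apply: leq_trans (leq_imset_card _ _) _; rewrite cardE size_enum_ord.
  have c2 : (4 * R * (#|{: KF}| * n + m1 + 1) <= 4 * R * #|X|)%N by apply: leq_trans cX.
  move: c2; rewrite leq_mul2l => /orP[|]; lia.
(* The pattern of [i]: for each chosen vertex, the label of the edge to [i], or [None] if there is
   no edge. *)
pose fv i : KF := [ffun j => if i \in nb (t0 j) then Some (g (t0 j) i) else None].
have [phi hphi] := fiber_card fv cX'.
have [s si sX] := inj_of_card (ltnW hphi).
have sX1 i : s i \in X' /\ fv (s i) = phi by have := sX i; rewrite inE => /andP[-> /eqP ->].
case: n s si sX sX1 cX' hphi hq => [|n] s si sX sX1 _ _ _.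
  have hk : (k <= m1)%N by rewrite /m1; nia.
  have i0 : 'I_m1 by apply: (@Ordinal _ 0); lia.
  exists (t0 \o widen_ord hk), s, (fun j => g (t0 i0) (t0 i0)); split=> //; try by case.
  by move=> i j /t0i /(congr1 val) /= h; apply: val_inj.
pose J := [set j | phi j != None].
have cJ : (k <= #|J|)%N.
  have [+ h] := sX1 ord0; rewrite inE => /andP[_]; rewrite inE => /leq_trans; apply.
  apply: subset_leq_card; apply/subsetP => j; rewrite !inE -h ffunE.
  by case: ifP.
have [t ti tJ] := inj_of_card cJ.
have [x0 _] : exists x : K, True.
  have := tJ (Ordinal k0); rewrite inE; case: (phi _) => // x _; by exists x.
exists (t0 \o t), s, (fun j => odflt x0 (phi (t j))); split => //.
- by move=> i j /t0i/ti.
- move=> i j; have [+ _] := sX1 i; rewrite inE => /andP[+ _]; apply: contra => /eqP ->.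
  by apply/imsetP; exists (t j).
move=> i j; have [_ h] := sX1 i; have := tJ j; rewrite inE -h ffunE.
by case: ifP.
Qed.

(** A uniformly random [W] meets [S] exactly in [Q] with probability 2^-|S|. *)
Lemma card_trace (I : finType) (S Q : {set I}) : Q \subset S ->
  (2 ^ #|I| <= #|[set W : {set I} | S :&: W == Q]| * 2 ^ #|S|)%N.
Proof.
move=> /subsetP QS; rewrite -(cardsC S) expnD mulnC leq_mul2r; apply/orP; right.
rewrite -card_powerset -(card_in_imset (f := fun W => W :|: Q)); last first.
  move=> W W'; rewrite !powersetE => /subsetP hW /subsetP hW' /setP h; apply/setP => x.
  have := h x; rewrite !inE; case: (boolP (x \in Q)) => [/QS xS _|_]; last by rewrite !orbF.
  by apply/idP/idP => [/hW|/hW']; rewrite inE xS.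
apply: subset_leq_card; apply/subsetP => _ /imsetP[W + ->]; rewrite powersetE => /subsetP hW.
rewrite inE; apply/eqP/setP => x; rewrite !inE.
apply/andP/idP => [[xS /orP[/hW|//]]|xQ]; first by rewrite inE xS.
by rewrite QS // xQ orbT.
Qed.

Lemma free_mod (F : fieldType) (V V' : vectType F) (f : 'Hom(V, V')) (s S : seq V) :
  lker f = <<S>>%VS -> free (s ++ S) -> free (map f s).
Proof.
move=> kf; elim: s => [|x s IH] /=; first by rewrite nil_free.
by rewrite !free_cons (mem_span_ker _ _ kf) => /andP[-> /IH ->].
Qed.

Lemma leq_sub6 m n : (m <= 2 -> 5 < m + n -> 0 < n)%N.
Proof. lia. Qed.

Lemma add_shadow n : (n + 5 = 3 + n.+1 + 1)%N.
Proof. lia. Qed.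

(** * Clique minors when the legs of [e] contain a basis modulo [e] *)

Section SpanningLegs.
Variables (F : finFieldType) (hF : #|F| = 4%N) (al : F) (hal : al ^+ 2 = al + 1).

Let two0 : (2%:R : F) = 0 := f4_two hF hal.
Let addff := f4_add hF hal.
Let addvv := f4_addv hF hal.
Let oppvv := f4_oppv hF hal.
Let oppff := f4_opp hF hal.

Section Fixed.
Variables (d : nat) (N : {set 'rV[F]_d}) (e : 'rV[F]_d) (q : nat) (b : 'I_q -> 'rV[F]_d).
Local Notation V := 'rV[F]_d.
Hypotheses (sN : scl N) (ff : FFree N) (eN : e \in N) (bN : forall i, b i \in N)
  (beN : forall i, b i + e \in N).

Let bt : q.+1.-tuple V := [tuple of e :: map_tuple b (ord_tuple q)].
Hypotheses (bfree : free bt) (bspan : (spn N <= <<bt>>)%VS).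

Definition ce v := coord bt ord0 v.
Definition cb v (i : 'I_q) := coord bt (lift ord0 i) v.
Definition coord_supp v := [set i | cb v i != 0].

Let btS (i : 'I_q) : (bt : seq V)`_(lift ord0 i) = b i.
Proof.
by rewrite lift0 /= (nth_map i) ?size_enum_ord //; congr b; apply: val_inj; rewrite /= nth_enum_ord.
Qed.

Lemma cE v : v \in N -> v = ce v *: e + \sum_i cb v i *: b i.
Proof.
move=> vN; rewrite {1}(coord_span (subvP bspan _ (mem_spn vN))) big_ord_recl; congr (_ + _).
by apply: eq_bigr => i _; rewrite btS.
Qed.

Lemma cb_b i j : cb (b i) j = (i == j)%:R.
Proof. by rewrite /cb -(btS i) coord_free // (inj_eq lift_inj). Qed.

Lemma ce_b i : ce (b i) = 0.
Proof. by rewrite /ce -(btS i) coord_free // eq_sym (negPf (neq_lift _ _)). Qed.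

Lemma cbD v w i : cb (v + w) i = cb v i + cb w i. Proof. exact: linearD. Qed.
Lemma ceD v w : ce (v + w) = ce v + ce w. Proof. exact: linearD. Qed.
Lemma cbZ c v i : cb (c *: v) i = c * cb v i. Proof. exact: linearZ. Qed.
Lemma ceZ c v : ce (c *: v) = c * ce v. Proof. exact: linearZ. Qed.

Lemma dim_bt : \dim <<bt>> = q.+1.
Proof. by move/eqP: bfree; rewrite size_tuple. Qed.

Lemma bt_mem (U : {vspace V}) : e \in U -> (forall i, b i \in U) -> (<<bt>> <= U)%VS.
Proof.
move=> eU bU; apply/span_subvP => x; rewrite inE => /orP[/eqP -> //|/mapP[i _ ->]].
exact: bU.
Qed.

Lemma bt_free s : e \in <<s>>%VS -> (forall i, b i \in <<s>>%VS) -> (size s <= q.+1)%N -> free s.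
Proof. by move=> h1 h2 h3; apply: (free_size_dim (bt_mem h1 h2)); rewrite dim_bt. Qed.

Lemma card3 (T : finType) (i j k : T) : i != j -> i != k -> j != k -> #|[set i; j; k]| = 3%N.
Proof. by move=> ij ik jk; rewrite setUC cardsU1 cards2 !inE (eq_sym k) (eq_sym k) negb_or ik jk ij. Qed.

Lemma sum3 (T : finType) (i j k : T) (G : T -> V) : i != j -> i != k -> j != k ->
  \sum_l G l = G i + G j + G k + \sum_(l in ~: [set i; j; k]) G l.
Proof.
move=> ij ik jk; rewrite (bigD1 i) //= (bigD1 j) /=; last by rewrite eq_sym.
rewrite (bigD1 k) /=; last by rewrite eq_sym ik eq_sym jk.
rewrite !addrA; congr (_ + _); by apply: eq_bigl => l; rewrite !inE !negb_or -andbA.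
Qed.

(** Every [b l] may be exchanged for [b l + e], and [tau] selects where. If this brings the total
    [e]-coordinate to 0 or [a], then contracting [z] and the chosen vectors leaves [a *: b i],
    [a *: b j] and [a *: b k + s *: e], each with its shift by [a *: e] in [N]: a Fano plane. *)
Lemma three_equal z (a : F) i j k (tau : 'I_q -> bool) : z \in N -> a != 0 ->
  i != j -> i != k -> j != k -> cb z i = a -> cb z j = a -> cb z k = a ->
  ce z + \sum_(l in ~: [set i; j; k]) cb z l * (tau l)%:R = 0 \/
  ce z + \sum_(l in ~: [set i; j; k]) cb z l * (tau l)%:R = a -> False.
Proof.
move=> zN a0 ij ik jk ci cj ck hs.
set S := ~: [set i; j; k] in hs; set s := ce z + _ in hs.
pose y l := b l + (tau l)%:R *: e.
pose T := z :: map y (enum S).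
have yN l : y l \in N by rewrite /y; case: (tau l); rewrite ?scale1r ?scale0r ?addr0.
have zE : z = a *: b i + a *: b j + a *: b k + s *: e + \sum_(l in S) cb z l *: y l.
  rewrite {1}(cE zN) (sum3 _ ij ik jk) -/S ci cj ck.
  have -> : \sum_(l in S) cb z l *: y l = \sum_(l in S) cb z l *: b l +
      (\sum_(l in S) cb z l * (tau l)%:R) *: e.
    rewrite scaler_suml -big_split; apply: eq_bigr => l _; by rewrite /= scalerDr scalerA.
  rewrite /s; move: (_ + _ + a *: b k) (\sum_(l in S) _ *: _) (\sum_(l in S) _ * _) => w u v.
  by rewrite scalerDl addrCA -!addrA (addrCA (v *: e) u) addvv addr0.
pose x3 := a *: b k + s *: e.
have ae0 l : a *: b l + a *: e \in N by rewrite -scalerDr sN.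
have x3N : x3 \in N by rewrite /x3; case: hs => ->; rewrite ?scale0r ?addr0 ?sN.
have y3N : x3 + a *: e \in N.
  rewrite /x3; case: hs => ->; rewrite ?scale0r ?addr0 ?ae0 //.
  by rewrite -addrA addvv addr0 sN.
pose L := a *: b j :: a *: b i :: a *: e :: T.
have sT : (size T + 3 = q.+1)%N.
  by rewrite /= size_map -cardE -(card3 ij ik jk) addSn addnC cardsC card_ord.
have eL : e \in <<L>>%VS by rewrite -(memvZeq _ _ a0) memv_span // !inE eqxx ?orbT.
have iL : b i \in <<L>>%VS by rewrite -(memvZeq _ _ a0) memv_span // !inE eqxx ?orbT.
have jL : b j \in <<L>>%VS by rewrite -(memvZeq _ _ a0) memv_span // !inE eqxx ?orbT.
have zL : z \in <<L>>%VS by rewrite memv_span // !inE eqxx ?orbT.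
have yL l : l \in S -> y l \in <<L>>%VS.
  by move=> lS; rewrite memv_span // !inE map_f ?orbT // mem_enum.
have SL : \sum_(l in S) cb z l *: y l \in <<L>>%VS.
  by rewrite memv_suml // => l lS; rewrite memvZ ?yL.
have kL : b k \in <<L>>%VS.
  have seL : s *: e \in <<L>>%VS by rewrite memvZ.
  have ijL : a *: b i + a *: b j \in <<L>>%VS by rewrite memvD ?memvZ.
  rewrite -(memvZeq _ _ a0); move: zL; rewrite {1}zE.
  by rewrite (rpredDr _ SL) (rpredDr _ seL) (rpredDl _ ijL).
have fL : free L.
  apply: bt_free => //; last by rewrite /= addn3 in sT; rewrite -sT.
  move=> l; case: (boolP (l \in S)) => [lS|]; last first.
    by rewrite !inE negbK => /orP[/orP[]|] /eqP ->.
  by move: (yL _ lS); rewrite /y (rpredDr _ (memvZ _ eL)).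
move: fL; rewrite !free_cons => /and4P[f2 f1 f0 _].
apply: (ff (T := T) (e := a *: e) (x1 := a *: b i) (y1 := a *: b i + a *: e) (x2 := a *: b j)
  (y2 := a *: b j + a *: e) (x3 := x3) (y3 := x3 + a *: e)) => //; rewrite ?subrr ?mem0v //; try exact: sN.
- by move=> x; rewrite inE => /orP[/eqP -> //|/mapP[l _ ->]].
have zT : z \in <<T>>%VS by rewrite memv_span ?mem_head.
have ST : \sum_(l in S) cb z l *: y l \in <<T>>%VS.
  by rewrite memv_suml // => l lS; rewrite memvZ // memv_span // inE map_f ?orbT // mem_enum.
by move: zT; rewrite {1}zE (rpredDr _ ST) /x3 !addrA.
Qed.

Lemma weight3 z (a : F) i j k : z \in N -> a != 0 ->
  i != j -> i != k -> j != k -> cb z i = a -> cb z j = a -> cb z k = a ->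
  [/\ forall l, cb z l = 0 \/ cb z l = a, ce z != 0 & ce z != a].
Proof.
move=> zN a0 ij ik jk ci cj ck.
have H tau := @three_equal z a i j k tau zN a0 ij ik jk ci cj ck.
have s0 : \sum_(l in ~: [set i; j; k]) cb z l * (false)%:R = 0.
  by rewrite big1 // => l _; rewrite mulr0.
have n0 : ce z != 0.
  by apply/negP => /eqP h; apply: (H (fun=> false)); left; rewrite s0 addr0.
have na : ce z != a.
  by apply/negP => /eqP h; apply: (H (fun=> false)); right; rewrite s0 addr0.
split=> // l; case: (eqVneq (cb z l) 0) => [|l0]; first by left.
case: (eqVneq (cb z l) a) => [|la]; first by right.
have lS : l \in ~: [set i; j; k].
  rewrite !inE !negb_or; apply/andP; split; [apply/andP; split|]; apply: contra la => /eqP ->;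
  by rewrite ?ci ?cj ?ck.
(* A further nonzero value [cb z l] different from [a] would let a single exchange move the
   [e]-coordinate into [{0, a}], by [f4_coset]. *)
case: (H (fun m => m == l)).
have -> : \sum_(m in ~: [set i; j; k]) cb z m * (m == l)%:R = cb z l.
  rewrite (bigD1 l) //= eqxx mulr1 big1 ?addr0 // => m /andP[_ /negPf ->]; by rewrite mulr0.
case: (f4_coset hF hal (ce z) a0 l0 la).
  by case/orP => h; [rewrite h in n0 | rewrite h in na].
by case/orP => /eqP ->; [left|right].
Qed.

(** Seven nonzero entries take only three values, so one value occurs three times. *)
Lemma big_supp z : z \in N -> (6 < #|coord_supp z|)%N -> exists a i j k,
  [/\ a != 0, [/\ i != j, i != k & j != k] & [/\ cb z i = a, cb z j = a & cb z k = a]].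
Proof.
move=> zN h; pose A x : {set 'I_q} := [set i | cb z i == x].
suff [x x0 hx] : exists2 x, x != 0 & (2 < #|A x|)%N.
  case/card_gt2P: hx => i [j [k [[]]]]; rewrite !inE => /eqP hi /eqP hj /eqP hk [ij jk ki].
  by exists x, i, j, k; split => //; rewrite ij jk eq_sym ki.
have sub : coord_supp z \subset A 1 :|: A al :|: A (al ^+ 2).
  apply/subsetP => i; rewrite !inE; case: (f4_case hF hal (cb z i)) => ->; by rewrite !eqxx ?orbT.
have hc := leq_trans h (subset_leq_card sub).
have cU (X Y : {set 'I_q}) : (#|X :|: Y| <= #|X| + #|Y|)%N by rewrite cardsU leq_subr.
have c1 := cU (A 1 :|: A al) (A (al ^+ 2)); have c2 := cU (A 1) (A al).
case: (ltnP 2 #|A 1%R|) => [h1|h1]; first by exists 1; rewrite ?oner_eq0.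
case: (ltnP 2 #|A al|) => [h2|h2]; first by exists al; rewrite ?(f4_a0 hal).
exists (al ^+ 2); first by rewrite (f4_b0 hal).
rewrite ltnNge; apply/negP => h3.
by have := leq_trans hc (leq_trans c1 (leq_add (leq_trans c2 (leq_add h1 h2)) h3)).
Qed.

(** The [e]-coordinates of [z] and [y] are neither 0 nor 1, so their sum is 0 or 1. Hence [z + y],
    which is supported on the positions where they differ, plays the role of the vector in
    [three_equal]. *)
Lemma unif_pair z y i j k k0 : z \in N -> y \in N ->
  (forall l, cb z l = 0 \/ cb z l = 1) -> (forall l, cb y l = 0 \/ cb y l = 1) ->
  ce z != 0 -> ce z != 1 -> ce y != 0 -> ce y != 1 ->
  cb z k0 = 1 -> cb y k0 = 1 -> i != j -> i != k -> j != k ->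
  cb z i != cb y i -> cb z j != cb y j -> cb z k != cb y k -> False.
Proof.
move=> zN yN z01 y01 z0 z1 y0 y1 zk0 yk0 ij ik jk di dj dk.
pose s := ce z + ce y.
have hs : s = 0 \/ s = 1.
  rewrite /s; move: z0 z1 y0 y1; case: (f4_case hF hal (ce z)) => ->;
  case: (f4_case hF hal (ce y)) => ->; rewrite ?eqxx ?(f4E hF hal) //; auto.
have d1 l : cb z l != cb y l -> cb z l + cb y l = 1.
  by case: (z01 l) => ->; case: (y01 l) => ->; rewrite ?eqxx ?addr0 ?add0r.
(* [b k0] is not contracted: [z] already eliminates it, while [z + y] supplies the relation among
   [b i], [b j] and [b k]. *)
pose S := ~: [set i; j; k] :\ k0.
have k0S : k0 \in ~: [set i; j; k].
  by rewrite !inE !negb_or; apply/andP; split; [apply/andP; split|]; [move: di|move: dj|move: dk];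
     apply: contra => /eqP <-; rewrite zk0 yk0.
have zyE : z + y = b i + b j + b k + s *: e + \sum_(l in S) (cb z l + cb y l) *: b l.
  have -> : z + y = s *: e + \sum_l (cb z l + cb y l) *: b l.
    rewrite {1}(cE zN) {1}(cE yN) addrACA -scalerDl; congr (_ + _).
    by rewrite -big_split; apply: eq_bigr => l _; rewrite scalerDl.
  rewrite (sum3 _ ij ik jk) !d1 // !scale1r (bigD1 k0) //= zk0 yk0 addff scale0r add0r.
  rewrite addrCA addrA; congr (_ + _); by apply: eq_bigl => l; rewrite !inE andbC.
pose T := z :: y :: map b (enum S).
pose L := b j :: b i :: e :: T.
have sL : (size L = q.+1)%N.
  have c1 : #|~: [set i; j; k]| = (1 + #|S|)%N by rewrite (cardsD1 k0) k0S.
  have c2 : (3 + #|~: [set i; j; k]| = q)%N by rewrite -(card3 ij ik jk) cardsC card_ord.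
  by rewrite c1 in c2; rewrite /= size_map -cardE; exact: (congr1 succn c2).
have inL x : x \in L -> x \in <<L>>%VS by apply: memv_span.
have eL : e \in <<L>>%VS by rewrite inL // !inE eqxx ?orbT.
have iL : b i \in <<L>>%VS by rewrite inL // !inE eqxx ?orbT.
have jL : b j \in <<L>>%VS by rewrite inL // !inE eqxx ?orbT.
have zL : z \in <<L>>%VS by rewrite inL // !inE eqxx ?orbT.
have yL : y \in <<L>>%VS by rewrite inL // !inE eqxx ?orbT.
have SL l : l \in S -> b l \in <<L>>%VS.
  by move=> lS; rewrite inL // !inE map_f ?orbT // mem_enum.
have sumL : \sum_(l in S) (cb z l + cb y l) *: b l \in <<L>>%VS.
  by rewrite memv_suml // => l lS; rewrite memvZ ?SL.
have kL : b k \in <<L>>%VS.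
  have : z + y \in <<L>>%VS by rewrite memvD.
  by rewrite zyE (rpredDr _ sumL) (rpredDr _ (memvZ _ eL)) (rpredDl _ (memvD iL jL)).
have nk l : l != k0 -> b l \in <<L>>%VS.
  move=> lk; case: (boolP (l \in [set i; j; k])) => [|h].
    by rewrite !inE => /orP[/orP[]|] /eqP ->.
  by apply: SL; rewrite !inE lk /=; move: h; rewrite !inE.
have k0L : b k0 \in <<L>>%VS.
  move: zL; rewrite {1}(cE zN) (rpredDl _ (memvZ _ eL)) (bigD1 k0) //= zk0 scale1r.
  rewrite rpredDr //; rewrite memv_suml // => l lk; by rewrite memvZ ?nk.
have fL : free L.
  apply: bt_free => //; last by rewrite sL.
  by move=> l; case: (eqVneq l k0) => [-> //|/nk].
move: fL; rewrite !free_cons => /and4P[f2 f1 f0 _].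
have x3N : b k + s *: e \in N by case: hs => ->; rewrite ?scale0r ?scale1r ?addr0.
have y3N : b k + s *: e + e \in N.
  by case: hs => ->; rewrite ?scale0r ?scale1r ?addr0 // -addrA addvv addr0.
apply: (ff (T := T) (e := e) (x1 := b i) (y1 := b i + e) (x2 := b j)
  (y2 := b j + e) (x3 := b k + s *: e) (y3 := b k + s *: e + e)) => //; rewrite ?subrr ?mem0v //.
- by move=> x; rewrite !inE => /or3P[/eqP -> //|/eqP -> //|/mapP[l _ ->]].
have zyT : z + y \in <<T>>%VS by rewrite memvD ?memv_span // !inE eqxx ?orbT.
have ST : \sum_(l in S) (cb z l + cb y l) *: b l \in <<T>>%VS.
  by rewrite memv_suml // => l lS; rewrite memvZ // memv_span // !inE map_f ?orbT // mem_enum.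
by move: zyT; rewrite zyE (rpredDr _ ST) !addrA.
Qed.

Section Leg.
Variable i0 : 'I_q.

(** Legs of [b i0] with large support. They escape the counting by [shadow], so they have to be
    confined to a bounded dimension. *)
Definition bad_coord z := [&& z \in N, cb z i0 != 0, (6 < #|coord_supp z|)%N & [exists c, (c != 0) && (z + c *: b i0 \in N)]].

Lemma bad_normal z : bad_coord z -> exists2 a, a != 0 &
  [/\ [/\ a *: z \in N, a *: z + b i0 \in N, forall l, cb (a *: z) l = 0 \/ cb (a *: z) l = 1,
       ce (a *: z) != 0 & ce (a *: z) != 1], cb (a *: z) i0 = 1 & coord_supp (a *: z) = coord_supp z].
Proof.
case/and4P=> zN z0 hz /existsP[c /andP[c0 zc]].
have [a [i [j [k [a0 [ij ik jk] [hi hj hk]]]]]] := big_supp zN hz.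
have [za ze0 zea] := weight3 zN a0 ij ik jk hi hj hk.
have hi0 : cb z i0 = a by case: (za i0) z0 => ->; rewrite ?eqxx.
have va : a^-1 != 0 by rewrite invr_eq0.
exists a^-1 => //; split; last 1 first.
- by apply/setP => l; rewrite !inE cbZ mulf_eq0 (negPf va).
- have h01 l : cb (a^-1 *: z) l = 0 \/ cb (a^-1 *: z) l = 1.
    by rewrite cbZ; case: (za l) => ->; rewrite ?mulr0 ?mulVf //; auto.
  split=> //; first exact: sN.
  + (* the partner leg is uniform as well, so its [i0]-coordinate must vanish *)
    pose z' := a^-1 *: z + (a^-1 * c) *: b i0.
    have z'N : z' \in N by rewrite /z' -scalerA -scalerDr sN.
    have z'b l : l != i0 -> cb z' l = cb (a^-1 *: z) l.
      by move=> ln; rewrite /z' cbD (cbZ _ (b i0)) cb_b eq_sym (negPf ln) mulr0 addr0.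
    have : (2 < #|coord_supp z :\ i0|)%N.
      by move: hz; rewrite (cardsD1 i0 (coord_supp z)) inE z0 add1n ltnS => /(leq_trans _); apply.
    case/card_gt2P => i' [j' [k' [[hi' hj' hk'] [ij' jk' ki']]]].
    have val1 l : l \in coord_supp z :\ i0 -> cb z' l = 1.
      rewrite !inE => /andP[li lz]; rewrite z'b // cbZ.
      by case: (za l) lz => ->; rewrite ?eqxx // mulVf.
    rewrite eq_sym in ki'.
    have [w _ _] := weight3 z'N (oner_neq0 F) ij' ki' jk' (val1 _ hi') (val1 _ hj') (val1 _ hk').
    have e1 : cb z' i0 = 1 + a^-1 * c.
      by rewrite /z' cbD (cbZ _ (b i0)) cb_b eqxx mulr1 cbZ hi0 mulVf.
    suff e2 : a^-1 * c = 1 by move: z'N; rewrite /z' e2 scale1r.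
    have nz : a^-1 * c != 0 by rewrite mulf_neq0.
    case: (w i0); rewrite e1 => /eqP.
      by rewrite addr_eq0 oppff => /eqP <-.
    by rewrite -subr_eq0 addrAC subrr add0r (negPf nz).
  + by rewrite ceZ mulf_neq0.
  by rewrite ceZ -(mulVf a0) (inj_eq (mulfI va)).
by rewrite cbZ hi0 mulVf.
Qed.

Definition symd (A B : {set 'I_q}) := (A :\: B) :|: (B :\: A).

(** [unif_pair] excludes three differences. Two are excluded as well, because replacing one vector
    by its partner over [b i0] creates a third difference at [i0]. *)
Lemma bad_close z y : bad_coord z -> bad_coord y -> (#|symd (coord_supp z) (coord_supp y)| <= 1)%N.
Proof.
move=> bz bY; have [a _ [[zN zbN z01 z0 z1] zi zs]] := bad_normal bz.
have [c _ [[yN ybN y01 y0 y1] yi ys]] := bad_normal bY.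
rewrite -zs -ys; move: (a *: z) (c *: y) zN zbN z01 z0 z1 zi yN ybN y01 y0 y1 yi zs ys => {a c}.
move=> z' y' zN zbN z01 z0 z1 zi yN ybN y01 y0 y1 yi zs ys.
have symE l : (l \in symd (coord_supp z') (coord_supp y')) = (cb z' l != cb y' l).
  rewrite !inE; case: (z01 l) => ->; case: (y01 l) => ->; by rewrite ?eqxx ?oner_eq0 // eq_sym oner_eq0.
have c2 : (#|symd (coord_supp z') (coord_supp y')| <= 2)%N.
  rewrite leqNgt; apply/negP => /card_gt2P[i [j [k [[hi hj hk] [ij jk ki]]]]].
  rewrite !symE in hi hj hk; rewrite eq_sym in ki.
  exact: (unif_pair zN yN z01 y01 z0 z1 y0 y1 zi yi ij ki jk hi hj hk).
rewrite leqNgt; apply/negP => c1.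
(* Same coordinates as [z'] away from [i0], but zero at [i0], where [y'] has a one. *)
pose w := z' + b i0.
have wl l : l != i0 -> cb w l = cb z' l.
  by move=> ln; rewrite /w cbD cb_b eq_sym (negPf ln) addr0.
have wi : cb w i0 = 0 by rewrite /w cbD cb_b eqxx zi addff.
have w01 l : cb w l = 0 \/ cb w l = 1.
  by case: (eqVneq l i0) => [->|/wl -> //]; rewrite wi; left.
have we : ce w = ce z' by rewrite /w ceD ce_b addr0.
have [k0 k0P] : exists k0, [&& k0 != i0, cb z' k0 == 1 & cb y' k0 == 1].
  have hz : (6 < #|coord_supp z'|)%N by rewrite zs; case/and4P: bz.
  have : (0 < #|(coord_supp z' :\ i0) :\: symd (coord_supp z') (coord_supp y')|)%N.
    move: hz; rewrite (cardsD1 i0 (coord_supp z')) inE zi oner_eq0 /= add1n ltnS.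
    rewrite -(cardsID (symd (coord_supp z') (coord_supp y')) (coord_supp z' :\ i0)).
    have : (#|(coord_supp z' :\ i0) :&: symd (coord_supp z') (coord_supp y')| <= 2)%N.
      by apply: leq_trans c2; rewrite subset_leq_card ?subsetIr.
    exact: leq_sub6.
  case/card_gt0P => l; rewrite in_setD symE negbK !inE => /and3P[/eqP e1 li lz].
  exists l; rewrite li -e1 /= ; by case: (z01 l) lz => ->; rewrite ?eqxx.
case/and3P: k0P => k0i /eqP zk0 /eqP yk0.
have /card_gt1P[i [j [hi hj ij]]] := c1.
rewrite !symE in hi hj.
have ni l : cb z' l != cb y' l -> l != i0 by apply: contra => /eqP ->; rewrite zi yi.
have we0 : ce w != 0 by rewrite we.
have we1 : ce w != 1 by rewrite we.
have wk0 : cb w k0 = 1 by rewrite wl.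
have [ii0 ji0] := (ni _ hi, ni _ hj).
have hi' : cb w i != cb y' i by rewrite wl.
have hj' : cb w j != cb y' j by rewrite wl.
have hk' : cb w i0 != cb y' i0 by rewrite wi yi eq_sym oner_eq0.
exact: (unif_pair zbN yN w01 y01 we0 we1 y0 y1 wk0 yk0 ij ii0 ji0 hi' hj' hk').
Qed.

Lemma supp_mem z (J : {set 'I_q}) (U : {vspace V}) : z \in N -> coord_supp z \subset J ->
  e \in U -> (forall l, l \in J -> b l \in U) -> z \in U.
Proof.
move=> zN /subsetP sJ eU bU; rewrite (cE zN) memvD ?memvZ // memv_suml // => l _.
case: (eqVneq (cb z l) 0) => [->|h]; first by rewrite scale0r mem0v.
by rewrite memvZ // bU // sJ // inE.
Qed.

(** A bad vector is determined up to scaling and a multiple of [e] by its support, and there are at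
    most two supports; together with [e] this gives dimension three. *)
Lemma bad_span : exists2 A : {vspace V}, (\dim A <= 3)%N & forall z, bad_coord z -> z \in A.
Proof.
pose w (z : V) := \sum_(l in coord_supp z) b l.
have bw z : bad_coord z -> z \in <<[:: e; w z]>>%VS.
  move=> bz; have [a a0 [[zN _ z01 _ _] _ zs]] := bad_normal bz.
  rewrite -(memvZeq _ _ a0) (cE zN) memvD //.
    by rewrite memvZ // memv_span // mem_head.
  suff -> : \sum_l cb (a *: z) l *: b l = w z by rewrite memv_span // !inE eqxx orbT.
  rewrite /w -zs [RHS]big_mkcond /=; apply: eq_bigr => l _; rewrite inE.
  by case: (z01 l) => ->; rewrite ?eqxx ?oner_eq0 /= ?scale0r ?scale1r.
have sub (s1 s2 : seq V) x : {subset s1 <= s2} -> x \in <<s1>>%VS -> x \in <<s2>>%VS.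
  by move=> h; apply: subvP; apply: sub_span.
case: (boolP [exists z, bad_coord z]) => [/existsP[z bz]|/existsPn h]; last first.
  by exists 0%VS => [|z bz]; [rewrite dimv0 | case/negP: (h z)].
case: (boolP [exists y, bad_coord y && (coord_supp y != coord_supp z)]) => [/existsP[y /andP[bY yz]]|/existsPn h].
  exists <<[:: e; w z; w y]>>%VS => [|x bx]; first exact: dim_span.
  (* Distinct supports differ in exactly one element and so have sizes of opposite parity, which
     three supports cannot have pairwise. *)
  have par u v : bad_coord u -> bad_coord v -> coord_supp u != coord_supp v -> odd #|coord_supp u| = ~~ odd #|coord_supp v|.
    move=> bu bv uv; have := bad_close bu bv; rewrite /symd cardsU.
    have -> : (coord_supp u :\: coord_supp v) :&: (coord_supp v :\: coord_supp u) = set0.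
      by apply/setP => l; rewrite !inE; do 2 case: eqP.
    rewrite cards0 subn0 -(cardsID (coord_supp v) (coord_supp u)) -(cardsID (coord_supp u) (coord_supp v)).
    rewrite (setIC (coord_supp v)); have : (0 < #|coord_supp u :\: coord_supp v| + #|coord_supp v :\: coord_supp u|)%N.
      rewrite lt0n addn_eq0 !cards_eq0 !setD_eq0; apply: contra uv => /andP[h1 h2].
      by rewrite eqEsubset h1.
    rewrite !oddD; move: #|coord_supp u :&: coord_supp v| #|coord_supp u :\: coord_supp v| #|coord_supp v :\: coord_supp u|.
    by move=> m0 [|[|m1]] [|[|m2]] //=; rewrite ?addbF ?addbT ?negbK.
  case: (eqVneq (coord_supp x) (coord_supp z)) => [e1|n1].
    apply: (sub [:: e; w x]); last exact: bw.
    by move=> t; rewrite !inE /w e1 => /orP[->|->]; rewrite ?orbT.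
  case: (eqVneq (coord_supp x) (coord_supp y)) => [e1|n2].
    apply: (sub [:: e; w x]); last exact: bw.
    by move=> t; rewrite !inE /w e1 => /orP[->|->]; rewrite ?orbT.
  by have := par _ _ bx bz n1; rewrite (par _ _ bx bY n2) (par _ _ bY bz yz); case: (odd _).
exists <<[:: e; w z]>>%VS => [|x bx]; first exact: leq_trans (dim_span _) _.
have := h x; rewrite bx /= negbK => /eqP e1; rewrite /w -e1; exact: bw.
Qed.

Definition shadow := [set l | [exists z in N, [&& (#|coord_supp z| <= 6)%N, cb z i0 != 0 & cb z l != 0]]].

(** The 5 is made up of one for [b i0], three for the bad legs and one for [e]. *)
Lemma shadow_dim : (\dim (Ul N (b i0)) <= #|shadow| + 5)%N.
Proof.
have [A dA hA] := bad_span.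
pose s := e :: map b (enum shadow).
apply: leq_trans (_ : \dim (<[b i0]> + (A + <<s>>)) <= _)%N; last first.
  have h1 := dimv_add_leqif <[b i0]>%VS (A + <<s>>)%VS; have h2 := dimv_add_leqif A <<s>>%VS.
  have h3 : (\dim <[b i0]> <= 1)%N by rewrite dim_vline leq_b1.
  have h4 : (\dim <<s>> <= #|shadow|.+1)%N by apply: leq_trans (dim_span _) _; rewrite /= size_map -cardE.
  apply: leq_trans h1.1 _; rewrite addnC add_shadow.
  by apply: leq_add h3; apply: leq_trans h2.1 _; apply: leq_add.
apply: dimvS; rewrite subv_add addvSl /=; apply: spn_sub => u.
rewrite inE => /and3P[uN _ /existsP[c /andP[c0 uc]]].
set U := (A + <<s>>)%VS.
have good z : z \in N -> cb z i0 != 0 -> (exists2 c, c != 0 & z + c *: b i0 \in N) -> z \in U.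
  move=> zN z0 [c' c'0 zc]; case: (leqP #|coord_supp z| 6) => hz; last first.
    by apply: (subvP (addvSl _ _)); apply: hA; rewrite /bad_coord zN z0 hz; apply/existsP; exists c'; rewrite c'0.
  apply: (subvP (addvSr _ _)); apply: (supp_mem (J := shadow)) => //.
  - apply/subsetP => l; rewrite inE => l0; rewrite inE; apply/exists_inP; exists z => //.
    by rewrite hz z0.
  - by rewrite memv_span ?mem_head.
  by move=> l lS; rewrite memv_span // inE map_f ?orbT // mem_enum.
have bU : c *: b i0 \in (<[b i0]> + U)%VS by apply: subvP (addvSl _ _) _ (memvZ _ (memv_line _)).
case: (eqVneq (cb u i0) 0) => [u0|u0]; last first.
  by apply: (subvP (addvSr _ _)); apply: good => //; exists c.
rewrite -(rpredDr _ bU); apply: (subvP (addvSr _ _)); apply: good => //.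
  by rewrite cbD cbZ cb_b eqxx mulr1 u0 add0r.
by exists c => //; rewrite -addrA addvv addr0.
Qed.
End Leg.

(** Large leg spaces force large shadows, so a positive fraction of the pairs [(i, l)] is joined by
    a vector of support at most six. Restricting to a well-chosen index set [W] makes many of these
    vectors behave like edges, and a complete bipartite pattern of edges contracts onto a clique. *)
Lemma legs_Kminor_aux n R : (0 < n)%N ->
  (forall (nb : 'I_q -> {set 'I_q}) (g : 'I_q -> 'I_q -> F), (q * q <= 128 * R * \sum_l #|nb l|)%N ->
  exists (t : 'I_#|{: 'I_n * 'I_n}| -> 'I_q) (s : 'I_n -> 'I_q) (ga : 'I_#|{: 'I_n * 'I_n}| -> F),
  [/\ injective t, injective s, forall i j, s i != t j &
      forall i j, s i \in nb (t j) /\ g (t j) (s i) = ga j]) ->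
  (12 * R <= q)%N -> (forall i, (q <= R * \dim (Ul N (b i)))%N) -> Kminor n N.
Proof.
move=> n0 pigeon q12 hdim.
pose zz (p : 'I_q * 'I_q) := odflt 0 [pick z in N | [&& (#|coord_supp z| <= 6)%N, cb z p.1 != 0 & cb z p.2 != 0]].
have zzP i l : l \in shadow i ->
   [/\ zz (i, l) \in N, (#|coord_supp (zz (i, l))| <= 6)%N, cb (zz (i, l)) i != 0 & cb (zz (i, l)) l != 0].
  rewrite inE => /exists_inP[z zN hz]; rewrite /zz; case: pickP => [z' /and4P[]|/(_ z)] //=.
  by rewrite zN hz.
pose Pr := [set p : 'I_q * 'I_q | (p.1 != p.2) && (p.2 \in shadow p.1)].
pose tr (W : {set 'I_q}) := [set p in Pr | coord_supp (zz p) :&: W == [set p.1; p.2]].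
(* The shadow bound loses 5 and the diagonal loses 1; the assumption [12 * R <= q] absorbs these
   six. *)
have cPr : (q * q <= 2 * R * #|Pr|)%N.
  have -> : #|Pr| = (\sum_i #|shadow i :\ i|)%N.
    rewrite -sum1_card (eq_bigl (fun p => (p.1 \in 'I_q) && (p.2 \in shadow p.1 :\ p.1))); last first.
      by move=> [i l]; rewrite !inE /= (eq_sym l).
    rewrite -(pair_big_dep (mem 'I_q) (fun i l => l \in shadow i :\ i) (fun _ _ => 1%N)) /=.
    by apply: eq_bigr => i _; rewrite sum1_card.
  rewrite big_distrr /= -{1}(card_ord q) -sum_nat_const; apply: leq_sum => i _.
  have h1 := hdim i; have h2 := shadow_dim i.
  have h3 : (#|shadow i| <= #|shadow i :\ i| + 1)%N by rewrite (cardsD1 i) addnC leq_add2l leq_b1.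
  have h4 : (q <= R * (#|shadow i :\ i| + 6))%N.
    apply: leq_trans h1 _; rewrite leq_mul2l; apply/orP; right; apply: leq_trans h2 _.
    by apply: leq_trans (leq_add h3 (leqnn 5)) _; rewrite -addnA.
  by move: h4 q12; clear; move: #|_| => m; nia.
(* Averaging over all [W]: a support of size at most six meets [W] exactly in the given pair with
   probability at least 1/64. With the factor 2 above this explains 128. *)
have [W hW] : exists W, (#|Pr| <= 64 * #|tr W|)%N.
  case: (boolP [exists W, (#|Pr| <= 64 * #|tr W|)%N]) => [/existsP //|/existsPn hn].
  have s1 : (\sum_(W : {set 'I_q}) #|tr W| = \sum_(p in Pr) #|[set W | coord_supp (zz p) :&: W == [set p.1; p.2]]|)%N.
    rewrite (eq_bigr (fun W => \sum_(p in Pr | coord_supp (zz p) :&: W == [set p.1; p.2]) 1)%N); last first.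
      by move=> W _; rewrite -sum1_card; apply: eq_bigl => p; rewrite inE.
    rewrite (exchange_big_dep (mem Pr)) /=; last by move=> ? ? _ /andP[].
    apply: eq_bigr => p pP; rewrite -sum1_card; apply: eq_bigl => W; by rewrite inE pP.
  have s2 : (#|Pr| * 2 ^ q <= 64 * \sum_(W : {set 'I_q}) #|tr W|)%N.
    rewrite s1 big_distrr /= -sum_nat_const; apply: leq_sum => -[i l]; rewrite inE /= => /andP[il lS].
    have [_ h6 hi hl] := zzP _ _ lS.
    have sub : [set i; l] \subset coord_supp (zz (i, l)).
      by apply/subsetP => x; rewrite !inE => /orP[] /eqP ->.
    have := card_trace sub; rewrite card_ord => /leq_trans; apply; rewrite mulnC leq_mul2r.
    by rewrite (leq_exp2l _ 6) // h6 orbT.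
  have s3 : (64 * \sum_(W : {set 'I_q}) #|tr W| <= 2 ^ q * #|Pr|.-1)%N.
    rewrite big_distrr /=.
    have -> : (2 ^ q * #|Pr|.-1 = \sum_(W : {set 'I_q}) #|Pr|.-1)%N.
      have c2q : #|{: {set 'I_q}}| = (2 ^ q)%N by rewrite -cardsT -powersetT card_powerset cardsT card_ord.
      by rewrite sum_nat_const c2q.
    apply: leq_sum => W _; have := hn W; rewrite -ltnNge; clear; move: #|tr W| #|Pr| => x y; lia.
  have := hn set0; rewrite -ltnNge => hp; have := leq_trans s2 s3; rewrite mulnC leq_mul2l.
  by rewrite expn_eq0 /=; move: hp; clear; move: #|Pr| #|tr _| => x y; lia.
pose nb l := [set i | (i, l) \in tr W].
have cnb : #|tr W| = (\sum_l #|nb l|)%N.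
  rewrite -sum1_card (reindex_inj (h := fun p : 'I_q * 'I_q => (p.2, p.1))); last by case=> ? ? [? ?] [-> ->].
  rewrite (eq_bigl (fun p => (p.1 \in 'I_q) && (p.2 \in nb p.1))); last by move=> [i l]; rewrite !inE.
  rewrite -(pair_big_dep (mem 'I_q) (fun l i => i \in nb l) (fun _ _ => 1%N)) /=.
  by apply: eq_bigr => l _; rewrite sum1_card.
pose g l i := cb (zz (i, l)) l / cb (zz (i, l)) i.
have [] := pigeon nb g.
  rewrite -cnb; apply: leq_trans cPr _; move: hW; clear; move: #|Pr| #|tr W| => x y; nia.
move=> t0 [s [ga0 [t0i si st0 hst0]]].
pose t p := t0 (enum_rank p); pose ga p := ga0 (enum_rank p).
have ti : injective t by move=> p p' /t0i /enum_rank_inj.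
have st i p : s i != t p by apply: st0.
have hst i p : [/\ zz (s i, t p) \in N, cb (zz (s i, t p)) (s i) != 0, cb (zz (s i, t p)) (t p) != 0,
    coord_supp (zz (s i, t p)) :&: W = [set s i; t p] & cb (zz (s i, t p)) (t p) = ga p * cb (zz (s i, t p)) (s i)].
  have [+ e1] := hst0 i (enum_rank p); rewrite inE inE => /andP[]; rewrite inE /= => /andP[_ lS] /eqP e2.
  have [h1 h2 h3 h4] := zzP _ _ lS; split=> //.
  by rewrite /ga -e1 /g divfK.
pose W0 := [set s i | i : 'I_n] :|: [set t p | p : 'I_n * 'I_n].
have W0W : W0 \subset W.
  have aux i p : (s i \in W) && (t p \in W).
    have [_ _ _ /setP e1 _] := hst i p; have := e1 (s i); have := e1 (t p).
    by rewrite !inE !eqxx orbT => /andP[_ ->] /andP[_ ->].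
  apply/subsetP => x; rewrite inE => /orP[] /imsetP[y _ ->].
    by case/andP: (aux y (Ordinal n0, Ordinal n0)).
  by case/andP: (aux (Ordinal n0) y).
have trace0 i p x : x \in W0 -> x != s i -> x != t p -> cb (zz (s i, t p)) x = 0.
  move=> /(subsetP W0W) xW xs xt; have [_ _ _ /setP/(_ x) e1 _] := hst i p.
  by move: e1; rewrite !inE xW (negPf xs) (negPf xt) andbT => /negbFE/eqP.
(* Contracting [zs p] with [p = (i, j)] identifies the scaled [b (t p)] with [b (s i)]. The vector
   joining [s j] to [t p] then becomes a multiple of the difference of [b (s i)] and [b (s j)]. *)
pose zs (p : 'I_n * 'I_n) := zz (s p.1, t p).
pose S := e :: map b (enum (~: W0)) ++ map zs (enum {: 'I_n * 'I_n}).
have SN : {subset S <= N}.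
  move=> x; rewrite inE mem_cat => /or3P[/eqP -> //|/mapP[l _ ->] //|/mapP[p _ ->]].
  by have [] := hst p.1 p.
pose f := kil <<S>>; have kf : lker f = <<S>>%VS by rewrite lker_kil.
have fS x : x \in S -> f x = 0 by move=> xS; apply/eqP; rewrite kil_eq0 memv_span.
have fe : f e = 0 by rewrite fS // mem_head.
have fb l : l \notin W0 -> f (b l) = 0.
  by move=> lW; rewrite fS // inE mem_cat map_f ?orbT // mem_enum inE.
have fz i p : f (zz (s i, t p)) = cb (zz (s i, t p)) (s i) *: (f (b (s i)) + ga p *: f (b (t p))).
  have [zN z1 z2 _ eg] := hst i p; rewrite {1}(cE zN) linearD linearZ /= fe scaler0 add0r linear_sum /=.
  rewrite (bigD1 (s i)) //= (bigD1 (t p)) /=; last by rewrite eq_sym st.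
  rewrite big1 ?addr0; first by rewrite !linearZ /= scalerDr scalerA (mulrC _ (ga p)) -eg.
  move=> l /andP[ls lt]; rewrite linearZ /=; case: (boolP (l \in W0)) => lW.
    by rewrite trace0 // scale0r.
  by rewrite fb // scaler0.
have fzs p : ga p *: f (b (t p)) = f (b (s p.1)).
  have : f (zs p) = 0 by rewrite fS // inE mem_cat map_f ?orbT // mem_enum.
  rewrite /zs fz => /eqP; rewrite scaler_eq0; have [_ /negPf -> _ _ _] := hst p.1 p.
  by rewrite addr_eq0 oppvv => /eqP.
exists f, S, (fun i => f (b (s i))); split=> //; last first.
  move=> j j' _; have [zN c0 _ _ _] := hst j (j', j).
  exists ((cb (zz (s j, t (j', j))) (s j))^-1 *: zz (s j, t (j', j))); first by rewrite sN ?invr_eq0.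
  by rewrite linearZ /= fz scalerA mulVf // scale1r fzs /= [- f _]oppvv.
rewrite (map_comp f (b \o s)) ; apply: (free_mod kf); apply: bt_free.
- by rewrite memv_span // mem_cat mem_head orbT.
- set U := <<_>>%VS.
  have eU : e \in U by rewrite memv_span // mem_cat mem_head orbT.
  have sU i : b (s i) \in U by rewrite memv_span // mem_cat; apply/orP; left; apply/mapP; exists i; rewrite ?mem_enum.
  have bU l : l \notin W0 -> b l \in U.
    by move=> lW; rewrite memv_span // !mem_cat inE mem_cat map_f ?orbT // mem_enum inE.
  have tU p : b (t p) \in U.
    have [zN z1 z2 _ _] := hst p.1 p.
    have : zs p \in U by rewrite memv_span // mem_cat inE mem_cat map_f ?orbT // mem_enum.
    rewrite /zs (cE zN) (rpredDl _ (memvZ _ eU)) (bigD1 (t p)) //= rpredDr ?memvZeq //.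
    rewrite memv_suml // => l lt; case: (boolP (l \in W0)) => lW; last by rewrite memvZ ?bU.
    case: (eqVneq l (s p.1)) => [->|ls]; first by rewrite memvZ.
    by rewrite trace0 // scale0r mem0v.
  move=> l; case: (boolP (l \in W0)) => [|/bU //].
  by rewrite inE => /orP[] /imsetP[y _ ->].
have cW0 : #|W0| = (n + n * n)%N.
  rewrite cardsU (_ : _ :&: _ = set0) ?cards0 ?subn0.
    by rewrite !card_imset // card_prod card_ord.
  apply/setP => x; rewrite !inE; apply/negP => /andP[/imsetP[i _ ->] /imsetP[p _ /eqP]].
  by rewrite (negPf (st i p)).
have cC : (#|W0| + #|~: W0| = q)%N by rewrite cardsC card_ord.
have s1 : size [seq (b \o s) i | i <- enum 'I_n] = n by rewrite size_map size_enum_ord.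
have s2 : size (map zs (enum {: 'I_n * 'I_n})) = (n * n)%N by rewrite size_map -cardE card_prod card_ord.
have s3 : size (map b (enum (~: W0))) = #|~: W0| by rewrite size_map -cardE.
rewrite size_cat s1 /S [size (e :: _)]/= size_cat s3 s2.
by move: cW0 cC; clear; move: #|W0| #|~: W0| => x y; lia.
Qed.

End Fixed.
Lemma legs_Kminor n R : (0 < n)%N -> (0 < R)%N -> exists q0, forall d (N : {set 'rV[F]_d}) e q (b : 'I_q -> 'rV[F]_d),
  scl N -> FFree N -> e \in N -> (forall i, b i \in N) -> (forall i, b i + e \in N) ->
  free (e :: [seq b i | i <- enum 'I_q]) -> (spn N <= <<e :: [seq b i | i <- enum 'I_q]>>)%VS ->
  (q0 <= q)%N -> (forall i, (q <= R * \dim (Ul N (b i)))%N) -> Kminor n N.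
Proof.
move=> n0 R0.
have [q0 hq0] := @bipartite_pigeon F n #|{: 'I_n * 'I_n}| (128 * R) ltac:(by rewrite muln_gt0)
   ltac:(by rewrite card_prod card_ord muln_gt0 n0).
exists (q0 + 12 * R)%N => d N e q b sN ff eN bN beN fr sp hq hd.
apply: (legs_Kminor_aux sN ff eN bN beN fr sp n0 (R := R)) => //.
  by move=> nb g; apply: hq0; move: hq; clear; lia.
by move: hq; clear; lia.
Qed.

End SpanningLegs.

(** Here [x], [y] are the dimensions of two leg spaces, [w] that of their intersection, [s] that of
    their sum and [d] the dimension after one contraction. The gain [y - w - 1] is at least
    [rho / (4 * C)]. *)
Lemma grow_arith C t rho x y w s d : (0 < C -> t <= 4 * C -> 4 * C * (4 * C + 2) <= rho ->
  t * rho <= 4 * C * x -> rho <= C * (y + t) -> 2 * C * w < rho -> s + w = x + y ->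
  s <= d + 1 -> t.+1 * rho <= 4 * C * d)%N.
Proof.
move=> C0 t4 hr h1 h2 h3 h4 h5.
have e1 : (4 * C * s <= 4 * C * d + 4 * C)%N by rewrite -[X in (_ + X)%N]muln1 -mulnDr leq_mul2l h5 orbT.
have e2 : (4 * C * s + 4 * C * w = 4 * C * x + 4 * C * y)%N by rewrite -!mulnDr h4.
have e3 : (4 * rho <= 4 * C * y + 4 * C * t)%N by rewrite -mulnDr -mulnA leq_mul2l.
have e4 : (4 * C * t <= 4 * C * (4 * C))%N by rewrite leq_mul2l t4 orbT.
have e5 : (4 * C * w <= 2 * rho)%N by lia.
have e6 : (4 * C * (4 * C) + 4 * C * 2 <= rho)%N by rewrite -mulnDr.
rewrite mulSn; move: (t * rho)%N h1 => a h1; lia.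
Qed.

Lemma extend_arith C t rho q0 x : (0 < C -> t <= 4 * C -> C * (q0 + 1 + 4 * C) <= rho -> rho <= C * (x + t) ->
  q0 < x)%N.
Proof.
move=> C0 t4 h1 h2; have := leq_trans h1 h2; rewrite leq_mul2l => /orP[/eqP|]; lia.
Qed.

(** * Dense Fano-free sets have large clique minors *)

Section Clique.
Variables (F : finFieldType) (hF : #|F| = 4%N) (al : F) (hal : al ^+ 2 = al + 1).

Section Dim.
Variable d : nat.
Local Notation V := 'rV[F]_d.
Implicit Types (N : {set V}) (s t : seq V) (e x y : V).

Lemma greedy_basis N t : free t -> exists s,
  [/\ {subset s <= N}, free (s ++ t) & <<s ++ t>>%VS = (<<t>> + spn N)%VS].
Proof.
have [n] := ubnP (\dim (<<t>> + spn N) - \dim <<t>>)%N; elim: n t => // n IH t hn ft.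
case: (boolP (spn N <= <<t>>)%VS) => [sub|nsub].
  by exists [::]; split=> //=; apply/esym/addv_idPl.
have [x xN xt] : exists2 x, x \in N & x \notin <<t>>%VS.
  case: (boolP [exists x in N, x \notin <<t>>%VS]) => [/exists_inP //|/exists_inPn h].
  by case/negP: nsub; apply: spn_sub => x /h; rewrite negbK.
have sE : (<<x :: t>> + spn N = <<t>> + spn N)%VS.
  rewrite span_cons -addvA; apply/addv_idPr; apply: subv_trans (addvSr _ _).
  by rewrite -memvE mem_spn.
have [|| s [sN fs ss]] := IH (x :: t).
- rewrite sE dim_span_cons xt.
  have : (\dim <<x :: t>> <= \dim (<<t>> + spn N))%N by rewrite -sE dimvS ?addvSl.
  by rewrite dim_span_cons xt; move: hn; clear; lia.
- by rewrite free_cons xt.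
exists (rcons s x); rewrite cat_rcons; split=> //; last by rewrite ss sE.
by move=> y; rewrite mem_rcons inE => /orP[/eqP -> //|/sN].
Qed.

(** Contracting [e] is injective on the points that are neither multiples of [e] nor legs of [e];
    the 3 counts the nonzero multiples. *)
Lemma loss N e : e \in N -> e != 0 ->
  (#|N :\ 0%R| <= #|(kil <[e]> @: N) :\ 0%R| + 3 + #|legs N e|)%N.
Proof.
move=> eN e0; set f := kil <[e]>.
pose P := [set x | x \in <[e]>%VS] :\ 0.
pose Rs := [set u in N | (u \notin <[e]>%VS) && (u \notin legs N e)].
have cP : (#|P| <= 3)%N.
  by have := card_vs <[e]>%VS; rewrite hF dim_vline e0 /= expn1 (cardsD1 0) inE mem0v add1n ltnS.
have sub : N :\ 0 \subset Rs :|: P :|: legs N e.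
  apply/subsetP => u; rewrite !inE => /andP[u0 uN]; rewrite uN u0 /=.
  by case: (u \in <[e]>%VS); rewrite ?orbT //=; case: [exists _, _].
have cR : (#|Rs| <= #|(f @: N) :\ 0%R|)%N.
  have <- : #|f @: Rs| = #|Rs|.
    apply: card_in_imset => u u'; rewrite inE => /and3P[uN ue uL]; rewrite inE => /and3P[u'N _ _] /eqP.
    rewrite -subr_eq0 -linearB /= kil_eq0 => /vlineP[c h].
    have u'E : u' = u + (- c) *: e by rewrite scaleNr -h opprB addrC subrK.
    case: (eqVneq c 0) => [c0|c0]; first by rewrite u'E c0 oppr0 scale0r addr0.
    case/negP: uL; rewrite inE uN ue /=; apply/existsP; exists (- c).
    by rewrite oppr_eq0 c0 -u'E.
  apply: subset_leq_card; apply/subsetP => _ /imsetP[u + ->]; rewrite inE => /and3P[uN ue _].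
  by rewrite !inE kil_eq0 ue imset_f.
have cU (X Y : {set V}) : (#|X :|: Y| <= #|X| + #|Y|)%N by rewrite cardsU leq_subr.
apply: leq_trans (subset_leq_card sub) _; apply: leq_trans (cU _ _) _; apply: leq_add => //.
by apply: leq_trans (cU _ _) _; apply: leq_add.
Qed.

Lemma Ul_img (f : 'End(V)) N h : (f @: Ul N h <= Ul (f @: N) (f h))%VS.
Proof.
rewrite limgD limg_line subv_add addvSl /= -spn_img; apply: spn_sub => _ /imsetP[u + ->].
rewrite inE => /and3P[uN _ /existsP[c /andP[c0 uc]]].
case: (boolP (f u \in <[f h]>%VS)) => hu; first exact: subvP (addvSl _ _) _ hu.
apply: subvP (addvSr _ _) _ (mem_spn _); rewrite inE imset_f //= hu /=.
by apply/existsP; exists c; rewrite c0 -linearZ -linearD imset_f.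
Qed.

Lemma vlineZ (c : F) e : c != 0 -> <[c *: e]>%VS = <[e]>%VS.
Proof.
move=> c0; apply/eqP; rewrite eqEsubv -!memvE memvZ ?memv_line //=.
by rewrite -(memvZeq _ _ c0) memv_line.
Qed.

Lemma UlZ N (c : F) e : c != 0 -> Ul N (c *: e) = Ul N e.
Proof.
move=> c0; rewrite /Ul vlineZ //; congr (_ + spn _)%VS; apply/setP => u; rewrite !inE vlineZ //.
congr [&& _, _ & _]; apply/existsP/existsP => -[k /andP[k0 h]].
  by exists (k * c); rewrite mulf_neq0 // -scalerA.
by exists (k / c); rewrite mulf_neq0 ?invr_eq0 //= scalerA divfK.
Qed.

Lemma dim_kil_line (U : {vspace V}) g : (\dim U <= \dim (kil <[g]> @: U) + 1)%N.
Proof.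
rewrite -(limg_ker_dim (kil <[g]>) U) addnC leq_add2l lker_kil.
by apply: leq_trans (dimvS (capvSr _ _)) _; rewrite dim_vline leq_b1.
Qed.

Lemma spn_nleg N e : scl N -> (spn (legs N e) <= spn (nleg N e))%VS.
Proof.
move=> sN; apply: spn_sub => u uL; have [c c0 h] := legs_nleg sN uL.
by rewrite -(memvZeq _ _ c0) mem_spn.
Qed.

End Dim.

(** If every leg space meets that of [e] in a large subspace, everything outside [Ul N e] can be
    contracted away. What remains has a basis of [e] and legs of [e], and the basis vectors keep
    large leg spaces. *)
Lemma good_Kminor n C q0 : (0 < C)%N ->
  (forall d (N : {set 'rV[F]_d}) e q (b : 'I_q -> 'rV[F]_d),
  scl N -> FFree N -> e \in N -> (forall i, b i \in N) -> (forall i, b i + e \in N) ->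
  free (e :: [seq b i | i <- enum 'I_q]) -> (spn N <= <<e :: [seq b i | i <- enum 'I_q]>>)%VS ->
  (q0 <= q)%N -> (forall i, (q <= 2 * C * \dim (Ul N (b i)))%N) -> Kminor n N) ->
  forall d (N : {set 'rV[F]_d}) e rho, scl N -> FFree N -> e \in N -> e != 0 ->
  (\dim (spn N) <= rho)%N -> (q0 < \dim (Ul N e))%N ->
  (forall f, f \in nleg N e -> (rho <= 2 * C * \dim (Ul N f :&: Ul N e))%N) -> Kminor n N.
Proof.
move=> C0 K d N e rho sN ff eN e0 hrho hq H.
have fe : free [:: e] by rewrite seq1_free.
have [B [BN fB sB]] := greedy_basis (nleg N e) fe.
have UE : Ul N e = <<B ++ [:: e]>>%VS.
  rewrite sB span_seq1 /Ul; apply/eqP; rewrite eqEsubv; apply/andP; split; apply: addvS => //.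
    exact: spn_nleg.
  apply: spnS; apply/subsetP => u; rewrite !inE => /and3P[-> -> h] /=.
  by apply/existsP; exists 1; rewrite oner_eq0 scale1r.
have [Z [ZN fZ sZ]] := greedy_basis N fB.
have UN : (Ul N e <= spn N)%VS.
  rewrite subv_add -memvE mem_spn //=; apply: spnS; apply/subsetP => u; by rewrite inE => /andP[].
have {}sZ : <<Z ++ (B ++ [:: e])>>%VS = spn N by rewrite sZ -UE; apply/addv_idPr.
(* [Z] is independent of [Ul N e], so this contraction is injective on that subspace. *)
pose P := kil <<Z>>; have kP : lker P = <<Z>>%VS by rewrite lker_kil.
apply: (@Kminor_img _ _ n P N Z) => //.
pose b (i : 'I_(size B)) := P (tnth (in_tuple B) i).
have bE : [seq b i | i <- enum 'I_(size B)] = map P B.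
  by rewrite /b (map_comp P) map_tnth_enum.
have BiB i : tnth (in_tuple B) i \in B by apply: mem_tnth.
have fb : free (P e :: [seq b i | i <- enum 'I_(size B)]).
  rewrite bE -map_cons; apply: (free_mod kP); move: fZ; rewrite (perm_free (Y := (e :: B) ++ Z)) //.
  by rewrite perm_catC -cat1s perm_cat2r perm_catC.
have szB : \dim (Ul N e) = (size B).+1.
  by rewrite UE; move/eqP: fB => ->; rewrite size_cat addn1.
apply: (K _ _ (P e) (size B) b) => //.
- exact: scl_img.
- exact: (FFree_img ZN kP ff).
- exact: imset_f.
- by move=> i; apply: imset_f; have := BN _ (BiB i); rewrite inE => /andP[].
- by move=> i; rewrite -linearD; apply: imset_f; have := BN _ (BiB i); rewrite inE => /and3P[].
- rewrite bE -map_cons spn_img -sZ !span_cat limgD.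
  rewrite (_ : (P @: <<Z>>)%VS = 0%VS); last by rewrite -kP; apply/eqP; rewrite -lkerE kP.
  by rewrite add0v -span_cat limg_span; apply: sub_span => x; rewrite map_cat mem_cat /= !inE orbC.
- by move: hq; rewrite szB.
move=> i; have h := H _ (BN _ (BiB i)).
have q1 : (size B <= rho)%N.
  by apply: leq_trans hrho; apply: leq_trans (dimvS UN); rewrite szB.
apply: leq_trans q1 (leq_trans h _); rewrite leq_mul2l; apply/orP; right.
have cap0 : ((Ul N (tnth (in_tuple B) i) :&: Ul N e) :&: lker P = 0)%VS.
  apply/eqP; rewrite -subv0; move: fZ; rewrite cat_free => /and3P[_ _ /directv_addP].
  rewrite -UE -kP capvC => <-; apply: capvS => //; exact: capvSr.
rewrite -(limg_dim_eq cap0); apply: dimvS; apply: subv_trans (limgS _ (capvSl _ _)) _.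
exact: Ul_img.
Qed.

(** Either [good_Kminor] applies, or some leg [f] has little overlap with [e]. Contracting [f + e]
    then makes [e] and [f] parallel and merges their leg spaces, so that of [e] grows by a fixed
    fraction of [rho]. It cannot exceed [rho], so at most [4 * C] such steps occur; [t] counts them,
    and every other leg space loses at most one dimension in each. *)
Lemma grow_Kminor n C q0 : (0 < C)%N ->
  (forall d (N : {set 'rV[F]_d}) e rho, scl N -> FFree N -> e \in N -> e != 0 ->
  (\dim (spn N) <= rho)%N -> (q0 < \dim (Ul N e))%N ->
  (forall f, f \in nleg N e -> (rho <= 2 * C * \dim (Ul N f :&: Ul N e))%N) -> Kminor n N) ->
  forall m d (N : {set 'rV[F]_d}) e rho t, (4 * C + 1 <= m + t)%N -> (t <= 4 * C + 1)%N ->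
  (4 * C * (4 * C + 2) <= rho)%N -> (C * (q0 + 1 + 4 * C) <= rho)%N ->
  scl N -> FFree N -> e \in N -> e != 0 ->
  (\dim (spn N) <= rho)%N -> (t * rho <= 4 * C * \dim (Ul N e))%N ->
  (forall f, f \in N -> f != 0 -> (rho <= C * (\dim (Ul N f) + t))%N) -> Kminor n N.
Proof.
move=> C0 good; elim=> [|m IH] d N e rho t hm ht hr hr2 sN ff eN e0 hrho hU hall.
all: have UN : (\dim (Ul N e) <= rho)%N.
all: try (apply: leq_trans hrho; apply: dimvS; rewrite subv_add -memvE mem_spn //=;
  apply: spnS; apply/subsetP => u; by rewrite inE => /andP[]).
  have tE : t = (4 * C + 1)%N by move: ht hm; clear; lia.
  have r0 : (0 < rho)%N by move: hr C0; clear; nia.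
  exfalso; have h1 : (4 * C * \dim (Ul N e) <= 4 * C * rho)%N by rewrite leq_mul2l UN orbT.
  by have := leq_trans hU h1; rewrite tE leq_mul2r; move: r0; clear; lia.
have t4 : (t <= 4 * C)%N.
  rewrite leqNgt; apply/negP => h.
  have tE : t = (4 * C + 1)%N by move: h ht; clear; lia.
  have r0 : (0 < rho)%N by move: hr C0; clear; nia.
  have h1 : (4 * C * \dim (Ul N e) <= 4 * C * rho)%N by rewrite leq_mul2l UN orbT.
  by have := leq_trans hU h1; rewrite tE leq_mul2r; move: r0; clear; lia.
case: (boolP [forall f in nleg N e, (rho <= 2 * C * \dim (Ul N f :&: Ul N e))%N]) => [/forall_inP hg|].
  apply: (good _ N e rho) => //.
  exact: (extend_arith C0 t4 hr2 (hall _ eN e0)).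
rewrite negb_forall_in => /exists_inP[f fL]; rewrite -ltnNge => hf.
move: (fL); rewrite inE => /and3P[fN fe feN].
pose g := f + e; pose k := kil <[g]>.
have kk : lker k = <<[:: g]>>%VS by rewrite lker_kil span_seq1.
have gN : {subset [:: g] <= N} by move=> x; rewrite inE => /eqP ->.
have f0 : f != 0 by apply: contra fe => /eqP ->; rewrite mem0v.
have ke0 : k e != 0.
  rewrite kil_eq0; apply: contra fe => /vlineP[c ec].
  have c0 : c != 0 by apply: contra e0 => /eqP c0; rewrite ec c0 scale0r.
  have : c *: f \in <[e]>%VS.
    have -> : c *: f = e - c *: e by rewrite {1}ec /g scalerDr addrK.
    by rewrite memvB ?memvZ ?memv_line.
  by rewrite memvZeq.
have kf : k f = (-1) *: k e.
  apply/eqP; rewrite scaleN1r -addr_eq0 -linearD; have : k g == 0 by rewrite kil_eq0 memv_line.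
  by [].
have Uke : (k @: (Ul N e + Ul N f) <= Ul (k @: N) (k e))%VS.
  rewrite limgD subv_add Ul_img /=; apply: subv_trans (Ul_img _ _ _) _.
  by rewrite kf UlZ // oppr_eq0 oner_eq0.
apply: (Kminor_img gN kk); apply: (IH _ _ (k e) rho t.+1) => //.
- by move: hm; clear; lia.
- by move: t4; clear; lia.
- exact: scl_img.
- exact: (FFree_img gN kk ff).
- exact: imset_f.
- by apply: leq_trans hrho; rewrite spn_img -(limg_ker_dim k (spn N)) leq_addl.
- apply: (@grow_arith C t rho (\dim (Ul N e)) (\dim (Ul N f)) (\dim (Ul N f :&: Ul N e))
     (\dim (Ul N e + Ul N f))) => //.
  + exact: hall.
  + by rewrite capvC dimv_sum_cap.
  by apply: leq_trans (dim_kil_line _ g) _; rewrite leq_add2r dimvS.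
move=> _ /imsetP[h hN ->] kh0.
have h0 : h != 0 by apply: contra kh0 => /eqP ->; rewrite linear0.
apply: leq_trans (hall _ hN h0) _; rewrite leq_mul2l; apply/orP; right.
rewrite addnS -addSn leq_add2r; apply: leq_trans (dim_kil_line _ g) _; rewrite addn1 ltnS.
by apply: dimvS; apply: Ul_img.
Qed.

Lemma card_spn d (N : {set 'rV[F]_d}) : (#|N :\ 0%R| <= 4 ^ \dim (spn N))%N.
Proof.
apply: leq_trans (card_F4 hF (leqnn (\dim (spn N)))).
by apply: subset_leq_card; apply/subsetP => x; rewrite !inE => /andP[_ /mem_spn].
Qed.

(** A point with fewer legs than the dimension is contracted, which preserves the hypothesis. When
    there is none, [sparse] makes all leg spaces linearly large and [grow_Kminor] finishes. *)
Theorem clique_minor n : (0 < n)%N -> exists K, forall d (N : {set 'rV[F]_d}), scl N -> FFree N ->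
  (\dim (spn N) * \dim (spn N) + K <= #|N :\ 0%R|)%N -> Kminor n N.
Proof.
move=> n0; have [C C0 sp] := sparse hF hal.
have [|q0 hq0] := @legs_Kminor F hF al hal n (2 * C) n0; first by rewrite muln_gt0.
have G := grow_Kminor C0 (good_Kminor C0 hq0).
pose r0 := (4 * C * (4 * C + 2) + C * (q0 + 1 + 4 * C) + 3)%N.
exists (4 ^ r0)%N => d N; have [m] := ubnP (\dim (spn N)); elim: m N => // m IH N hm sN ff hc.
(* There are at most 4^dim vectors, so the additive constant forces a large dimension. *)
have hr : (r0 <= \dim (spn N))%N.
  rewrite -(leq_exp2l r0 _ (isT : 1 < 4)%N); apply: leq_trans (card_spn N).
  by apply: leq_trans hc; rewrite leq_addl.
have r3 : (3 <= \dim (spn N))%N by apply: leq_trans hr; rewrite /r0 leq_addl.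
case: (boolP [exists e in N, (e != 0) && (#|legs N e| < \dim (spn N))%N]).
  case/exists_inP => e eN /andP[e0 he]; set f := kil <[e]>.
  have kf : lker f = <<[:: e]>>%VS by rewrite lker_kil span_seq1.
  have eS : {subset [:: e] <= N} by move=> x; rewrite inE => /eqP ->.
  apply: (Kminor_img eS kf).
  have hd : (\dim (spn (f @: N)) + 1 = \dim (spn N))%N.
    rewrite spn_img -(limg_ker_dim f (spn N)) addnC; congr (_ + _)%N.
    rewrite kf span_seq1 (_ : (spn N :&: <[e]>)%VS = <[e]>%VS) ?dim_vline ?e0 //.
    by apply/capv_idPr; rewrite -memvE mem_spn.
  apply: IH.
  - by move: hm; rewrite -hd addn1 ltnS.
  - exact: scl_img.
  - exact: (FFree_img eS kf ff).
  (* At most 3 + (r - 1) vectors are lost, while r^2 - (r - 1)^2 = 2r - 1; hence the need for r >=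
     3. *)
  have := loss eN e0; rewrite -/f; move: hc he r3; rewrite -hd; move: (4 ^ r0)%N => K.
  by move: #|_ :\ _| #|_ :\ _| #|legs N e| (\dim (spn _)) => x y z w; clear; nia.
rewrite negb_exists_in => /forall_inP hall.
have hall' f : f \in N -> f != 0 -> (\dim (spn N) <= C * (\dim (Ul N f) + 0))%N.
  move=> fN f0; have := hall _ fN; rewrite f0 /= -leqNgt addn0 => h.
  exact: leq_trans h (sp _ _ _ sN ff fN f0).
have [e eN e0] : exists2 e, e \in N & e != 0.
  have : (0 < #|N :\ 0%R|)%N by apply: leq_trans hc; apply: leq_trans (leq_addl _ _); rewrite expn_gt0.
  by case/card_gt0P => e; rewrite !inE => /andP[h1 h2]; exists e.
apply: (G (4 * C + 1)%N _ _ e (\dim (spn N)) 0%N) => //.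
- by rewrite addn0.
- by apply: leq_trans hr; rewrite /r0; clear; lia.
by apply: leq_trans hr; rewrite /r0; clear; lia.
Qed.

End Clique.

(** * The Fano matroid is not representable in characteristic other than two *)

Section Small.
Variables (K : fieldType) (W : vectType K).
Implicit Types a b c x : W.

Lemma span2P a b x : x \in <<[:: a; b]>>%VS -> exists s t, x = s *: a + t *: b.
Proof.
rewrite span_cons span_seq1 => /memv_addP[_ /vlineP[s ->] [_ /vlineP[t ->] ->]]; by exists s, t.
Qed.

Lemma span2_mem a b (s t : K) : s *: a + t *: b \in <<[:: a; b]>>%VS.
Proof. by rewrite memvD ?memvZ // memv_span // !inE eqxx ?orbT. Qed.

Lemma free3P a b c (s t u : K) : free [:: a; b; c] -> s *: a + t *: b + u *: c = 0 ->
  [/\ s = 0, t = 0 & u = 0].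
Proof.
move=> /(@freeP _ _ _ [tuple a; b; c]) h e.
have := h (fun i => nth 0 [:: s; t; u] i); rewrite !big_ord_recl big_ord0 /= addr0 addrA e.
by move=> /(_ erefl) k; split; [have := k ord0 | have := k (inord 1) | have := k (inord 2)];
  rewrite /= ?inordK.
Qed.

Lemma free2P a b (s t : K) : free [:: a; b] -> s *: a + t *: b = 0 -> s = 0 /\ t = 0.
Proof.
move=> /(@freeP _ _ _ [tuple a; b]) h e.
have := h (fun i => nth 0 [:: s; t] i); rewrite !big_ord_recl big_ord0 /= addr0 e.
by move=> /(_ erefl) k; split; [have := k ord0 | have := k (inord 1)]; rewrite /= ?inordK.
Qed.

Lemma dual3 a b c : free [:: a; b; c] -> exists f g h : W -> K,
  [/\ [/\ functional f, functional g & functional h], [/\ f a = 1, f b = 0 & f c = 0],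
      [/\ g a = 0, g b = 1 & g c = 0] & [/\ h a = 0, h b = 0 & h c = 1]].
Proof.
move=> fr; pose X := [tuple a; b; c].
have fX : free X by [].
have cf (i j : 'I_3) : coord X j (X`_i) = (i == j)%:R by apply: coord_free.
have lin i : functional (coord X i) by move=> k u v; rewrite linearP.
exists (coord X ord0), (coord X (inord 1)), (coord X (inord 2)).
have h0 i := cf ord0 i; have h1 i := cf (inord 1) i; have h2 i := cf (inord 2) i.
move: h0 h1 h2; rewrite /= !inordK //= => h0 h1 h2.
have ne (i j : nat) : (i < 3)%N -> (j < 3)%N -> (inord i == inord j :> 'I_3) = (i == j).
  by move=> hi hj; rewrite -val_eqE /= !inordK.
have -> : ord0 = inord 0 :> 'I_3 by apply: val_inj; rewrite /= inordK.
have e0 : ord0 = inord 0 :> 'I_3 by apply: val_inj; rewrite /= inordK.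
by split; split => //; rewrite ?h0 ?h1 ?h2 ?e0 ?ne.
Qed.

(** Read in coordinates dual to [x2], [x1], [e], the collinearities force twice a coefficient of
    [y3] to vanish, and then [y3 = 0]. *)
Lemma no_fano (e x1 y1 x2 y2 x3 y3 : W) : (2%:R : K) != 0 -> free [:: x2; x1; e] ->
  y1 \in <<[:: e; x1]>>%VS -> y1 \notin <<[:: e]>>%VS -> y1 \notin <<[:: x1]>>%VS ->
  y2 \in <<[:: e; x2]>>%VS -> y2 \notin <<[:: e]>>%VS -> y2 \notin <<[:: x2]>>%VS ->
  x3 \in <<[:: x1; x2]>>%VS -> x3 \in <<[:: y1; y2]>>%VS ->
  y3 \in <<[:: e; x3]>>%VS -> y3 \in <<[:: x1; y2]>>%VS -> y3 \in <<[:: y1; x2]>>%VS -> y3 != 0 ->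
  False.
Proof.
move=> two fr /span2P[a [b ->]] ya yb /span2P[c [d ->]] yc yd.
have a0 : a != 0.
  by apply: contra yb => /eqP ->; rewrite scale0r add0r memvZ ?memv_span ?mem_head.
have b0 : b != 0.
  by apply: contra ya => /eqP ->; rewrite scale0r addr0 memvZ ?memv_span ?mem_head.
have c0 : c != 0.
  by apply: contra yd => /eqP ->; rewrite scale0r add0r memvZ ?memv_span ?mem_head.
have d0 : d != 0.
  by apply: contra yc => /eqP ->; rewrite scale0r addr0 memvZ ?memv_span ?mem_head.
move=> /span2P[al [be ->]] /span2P[ga [de ex3]].
move=> /span2P[k [l ->]] /span2P[la [mu ey3]] /span2P[nu [xi ey3']] y30.
have [f2 [f1 [fe [[l2 l1 le] [v22 v21 v2e] [v12 v11 v1e] [ve2 ve1 vee]]]]] := dual3 fr.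
have rwD (f : W -> K) (hf : functional f) : {morph f : x y / x + y} by move=> x y; apply: functionalD.
have rwZ (f : W -> K) (hf : functional f) k0 x : f (k0 *: x) = k0 * f x by apply: functionalZ.
have re := (rwD _ le, rwZ _ le); have r1 := (rwD _ l1, rwZ _ l1); have r2 := (rwD _ l2, rwZ _ l2).
have vals := (v22, v21, v2e, v12, v11, v1e, ve2, ve1, vee, mulr0, mulr1, addr0, add0r).
have A1 := congr1 fe ex3; rewrite !re !vals in A1.
have A2 := congr1 f1 ex3; rewrite !r1 !vals in A2.
have A3 := congr1 f2 ex3; rewrite !r2 !vals in A3.
have ey := etrans (esym ey3) ey3'.
have B1 := congr1 fe ey; rewrite !re !vals in B1.
have B2 := congr1 f1 ey; rewrite !r1 !vals in B2.
have C1 := congr1 f1 ey3; rewrite !r1 !vals in C1.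
have C2 := congr1 f2 ey3; rewrite !r2 !vals in C2.
have D1 : l * ga = nu by apply: (mulIf b0); rewrite -B2 -C1 A2 mulrA.
have D2 : l * de = mu by apply: (mulIf d0); rewrite -C2 A3 mulrA.
have : 2%:R * (nu * a) = 0.
  have : l * (ga * a + de * c) = 0 by rewrite -A1 mulr0.
  by rewrite mulrDr (mulrA l ga) (mulrA l de) D1 D2 B1 => h; rewrite mulr_natl mulr2n.
move/eqP; rewrite !mulf_eq0 (negPf two) (negPf a0) orbF /= => /eqP nu0.
have mu0 : mu = 0 by apply/eqP; move/eqP: B1; rewrite nu0 mul0r mulf_eq0 (negPf c0) orbF.
by case/eqP: y30; rewrite ey3 B2 nu0 mu0 mul0r !scale0r addr0.
Qed.

End Small.

Section FanoTwin.
Variables (F K : fieldType) (V : vectType F) (W : vectType K) (E : Type) (v : E -> V) (w : E -> W).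
Hypotheses (two : (2%:R : F) = 0) (twoK : (2%:R : K) != 0) (tw : twin v w).

Lemma fano_twin e x1 y1 x2 y2 x3 y3 (ce c1 d1 c2 d2 c3 d3 : F) :
  ce != 0 -> c1 != 0 -> d1 != 0 -> c2 != 0 -> d2 != 0 -> c3 != 0 -> d3 != 0 ->
  free [:: v x2; v x1; v e] ->
  c1 *: v x1 + ce *: v e = d1 *: v y1 -> c2 *: v x2 + ce *: v e = d2 *: v y2 ->
  c3 *: v x3 + ce *: v e = d3 *: v y3 -> c1 *: v x1 + c2 *: v x2 + c3 *: v x3 = 0 -> False.
Proof.
move=> ce0 c10 d10 c20 d20 c30 d30 fr h1 h2 h3 h4.
have char2 (x : V) : x + x = 0 by rewrite -mulr2n -scaler_nat two scale0r.
have opp2 (x : V) : - x = x by apply/eqP; rewrite eq_sym -addr_eq0 char2.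
pose X1 := c1 *: v x1; pose X2 := c2 *: v x2; pose X3 := c3 *: v x3; pose Ee := ce *: v e.
have mem (z a b : E) (cz ca cb : F) : cz != 0 -> ca *: v a + cb *: v b = cz *: v z ->
    w z \in <<[:: w a; w b]>>%VS.
  move=> cz0 h; rewrite -[[:: w a; w b]]/(map w [:: a; b]) -tw /=.
  by rewrite -(memvZeq _ _ cz0) -h span2_mem.
have e12 : X1 + X2 = X3 by apply/eqP; rewrite -[X3]opp2 -addr_eq0; apply/eqP.
have frw : free [:: w x2; w x1; w e] by rewrite -[[:: _; _; _]]/(map w [:: x2; x1; e]) -(twin_free _ tw).
have xe1 : v x1 \notin <<[:: v e]>>%VS by move: fr; rewrite !free_cons => /and3P[].
have xe2 : v x2 \notin <<[:: v e]>>%VS.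
  move: fr; rewrite free_cons => /andP[+ _]; apply: contra; apply: subvP; apply: sub_span => z.
  by rewrite !inE => ->; rewrite orbT.
have e0 : v e != 0 by apply: (free_not0 fr); rewrite !inE eqxx !orbT.
have nin x y c d : c != 0 -> d != 0 -> v x \notin <<[:: v e]>>%VS -> c *: v x + ce *: v e = d *: v y ->
   (w y \notin <<[:: w e]>>%VS) * (w y \notin <<[:: w x]>>%VS).
  move=> c0 d0 xe hy; split.
    rewrite -[[:: w e]]/(map w [:: e]) -tw /= -(memvZeq _ _ d0) -hy rpredDr ?memvZeq //.
    by rewrite memv_span ?mem_head.
  rewrite -[[:: w x]]/(map w [:: x]) -tw /= -(memvZeq _ _ d0) -hy rpredDl ?memvZeq //; last first.
    by rewrite memv_span ?mem_head.
  apply: contra xe; rewrite !span_seq1 => /vlineP[k ek].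
  have k0 : k != 0 by apply: contra e0 => /eqP k0; rewrite ek k0 scale0r.
  by rewrite -(memvZeq _ _ k0) -ek memv_line.
apply: (@no_fano _ _ (w e) (w x1) (w y1) (w x2) (w y2) (w x3) (w y3)) => //.
- by apply: (mem _ _ _ _ ce c1 d10); rewrite addrC.
- by rewrite (nin _ _ _ _ c10 d10 xe1 h1).
- by rewrite (nin _ _ _ _ c10 d10 xe1 h1).
- by apply: (mem _ _ _ _ ce c2 d20); rewrite addrC.
- by rewrite (nin _ _ _ _ c20 d20 xe2 h2).
- by rewrite (nin _ _ _ _ c20 d20 xe2 h2).
- exact: (mem _ _ _ _ c1 c2 c30).
- apply: (mem _ _ _ _ d1 d2 c30); rewrite -h1 -h2 addrACA char2 addr0; exact: e12.
- by apply: (mem _ _ _ _ ce c3 d30); rewrite addrC.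
- apply: (mem _ _ _ _ c1 d2 d30); rewrite -h2 -h3 addrA; congr (_ + _); exact: e12.
- apply: (mem _ _ _ _ d1 c2 d30); rewrite -h1 -h3 addrAC; congr (_ + _); exact: e12.
rewrite -(twin0 _ tw) -(inj_eq (scalerI d30)) scaler0 -h3 addr_eq0 opp2; apply/negP => /eqP h.
have := free3P (s := c2) (t := c1) (u := ce) fr; rewrite [c2 *: _ + _]addrC.
by rewrite [X in X + _]e12 /X3 h char2 => /(_ erefl)[h20]; rewrite h20 eqxx in c20.
Qed.

End FanoTwin.

Section Nv.
Variables (F : finFieldType) (d : nat) (E : finType) (v : E -> 'rV[F]_d).

(** Closing under nonzero scalars makes [scl] hold and multiplies the size of a simple matroid by
    the number of nonzero scalars. *)
Definition Nv := [set x | [exists e, exists c, (c != 0) && (x == c *: v e)]].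

Lemma NvP x : reflect (exists e, exists2 c, c != 0 & x = c *: v e) (x \in Nv).
Proof.
rewrite inE; apply: (iffP existsP) => -[e].
  by move=> /existsP[c /andP[c0 /eqP ->]]; exists e, c.
by move=> [c c0 ->]; exists e; apply/existsP; exists c; rewrite c0 /=.
Qed.

Lemma Nv_scl : scl Nv.
Proof.
move=> c x c0 /NvP[e [k k0 ->]]; apply/NvP; exists e, (c * k); rewrite ?mulf_neq0 //.
by rewrite scalerA.
Qed.

Lemma Nv_lift s : {subset s <= Nv} -> exists s', <<s>>%VS = <<map v s'>>%VS.
Proof.
elim: s => [|x s IH] h; first by exists [::].
have [|s' hs'] := IH; first by move=> y ys; apply: h; rewrite inE ys orbT.
have /NvP[e [c c0 ->]] := h x (mem_head _ _); exists (e :: s').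
rewrite /= !span_cons hs'; congr (_ + _)%VS; apply/eqP; rewrite eqEsubv -!memvE memvZ ?memv_line //=.
by rewrite -(memvZeq _ _ c0) memv_line.
Qed.

Lemma Nv_FFree (K : fieldType) (W : vectType K) (w : E -> W) : (2%:R : F) = 0 -> (2%:R : K) != 0 ->
  twin v w -> FFree Nv.
Proof.
move=> two twoK tw T _ _ _ _ _ _ _ /Nv_lift[s sE] /NvP[e [ce ce0 ->]] /NvP[x1 [c1 c10 ->]]
  /NvP[y1 [d1 d10 ->]] /NvP[x2 [c2 c20 ->]] /NvP[y2 [d2 d20 ->]] /NvP[x3 [c3 c30 ->]] /NvP[y3 [d3 d30 ->]].
move=> h1 h2 h3 h4 n1 n2 n3.
pose f := kil <<map v s>>; have kf : lker f = <<map v s>>%VS by rewrite lker_kil.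
have tw' := twin_contract_kil tw kf.
have fe x : x \in <<T>>%VS -> f x = 0 by move=> xT; apply/eqP; rewrite kil_eq0 -sE.
have mk t x : (f x \in <<map f t>>%VS) = (x \in <<t ++ T>>%VS).
  by rewrite (mem_span_ker _ _ kf) !span_cat -sE.
apply: (@fano_twin _ _ _ _ _ _ _ two twoK tw' e x1 y1 x2 y2 x3 y3 ce c1 d1 c2 d2 c3 d3) => //=.
- rewrite !free_cons nil_free span_nil memv0 andbT.
  rewrite -[[:: f (v x1); f (v e)]]/(map f [:: v x1; v e]) -[[:: f (v e)]]/(map f [:: v e]) !mk /=.
  have eqs (L L' : seq 'rV[F]_d) : (<<L>> <= <<L'>>)%VS -> forall z, z \in <<L>>%VS -> z \in <<L'>>%VS.
    by move=> /subvP.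
  apply/and3P; split.
  + apply: contra n3 => h; rewrite memvZ //; apply: eqs h.
    rewrite !span_cons; apply: addvS; last apply: addvS => //.
      by rewrite -memvE -(memvZeq _ _ c10) memv_line.
    by rewrite -memvE -(memvZeq _ _ ce0) memv_line.
  + apply: contra n2 => h; rewrite memvZ //; apply: eqs h.
    by rewrite !span_cons; apply: addvS => //; rewrite -memvE -(memvZeq _ _ ce0) memv_line.
  by apply: contra n1; rewrite kil_eq0 -sE => h; rewrite memvZ.
- by apply/eqP; rewrite -subr_eq0 -!linearZ -linearD -linearB /= fe.
- by apply/eqP; rewrite -subr_eq0 -!linearZ -linearD -linearB /= fe.
- by apply/eqP; rewrite -subr_eq0 -!linearZ -linearD -linearB /= fe.
by rewrite -!linearZ -!linearD /= fe.
Qed.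

End Nv.

(** * Clique minors of abstract matroids *)

Section Cycle.
Variables (F : fieldType) (V : vectType F) (n : nat) (b : 'I_n -> V).
Hypothesis fb : free (map b (enum 'I_n)).
Implicit Types X : {set edge n}.

Lemma adjC X : connect_sym (adj X).
Proof. by apply: sym_connect_sym => i j; apply: eq_existsb => e; rewrite orbC. Qed.

(** Edge vectors lie in the span of the vectors [b i - b (rt i)], one for every non-root; conversely
    the edge vectors together with the [b] at the roots span everything. *)
Lemma dim_cycle X :
  \dim <<[seq b (val e).1 - b (val e).2 | e in X]>> = cycle_rk X.
Proof.
set D := <<_>>%VS; pose rt := fingraph.root (adj X); pose Rt := [set rt i | i : 'I_n].
have inD i j : connect (adj X) i j -> b i - b j \in D.
  case/connectP => p + ->; elim: p i => [|k p IH] i /=; first by rewrite subrr mem0v.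
  case/andP => /exists_inP[e eX he] /IH h.
  have eD : b (val e).1 - b (val e).2 \in D by apply: memv_span; apply: image_f.
  have ik : b i - b k \in D.
    by case/orP: he => /eqP he; move: eD; rewrite he //= -memvN opprB.
  by rewrite -(subrK (b k) (b i)) -addrA memvD.
have rtC i : connect (adj X) i (rt i) by apply: connect_root.
have rtE i j : (rt i == rt j) = connect (adj X) i j by apply: (root_connect (@adjC X)).
have cc : #|components X| = #|Rt|.
  have -> : components X = component X @: Rt.
    apply/setP => S; apply/imsetP/imsetP => [[i _ ->]|[i _ ->]]; last by exists i.
    exists (rt i); first exact: imset_f.
    by apply/setP => j; rewrite !inE (same_connect (@adjC X) (rtC i)).
  apply: card_in_imset => _ _ /imsetP[i _ ->] /imsetP[j _ ->] /setP/(_ (rt j)).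
  rewrite !inE connect0 -rtE => /eqP.
  have rr k : rt (rt k) = rt k by apply: (root_root (@adjC X)).
  by rewrite !rr.
have hC : (#|Rt| + #|~: Rt| = n)%N by rewrite cardsC card_ord.
rewrite /cycle_rk cc; apply/eqP; rewrite eqn_leq; apply/andP; split.
  apply: leq_trans (_ : #|~: Rt| <= _)%N; last by move: #|Rt| #|~: Rt| hC => x y; clear; lia.
  pose U1 : {vspace V} := <<[seq b i - b (rt i) | i in ~: Rt]>>%VS.
  apply: (@leq_trans (\dim U1)); last first.
    by apply: leq_trans (dim_span _) _; rewrite size_map -cardE.
  apply: dimvS; apply/span_subvP => _ /imageP[e eX ->]; rewrite -/U1; set U := U1.
  have h i : b i - b (rt i) \in U.
    case: (boolP (i \in Rt)) => [/imsetP[j _ ->]|iR]; last by apply/memv_span/image_f; rewrite inE.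
    by rewrite {2}/rt (root_root (@adjC X)) subrr mem0v.
  have : rt (val e).1 = rt (val e).2.
    apply/eqP; rewrite rtE; apply/connect1/exists_inP; exists e => //; by rewrite -surjective_pairing eqxx.
  move=> hr; have := memvB (h (val e).1) (h (val e).2); rewrite hr opprB addrA subrK; exact.
rewrite leq_subLR.
have nE : \dim <<map b (enum 'I_n)>> = n by move/eqP: fb => ->; rewrite size_map size_enum_ord.
apply: (@leq_trans (\dim <<map b (enum 'I_n)>>)); first by rewrite nE.
apply: leq_trans (_ : \dim (<<[seq b i | i in Rt]>> + D) <= _)%N; last first.
  apply: leq_trans (dimv_add_leqif _ _).1 _; rewrite leq_add2r.
  by apply: leq_trans (dim_span _) _; rewrite size_map -cardE.
apply: dimvS; apply/span_subvP => _ /mapP[i _ ->]; rewrite -(subrK (b (rt i)) (b i)) addrC.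
by apply: memv_add; [apply/memv_span/image_f/imset_f | apply: inD].
Qed.

End Cycle.

Section HasMinor.
Variables (F : finFieldType) (d n : nat) (M : matroid) (v : M -> 'rV[F]_d).
Hypothesis hv : forall X : {set M}, rk X = \dim <<[seq v e | e in X]>>.

(** Each edge selects an element of [M] whose image is a multiple of its difference vector. Contract
    the elements spanning the kernel of [f] and delete all that are neither contracted nor
    selected. *)
Lemma Kminor_has_minor : Kminor n (Nv v) -> has_minor M (MK n).
Proof.
case=> f [s [b [sN kf fb hb]]]; have [s' sE] := Nv_lift sN; rewrite sE in kf.
have gex (e : edge n) : exists x : M, [exists c, (c != 0) && (f (v x) == c *: (b (val e).1 - b (val e).2))].
  have [|u /NvP[x [c c0 ->]]] := hb (val e).1 (val e).2; first by have := valP e; rewrite -val_eqE /= ltn_neqAle => /andP[].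
  rewrite linearZ /= => h; exists x; apply/existsP; exists c^-1; rewrite invr_eq0 c0 /=.
  by rewrite -h scalerA mulVf ?scale1r.
pose g e := xchoose (gex e).
have gP e : exists2 c, c != 0 & f (v (g e)) = c *: (b (val e).1 - b (val e).2).
  by have /existsP[c /andP[c0 /eqP h]] := xchooseP (gex e); exists c.
pose C := [set x in s']; pose D := ~: (C :|: [set g e | e : edge n]).
have /injectiveP binj : injectiveb b := free_uniq fb.
have co m : exists2 l, functional l & forall x, l (b x) = (x == m)%:R.
  pose X := [tuple of map b (ord_tuple n)]; have fX : free X by [].
  have bX (x : 'I_n) : X`_x = b x by rewrite (nth_map x) ?size_enum_ord //; congr b; apply: val_inj; rewrite /= nth_enum_ord.
  exists (coord X m); first by move=> k y z; rewrite linearP.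
  by move=> x; rewrite -bX coord_free.
have ene (e : edge n) : (val e).1 != (val e).2.
  by apply/negP => /eqP h; have := valP e; rewrite h ltnn.
have bne (e : edge n) : b (val e).1 - b (val e).2 != 0.
  by rewrite subr_eq0 (inj_eq binj) ene.
have fC x : x \in C -> f (v x) = 0.
  by rewrite inE => xs; apply/eqP; rewrite -memv_ker kf memv_span // map_f.
have gC e : g e \notin C.
  apply/negP => /fC; have [c c0 ->] := gP e; move/eqP.
  by rewrite scaler_eq0 (negPf c0) (negPf (bne e)).
have ginj : injective g.
  move=> e e' ee; have [c c0 h] := gP e; have [c' c'0 h'] := gP e'; rewrite -ee h in h'.
  have key m : (m == (val e).1) || (m == (val e).2) -> (m == (val e').1) || (m == (val e').2).
    move=> hm; have [l hl lb] := co m; move/(congr1 l): h'.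
    have sub x y : l (b x - b y) = (x == m)%:R - (y == m)%:R.
      by rewrite functionalD // -scaleN1r functionalZ // mulN1r !lb.
    rewrite !functionalZ // !sub => hh; apply/negPn/negP; rewrite negb_or => /andP[/negPf n1 /negPf n2].
    move/eqP: hh; rewrite [_ == m]eq_sym [(val e).2 == m]eq_sym.
    rewrite [(val e').1 == m]eq_sym [(val e').2 == m]eq_sym n1 n2 subrr mulr0 mulf_eq0 (negPf c0) /=.
    case/orP: hm => /eqP hm; rewrite hm eqxx.
      by rewrite (negPf (ene e)) subr0 oner_eq0.
    have := ene e; rewrite eq_sym => /negPf he; by rewrite he sub0r oppr_eq0 oner_eq0.
  have k1 := key (val e).1; have k2 := key (val e).2; rewrite !eqxx /= orbT in k1 k2.
  have fin (x y : 'I_n * 'I_n) : (x.1 == y.1) || (x.1 == y.2) -> (x.2 == y.1) || (x.2 == y.2) ->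
      (x.1 < x.2)%N -> (y.1 < y.2)%N -> x = y.
    case: x y => [i j] [k l] /= /orP[] /eqP -> /orP[] /eqP -> //; rewrite ?ltnn // => h1 h2.
    by have := ltn_trans h1 h2; rewrite ltnn.
  by apply: val_inj; apply: (fin _ _ (k1 isT) (k2 isT) (valP e) (valP e')).
have gCD e : g e \notin C :|: D by rewrite inE (negPf (gC e)) !inE negbK imset_f ?orbT.
pose psi (e : edge n) : minor C D := exist _ (g e) (gCD e).
have psi_sur (x : minor C D) : exists e, psi e == x.
  have := valP x; rewrite /= inE negb_or !inE negbK => /andP[/negPf xC].
  rewrite xC /= => /imsetP[e _ xe]; exists e; by rewrite -val_eqE /= -xe.
pose phi x := xchoose (psi_sur x).
have phiK x : psi (phi x) = x by apply/eqP/(xchooseP (psi_sur x)).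
have gphi x : g (phi x) = val x by rewrite -{2}(phiK x).
exists C, D; split; first by rewrite disjoints_subset; apply/subsetP => x xC; rewrite in_setC /D in_setC negbK in_setU xC.
exists phi.
  exists psi => // e; have := gphi (psi e) => /= /ginj; exact.
move=> X; rewrite /rk /= /minor_rk -(dim_cycle fb) !hv.
have CE : <<[seq v e | e in C]>>%VS = lker f.
  rewrite kf; apply: eq_span => x; apply/imageP/mapP => -[y ys ->]; exists y => //.
    by move: ys; rewrite inE.
  by rewrite inE.
rewrite CE; set U := <<_>>%VS; set U' := <<_>>%VS.
have kU : (lker f <= U')%VS.
  rewrite -CE; apply: sub_span => _ /imageP[x xC ->]; by apply: image_f; rewrite inE xC orbT.
have := limg_ker_dim f U'; rewrite (capv_idPr kU) => <-; rewrite addKn; congr (\dim _).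
apply/eqP; rewrite eqEsubv limg_span; apply/andP; split; apply/span_subvP.
  move=> _ /imageP[e /imsetP[x xX ->] ->]; have [c c0 h] := gP (phi x).
  rewrite -(memvZeq _ _ c0) -h gphi; apply: memv_span; apply/map_f/image_f.
  by rewrite inE imset_f.
move=> _ /mapP[_ /imageP[x + ->] ->]; rewrite inE => /orP[/imsetP[y yX ->]|/fC ->]; last exact: mem0v.
have [c c0 h] := gP (phi y); rewrite -gphi h memvZ //; apply: memv_span.
by apply: (image_f (fun e : edge n => b (val e).1 - b (val e).2)); apply: imset_f.
Qed.

End HasMinor.

(** * Represented matroids through vector families *)

Definition delta (F : fieldType) (B : finType) (b : B) : {ffun B -> F^o} := [ffun b' => (b' == b)%:R].

Lemma ffun_delta (F : fieldType) (B : finType) (x : {ffun B -> F^o}) : x = \sum_b x b *: delta F b.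
Proof.
apply/ffunP=> b; rewrite sum_ffunE (bigD1 b) //= !ffunE eqxx big1 => [|b' h].
  by rewrite addr0 /GRing.scale /= mulr1.
by rewrite !ffunE eq_sym (negPf h) scaler0.
Qed.

Lemma functional_delta (F : fieldType) (B : finType) (f : {ffun B -> F^o} -> F) x :
  functional f -> f x = \sum_b (x b : F) * f (delta F b).
Proof.
move=> hf; rewrite {1}[x]ffun_delta functional_sum //; apply: eq_bigr => b _.
by rewrite functionalZ.
Qed.

Lemma rows_functional (F : fieldType) (B E : finType) (A : B -> E -> F) (u : {ffun E -> F^o}) :
  u \in <<[seq ([ffun e => A b e] : {ffun E -> F^o}) | b <- enum B]>>%VS <->
  exists2 f : {ffun B -> F^o} -> F, functional f & forall e, u e = f (column A e).
Proof.
set row := fun b => ([ffun e => A b e] : {ffun E -> F^o}); split; last first.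
  case=> f hf hu; have -> : u = \sum_b f (delta F b) *: row b.
    apply/ffunP=> e; rewrite hu (functional_delta _ hf) sum_ffunE; apply: eq_bigr => b _.
    by rewrite !ffunE mulrC.
  by apply: memv_suml => b _; apply/memvZ/memv_span/map_f; rewrite mem_enum.
move=> hu; pose L (x : {ffun B -> F^o}) : {ffun E -> F^o} := \sum_b (x b : F) *: row b.
have Llin : linear L.
  move=> k x y; rewrite /L scaler_sumr -big_split; apply: eq_bigr => b _.
  by rewrite !ffunE scalerDl scalerA.
pose Lm := GRing.isLinear.Build F _ _ _ L Llin.
pose L' : {linear {ffun B -> F^o} -> {ffun E -> F^o}} := HB.pack L Lm.
have : u \in limg (linfun L').
  move: hu; apply: subvP; apply/span_subvP => _ /mapP[b _ ->]; apply/memv_imgP; exists (delta F b).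
    exact: memvf.
  rewrite lfunE /= /L (bigD1 b) //= big1 ?addr0 => [|b' h].
    by rewrite ffunE eqxx scale1r.
  by rewrite ffunE (negPf h) scale0r.
case/memv_imgP=> x _; rewrite lfunE /= /L => ->.
exists (fun y : {ffun B -> F^o} => \sum_b (x b : F) * (y b : F)).
  move=> k y z; rewrite mulr_sumr -big_split; apply: eq_bigr => b _ /=.
  by rewrite !ffunE mulrDr; congr (_ + _); rewrite /GRing.scale /=; ring.
by move=> e; rewrite sum_ffunE; apply: eq_bigr => b _; rewrite !ffunE.
Qed.

(** The closure operator of a represented matroid, read off its row space: [e] is spanned by [s]
    when every row vector vanishing on [s] vanishes at [e]. The vectors [w] may live over another
    field. *)
Definition Rep (F K : fieldType) (W : vectType K) (M : rmatroid F) (w : rground M -> W) : Prop :=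
  forall e s, w e \in <<map w s>>%VS <->
    forall u, u \in rspace M -> (forall x, x \in s -> u x = 0) -> u e = 0.

Arguments Rep {F K W} M w.

Section Rep.
Variable F : fieldType.
Implicit Types M N : rmatroid F.

Lemma Rep_rows (B : finType) M (A : B -> rground M -> F) :
  rspace M = <<[seq ([ffun e => A b e] : {ffun rground M -> F^o}) | b <- enum B]>>%VS ->
  Rep M (column A).
Proof.
move=> hM e s; split.
  move/span_annP=> h u; rewrite hM => /rows_functional[f hf hu] us; rewrite hu; apply: h => //.
  by move=> _ /mapP[x xs ->]; rewrite -hu us.
move=> h; apply/span_annP => f hf fs.
have := h [ffun e => f (column A e)]; rewrite ffunE; apply.
  by rewrite hM; apply/rows_functional; exists f => // x; rewrite ffunE.
by move=> x xs; rewrite ffunE fs // map_f.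
Qed.

Lemma Rep_rmat (B E : finType) (A : B -> E -> F) : @Rep F F _ (rmat A) (column A).
Proof. exact: (@Rep_rows B (rmat A) A). Qed.

Definition absmx M : 'I_(\dim (rspace M)) -> rground M -> F :=
  fun i e => tnth (vbasis (rspace M)) i e.

Lemma Rep_abs M : Rep M (column (@absmx M)).
Proof.
have H : rspace M = <<[seq ([ffun e => absmx i e] : {ffun rground M -> F^o}) | i <- enum 'I_(\dim (rspace M))]>>%VS.
rewrite -{1}(span_basis (vbasisP (rspace M))); apply: eq_span => x.
have rowE i : ([ffun e => absmx i e] : {ffun rground M -> F^o}) = tnth (vbasis (rspace M)) i.
  by apply/ffunP => e; rewrite ffunE.
apply/idP/mapP => [/tnthP[i ->]|[i _ ->]]; last by rewrite rowE mem_tnth.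
by exists i; rewrite ?rowE ?mem_enum.
exact: (Rep_rows H).
Qed.

Lemma Rep_twin (K L : fieldType) (V : vectType K) (W : vectType L) M (v : rground M -> V) (w : rground M -> W) :
  Rep M v -> twin v w -> Rep M w.
Proof. by move=> hv t e s; rewrite -t. Qed.

Lemma twin_Rep (K L : fieldType) (V : vectType K) (W : vectType L) M (v : rground M -> V) (w : rground M -> W) :
  Rep M v -> Rep M w -> twin v w.
Proof. by move=> hv hw e s; apply/idP/idP => [/hv/hw|/hw/hv]. Qed.

Lemma Rep_delete (K : fieldType) (W : vectType K) M (w : rground M -> W) (X : {set rground M}) :
  Rep M w -> @Rep F K W (rdelete X) (fun e => w (val e)).
Proof.
move=> hw e s; rewrite (map_comp w val); split.
  move/hw => h u /memv_imgP[u1 u1M ->]; rewrite lfunE /= => us; rewrite ffunE; apply: h => // _ /mapP[x xs ->].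
  by have := us x xs; rewrite ffunE.
move=> h; apply/hw => u uM us.
have := h (restr (~: X) u); rewrite ffunE; apply.
  by apply/memv_imgP; exists u => //; rewrite lfunE.
by move=> x xs; rewrite ffunE us ?map_f.
Qed.

Lemma dotC (E : finType) (u v : {ffun E -> F^o}) : dot u v = dot v u.
Proof. by apply: eq_bigr => e _; rewrite mulrC. Qed.

Lemma orth_orth (E : finType) (U : {vspace {ffun E -> F^o}}) x : (x \in orth (orth U)) = (x \in U).
Proof.
apply/idP/idP => [|xU]; last by apply/orthP => u /orthP h; rewrite dotC h.
move/orthP => h; apply/negPn/negP => /ann_sep[f [hf fU fx]].
pose t : {ffun E -> F^o} := [ffun e => f (delta F e)].
have tE y : dot t y = f y.
  by rewrite (functional_delta _ hf); apply: eq_bigr => e _; rewrite ffunE mulrC.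
case/eqP: fx; rewrite -tE; apply: h; apply/orthP => u uU; by rewrite dotC tE fU.
Qed.

Definition zext (E : finType) (X : {set E}) (u : {ffun {x : E | x \in X} -> F^o}) : {ffun E -> F^o} :=
  [ffun e => oapp u 0 (insub e)].

Lemma zext_val (E : finType) (X : {set E}) u x : @zext E X u (val x) = u x.
Proof. by rewrite ffunE valK. Qed.

Lemma zext_out (E : finType) (X : {set E}) u e : e \notin X -> @zext E X u e = 0.
Proof. by move=> h; rewrite ffunE insubN. Qed.

Lemma dot_zext (E : finType) (X : {set E}) (t : {ffun E -> F^o}) (u : {ffun {x : E | x \in X} -> F^o}) :
  dot (restr X t) u = dot t (zext u).
Proof.
rewrite /dot [RHS](bigID (mem X)) /= [X in _ = _ + X]big1 ?addr0 => [|e eX]; last first.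
  by rewrite zext_out // mulr0.
by rewrite (big_sub (mem X)) /=; apply: eq_bigr => x _; rewrite ffunE zext_val.
Qed.

(** Contraction is defined through two duals; since [orth] is an involution and restriction is
    adjoint to extension by zero, only this extension remains. *)
Lemma mem_contract M (X : {set rground M}) (u : {ffun rground (rcontract X) -> F^o}) :
  (u \in rspace (rcontract X)) = (zext u \in rspace M).
Proof.
rewrite -(orth_orth (rspace M)) /=; apply/orthP/orthP => h t.
  move=> tU; rewrite -dot_zext; apply: h; apply/memv_imgP; exists t => //; by rewrite lfunE.
by case/memv_imgP=> t1 t1U ->; rewrite lfunE dot_zext h.
Qed.

Lemma Rep_contract (K : fieldType) (W : vectType K) M (w : rground M -> W) (X : {set rground M}) :
  Rep M w -> @Rep F K W (rcontract X) (fun e => kil <<map w (enum X)>> (w (val e))).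
Proof.
move=> hw e s; have kf := lker_kil <<map w (enum X)>>%VS.
rewrite -[map _ s]/(map (kil <<map w (enum X)>> \o (w \o val)) s) map_comp (mem_span_ker _ _ kf).
rewrite (map_comp w val) -map_cat; split.
  move/hw => h u uC us; have uM : zext u \in rspace M by rewrite -mem_contract.
  rewrite -(zext_val u e); apply: h => // x.
  rewrite mem_cat => /orP[/mapP[y ys ->]|]; first by rewrite zext_val us.
  by rewrite mem_enum => xX; rewrite zext_out // inE negbK.
move=> h; apply/hw => u uM us.
have uE : zext (restr (~: X) u) = u.
  apply/ffunP=> x; case: (boolP (x \in ~: X)) => xX.
    by rewrite -[x]/(val (exist (fun x => x \in ~: X) x xX)) zext_val ffunE.
  rewrite zext_out // us // mem_cat mem_enum; move: xX; rewrite inE negbK => ->; by rewrite orbT.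
have := h (restr (~: X) u); rewrite ffunE => h1; apply: h1; first by rewrite mem_contract uE.
by move=> x xs; rewrite ffunE us // mem_cat map_f.
Qed.

Lemma Rep_iso1 (K : fieldType) (W : vectType K) M N f s (w : rground N -> W) : bijective f ->
  (forall e, s e != 0) ->
  (forall u : {ffun rground N -> F^o}, (u \in rspace N) = ([ffun e => s e * u (f e)] \in rspace M)) ->
  Rep N w -> Rep M (w \o f).
Proof.
case=> g fK gK s0 hu hw e t; rewrite (map_comp w f); split.
  move/hw => h u uM ut.
  have := h [ffun y => (s (g y))^-1 * u (g y)]; rewrite hu ffunE fK => h1.
  have /eqP : (s e)^-1 * u e = 0.
    apply: h1.
      suff -> : [ffun e0 => s e0 * [ffun y => (s (g y))^-1 * u (g y)] (f e0)] = u by [].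
      by apply/ffunP => x; rewrite !ffunE fK mulVKf.
    by move=> _ /mapP[x xt ->]; rewrite ffunE fK ut ?mulr0.
  by rewrite mulf_eq0 invr_eq0 (negPf (s0 e)) => /eqP.
move=> h; apply/hw => u; rewrite hu => uM us; have := h _ uM; rewrite ffunE => h1.
have /eqP : s e * u (f e) = 0 by apply: h1 => x xt; rewrite ffunE us ?mulr0 ?map_f.
by rewrite mulf_eq0 (negPf (s0 e)) => /eqP.
Qed.

Lemma Rep_iso2 (K : fieldType) (W : vectType K) M N f g s (w : rground M -> W) : cancel f g -> cancel g f ->
  (forall e, s e != 0) ->
  (forall u : {ffun rground N -> F^o}, (u \in rspace N) = ([ffun e => s e * u (f e)] \in rspace M)) ->
  Rep M w -> Rep N (w \o g).
Proof.
move=> fK gK s0 hu; apply: (@Rep_iso1 K W N M g (fun y => (s (g y))^-1)).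
- by exists f.
- by move=> y; rewrite invr_eq0.
move=> u; rewrite hu; suff -> : [ffun e => s e * [ffun e => (s (g e))^-1 * u (g e)] (f e)] = u by [].
by apply/ffunP=> e; rewrite !ffunE fK mulVKf.
Qed.

Lemma risomorphic_refl M : risomorphic M M.
Proof.
exists id, (fun=> 1); split; first by exists id.
  by move=> _; apply: oner_neq0.
move=> u; suff -> : [ffun e => 1 * u e] = u by [].
by apply/ffunP => e; rewrite ffunE mul1r.
Qed.

Definition ratrep M : Prop := exists (W : vectType rat) (w : rground M -> W), Rep M w.

Lemma ratrep_minor_closed : minor_closed ratrep.
Proof.
split.
- move=> M N [f [s [[g fK gK] s0 hu]]] [W [w hw]]; exists W, (w \o g).
  exact: (Rep_iso2 fK gK s0 hu hw).
- by move=> M X [W [w hw]]; exists W, (fun e => w (val e)); apply: Rep_delete.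
by move=> M X [W [w hw]]; exists W; eexists; apply: Rep_contract hw.
Qed.

End Rep.

(** The entries used by [abs] are typed in the regular module [F^o], so the field there is another
    presentation of [F]. *)
Lemma column_rk_regular (F : fieldType) (B E : finType) (A : B -> E -> F) (X : {set E}) :
  @column_rk (GRing.GRing_regular__canonical__GRing_Field F) B E A X = @column_rk F B E A X.
Proof. by case: F A. Qed.

Lemma rk_abs (F K : fieldType) (W : vectType K) (M : rmatroid F) (w : rground M -> W) (X : {set abs M}) :
  Rep M w -> rk X = \dim <<[seq w e | e in X]>>.
Proof. move=> hw; have h := twin_dim (enum (X : {set rground M})) (twin_Rep (@Rep_abs _ M) hw).
rewrite -h; exact: (column_rk_regular (@absmx _ M) X).
Qed.

Section NoFano.
Variables (F : fieldType) (M : rmatroid F).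

Definition pvec (s : seq 'F_2) : 'rV['F_2]_3 := \row_i nth 0 s i.

Lemma pg_pvec s (k : 'I_3) : nth 0 s k = 1 -> (forall j : 'I_3, (j < k)%N -> nth 0 s j = 0) -> pg_point (pvec s).
Proof.
move=> h1 h2; apply/existsP; exists k; rewrite mxE h1 eqxx /=; apply/forallP => j.
by apply/implyP => jk; rewrite mxE h2.
Qed.

Lemma ratrep_no_fano : ratrep M -> ~ has_minor (abs M) (PG 'F_2 3).
Proof.
case=> W [w hw] [C [D [_ [f [g fK gK] hf]]]].
pose wg p := kil <<[seq w e | e in C]>> (w (val (g p))).
have tw : twin (column (fun (i : 'I_3) (v : {v : 'rV['F_2]_3 | pg_point v}) => val v 0 i)) wg.
  apply: twin_of_dim => X.
  transitivity (rk (f @: (g @: X)) : nat).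
    by rewrite -imset_comp (eq_imset X gK) imset_id.
  rewrite hf /= /minor_rk !(rk_abs _ hw).
  set U := <<[seq w e | e in C]>>%VS; set U' := <<_>>%VS.
  have kU : (U <= U')%VS.
    apply: sub_span => _ /imageP[x xC ->]; by apply: image_f; rewrite inE xC orbT.
  have := limg_ker_dim (kil U) U'; rewrite lker_kil (capv_idPr kU) => <-; rewrite addKn; congr (\dim _).
  apply/eqP; rewrite eqEsubv limg_span; apply/andP; split; apply/span_subvP.
    move=> _ /mapP[_ /imageP[x + ->] ->]; rewrite inE => /orP[/imsetP[y /imsetP[p pX ->] ->]|xC].
      by apply: memv_span; apply: (image_f wg).
    have /eqP -> : kil U (w x) == 0 by rewrite kil_eq0; apply/memv_span/image_f.
    exact: mem0v.
  move=> _ /imageP[p pX ->]; apply: memv_span; apply: map_f; apply: image_f.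
  by rewrite inE imset_f ?imset_f.
have p1 s : nth 0 s 0 = 1 -> pg_point (pvec s) by move=> h; apply: (@pg_pvec s ord0).
have h2 : (1 < 3)%N by []. have h3 : (2 < 3)%N by [].
have pe : pg_point (pvec [:: 0; 0; 1]).
  by apply: (@pg_pvec _ (Ordinal h3)) => // -[[|[|[]]]].
have px2 : pg_point (pvec [:: 0; 1; 0]).
  by apply: (@pg_pvec _ (Ordinal h2)) => // -[[|[|[]]]].
have py2 : pg_point (pvec [:: 0; 1; 1]).
  by apply: (@pg_pvec _ (Ordinal h2)) => // -[[|[|[]]]].
pose P s (h : pg_point (pvec s)) : {v : 'rV['F_2]_3 | pg_point v} := exist _ (pvec s) h.
have two : (2%:R : 'F_2) = 0 by apply/val_inj.
have col s h i : column (fun (i : 'I_3) (v : {v : 'rV['F_2]_3 | pg_point v}) => val v 0 i) (@P s h) i = nth 0 s i.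
  by rewrite ffunE mxE.
have o1 : (1 : 'F_2) != 0 by [].
apply: (@fano_twin _ _ _ _ _ _ _ two _ tw (P _ pe) (P _ (p1 [:: 1; 0; 0] erefl)) (P _ (p1 [:: 1; 0; 1] erefl))
  (P _ px2) (P _ py2) (P _ (p1 [:: 1; 1; 0] erefl)) (P _ (p1 [:: 1; 1; 1] erefl)) 1 1 1 1 1 1 1) => //.
- have ev (i : 'I_3) : functional (fun x : {ffun 'I_3 -> ('F_2)^o} => x i) by move=> k x y; rewrite !ffunE.
  rewrite !free_cons span_nil nil_free memv0 andbT; apply/and3P; split.
  + apply/negP => /(functional_span (ev (Ordinal h2))); rewrite col /= => h.
    have : (1 : 'F_2) = 0; last by move/eqP.
    by apply: h => x; rewrite !inE => /orP[] /eqP ->; rewrite col.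
  + apply/negP => /(functional_span (ev ord0)); rewrite col /= => h.
    have : (1 : 'F_2) = 0; last by move/eqP.
    by apply: h => x; rewrite !inE => /eqP ->; rewrite col.
  by apply/negP => /eqP/(congr1 (fun x : {ffun 'I_3 -> ('F_2)^o} => x (Ordinal h3))); rewrite col ffunE.
all: by rewrite !scale1r; apply/ffunP => i; do ?rewrite ffunE; rewrite ?mxE; case: i => [[|[|[]]]] //= _; apply/val_inj.
Qed.

End NoFano.

Section DeleteContract.
Variables (F : fieldType) (B E I : finType) (A : B -> E -> F) (C Y : {set E}) (h : I -> E).
Hypothesis hI : forall x, [\/ x \in C, x \in Y | exists i, x == h i].
Hypothesis hC : forall i, h i \notin C.
Hypothesis hY : forall i, h i \notin Y.
Let N := @rdelete F (@rcontract F (rmat A) C) [set x | val x \in Y].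
Let fam (e : rground N) := kil <<map (column A) (enum C)>> (column A (val (val e))).

Let Rep_fam : Rep N fam.
Proof. exact: Rep_delete (@Rep_contract F F _ (rmat A) _ C (@Rep_rmat _ _ _ A)). Qed.

Let N_elt (e : rground N) : exists i, val (val e) == h i.
Proof.
have := valP e; have := valP (val e); rewrite !inE => h1 h2.
by have [h3|h3|//] := hI (val (val e)); [rewrite h3 in h1|rewrite h3 in h2].
Qed.

Let elt_N (i : I) : exists e : rground N, val (val e) == h i.
Proof.
have h1 : h i \in ~: C by rewrite inE.
have h2 : exist (fun x => x \in ~: C) (h i) h1 \in ~: [set x | val x \in Y] by rewrite !inE /= hY.
by exists (exist (fun x => x \in ~: [set x | val x \in Y]) _ h2).
Qed.

Definition minor_vec (i : I) := kil <<map (column A) (enum C)>> (column A (h i)).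

Lemma ratrep_minor_vec : ratrep N -> exists (W : vectType rat) (w : I -> W), twin minor_vec w.
Proof.
case=> W [w hw]; have t := twin_Rep Rep_fam hw.
exists W, (fun i => w (xchoose (elt_N i))) => e s.
have := twin_sub (fun i => xchoose (elt_N i)) t e s.
have E1 : fam \o (fun i => xchoose (elt_N i)) =1 minor_vec.
  by move=> i; rewrite /= /fam (eqP (xchooseP (elt_N i))).
by rewrite (eq_map E1) E1.
Qed.

Lemma iso_minor_vec M (K : fieldType) (V : vectType K) (v : rground M -> V) : Rep M v -> risomorphic M N ->
  exists2 g : rground M -> I, injective g & twin v (minor_vec \o g).
Proof.
move=> hv [f [s [bf s0 hu]]]; exists (fun e => xchoose (N_elt (f e))).
  move=> e e' /(congr1 h); rewrite -(eqP (xchooseP (N_elt (f e)))) -(eqP (xchooseP (N_elt (f e')))).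
  by move/val_inj/val_inj; apply: bij_inj.
have := twin_Rep hv (Rep_iso1 bf s0 hu Rep_fam).
have E1 : fam \o f =1 minor_vec \o (fun e => xchoose (N_elt (f e))).
  by move=> e; rewrite /= /fam /minor_vec -(eqP (xchooseP (N_elt (f e)))).
by move=> t e s'; rewrite t (eq_map E1) E1.
Qed.

End DeleteContract.

Section TemplateFamily.
Variables (F : finFieldType) (Phi : template F).
Local Notation K := (tC Phi + tY0 Phi + tY1 Phi)%type.

(** The elements that survive contracting [C] and deleting [Y1]. Indexing by this sum avoids the
    nested subtypes of [rcontract] and [rdelete]. *)
Definition elt (E' : finType) (e : tY0 Phi + E') : K + E' :=
  match e with inl y => inl (inl (inr y)) | inr e' => inr e' end.

Lemma elt_cover (E' : finType) (x : K + E') :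
  [\/ x \in Cset Phi E', x \in Y1set Phi E' | exists i, x == elt i].
Proof.
case: x => [[[c|y]|y]|e].
- by constructor 1; apply/imsetP; exists c.
- by constructor 3; exists (inl y).
- by constructor 2; apply/imsetP; exists y.
by constructor 3; exists (inr e).
Qed.

Lemma elt_C (E' : finType) (i : tY0 Phi + E') : elt i \notin Cset Phi E'.
Proof. by apply/imsetP => -[c _]; case: i. Qed.

Lemma elt_Y (E' : finType) (i : tY0 Phi + E') : elt i \notin Y1set Phi E'.
Proof. by apply/imsetP => -[c _]; case: i. Qed.

Section One.
Variables (B' E' : finType) (A : tX Phi + B' -> K + E' -> F).

Definition Cspan := <<map (column A) (enum (Cset Phi E'))>>%VS.

Definition telt (e : tY0 Phi + E') := kil Cspan (column A (elt e)).

Lemma template_rat : (forall M, conforms Phi M -> ratrep M) -> matrix_conforms A ->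
  exists (W : vectType rat) (w : tY0 Phi + E' -> W), twin telt w.
Proof.
move=> hP hA; have H := @ratrep_minor_vec F _ _ _ A _ _ (@elt E') (@elt_C E') (@elt_Y E'); apply: H; apply: hP.
by exists B', E', A; split=> //; apply: risomorphic_refl.
Qed.

Lemma mem_Cspan c : column A (inl (inl (inl c))) \in Cspan.
Proof. by apply/memv_span/map_f; rewrite mem_enum; apply: imset_f. Qed.

End One.

Lemma template_embed M (K' : fieldType) (V : vectType K') (v : rground M -> V) : Rep M v -> conforms Phi M ->
  exists (B' E' : finType) (A : tX Phi + B' -> K + E' -> F)
    (g : rground M -> tY0 Phi + E'), [/\ matrix_conforms A, injective g & twin v (telt A \o g)].
Proof.
move=> hv [B' [E' [A [hA hi]]]].
by have [g gi t] := iso_minor_vec (@elt_cover E') hv hi; exists B', E', A, g.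
Qed.

End TemplateFamily.

(** * Frame templates all of whose members are rational *)

Lemma rat_cube1 (x : rat) : x ^+ 3 = 1 -> x = 1.
Proof.
move=> h; have : (x - 1) * (x ^+ 2 + x + 1) = 0 by transitivity (x ^+ 3 - 1); [ring | rewrite h subrr].
by move/eqP; rewrite mulf_eq0 subr_eq0 => /orP[/eqP //|/eqP k]; nra.
Qed.

Lemma sub_subl (V : zmodType) (a b c : V) : b - c = (a - c) - (a - b).
Proof. by rewrite opprB [RHS]addrC addrA subrK. Qed.

Lemma sub_subr (V : zmodType) (a b c : V) : a - b = (a - c) - (b - c).
Proof. by rewrite opprB addrA subrK. Qed.

Section Dowling.
Variables (F : fieldType) (V : vectType F) (W : vectType rat) (E : Type) (v : E -> V) (w : E -> W).
Hypothesis tw : twin v w.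

Lemma twin_span2 z a b (cz ca cb : F) : cz != 0 -> cz *: v z = ca *: v a + cb *: v b ->
  exists s t, w z = s *: w a + t *: w b.
Proof.
move=> cz0 h; apply: span2P; rewrite -[[:: w a; w b]]/(map w [:: a; b]) -tw /=.
by rewrite -(memvZeq _ _ cz0) h span2_mem.
Qed.

Lemma twin_ratio z a b (c : F) : c != 0 -> free [:: v a; v b] -> v z = v a - c *: v b ->
  exists2 s, s != 0 & exists2 t, t != 0 & w z = s *: (w a - t *: w b).
Proof.
move=> c0 fr hz; have [|s [t hw]] := @twin_span2 z a b 1 1 (- c) (oner_neq0 _).
  by rewrite !scale1r scaleNr.
have s0 : s != 0.
  apply/negP => /eqP s0; move: hw; rewrite s0 scale0r add0r => hw.
  have : v z \in <<map v [:: b]>>%VS by rewrite tw /= hw memvZ // memv_span ?mem_head.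
  rewrite /= hz (rpredBr _ (memvZ c (memv_span (mem_head _ _)))) => vab.
  by move: fr; rewrite free_cons vab.
have t0 : t != 0.
  apply/negP => /eqP t0; move: hw; rewrite t0 scale0r addr0 => hw.
  have : v z \in <<map v [:: a]>>%VS by rewrite tw /= hw memvZ // memv_span ?mem_head.
  rewrite /= hz span_seq1 => /vlineP[k hk].
  have [|_ c00] := @free2P _ _ (v a) (v b) (1 - k) (- c) fr.
    by rewrite scalerBl scale1r scaleNr addrAC hk subrr.
  by move/eqP: c00; rewrite oppr_eq0 (negPf c0).
exists s => //; exists (- t / s); first by rewrite mulf_neq0 ?invr_eq0 ?oppr_eq0.
by rewrite hw scalerBr scalerA mulrC divfK // scaleNr opprK.
Qed.

(* A rank-3 Dowling geometry of a group with an element of order 3 would give a rational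
   number of multiplicative order 3. *)
Lemma no_dowling (g : F) a b c x1 x2 x3 y1 y2 z1 z2 z3 : g != 1 -> g ^+ 3 = 1 ->
  free [:: v a; v b; v c] ->
  v x1 = v a - v b -> v x2 = v a - g *: v b -> v x3 = v a - g ^+ 2 *: v b ->
  v y1 = v b - v c -> v y2 = v b - g *: v c ->
  v z1 = v a - v c -> v z2 = v a - g *: v c -> v z3 = v a - g ^+ 2 *: v c -> False.
Proof.
move=> g1 g3 fr hx1 hx2 hx3 hy1 hy2 hz1 hz2 hz3.
have g0 : g != 0 by apply/negP => /eqP g0; move: g3; rewrite g0 expr0n /= => /eqP; rewrite eq_sym oner_eq0.
have fw : free [:: w a; w b; w c] by rewrite -[[:: _; _; _]]/(map w [:: a; b; c]) -(twin_free _ tw).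
have fab : free [:: v a; v b].
  have /perm_free -> : perm_eq [:: v a; v b] [:: v b; v a] by rewrite -[[:: v a; v b]]cat1s -[[:: v b; v a]]cat1s perm_catC.
  move: fr; rewrite -[[:: v a; v b; v c]]/([:: v a; v b] ++ [:: v c]) => /catl_free fr.
  have /perm_free <- : perm_eq [:: v a; v b] [:: v b; v a] by rewrite -[[:: v a; v b]]cat1s -[[:: v b; v a]]cat1s perm_catC.
  exact: fr.
have fbc : free [:: v b; v c] by move: fr; rewrite free_cons => /andP[].
have fac : free [:: v a; v c].
  have /perm_free pf : perm_eq [:: v a; v b; v c] ([:: v a; v c] ++ [:: v b]).
    by rewrite /= perm_cons -[[:: v b; v c]]cat1s -[[:: v c; v b]]cat1s perm_catC.
  by move: fr; rewrite pf => /catl_free.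
have o1 := oner_neq0 F.
have [p1 p10 [X1 X10 e1]] : exists2 s, s != 0 & exists2 t, t != 0 & w x1 = s *: (w a - t *: w b).
  by apply: twin_ratio o1 fab _; rewrite scale1r.
have [p2 p20 [X2 X20 e2]] := twin_ratio g0 fab hx2.
have [p3 p30 [X3 X30 e3]] := twin_ratio (expf_neq0 2 g0) fab hx3.
have [q1 q10 [Y1 Y10 f1]] : exists2 s, s != 0 & exists2 t, t != 0 & w y1 = s *: (w b - t *: w c).
  by apply: twin_ratio o1 fbc _; rewrite scale1r.
have [q2 q20 [Y2 Y20 f2]] := twin_ratio g0 fbc hy2.
have [r1 r10 [Z1 Z10 k1]] : exists2 s, s != 0 & exists2 t, t != 0 & w z1 = s *: (w a - t *: w c).
  by apply: twin_ratio o1 fac _; rewrite scale1r.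
have [r2 r20 [Z2 Z20 k2]] := twin_ratio g0 fac hz2.
have [r3 r30 [Z3 Z30 k3]] := twin_ratio (expf_neq0 2 g0) fac hz3.
(* In a triangle on [a], [b], [c] the rational gains multiply. *)
have rel x y z (k : F) (p q r X Y Z : rat) : p != 0 -> q != 0 -> r != 0 ->
    v z = v x + k *: v y -> w x = p *: (w a - X *: w b) -> w y = q *: (w b - Y *: w c) ->
    w z = r *: (w a - Z *: w c) -> Z = X * Y.
  move=> p0 q0 r0 hz ex ey ez; have [|s [t hw]] := @twin_span2 z x y 1 1 k o1; first by rewrite !scale1r.
  have := hw; rewrite ez ex ey => /eqP; rewrite -subr_eq0 => /eqP H.
  have : (r - s * p) *: w a + (s * p * X - t * q) *: w b + (t * q * Y - r * Z) *: w c = 0.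
    rewrite -H !scalerBr !scalerDl !scaleNr !scalerA opprD !opprB.
    by rewrite (AC (2*2*2) ((1*6)*((3*2)*(5*4)))).
  case/(free3P fw) => h1 h2 h3.
  have e1' : s * p = r by apply/eqP; rewrite eq_sym -subr_eq0; apply/eqP.
  have e2' : s * p * X = t * q by apply/eqP; rewrite -subr_eq0; apply/eqP.
  have e3' : t * q * Y = r * Z by apply/eqP; rewrite -subr_eq0; apply/eqP.
  by apply: (mulfI r0); rewrite -e3' -e2' e1' mulrA.
have E1 := rel x1 y1 z1 1 _ _ _ _ _ _ p10 q10 r10 _ e1 f1 k1.
have E2 := rel x2 y1 z2 g _ _ _ _ _ _ p20 q10 r20 _ e2 f1 k2.
have E3 := rel x1 y2 z2 1 _ _ _ _ _ _ p10 q20 r20 _ e1 f2 k2.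
have E4 := rel x2 y2 z3 g _ _ _ _ _ _ p20 q20 r30 _ e2 f2 k3.
have E5 := rel x3 y1 z3 (g ^+ 2) _ _ _ _ _ _ p30 q10 r30 _ e3 f1 k3.
have E6 := rel x3 y2 z1 (g ^+ 2) _ _ _ _ _ _ p30 q20 r10 _ e3 f2 k1.
have {}E1 : Z1 = X1 * Y1 by apply: E1; rewrite hz1 hx1 hy1 scale1r addrA subrK.
have {}E2 : Z2 = X2 * Y1 by apply: E2; rewrite hz2 hx2 hy1 scalerBr addrA subrK.
have {}E3 : Z2 = X1 * Y2 by apply: E3; rewrite hz2 hx1 hy2 scale1r addrA subrK.
have {}E4 : Z3 = X2 * Y2 by apply: E4; rewrite hz3 hx2 hy2 scalerBr addrA subrK scalerA.
have {}E5 : Z3 = X3 * Y1 by apply: E5; rewrite hz3 hx3 hy1 scalerBr addrA subrK.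
have {}E6 : Z1 = X3 * Y2.
  by apply: E6; rewrite hz1 hx3 hy2 scalerBr addrA subrK scalerA -exprSr g3 scale1r.
(* The six triangles say that the three gains on [a], [b] are in geometric progression with ratio
   [rho], and that the progression closes up after three steps. *)
pose rho := X2 / X1.
have hX2 : X2 = rho * X1 by rewrite divfK.
have hY2 : Y2 = rho * Y1.
  by apply: (mulfI X10); rewrite -E3 E2 hX2; ring.
have hX3 : X3 = rho * rho * X1.
  by apply: (mulIf Y10); rewrite -E5 E4 hX2 hY2; ring.
have rh3 : rho ^+ 3 = 1.
  have XY : X1 * Y1 != 0 by rewrite mulf_neq0.
  by apply: (mulIf XY); rewrite mul1r -[RHS]E1 E6 hX3 hY2; ring.
have rh1 : rho = 1 := rat_cube1 rh3.
have : v x2 \in <<map v [:: x1]>>%VS.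
  by rewrite tw /= e1 e2 hX2 rh1 mul1r memvZ // -(memvZeq _ _ p10) memv_span ?mem_head.
rewrite /= span_seq1 => /vlineP[k]; rewrite hx1 hx2 => /eqP; rewrite -subr_eq0 => /eqP h.
have [|k1' k2'] := @free2P _ _ (v a) (v b) (1 - k) (k - g) fab.
  by rewrite -h !scalerBl scale1r scalerBr opprB (AC (2*2) ((1*4)*(3*2))).
by case/eqP: g1; move/eqP: k1'; rewrite subr_eq0 => /eqP ->; apply/esym/eqP; rewrite -subr_eq0 k2'.
Qed.

End Dowling.

Lemma inr_eqE (T U : eqType) (a b : U) : (@inr T U a == inr b) = (a == b). Proof. by []. Qed.

(** * Assembling conforming matrices from prescribed columns *)

Section Build.
Variables (F : finFieldType) (Phi : template F).
Local Notation K := (tC Phi + tY0 Phi + tY1 Phi)%type.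
Variables (B' : finType) (dlt : B' -> {ffun K -> F}).
Local Notation S := {ffun tX Phi + B' -> F^o}.

Definition kc (c : K) : S := [ffun i => match i with inl x => tA1 x c | inr b => dlt b c end].
Definition lamv (l : {ffun tX Phi -> F}) : S := [ffun i => match i with inl x => l x | inr _ => 0 end].
Definition dl (b : B') : S := delta F (inr b : tX Phi + B').

(** A column of a conforming matrix: [Frm] has its top part in [Lambda] and a frame column with at
    most two entries below, [Zed] is a unit column with a [Y1] column already added. The rows over
    [C], [Y0], [Y1] are given by [dlt]. *)
Inductive desc := Frm of {ffun tX Phi -> F} & option (B' * option (B' * F)) | Zed of B' & tY1 Phi.

Definition dvec (d : desc) : S := match d with
  | Frm l None => lamv l
  | Frm l (Some (b, None)) => lamv l + dl b
  | Frm l (Some (b, Some (b', g))) => lamv l + dl b - g *: dl b'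
  | Zed b y => dl b + kc (inr y) end.

Definition dvalid (d : desc) : Prop := match d with
  | Frm l w => l \in tLambda Phi /\
     match w with Some (b, Some (b', g)) => b != b' /\ exists2 u, u \in tG Phi & g = val u | _ => True end
  | Zed _ _ => True end.

Variables (E' : finType) (D : E' -> desc).

Definition mkA : tX Phi + B' -> K + E' -> F :=
  fun i e => match e with inl c => kc c i | inr e' => dvec (D e') i end.

Lemma column_mkA_inl c : column mkA (inl c) = kc c.
Proof. by apply/ffunP => i; rewrite ffunE. Qed.

Lemma column_mkA_inr e : column mkA (inr e) = dvec (D e).
Proof. by apply/ffunP => i; rewrite ffunE. Qed.

Lemma dl_inr b b' : dl b (inr b') = (b' == b)%:R :> F.
Proof. by rewrite ffunE. Qed.

Lemma dvec_pair l b b' g b0 :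
  dvec (Frm l (Some (b, Some (b', g)))) (inr b0) = (if b0 == b then 1 else 0) - g * (if b0 == b' then 1 else 0) :> F.
Proof. by rewrite !ffunE add0r !mulrb. Qed.

Lemma mkA_conforms : (forall b, dlt b \in tDelta Phi) -> (forall e, dvalid (D e)) -> matrix_conforms mkA.
Proof.
move=> hd hD; pose isZ e := if D e is Zed _ _ then true else false.
pose A' : tX Phi + B' -> K + E' -> F := fun i e => match e with
  | inl c => kc c i | inr e' => if D e' is Zed b y then dl b i else dvec (D e') i end.
exists A', [set e | isZ e]; split.
- split.
  + by move=> x c; rewrite /A' ffunE.
  + by move=> x z; rewrite inE /isZ /A'; case: (D z) => // b y _; rewrite ffunE.
  + by move=> z; rewrite inE /isZ /A'; case: (D z) => // b y _; exists b => b'; rewrite dl_inr.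
  + move=> e; rewrite inE /isZ /A'; have := hD e; case: (D e) => // l w [_ hw] _.
    case: w hw => [[b [[b' g]|]]|].
    * case=> bb' [u uG gu]; split.
        apply: leq_trans (_ : #|[set b; b']| <= _)%N; last by rewrite cards2; case: eqP.
        apply: subset_leq_card; apply/subsetP => b0; rewrite !inE dvec_pair.
        by case: (b0 =P b) => //= _; case: (b0 =P b') => //= _; rewrite mulr0 subr0 eqxx.
      move=> _; exists b; first by rewrite dvec_pair eqxx (negPf bb') /= mulr0 subr0.
      move=> b0 h; rewrite dvec_pair (negPf h) sub0r; case: (b0 =P b') => [_|_] /=; last by rewrite mulr0 oppr0 eqxx.
      by move=> _; exists u => //; rewrite gu mulr1.
    * move=> _; split.
        apply: leq_trans (_ : #|[set b]| <= _)%N; last by rewrite cards1.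
        apply: subset_leq_card; apply/subsetP => b0; rewrite !inE !ffunE !inr_eqE.
        by rewrite add0r mulrb; case: (b0 =P b) => //= _; rewrite eqxx.
      move=> _; exists b; first by rewrite !ffunE !inr_eqE eqxx add0r.
      by move=> b0 h; rewrite !ffunE !inr_eqE (negPf h) addr0 eqxx.
    move=> _; split; last by case=> b; rewrite ffunE eqxx.
    by rewrite (_ : [set _ | _] = set0) ?cards0 //; apply/setP => b; rewrite !inE ffunE eqxx.
  + move=> e; rewrite inE /isZ /A'; have := hD e; case: (D e) => // l w [hl _] _.
    suff -> : [ffun x => dvec (Frm l w) (inl x)] = l by [].
    apply/ffunP => x; rewrite ffunE; case: w => [[b [[b' g]|]]|]; rewrite !ffunE //=.
      by rewrite scaler0 oppr0 !addr0.
    by rewrite addr0.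
  move=> b; suff -> : [ffun c => A' (inr b) (inl c)] = dlt b by [].
  by apply/ffunP => c; rewrite ffunE /A' ffunE.
- by [].
- by move=> i e; rewrite inE /isZ /A' /=; case: (D e).
move=> z; rewrite inE /isZ /A' /=; case: (D z) => // b y _; exists y => i.
by rewrite !ffunE.
Qed.

End Build.

Lemma functional_kil (F : fieldType) (V : vectType F) (U : {vspace V}) (f : V -> F) x : functional f ->
  (forall u, u \in U -> f u = 0) -> f (kil U x) = f x.
Proof.
move=> hf h; rewrite kilE functionalD // -scaleN1r functionalZ // [f (projv U x)]h ?mulr0 ?addr0 //.
exact: memv_proj.
Qed.

Lemma free3_tri (F : fieldType) (V : vectType F) (a b c : V) (f g h : V -> F) :
  functional f -> functional g -> functional h -> f a != 0 -> f b = 0 -> f c = 0 ->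
  g b != 0 -> g c = 0 -> h c != 0 -> free [:: a; b; c].
Proof.
move=> hf hg hh fa fb fc gb gc hc; rewrite !free_cons span_nil nil_free memv0 andbT; apply/and3P; split.
- apply/negP => /(functional_span hf) k; move/eqP: fa; apply; apply: k => u.
  by rewrite !inE => /orP[] /eqP ->.
- apply/negP => /(functional_span hg) k; move/eqP: gb; apply; apply: k => u.
  by rewrite !inE => /eqP ->.
by apply: contra hc => /eqP ->; rewrite functional0.
Qed.

Lemma functional_ev (F : fieldType) (B : finType) (b : B) : functional (fun x : {ffun B -> F^o} => x b : F).
Proof. by move=> k x y; rewrite !ffunE. Qed.

Lemma eq_twin (F K : fieldType) (V : vectType F) (W : vectType K) (E : Type) (v v' : E -> V) (w w' : E -> W) :
  v =1 v' -> w =1 w' -> twin v w -> twin v' w'.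
Proof. by move=> ev ew t e s; rewrite -(eq_map ev) -(eq_map ew) -ev -ew. Qed.

Section LiftAlg.
Variables (F K : fieldType) (V : vectType F) (W : vectType K) (T I : finType) (em : T -> I) (y : I -> V).
Variable w : T * I -> W.
Hypothesis tw : twin (fun e : T * I => y (em e.1) - y e.2) w.
Variables t1 t2 : T.

Let span2w (a b c : T * I) : y (em c.1) - y c.2 \in <<[:: y (em a.1) - y a.2; y (em b.1) - y b.2]>>%VS ->
  exists s t, w c = s *: w a + t *: w b.
Proof. by move=> h; apply: span2P; have := tw c [:: a; b]; rewrite /= h => /esym. Qed.

Let span1w (a c : T * I) k : w c = k *: w a ->
  exists k', y (em c.1) - y c.2 = k' *: (y (em a.1) - y a.2).
Proof.
move=> h; have : w c \in <<map w [:: a]>>%VS by rewrite h memvZ // memv_span ?mem_head.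
by rewrite -tw /= span_seq1 => /vlineP.
Qed.

(* The rational vectors [w (t1, i)] and [w (t2, i)] can be rescaled so that their difference is the
   fixed vector [w (t1, t2)]; this turns the family into differences of points. *)
Lemma lift_psi : exists psi : I -> W, forall t i,
  free [:: y (em t1) - y (em t2); y (em t1) - y (em t); y (em t1) - y i] ->
  exists2 c, c != 0 & w (t, i) = c *: (psi (em t) - psi i).
Proof.
pose m := w (t1, em t2).
have step i : exists p, free [:: y (em t1) - y (em t2); y (em t1) - y i] ->
    (exists2 b, b != 0 & w (t1, i) = b *: p) /\ (exists2 c, c != 0 & w (t2, i) = c *: (p + m)).
  case: (boolP (free _)) => fr; last by exists 0.
  have [|b [c hm]] := @span2w (t1, i) (t2, i) (t1, em t2).
    rewrite /= (sub_subr _ _ (y i)).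
    by rewrite memvB // memv_span // !inE eqxx ?orbT.
  have yy : y (em t2) - y i = (y (em t1) - y i) - (y (em t1) - y (em t2)).
    exact: sub_subl.
  have b0 : b != 0.
    apply/negP => /eqP b0; move: hm; rewrite b0 scale0r add0r => /span1w[k] /=; rewrite yy => /eqP.
    rewrite -subr_eq0 scalerBr opprB addrA -{1}[y (em t1) - y (em t2)]scale1r -scalerDl addrC -scaleNr addrC => /eqP h.
    have [h1 h2] := free2P fr h; move: h1; move/eqP: h2; rewrite oppr_eq0 => /eqP ->; rewrite addr0 => /eqP; by rewrite oner_eq0.
  have c0 : c != 0.
    apply/negP => /eqP c0; move: hm; rewrite c0 scale0r addr0 => /span1w[k] /= /eqP.
    rewrite -subr_eq0 -{1}[y (em t1) - y (em t2)]scale1r -scaleNr => /eqP h.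
    by have [/eqP] := free2P fr h; rewrite oner_eq0.
  exists (- b *: w (t1, i)) => _; split.
    by exists (- b)^-1; rewrite ?invr_eq0 ?oppr_eq0 // scalerA mulVf ?oppr_eq0 // scale1r.
  exists c^-1; first by rewrite invr_eq0.
  by rewrite /m hm scaleNr addrA addNr add0r scalerA mulVf // scale1r.
have [psi hpsi] := fin_all_exists step; exists psi => t i fr.
have frt : free [:: y (em t1) - y (em t2); y (em t1) - y (em t)].
  by move: fr; rewrite -[[:: _; _; _]]/([:: _; _] ++ [:: _]) => /catl_free.
have fri : free [:: y (em t1) - y (em t2); y (em t1) - y i].
  move: fr; rewrite (perm_free (_ : perm_eq _ ([:: y (em t1) - y (em t2); y (em t1) - y i] ++ [:: y (em t1) - y (em t)]))).
    by move/catl_free.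
  by rewrite /= perm_cons -[[:: _; _]]cat1s -[X in perm_eq _ X]cat1s perm_catC.
have [[b1 b10 e1] [c1 c10 f1]] := hpsi (em t) frt.
have [[b2 b20 e2] [c2 c20 f2]] := hpsi i fri.
have [|s [s' h]] := @span2w (t1, i) (t1, em t) (t, i).
  rewrite /= (_ : y (em t) - y i = (y (em t1) - y i) - (y (em t1) - y (em t))).
    by rewrite memvB // memv_span // !inE eqxx ?orbT.
  exact: sub_subl.
have [|u [u' h']] := @span2w (t2, i) (t2, em t) (t, i).
  rewrite /= (_ : y (em t) - y i = (y (em t2) - y i) - (y (em t2) - y (em t))).
    by rewrite memvB // memv_span // !inE eqxx ?orbT.
  exact: sub_subl.
have fw : free [:: m; w (t1, em t); w (t1, i)].
  by have := twin_free [:: (t1, em t2); (t1, em t); (t1, i)] tw => /= <-.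
move: h h'; rewrite e1 e2 f1 f2 !scalerA; move: (s * b2) (s' * b1) (u * c2) (u' * c1) => {}s {}s' {}u {}u' h h'.
have H : (- (u + u')) *: m + ((s' - u') / b1) *: w (t1, em t) + ((s - u) / b2) *: w (t1, i) = 0.
  rewrite e1 e2 !scalerA !divfK //; move: h'; rewrite h !scalerDr => /eqP; rewrite -subr_eq0 => /eqP <-.
  rewrite !scalerDl !scaleNr !scalerDl !opprD; move: (s *: _) (s' *: _) (u *: _) (u' *: _) (u *: m) (u' *: m).
  move=> a1 a2 a3 a4 a5 a6; by rewrite !addrA (AC (6%AC) ((5*3*6*1*4*2)%AC)).
have [h1 h2 h3] := free3P fw H.
have su : s = u by apply/eqP; rewrite -subr_eq0; move/eqP: h3; rewrite mulf_eq0 invr_eq0 (negPf b20) orbF.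
have su' : s' = u' by apply/eqP; rewrite -subr_eq0; move/eqP: h2; rewrite mulf_eq0 invr_eq0 (negPf b10) orbF.
have ss : s' = - s by apply/eqP; rewrite -addr_eq0 addrC su su' -oppr_eq0 h1.
exists (- s); last by rewrite h ss scalerBr !scaleNr opprK addrC.
rewrite oppr_eq0; apply/negP => /eqP s0; move: h; rewrite ss s0 oppr0 !scale0r addr0 => /eqP.
rewrite -(twin0 (t, i) tw) /= subr_eq0 => /eqP yt.
move: fr; rewrite yt !free_cons => /and3P[_ /negP h _]; apply: h.
by rewrite memv_span // mem_head.
Qed.

End LiftAlg.

Definition dfam (F : fieldType) (X : vectType F) (P E : Type) (phi : P -> X) (x : E -> X) (e : P * P + E) : X :=
  match e with inl pq => phi pq.1 - phi pq.2 | inr i => x i end.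

Lemma sum_eq_in (F : fieldType) (B : finType) (S : {set B}) b0 : \sum_(b in S) (b0 == b)%:R = (b0 \in S)%:R :> F.
Proof.
case: (boolP (b0 \in S)) => h.
  by rewrite (bigD1 b0) //= eqxx big1 ?addr0 // => b /andP[_ hb]; rewrite eq_sym (negPf hb).
by rewrite big1 // => b bS; case: eqP => // e; rewrite e bS in h.
Qed.

Section Rational.
Variables (F : finFieldType) (hF : #|F| = 4%N) (al : F) (hal : al ^+ 2 = al + 1).
Variable (Phi : template F).
Hypothesis hP : forall M, conforms Phi M -> ratrep M.
Local Notation K := (tC Phi + tY0 Phi + tY1 Phi)%type.

Lemma ev_Cspan (B' E' : finType) (A : tX Phi + B' -> K + E' -> F) b u :
  (forall c, A (inr b) (inl c) = 0) -> u \in Cspan A -> u (inr b) = 0.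
Proof.
move=> h /(functional_span (functional_ev (inr b))); apply => _ /mapP[e + ->].
by rewrite mem_enum => /imsetP[c _ ->]; rewrite ffunE h.
Qed.

Lemma ev_kil (B' E' : finType) (A : tX Phi + B' -> K + E' -> F) b x :
  (forall c, A (inr b) (inl c) = 0) -> kil (Cspan A) x (inr b) = x (inr b).
Proof.
move=> h; apply: (functional_kil x (functional_ev (inr b))) => u; exact: ev_Cspan.
Qed.

Let Lam0 : (0 : {ffun tX Phi -> F}) \in tLambda Phi.
Proof. by case: (tLambda_add Phi). Qed.

Let Del0 : (0 : {ffun K -> F}) \in tDelta Phi.
Proof. by case: (tDelta_add Phi). Qed.

Lemma lamv0 (B' : finType) : lamv (Phi := Phi) B' 0 = 0.
Proof. by apply/ffunP => -[x|b]; rewrite !ffunE. Qed.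

(** A nontrivial unit of GF(4) has order three. On three rows with zero [Delta] part, the unit
    columns and all columns with gain [g ^+ k] then form the configuration excluded by
    [no_dowling]. *)
Lemma Gamma_trivial g : g \in tG Phi -> val g = 1.
Proof.
move=> gG; apply/eqP/negPn/negP => g1.
pose D (e : 'I_3 + 'I_3 * 'I_3 * 'I_3) : desc Phi 'I_3 := match e with
  | inl i => Frm 0 (Some (i, None))
  | inr (i, j, k) => if i == j then Frm 0 None else Frm 0 (Some (i, Some (j, val (g ^+ k)%g))) end.
pose dz (b : 'I_3) : {ffun K -> F} := 0.
have hA : matrix_conforms (mkA dz D).
  apply: mkA_conforms => // -[i|[[i j] k]] //=; case: eqP => //= /eqP ij.
  by split=> //; split=> //; exists (g ^+ k)%g => //; apply: groupX.
have [W [w tw]] := template_rat hP hA.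
have z0 b c : mkA dz D (inr b) (inl c) = 0 by rewrite /= !ffunE.
pose Q := kil (Cspan (mkA dz D)).
have v1 i : telt (mkA dz D) (inr (inl i)) = Q (dl Phi i).
  by rewrite /telt column_mkA_inr /= lamv0 add0r.
have v2 i j k : i != j -> telt (mkA dz D) (inr (inr (i, j, k))) = Q (dl Phi i) - val g ^+ k *: Q (dl Phi j).
  move=> /negPf ij; rewrite /telt column_mkA_inr /= ij /= lamv0 add0r linearB linearZ /=.
  by rewrite FinRing.val_unitX.
pose o0 : 'I_3 := ord0; pose o1 : 'I_3 := Ordinal (isT : (1 < 3)%N); pose o2 : 'I_3 := Ordinal (isT : (2 < 3)%N).
have ev i j : Q (dl Phi i) (inr j) = (j == i)%:R :> F by rewrite ev_kil ?dl_inr.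
pose el i : tY0 Phi + ('I_3 + 'I_3 * 'I_3 * 'I_3) := inr (inl i).
pose ex i j k : tY0 Phi + ('I_3 + 'I_3 * 'I_3 * 'I_3) := inr (inr (i, j, k)).
have g3 : val g ^+ 3 = 1.
  have := expf_card (val g); rewrite hF exprS => h; apply: (mulfI (_ : val g != 0)); last by rewrite h mulr1.
  by have := valP g; rewrite unitfE.
apply: (no_dowling tw (g := val g) (a := el o0) (b := el o1) (c := el o2) (x1 := ex o0 o1 o0)
  (x2 := ex o0 o1 o1) (x3 := ex o0 o1 o2) (y1 := ex o1 o2 o0) (y2 := ex o1 o2 o1) (z1 := ex o0 o2 o0)
  (z2 := ex o0 o2 o1) (z3 := ex o0 o2 o2)); rewrite ?v1 ?v2 ?expr0 ?expr1 ?scale1r //.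
apply: (free3_tri (functional_ev (inr o0)) (functional_ev (inr o1)) (functional_ev (inr o2)));
  by rewrite ev //= oner_eq0.
Qed.

(** If [l] survived the contraction of [C], it would form a Fano plane with two new unit vectors,
    their sum and the translates of these three by [l]. This is carried out in one universal matrix
    having a row for each element of [Delta] and two zero rows. *)
Lemma Lambda_killed (B' E' : finType) (A : tX Phi + B' -> K + E' -> F) l :
  matrix_conforms A -> l \in tLambda Phi -> lamv B' l \in Cspan A.
Proof.
move=> hA lL; pose Bu := ({d : {ffun K -> F} | d \in tDelta Phi} + 'I_2)%type.
pose du (b : Bu) : {ffun K -> F} := match b with inl d => val d | inr _ => 0 end.
pose o0 : Bu := inr ord0; pose o1 : Bu := inr (Ordinal (isT : (1 < 2)%N)).
pose D (e : option 'I_2 * 'I_3) : desc Phi Bu := 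
  let l' := if e.1 is Some i then (if i == ord0 then 0 else l) else 0 in
  match e with
  | (None, _) => Frm l None
  | (_, k) => if k == ord0 then Frm l' (Some (o0, None)) else if k == Ordinal (isT : (1 < 3)%N) then Frm l' (Some (o1, None))
     else Frm l' (Some (o0, Some (o1, 1))) end.
have hAu : matrix_conforms (mkA du D).
  apply: mkA_conforms => [[[d dD]|b] //|[[i|] k]] /=; last by [].
  have l'L : (if i == ord0 then 0 else l) \in tLambda Phi by case: ifP.
  by case: ifP => _; [|case: ifP => _]; split=> //=; split=> //; exists 1%g.
pose Q := kil (Cspan (mkA du D)).
suff hu : lamv Bu l \in Cspan (mkA du D).
  have [A' [Z [rA hAA' _ _]]] := hA.
  have hd b : [ffun c => A (inr b) (inl c)] \in tDelta Phi.
    have -> : [ffun c => A (inr b) (inl c)] = [ffun c => A' (inr b) (inl c)] by apply/ffunP => c; rewrite !ffunE hAA'.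
    exact: (resp_Delta rA).
  (* Each row of [A] repeats some [Delta] row of the universal matrix, so a dependence on the [C]
     columns found there carries over to [A]. *)
  pose T (f : {ffun tX Phi + Bu -> F^o}) : {ffun tX Phi + B' -> F^o} :=
    [ffun i => match i with inl x => f (inl x) | inr b => f (inr (inl (exist (fun d => d \in tDelta Phi) _ (hd b)))) end].
  have Tlin : linear T by move=> k f g; apply/ffunP => -[x|b]; rewrite !ffunE.
  pose Tm := GRing.isLinear.Build F _ _ _ T Tlin.
  pose T' : {linear {ffun tX Phi + Bu -> F^o} -> {ffun tX Phi + B' -> F^o}} := HB.pack T Tm.
  have : linfun T' (lamv Bu l) \in (linfun T' @: Cspan (mkA du D))%VS by apply: memv_img.
  have -> : linfun T' (lamv Bu l) = lamv B' l by rewrite lfunE /=; apply/ffunP => -[x|b]; rewrite !ffunE.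
  apply: subvP; rewrite limg_span; apply/span_subvP => _ /mapP[_ /mapP[e + ->] ->].
  rewrite mem_enum => /imsetP[c _ ->]; rewrite lfunE /=.
  suff -> : T (column (mkA du D) (inl (inl (inl c)))) = column A (inl (inl (inl c))) by apply: mem_Cspan.
  by apply/ffunP => -[x|b]; rewrite !ffunE /= !ffunE // hAA' (resp_A1 rA).
apply/negPn/negP => nl; have [W [w tw]] := template_rat hP hAu.
have two : (2%:R : F) = 0 := f4_two hF hal.
have z0 (i : 'I_2) c : mkA du D (inr (inr i)) (inl c) = 0 by rewrite /= !ffunE.
have ql : Q (lamv Bu l) != 0 by rewrite kil_eq0.
pose el (x : option 'I_2 * 'I_3) : tY0 Phi + (option 'I_2 * 'I_3) := inr x.
pose i0 : 'I_2 := ord0; pose i1 : 'I_2 := Ordinal (isT : (1 < 2)%N).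
pose k0 : 'I_3 := ord0; pose k1 : 'I_3 := Ordinal (isT : (1 < 3)%N); pose k2 : 'I_3 := Ordinal (isT : (2 < 3)%N).
have t0 k : telt (mkA du D) (el (None, k)) = Q (lamv Bu l) by rewrite /telt column_mkA_inr.
have t1 k : telt (mkA du D) (el (Some i0, k)) = match val k with 0%N => Q (dl Phi o0) | 1%N => Q (dl Phi o1) | _ => Q (dl Phi o0) + Q (dl Phi o1) end.
  rewrite /telt column_mkA_inr /=; case: k => -[|[|[|//]]] h /=; rewrite lamv0 add0r ?scale1r //.
  by rewrite linearB /= (f4_oppv hF hal).
have t2 k : telt (mkA du D) (el (Some i1, k)) = match val k with 0%N => Q (lamv Bu l) + Q (dl Phi o0) | 1%N => Q (lamv Bu l) + Q (dl Phi o1) | _ => Q (lamv Bu l) + Q (dl Phi o0) + Q (dl Phi o1) end.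
  rewrite /telt column_mkA_inr /=; case: k => -[|[|[|//]]] h /=; rewrite ?scale1r ?linearB ?linearD //=.
  by rewrite (f4_oppv hF hal).
have one := oner_neq0 F.
apply: (fano_twin two _ tw (e := el (None, k0)) (x1 := el (Some i0, k0)) (y1 := el (Some i1, k0))
   (x2 := el (Some i0, k1)) (y2 := el (Some i1, k1)) (x3 := el (Some i0, k2)) (y3 := el (Some i1, k2))
   one one one one one one one); rewrite ?t0 ?t1 ?t2 /= ?scale1r //.
- have ev (i : 'I_2) b : Q (dl Phi b) (inr (inr i)) = (inr i == b)%:R :> F by rewrite ev_kil ?dl_inr.
  have evl (i : 'I_2) : Q (lamv Bu l) (inr (inr i)) = 0 :> F by rewrite ev_kil // ffunE.
  rewrite !free_cons span_nil nil_free memv0 andbT ql andbT; apply/andP; split.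
    apply/negP => /(functional_span (functional_ev (inr (inr i1)))) k.
    have kk : Q (dl Phi o1) (inr (inr i1)) = 0 :> F.
      by apply: k => u; rewrite !inE => /orP[] /eqP ->; rewrite ?ev ?evl.
    by move/eqP: kk; rewrite ev eqxx oner_eq0.
  apply/negP => /(functional_span (functional_ev (inr (inr i0)))) k.
  have kk : Q (dl Phi o0) (inr (inr i0)) = 0 :> F by apply: k => u; rewrite !inE => /eqP ->; rewrite evl.
  by move/eqP: kk; rewrite ev eqxx oner_eq0.
- by rewrite addrC.
- by rewrite addrC.
- by rewrite addrC addrA.
by rewrite -mulr2n -scaler_nat two scale0r.
Qed.

(** The points of the template: the origin, a unit vector for each row outside [X], and the [Y1]
    columns. *)
Definition phi0 (B' E' : finType) (A : tX Phi + B' -> K + E' -> F) (p : option B' + tY1 Phi) :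
    {ffun tX Phi + B' -> F^o} :=
  match p with inl None => 0 | inl (Some b) => dl Phi b | inr y => column A (inl (inr y)) end.

(** The group is trivial and [Lambda] is killed, so a frame column is a difference of unit vectors
    or the origin. A column of [Z] is a unit vector plus a [Y1] column, which is a difference in
    characteristic two. *)
Lemma telt_phi (B' E' : finType) (A : tX Phi + B' -> K + E' -> F) (e : E') : matrix_conforms A ->
  exists p q, telt A (inr e) = kil (Cspan A) (phi0 A p) - kil (Cspan A) (phi0 A q).
Proof.
move=> hA; have [A' [Z [rA hAA' hE hZ]]] := hA.
case: (boolP (e \in Z)) => eZ.
  have [y hy] := hZ e eZ; have [b hb] := resp_Zunit rA eZ.
  exists (inl (Some b)), (inr y); rewrite -[- _](f4_oppv hF hal) opprK -linearD /telt /=; congr (kil _ _).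
  apply/ffunP => -[x|b']; rewrite !ffunE hy hAA' ?(resp_Z0 rA) ?hb //=.
pose f b := A' (inr b) (inr e).
have [c2 hf] := resp_frame rA eZ.
have f1 b : f b != 0 -> f b = 1.
  move=> fb; have [|b0 h0 h1] := hf; first by exists b.
  case: (eqVneq b b0) => [-> //|bb0]; have [g gG hg] := h1 b bb0 fb.
  by rewrite /f hg Gamma_trivial // (f4_opp hF hal).
have colE : column A (inr e) = lamv B' [ffun x => A' (inl x) (inr e)] + \sum_(b in [set b | f b != 0]) dl Phi b.
  apply/ffunP => -[x|b]; rewrite !ffunE hE // sum_ffunE.
    by rewrite big1 ?addr0 // => b _; rewrite ffunE.
  under eq_bigr => b' _ do rewrite dl_inr.
  rewrite sum_eq_in inE add0r -/(f b); case: (boolP (f b == 0)) => [/eqP ->|fb] //.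
  by rewrite f1.
have kE : telt A (inr e) = kil (Cspan A) (\sum_(b in [set b | f b != 0]) dl Phi b).
  rewrite /telt /= colE linearD /=.
  have /eqP -> : kil (Cspan A) (lamv B' [ffun x => A' (inl x) (inr e)]) == 0.
    by rewrite kil_eq0; apply: Lambda_killed hA _; apply: (resp_Lambda rA).
  by rewrite add0r.
rewrite kE; move: c2; rewrite -/f leq_eqVlt => /orP[/cards2P[b [b' [bb' ->]]]|].
  exists (inl (Some b)), (inl (Some b')); rewrite big_setU1 ?inE //= big_set1 linearD /=.
  by rewrite (f4_oppv hF hal).
rewrite ltnS leq_eqVlt => /orP[/cards1P[b ->]|].
  by exists (inl (Some b)), (inl None); rewrite big_set1 /= linear0 subr0.
rewrite ltnS leqn0 cards_eq0 => /eqP ->; exists (inl None), (inl None).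
by rewrite big_set0 /= subrr linear0.
Qed.

(** Enlarge [A] by rows with zero [Delta] part and by the differences of each new row with all
    points. [lift_psi] turns a rational representation into rational points; contracting one column
    per pair then places a new row on the second point of the pair, so its column to the first point
    becomes their difference. *)
Theorem template_points (B' E' : finType) (A : tX Phi + B' -> K + E' -> F) : matrix_conforms A ->
  exists (W : vectType rat) (psi : option B' + tY1 Phi -> W) (xi : tY0 Phi -> W),
  twin (dfam (fun p => kil (Cspan A) (phi0 A p)) (fun z => telt A (inl z))) (dfam psi xi).
Proof.
move=> hA; have [A' [Z [rA hAA' _ _]]] := hA.
have topA x c : A (inl x) (inl c) = tA1 x c by rewrite hAA' (resp_A1 rA).
(* The two Boolean rows are the reference points for [lift_psi]; there is one further row for each
   ordered pair of points. *)
pose Vt : finType := (option B' + tY1 Phi)%type; pose T : finType := (bool + Vt * Vt)%type.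
pose Bp : finType := (B' + T)%type.
pose dp (b : Bp) : {ffun K -> F} := match b with inl b => [ffun c => A (inr b) (inl c)] | inr _ => 0 end.
pose Ep : finType := (T * (T + Vt))%type.
pose D (e : Ep) : desc Phi Bp := match e with
  | (t, inl t') => if t == t' then Frm 0 None else Frm 0 (Some (inr t, Some (inr t', 1)))
  | (t, inr (inl None)) => Frm 0 (Some (inr t, None))
  | (t, inr (inl (Some b))) => Frm 0 (Some (inr t, Some (inl b, 1)))
  | (t, inr (inr z)) => Zed (inr t) z end.
have hAp : matrix_conforms (mkA dp D).
  apply: mkA_conforms => [[b|t] //=|[t [t'|[[b|]|z]]] //=].
  - suff -> : [ffun c => A (inr b) (inl c)] = [ffun c => A' (inr b) (inl c)] by apply: (resp_Delta rA).
    by apply/ffunP => c; rewrite !ffunE hAA'.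
  - by case: eqP => //= /eqP tt'; split=> //; split=> //; exists 1%g.
  by split=> //; split=> //; exists 1%g.
pose S := {ffun tX Phi + B' -> F^o}; pose Sp := {ffun tX Phi + Bp -> F^o}.
pose J0 (f : S) : Sp := [ffun i => match i with inl x => f (inl x) | inr (inl b) => f (inr b) | inr (inr _) => 0 end].
have Jlin : linear J0 by move=> k f g; apply/ffunP => -[x|[b|t]]; rewrite !ffunE // scaler0 addr0.
pose Jm := GRing.isLinear.Build F S Sp _ J0 Jlin.
pose J := linfun (HB.pack J0 Jm : {linear S -> Sp}).
have JE f : J f = J0 f by rewrite lfunE.
pose pos0 (i : T + Vt) : Sp := match i with inl t => dl Phi (inr t : Bp) | inr p => J (phi0 A p) end.
have colc c : column (mkA dp D) (inl c) = J (column A (inl c)).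
  by rewrite column_mkA_inl JE; apply/ffunP => -[x|[b|t]]; rewrite !ffunE.
have opp (X : vectType F) (x : X) : - x = x := f4_oppv hF hal x.
have colt t i : column (mkA dp D) (inr (t, i)) = pos0 (inl t) - pos0 i.
  rewrite column_mkA_inr; case: i => [t'|[[b|]|z]] /=.
  - by case: eqP => [->|_] /=; rewrite lamv0 ?subrr ?scale1r ?add0r.
  - rewrite lamv0 add0r scale1r; congr (_ - _); rewrite JE.
    by apply/ffunP => -[x|[b'|t']]; rewrite !ffunE.
  - by rewrite lamv0 add0r linear0 subr0.
  by rewrite opp; congr (_ + _); rewrite -colc column_mkA_inl.
have [W [w tw]] := template_rat hP hAp.
pose Qp := kil (Cspan (mkA dp D)); pose y i := Qp (pos0 i).
have teltE t i : telt (mkA dp D) (inr (t, i)) = y (inl t) - y i by rewrite /telt /= colt linearB.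
have tw1 : twin (fun e : T * (T + Vt) => y (inl e.1) - y e.2) (w \o inr).
  by apply: eq_twin (twin_sub inr tw) => // -[t i]; rewrite /= teltE.
have [psi hpsi] := lift_psi tw1 (inl true) (inl false).
have ev (t t' : T) : y (inl t') (inr (inr t)) = (t == t')%:R :> F.
  by rewrite /y /Qp ev_kil => [|c]; rewrite /= !ffunE.
have evp (t : T) p : y (inr p) (inr (inr t)) = 0 :> F.
  by rewrite /y /Qp ev_kil => [|c]; rewrite /= ?JE !ffunE.
have hw ab p : exists2 c, c != 0 & w (inr (inr ab, inr p)) = c *: (psi (inl (inr ab)) - psi (inr p)).
  apply: (hpsi (inr ab) (inr p)).
  apply: (free3_tri (functional_ev (inr (inr (inl false)))) (functional_ev (inr (inr (inr ab))))
    (functional_ev (inr (inr (inl true))))); rewrite /= !ffunE !ev ?evp //= ?subr0 ?sub0r ?oppr0 ?addr0 ?oppr_eq0 ?oner_eq0 //.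
  by rewrite eqxx oner_eq0.
pose e0 (ab : Vt * Vt) : tY0 Phi + Ep := inr (inr ab, inr ab.2).
pose e1 (ab : Vt * Vt) : tY0 Phi + Ep := inr (inr ab, inr ab.1).
pose c0 := [seq e0 ab | ab <- enum {: Vt * Vt}].
pose pi := kil <<map w c0>>.
pose Psi p := pi (psi (inr p)).
have pi0 ab : pi (psi (inl (inr ab))) = Psi ab.2.
  have [c cn0 h] := hw ab ab.2; apply/eqP; rewrite -subr_eq0 -linearB kil_eq0.
  rewrite -(memvZeq _ _ cn0) -h; apply/memv_span/map_f/map_f; by rewrite mem_enum.
exists W, Psi, (fun z => pi (w (inl z))).
pose emb (e : Vt * Vt + tY0 Phi) := match e with inl ab => e1 ab | inr z => inl z end.
apply: (@twin_scaleE _ _ _ _ _ (dfam (fun p => kil (Cspan A) (phi0 A p)) (fun z => telt A (inl z))) _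
  (fun e => pi (w (emb e)))) => [e|[ab|z]|]; try exact: scale1P.
  have [c cn0 h] := hw ab ab.1; exists (- c^-1); first by rewrite oppr_eq0 invr_eq0.
  rewrite /= h linearZ linearB /= pi0 scalerA mulNr mulVf // scaleN1r opprB //.
pose d0 (e : Vt * Vt + tY0 Phi) : S := dfam (phi0 A) (fun z => column A (inl (inl (inr z)))) e.
have dE e : dfam (fun p => kil (Cspan A) (phi0 A p)) (fun z => telt A (inl z)) e = kil (Cspan A) (d0 e).
  by case: e => [ab|z]; rewrite /= ?linearB.
move=> e s; rewrite dE (eq_map dE) (map_comp (kil (Cspan A)) d0) (mem_span_ker _ _ (lker_kil (Cspan A))).
rewrite (map_comp pi (w \o emb)) (map_comp w emb) (mem_span_ker _ _ (lker_kil _)) -map_cat.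
rewrite -(tw (emb e)).
have tE e' : telt (mkA dp D) e' = Qp (column (mkA dp D) (elt e')) by [].
rewrite (eq_map tE) tE (map_comp Qp (fun e' => column (mkA dp D) (elt e'))) (mem_span_ker _ _ (lker_kil _)).
pose Up := <<[seq column (mkA dp D) (elt e') | e' <- map emb s ++ c0] ++ [seq column (mkA dp D) i | i <- enum (Cset Phi Ep)]>>%VS.
pose U := <<[seq d0 i | i <- s] ++ [seq column A i | i <- enum (Cset Phi E')]>>%VS.
suff : (d0 e \in U) = (column (mkA dp D) (elt (emb e)) \in Up) by [].
(* A left inverse of the inclusion [J] that sends the new row of a pair to the second point of that
   pair. It realises the contraction by [c0] explicitly. *)
pose Lm0 (f : Sp) : S := [ffun i => match i with inl x => f (inl x) | inr b => f (inr (inl b)) end]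
   + \sum_(ab : Vt * Vt) (f (inr (inr (inr ab))) : F) *: phi0 A ab.2.
have Lmlin : linear Lm0.
  move=> k f g; rewrite /Lm0 scalerDr scaler_sumr addrACA -big_split /=; congr (_ + _).
    by apply/ffunP => -[x|b]; rewrite !ffunE.
  by apply: eq_bigr => ab _; rewrite !ffunE scalerDl scalerA.
pose Lmm := GRing.isLinear.Build F Sp S _ Lm0 Lmlin.
pose Lm := linfun (HB.pack Lm0 Lmm : {linear Sp -> S}).
have LE f : Lm f = Lm0 f by rewrite lfunE.
have LJ f : Lm (J f) = f.
  rewrite LE JE /Lm0 big1 ?addr0 => [|ab _]; last by rewrite ffunE scale0r.
  by apply/ffunP => -[x|b]; rewrite !ffunE.
have Ldl ab : Lm (dl Phi (inr (inr ab) : Bp)) = phi0 A ab.2.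
  rewrite LE /Lm0 (bigD1 ab) //= big1 => [|ab' h]; last by rewrite dl_inr !inr_eqE (negPf h) scale0r.
  rewrite dl_inr eqxx scale1r addr0 -[RHS]add0r; congr (_ + _).
  by apply/ffunP => -[x|b]; rewrite !ffunE.
have subC (X : vectType F) (a b : X) : a - b = b - a by rewrite -[LHS]opp opprB.
have Ld e' : Lm (column (mkA dp D) (elt (emb e'))) = d0 e'.
  case: e' => [ab|z] /=; last by rewrite colc LJ.
  by rewrite colt linearB /= Ldl LJ subC.
have J1 e' : column (mkA dp D) (elt (emb e')) - J (d0 e') \in Up.
  case: e' => [ab|z] /=; last by rewrite colc subrr mem0v.
  have -> : column (mkA dp D) (inr (inr ab, inr ab.1)) - J (phi0 A ab.1 - phi0 A ab.2) = column (mkA dp D) (elt (e0 ab)).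
    by rewrite [phi0 A ab.1 - _]subC /= !colt /= linearB /= opprB addrA subrK.
  apply: memv_span; rewrite mem_cat; apply/orP; left; apply: (map_f (fun e' => column (mkA dp D) (elt e'))).
  by rewrite mem_cat; apply/orP; right; apply: map_f; rewrite mem_enum.
apply/idP/idP => h.
  have : J (d0 e) \in (J @: U)%VS by apply: memv_img.
  have hs : (J @: U <= Up)%VS.
    rewrite limg_span; apply/span_subvP => _ /mapP[u + ->]; rewrite mem_cat => /orP[/mapP[e' es ->]|/mapP[c hc ->]].
      rewrite -(subKr (column (mkA dp D) (elt (emb e'))) (J (d0 e'))) memvB //.
      apply: memv_span; rewrite mem_cat; apply/orP; left.
      by apply: (map_f (fun e' => column (mkA dp D) (elt e'))); rewrite mem_cat map_f.
    have [c' hc'] : exists c', c = inl (inl (inl c')) by move: hc; rewrite mem_enum => /imsetP[c' _ ->]; exists c'.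
    rewrite hc' -colc; apply: memv_span; rewrite mem_cat; apply/orP; right; apply: map_f.
    by rewrite mem_enum; apply: imset_f.
  by move/(subvP hs) => h1; rewrite -(subrK (J (d0 e)) (column _ _)) memvD.
have : Lm (column (mkA dp D) (elt (emb e))) \in (Lm @: Up)%VS by apply: memv_img.
rewrite Ld; apply: subvP; rewrite limg_span; apply/span_subvP => _ /mapP[u + ->].
rewrite mem_cat => /orP[/mapP[e' + ->]|/mapP[c hc ->]].
  rewrite mem_cat => /orP[/mapP[e'' es ->]|/mapP[ab _ ->]].
    by rewrite Ld; apply: memv_span; rewrite mem_cat map_f.
  by rewrite /= colt linearB /= Ldl LJ subrr mem0v.
have [c' hc'] : exists c', c = inl (inl (inl c')) by move: hc; rewrite mem_enum => /imsetP[c' _ ->]; exists c'.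
rewrite hc' colc LJ; apply: memv_span; rewrite mem_cat; apply/orP; right; apply: map_f.
by rewrite mem_enum; apply: imset_f.
Qed.

End Rational.

(** * Forbidden affine configurations *)

(** The field with four elements as an enumerated type, so that the case analysis on configurations
    can be done by evaluation. *)
Inductive q4 := Q0 | Q1 | Qa | Qb.

Definition qadd x y := match x, y with
  | Q0, z => z | z, Q0 => z
  | Q1, Q1 => Q0 | Q1, Qa => Qb | Q1, Qb => Qa
  | Qa, Q1 => Qb | Qa, Qa => Q0 | Qa, Qb => Q1
  | Qb, Q1 => Qa | Qb, Qa => Q1 | Qb, Qb => Q0 end.

Definition qmul x y := match x, y with
  | Q0, _ => Q0 | _, Q0 => Q0
  | Q1, z => z | z, Q1 => z
  | Qa, Qa => Qb | Qa, Qb => Q1 | Qb, Qa => Q1 | Qb, Qb => Qa end.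

Definition qz x := if x is Q0 then true else false.

Definition pt := (q4 * q4 * q4)%type.

Definition psub (u v : pt) : pt :=
  let: (a, b, c) := u in let: (x, y, z) := v in (qadd a x, qadd b y, qadd c z).

Definition qdet (u v w : pt) : q4 :=
  let: (a, b, c) := u in let: (d, e, f) := v in let: (g, h, i) := w in
  qadd (qmul a (qadd (qmul e i) (qmul f h)))
    (qadd (qmul b (qadd (qmul f g) (qmul d i))) (qmul c (qadd (qmul d h) (qmul e g)))).

Section Det.
Variable K : fieldType.
Definition vec3 := (K * K * K)%type.

Definition vsub3 (u v : vec3) : vec3 :=
  let: (a, b, c) := u in let: (x, y, z) := v in (a - x, b - y, c - z).

Definition det3 (u v w : vec3) : K :=
  let: (a, b, c) := u in let: (d, e, f) := v in let: (g, h, i) := w in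
  a * (e * i - f * h) + b * (f * g - d * i) + c * (d * h - e * g).

(** Cramer's rule: the coordinates with respect to [e1], [e2], [e3] are quotients of determinants,
    and passing to them scales every determinant by the same nonzero factor. *)
Lemma det3_frame (e1 e2 e3 : vec3) : det3 e1 e2 e3 != 0 ->
  exists c1 c2 c3 : vec3 -> K,
  [/\ [/\ forall u v, c1 (vsub3 u v) = c1 u - c1 v, forall u v, c2 (vsub3 u v) = c2 u - c2 v &
      forall u v, c3 (vsub3 u v) = c3 u - c3 v],
      [/\ c1 e1 = 1, c2 e1 = 0 & c3 e1 = 0], [/\ c1 e2 = 0, c2 e2 = 1 & c3 e2 = 0],
      [/\ c1 e3 = 0, c2 e3 = 0 & c3 e3 = 1] &
      forall u v w, (det3 u v w == 0) =
        (det3 (c1 u, c2 u, c3 u) (c1 v, c2 v, c3 v) (c1 w, c2 w, c3 w) == 0)].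
Proof.
move=> T0; pose T := det3 e1 e2 e3.
exists (fun u => det3 u e2 e3 / T), (fun u => det3 e1 u e3 / T), (fun u => det3 e1 e2 u / T).
have key u v w : det3 u v w * T ^+ 2 =
    det3 (det3 u e2 e3, det3 e1 u e3, det3 e1 e2 u) (det3 v e2 e3, det3 e1 v e3, det3 e1 e2 v)
      (det3 w e2 e3, det3 e1 w e3, det3 e1 e2 w).
  rewrite /T; case: u v w e1 e2 e3 {T0 T} => [[u1 u2] u3] [[v1 v2] v3] [[w1 w2] w3]
    [[a1 a2] a3] [[b1 b2] b3] [[d1 d2] d3]; rewrite /det3; ring.
have key2 u v w : det3 (det3 u e2 e3 / T, det3 e1 u e3 / T, det3 e1 e2 u / T)
    (det3 v e2 e3 / T, det3 e1 v e3 / T, det3 e1 e2 v / T)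
    (det3 w e2 e3 / T, det3 e1 w e3 / T, det3 e1 e2 w / T) = det3 u v w / T.
  have -> : det3 u v w / T = (det3 u v w * T ^+ 2) * (T^-1 ^+ 3).
    by field.
  rewrite key; move: (det3 u e2 e3) (det3 e1 u e3) (det3 e1 e2 u) (det3 v e2 e3) (det3 e1 v e3)
    (det3 e1 e2 v) (det3 w e2 e3) (det3 e1 w e3) (det3 e1 e2 w) => *; rewrite /det3; ring.
have lin1 u v : det3 (vsub3 u v) e2 e3 = det3 u e2 e3 - det3 v e2 e3.
  by case: u v e2 e3 {key key2 T0 T} => [[? ?] ?] [[? ?] ?] [[? ?] ?] [[? ?] ?]; rewrite /det3 /=; ring.
have lin2 u v : det3 e1 (vsub3 u v) e3 = det3 e1 u e3 - det3 e1 v e3.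
  by case: u v e1 e3 {key key2 T0 T lin1} => [[? ?] ?] [[? ?] ?] [[? ?] ?] [[? ?] ?]; rewrite /det3 /=; ring.
have lin3 u v : det3 e1 e2 (vsub3 u v) = det3 e1 e2 u - det3 e1 e2 v.
  by case: u v e1 e2 {key key2 T0 T lin1 lin2} => [[? ?] ?] [[? ?] ?] [[? ?] ?] [[? ?] ?]; rewrite /det3 /=; ring.
have alt1 (u v : vec3) : det3 u u v = 0 by case: u v => [[? ?] ?] [[? ?] ?]; rewrite /det3; ring.
have alt2 (u v : vec3) : det3 u v v = 0 by case: u v => [[? ?] ?] [[? ?] ?]; rewrite /det3; ring.
have alt3 (u v : vec3) : det3 u v u = 0 by case: u v => [[? ?] ?] [[? ?] ?]; rewrite /det3; ring.
split; first by split=> u v; rewrite ?lin1 ?lin2 ?lin3 mulrBl.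
- by split; rewrite ?alt1 ?alt3 ?mul0r // divff.
- by split; rewrite ?alt1 ?alt2 ?mul0r // divff.
- by split; rewrite ?alt2 ?alt3 ?mul0r // divff.
by move=> u v w; rewrite key2 mulf_eq0 invr_eq0 (negPf T0) orbF.
Qed.

End Det.

(** The discriminant is 5. By coprimality the denominator is 1, and then n (n + 1) = 1 has no
    integral solution. *)
Lemma rat_noroot5 (p : rat) : p ^+ 2 + p - 1 <> 0.
Proof.
move=> h; have d0 : (denq p)%:Q != 0 by rewrite intr_eq0 denq_eq0.
have E : numq p ^+ 2 + numq p * denq p - denq p ^+ 2 = 0.
  apply/eqP; rewrite -(intr_eq0 rat) !rmorphD !rmorphN !rmorphXn !rmorphM /=; apply/eqP.
  have -> : (numq p)%:Q = p * (denq p)%:Q by rewrite -{2}(divq_num_den p) divfK.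
  by transitivity ((p ^+ 2 + p - 1) * (denq p)%:Q ^+ 2); [ring | rewrite h mul0r].
have dv : (denq p %| numq p ^+ 2)%Z.
  apply/dvdzP; exists (denq p - numq p); move: E; move: (numq p) (denq p) => n d E; clear -E; nia.
have d1 : denq p = 1.
  have := coprime_num_den p; rewrite coprime_sym => cp.
  have : (`|denq p|%N %| `|numq p|%N ^ 2)%N by move: dv; rewrite dvdzE abszX.
  rewrite Gauss_dvdr ?coprimeXr // => h1.
  have := denq_gt0 p; move/gcdn_idPl: h1; move: cp; rewrite /coprime => /eqP ->.
  by move: (denq p) => n; clear; lia.
move: E; rewrite d1; move: (numq p) => n {h d0 dv d1} E.
have : (n * (n + 1) = 1)%R by clear -E; lia.
by case: n E => k _ H; clear -H; nia.
Qed.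

Section Config.
Variables (c : nat -> pt) (x : nat -> vec3 rat).
Hypothesis cx : forall i j k l m t,
  qz (qdet (psub (c i) (c j)) (psub (c k) (c l)) (psub (c m) (c t))) =
  (det3 (vsub3 (x i) (x j)) (vsub3 (x k) (x l)) (vsub3 (x m) (x t)) == 0).

Section Plane.
Variables m t : nat.
Let par i j k l := qz (qdet (psub (c i) (c j)) (psub (c k) (c l)) (psub (c m) (c t))).

(* Affine coordinates on the quotient by the direction [x m - x t]. *)
Lemma plane_coords o y z : ~~ par y o z o -> exists X Y : nat -> rat,
  [/\ X o = 0 /\ Y o = 0, X y = 1 /\ Y y = 0, X z = 0 /\ Y z = 1 &
   forall i j k l, par i j k l = ((X i - X j) * (Y k - Y l) - (Y i - Y j) * (X k - X l) == 0)].
Proof.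
rewrite /par cx => /det3_frame[c1 [c2 [c3 [[l1 l2 l3] [h11 h12 h13] [h21 h22 h23] [h31 h32 h33] hd]]]].
exists (fun i => c1 (vsub3 (x i) (x o))), (fun i => c2 (vsub3 (x i) (x o))); split=> //.
  by rewrite l1 l2 !subrr.
move=> i j k l; rewrite cx hd h31 h32 h33 /det3 !l1 !l2; congr (_ == 0); ring.
Qed.

(** A parallelogram [a b e d] with parallel diagonals exists only in characteristic two. *)
Lemma pat_F1 a b d e : par a b d e -> par a d b e -> par a e b d -> ~~ par b a d a -> False.
Proof.
move=> h1 h2 h3 /plane_coords[X [Y [[xo yo] [xy yy] [xz yz] hp]]].
move: (h1); rewrite hp => /eqP; move: (h2); rewrite hp => /eqP; move: (h3); rewrite hp => /eqP.
rewrite xo yo xy yy xz yz; lra.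
Qed.

(** With [o], [y], [z] as affine frame, the coordinate x of [a] satisfies x^2 - x + 1 = 0. *)
Lemma pat_F3 o y a z b : par o y o a -> par z o b y -> par z y b a -> par z a b o ->
  ~~ par y o z o -> False.
Proof.
move=> h0 h1 h2 h3 /plane_coords[X [Y [[xo yo] [xy yy] [xz yz] hp]]].
move: (h0); rewrite hp => /eqP; move: (h1); rewrite hp => /eqP; move: (h2); rewrite hp => /eqP; move: (h3); rewrite hp => /eqP.
rewrite xo yo xy yy xz yz; move: (X a) (Y a) (X b) (Y b) => xa ya xb yb e3 e2 e1 e0.
have ya0 : ya = 0 by lra.
have xb1 : xb = 1 by lra.
have yb1 : yb = xa - 1 by move: e2; rewrite ya0 xb1; lra.
move: e3; rewrite ya0 xb1 yb1 => e3; nra.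
Qed.

(** An affinely regular pentagon, each side parallel to a diagonal: one coordinate satisfies p^2 + p
    - 1 = 0. *)
Lemma pat_P v0 v1 v2 v3 v4 : par v0 v1 v4 v2 -> par v1 v2 v0 v3 -> par v2 v3 v1 v4 ->
  par v3 v4 v2 v0 -> par v4 v0 v3 v1 -> ~~ par v1 v0 v2 v0 -> False.
Proof.
move=> h0 h1 h2 h3 h4 /plane_coords[X [Y [[xo yo] [xy yy] [xz yz] hp]]].
move: (h0); rewrite hp => /eqP; move: (h1); rewrite hp => /eqP; move: (h2); rewrite hp => /eqP; move: (h3); rewrite hp => /eqP.
move: (h4); rewrite hp => /eqP; rewrite xo yo xy yy xz yz; move: (X v3) (Y v3) (X v4) (Y v4) => p q s t'.
move=> e4 e3 e2 e1 e0.
have t1 : t' = 1 by lra.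
have qp : q = - p by lra.
have sp : s = p by lra.
apply: (@rat_noroot5 p); move: e4; rewrite t1 qp sp => e4; lra.
Qed.

(** [p] is the intersection of the lines [y b] and [a z], while [o p] is parallel to [a b]. The two
    collinearities, added, give 2 = 0. *)
Lemma pat_Q o y a z b p : par o y o a -> par o z o b -> par y z a b -> par o p a b ->
  par p y p b -> par p a p z -> ~~ par y o z o -> ~~ par o a o z -> False.
Proof.
move=> h0 h1 h2 h3 h4 h5 /plane_coords[X [Y [[xo yo] [xy yy] [xz yz] hp]]] na.
move: (h0); rewrite hp => /eqP; move: (h1); rewrite hp => /eqP; move: (h2); rewrite hp => /eqP; move: (h3); rewrite hp => /eqP.
move: (h4); rewrite hp => /eqP; move: (h5); rewrite hp => /eqP.
rewrite xo yo xy yy xz yz; move ea: (X a) => xa; move: (Y a) (X b) (Y b) (X p) (Y p) => ya xb yb xp yp.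
move=> e5 e4 e3 e2 e1 e0.
have ya0 : ya = 0 by lra.
have xb0 : xb = 0 by lra.
have yb0 : yb = xa by move: e2; rewrite ya0 xb0; lra.
move: e3 e4 e5; rewrite ya0 xb0 yb0 => e3 e4 e5.
have xa0 : xa != 0.
  by apply: contra na => /eqP xa0; rewrite hp ea xo yo xz yz xa0; apply/eqP; ring.
have xpy : xp = - yp.
  by apply/eqP; rewrite -addr_eq0; apply/eqP/(mulfI xa0); lra.
by move/eqP: xa0; apply; move: e4 e5; rewrite xpy => e4 e5; lra.
Qed.

End Plane.

Let dt a a' b b' d d' := qz (qdet (psub (c a) (c a')) (psub (c b) (c b')) (psub (c d) (c d'))).

(** A spatial pattern: [n] lies on the line [s m] at parameter u, [n'] on the skew line [s' m'] at
    parameter v. The last two dependences give u = v and u^2 - u + 1 = 0. *)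
Lemma pat_F2 s m n s' m' n' : ~~ dt m s m' s' s' s ->
  dt n s m s s' s -> dt n s m s m' s' -> dt n' s' m' s' s' s -> dt n' s' m' s' m s ->
  dt s s' m m' n n' -> dt m s' n m' s n' -> False.
Proof.
rewrite /dt !cx => /det3_frame[c1 [c2 [c3 [[l1 l2 l3] [h11 h12 h13] [h21 h22 h23] [h31 h32 h33] hd]]]].
move=> a1 a2 a3 a4 a5 a6; rewrite hd in a1; rewrite hd in a2; rewrite hd in a3; rewrite hd in a4; rewrite hd in a5; rewrite hd in a6.
move: a1 a2 a3 a4 a5 a6; clear hd; rewrite h11 h12 h13 h21 h22 h23 h31 h32 h33 !l1 !l2 !l3; move: h11 h12 h13 h21 h22 h23 h31 h32 h33; rewrite !l1 !l2 !l3 /det3.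
move: (c1 (x s)) (c2 (x s)) (c3 (x s)) (c1 (x m)) (c2 (x m)) (c3 (x m)) (c1 (x n)) (c2 (x n)) (c3 (x n))
  (c1 (x s')) (c2 (x s')) (c3 (x s')) (c1 (x m')) (c2 (x m')) (c3 (x m')) (c1 (x n')) (c2 (x n')) (c3 (x n')).
move=> s1 s2 s3 m1 m2 m3 n1 n2 n3 t1 t2 t3 k1 k2 k3 p1 p2 p3.
move=> h11 h12 h13 h21 h22 h23 h31 h32 h33.
have -> : m1 = s1 + 1 by lra. have -> : m2 = s2 by lra. have -> : m3 = s3 by lra.
have -> : k1 = t1 by lra. have -> : k2 = t2 + 1 by lra. have -> : k3 = t3 by lra.
have -> : t1 = s1 by lra. have -> : t2 = s2 by lra. have -> : t3 = s3 + 1 by lra.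
move=> /eqP e1 /eqP e2 /eqP e3 /eqP e4.
have en2 : n2 = s2 by lra.
have en3 : n3 = s3 by lra.
have ep1 : p1 = s1 by lra.
have ep3 : p3 = s3 + 1 by lra.
rewrite en2 en3 ep1 ep3 {e1 e2 e3 e4 en2 en3 ep1 ep3}.
have [u ->] : exists u, n1 = s1 + u by exists (n1 - s1); ring.
have [v ->] : exists v, p2 = s2 + v by exists (p2 - s2); ring.
move=> /eqP e5 /eqP e6.
have uv : v = u by lra.
move: e6; rewrite uv => e6; nra.
Qed.

End Config.

(* These connectives are lazy under call-by-value evaluation. *)
Notation "x &&& y" := (if x then y else false) (at level 40, left associativity).
Notation "x ||| y" := (if x then true else y) (at level 50, left associativity).

Fixpoint anyn n (f : nat -> bool) : bool := if n is k.+1 then f k ||| anyn k f else false.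

Lemma anynP n f : anyn n f -> exists i, f i.
Proof. by elim: n => //= k IH; case: ifP => [fk _|_ /IH //]; exists k. Qed.

Lemma andiP (x y : bool) : x &&& y -> x /\ y. Proof. by case: x. Qed.
Lemma oriP (x y : bool) : x ||| y -> x \/ y. Proof. by case: x; [left|right]. Qed.

(** A computable certificate that a configuration over GF(4) has no rational counterpart. In the
    first four patterns the direction from [t] to [m] is factored out; the order of the tests serves
    early failure. *)
Definition bad n (c : nat -> pt) : bool :=
  anyn n (fun m => anyn m (fun t => let d := psub (c m) (c t) in
   let par i j k l := qz (qdet (psub (c i) (c j)) (psub (c k) (c l)) d) in
   anyn n (fun a => anyn a (fun b => anyn b (fun e => anyn e (fun f =>
         par a b e f &&& (par a e b f &&& (par a f b e &&& ~~ par b a e a))))))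
   ||| (anyn n (fun o => anyn n (fun y => anyn n (fun a => par o y o a &&& anyn n (fun z =>
         ~~ par y o z o &&& anyn n (fun b => par z o b y &&& (par z y b a &&& par z a b o))))))
   ||| (anyn n (fun v0 => anyn n (fun v1 => anyn n (fun v2 => ~~ par v1 v0 v2 v0 &&&
         anyn n (fun v4 => par v0 v1 v4 v2 &&& anyn n (fun v3 =>
         par v1 v2 v0 v3 &&& (par v2 v3 v1 v4 &&& (par v3 v4 v2 v0 &&& par v4 v0 v3 v1)))))))
   ||| anyn n (fun o => anyn n (fun y => anyn n (fun a => par o y o a &&& anyn n (fun z =>
         ~~ par y o z o &&& (~~ par o a o z &&& anyn n (fun b => par o z o b &&& (par y z a b &&&
          anyn n (fun p => par o p a b &&& (par p y p b &&& par p a p z)))))))))))))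
  ||| let dt a a' b b' d d' := qz (qdet (psub (c a) (c a')) (psub (c b) (c b')) (psub (c d) (c d'))) in
   anyn n (fun s => anyn n (fun m => anyn n (fun s' => anyn n (fun m' =>
     ~~ dt m s m' s' s' s &&& anyn n (fun k => dt k s m s s' s &&& (dt k s m s m' s' &&&
       anyn n (fun k' => dt k' s' m' s' s' s &&& (dt k' s' m' s' m s &&&
         (dt s s' m m' k k' &&& dt m s' k m' s k'))))))))).

Lemma badP n c x : (forall i j k l m t,
    qz (qdet (psub (c i) (c j)) (psub (c k) (c l)) (psub (c m) (c t))) =
    (det3 (vsub3 (x i) (x j)) (vsub3 (x k) (x l)) (vsub3 (x m) (x t)) == 0 :> rat)) ->
  bad n c -> False.
Proof.
move=> cx /oriP[/anynP[m /anynP[t]]|].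
  case/oriP.
    case/anynP=> a /anynP[b /anynP[e /anynP[f /andiP[h1 /andiP[h2 /andiP[h3 h4]]]]]].
    exact: (pat_F1 cx h1 h2 h3 h4).
  case/oriP.
    case/anynP=> o /anynP[y /anynP[a /andiP[h0 /anynP[z /andiP[h1 /anynP[b /andiP[h2 /andiP[h3 h4]]]]]]]].
    exact: (pat_F3 cx h0 h2 h3 h4 h1).
  case/oriP.
    case/anynP=> v0 /anynP[v1 /anynP[v2 /andiP[h /anynP[v4 /andiP[h0 /anynP[v3 /andiP[h1 /andiP[h2 /andiP[h3 h4]]]]]]]]].
    exact: (pat_P cx h0 h1 h2 h3 h4 h).
  case/anynP=> o /anynP[y /anynP[a /andiP[h0 /anynP[z /andiP[h1 /andiP[h2 /anynP[b /andiP[h3 /andiP[h4 /anynP[p /andiP[h5 /andiP[h6 h7]]]]]]]]]]]].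
  exact: (pat_Q cx h0 h3 h4 h5 h6 h7 h1 h2).
case/anynP=> s /anynP[m /anynP[s' /anynP[m' /andiP[h0 /anynP[k /andiP[h1 /andiP[h2 /anynP[k' /andiP[h3 /andiP[h4 /andiP[h5 h6]]]]]]]]]]].
exact: (pat_F2 cx h0 h1 h2 h3 h4 h5 h6).
Qed.

(** Barycentric coordinates with respect to four affinely independent points; the extra points
   are numbered from 4 on. *)
Definition q4s := [:: Q0; Q1; Qa; Qb].

Definition pts : seq pt := [seq (u, w) | u <- [seq (x, y) | x <- q4s, y <- q4s], w <- q4s].

(** The barycentric coordinate at the base point chosen as origin; 1 minus the others becomes a sum
    in characteristic two. *)
Definition bary (p : pt) : q4 := let: (x, y, z) := p in qadd Q1 (qadd x (qadd y z)).

Definition conf4 (s : seq pt) (i : nat) : pt :=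
  nth (Q0, Q0, Q0) ([:: (Q0, Q0, Q0); (Q1, Q0, Q0); (Q0, Q1, Q0); (Q0, Q0, Q1)] ++ s) i.

Definition supp (p : pt) : seq bool :=
  let: (x, y, z) := p in [:: ~~ qz (bary p); ~~ qz x; ~~ qz y; ~~ qz z].

Definition orb2 (s t : seq bool) := [seq x.1 || x.2 | x <- zip s t].

Definition wt (s : seq bool) := count id s.

Definition qeq x y := qz (qadd x y).
Definition peq (u v : pt) := let: (a, b, c) := u in let: (x, y, z) := v in [&& qeq a x, qeq b y & qeq c z].

Definition pscal (k : q4) (u : pt) : pt := let: (a, b, c) := u in (qmul k a, qmul k b, qmul k c).

(* s = o + k (t - o) *)
Definition onl (k : q4) (o t s : pt) := peq (psub s o) (pscal k (psub t o)).

Definition T2chk (c : nat -> pt) := anyn 6 (fun o => anyn 6 (fun t => ~~ peq (c t) (c o) &&&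
  anyn 6 (fun s => onl Qa (c o) (c t) (c s) &&& anyn 6 (fun s' => onl Qb (c o) (c t) (c s'))))).

Definition offl (o t z : pt) := ~~ peq z o &&& (~~ onl Q1 o t z &&& (~~ onl Qa o t z &&& ~~ onl Qb o t z)).

Definition Gchk (c : nat -> pt) := anyn 6 (fun o => anyn 6 (fun t => ~~ peq (c t) (c o) &&&
  anyn 6 (fun s => onl Qa (c o) (c t) (c s) &&& anyn 6 (fun t' => offl (c o) (c t) (c t') &&&
  anyn 6 (fun s' => onl Qa (c o) (c t') (c s')))))).

(** Two extra points that may coexist: their supports lie in three common base points, and with the
    base points they contain the configuration of [T_r^2] or of [G_r]. *)
Definition GT (a b : pt) := (wt (orb2 (supp a) (supp b)) <= 3)%N &&& (T2chk (conf4 [:: a; b]) ||| Gchk (conf4 [:: a; b])).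

Definition good1 := Eval vm_compute in
  [seq a <- pts | (1 < wt (supp a) < 4)%N &&& ~~ bad 5 (conf4 [:: a])].

Definition tab1 := all (fun a => (wt (supp a) <= 1)%N ||| (has (peq a) good1 ||| bad 5 (conf4 [:: a]))) pts.

Fixpoint pw (r : pt -> pt -> bool) s := if s is x :: s' then all (r x) s' &&& pw r s' else true.
Fixpoint pw3 (r : pt -> pt -> pt -> bool) s := if s is x :: s' then pw (r x) s' &&& pw3 r s' else true.

(** Two distinct admissible extra points necessarily form one of the two extremal configurations;
    [tab3] below shows that a third extra point always creates a forbidden pattern. *)
Definition tab2 := pw (fun a b => GT a b ||| bad 6 (conf4 [:: a; b])) good1.

Definition tab3 := pw3 (fun a b e => ~~ GT a b ||| (~~ GT a e ||| (~~ GT b e |||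
  bad 7 (conf4 [:: a; b; e])))) good1.

Lemma tab1T : tab1. Proof. by vm_compute. Qed.
Lemma tab2T : tab2. Proof. by vm_compute. Qed.
Lemma tab3T : tab3. Proof. by vm_compute. Qed.

Definition nobad (s : seq pt) := ~ bad (4 + size s) (conf4 s).

Lemma peqE a b : peq a b -> a = b.
Proof. by case: a b => [[[] []] []] [[[] []] []]. Qed.

Lemma all_has (f : pt -> bool) s a : all f s -> has (peq a) s -> f a.
Proof. by elim: s => //= x s IH /andP[fx fs] /orP[/peqE -> //|]; apply: IH. Qed.

Lemma pwP r s a b : pw r s -> has (peq a) s -> has (peq b) s -> a <> b -> r a b \/ r b a.
Proof.
elim: s => //= x s IH; case: ifP => // hx hp.
case/orP=> [/peqE ->|ha]; case/orP=> [/peqE ->|hb] ab //.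
- by left; apply: all_has hx hb.
- by right; apply: all_has hx ha.
by apply: IH.
Qed.

Lemma in_pts a : has (peq a) pts.
Proof. by case: a => [[[] []] []]. Qed.

Lemma class1 a : (1 < wt (supp a))%N -> nobad [:: a] -> has (peq a) good1.
Proof.
move=> h nb; have := all_has tab1T (in_pts a); rewrite leqNgt h /=.
by case: ifP => // _ hb; case: nb.
Qed.

Lemma class2 a b : (1 < wt (supp a))%N -> (1 < wt (supp b))%N -> a <> b -> nobad [:: a] -> nobad [:: b] ->
  nobad [:: a; b] -> nobad [:: b; a] -> GT a b \/ GT b a.
Proof.
move=> wa wb ab na nb nab nba.
have [] := pwP tab2T (class1 wa na) (class1 wb nb) ab; case: ifP => // h; by [left|right].
Qed.

Lemma pw3P r s a b e : pw3 r s -> has (peq a) s -> has (peq b) s -> has (peq e) s -> a <> b -> a <> e -> b <> e ->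
  [\/ r a b e, r a e b | r b a e] \/ [\/ r b e a, r e a b | r e b a].
Proof.
elim: s => //= x s IH; case: ifP => // hx hp.
case/orP=> [/peqE ->|ha]; case/orP=> [/peqE ->|hb] //; case/orP=> [/peqE ->|he] ab ae be //.
- by have [h|h] := pwP hx hb he be; left; [constructor 1|constructor 2].
- have [h|h] := pwP hx ha he ae; [left; constructor 3|right; constructor 1]; done.
- have [h|h] := pwP hx ha hb ab; right; [constructor 2|constructor 3]; done.
exact: IH.
Qed.

Definition tab4 := all (fun a => all (fun b => ~~ GT a b ||| GT b a) good1) good1.
Lemma tab4T : tab4. Proof. by vm_compute. Qed.

Lemma GT_sym a b : has (peq a) good1 -> has (peq b) good1 -> GT a b -> GT b a.
Proof. by move=> ha hb; have := all_has (all_has tab4T ha) hb; case: (GT a b). Qed.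

Lemma good1_wt a : has (peq a) good1 -> (wt (supp a) <= 3)%N.
Proof. by apply: all_has (_ : all (fun a => wt (supp a) <= 3)%N good1); vm_compute. Qed.

Lemma good1_ones a : has (peq a) good1 -> ~~ (qeq a.1.1 Q1 && qeq a.1.2 Q1).
Proof. by apply: all_has (_ : all (fun a => ~~ (qeq a.1.1 Q1 && qeq a.1.2 Q1)) good1); vm_compute. Qed.

(** * Point sets whose differences are rational *)

Lemma functionalB (F : fieldType) (V : vectType F) (f : V -> F) x y : functional f -> f (x - y) = f x - f y.
Proof. by move=> hf; rewrite functionalD // -scaleN1r functionalZ // mulN1r. Qed.

Section FreeDet.
Variables (K : fieldType) (V : vectType K) (d1 d2 d3 : V).
Hypothesis fr : free [:: d1; d2; d3].

Definition comb3 (u : vec3 K) : V := let: (a, b, c) := u in a *: d1 + b *: d2 + c *: d3.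

Definition mx3 (u v w : vec3 K) : 'M[K]_3 := \matrix_(i, j)
  let: (a, b, c) := nth u [:: u; v; w] i in nth 0 [:: a; b; c] j.

Lemma det_mx3 u v w : \det (mx3 u v w) = det3 u v w.
Proof.
case: u v w => [[a b] c] [[d e] f] [[g h] i]; rewrite (expand_det_row _ ord0) !big_ord_recl big_ord0 /cofactor.
rewrite !(expand_det_row _ ord0) !big_ord_recl !big_ord0 /cofactor !det_mx11 !mxE /= /det3; ring.
Qed.

Lemma free_comb3 u v w : free [:: comb3 u; comb3 v; comb3 w] = (det3 u v w != 0).
Proof.
rewrite -det_mx3; apply/idP/idP => [fc|].
  apply/negP => /det0P[x x0 hx]; case/negP: x0; apply/eqP.
  have [] := @free3P _ _ _ _ _ (x 0 ord0) (x 0 (lift ord0 ord0)) (x 0 (lift ord0 (lift ord0 ord0))) fc.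
    have col j := congr1 (fun m : 'rV_3 => m 0 j) hx.
    have := col ord0; have := col (lift ord0 ord0); have := col (lift ord0 (lift ord0 ord0)).
    rewrite !mxE !big_ord_recl !big_ord0 !mxE /= !addr0.
    move: (x 0 ord0) (x 0 (lift ord0 ord0)) (x 0 (lift ord0 (lift ord0 ord0))) => x1 x2 x3.
    case: u v w {fc hx col} => [[a b] c] [[d e] f] [[g h] i] /= h3 h2 h1.
    transitivity ((x1 * a + (x2 * d + x3 * g)) *: d1 + (x1 * b + (x2 * e + x3 * h)) *: d2 + (x1 * c + (x2 * f + x3 * i)) *: d3).
      rewrite !scalerDr !scalerDl !scalerA !addrA.
      by rewrite (AC (9%AC) ((1*4*7*2*5*8*3*6*9)%AC)).
    by rewrite h1 h2 h3 !scale0r !addr0.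
  move=> h1 h2 h3; apply/rowP => j; rewrite mxE.
  by case: j => -[|[|[|//]]] hj; [rewrite -[RHS]h1|rewrite -[RHS]h2|rewrite -[RHS]h3]; congr (x 0 _); apply: val_inj.
case: u v w => [[a b] c] [[d e] f] [[g h] i] dn.
apply/(@freeP _ _ _ (in_tuple [:: comb3 (a, b, c); comb3 (d, e, f); comb3 (g, h, i)])) => k.
rewrite !big_ord_recl big_ord0 /= addr0 => hk.
pose x : 'rV[K]_3 := \row_i k i.
case: (eqVneq x 0) => [/rowP x0 i'|x0]; first by have := x0 i'; rewrite !mxE.
case/negP: dn; apply/det0P; exists x => //; apply/rowP => j.
have : (k ord0 * a + (k (lift ord0 ord0) * d + k (lift ord0 (lift ord0 ord0)) * g)) *: d1
  + (k ord0 * b + (k (lift ord0 ord0) * e + k (lift ord0 (lift ord0 ord0)) * h)) *: d2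
  + (k ord0 * c + (k (lift ord0 ord0) * f + k (lift ord0 (lift ord0 ord0)) * i)) *: d3 = 0.
  rewrite -hk; move: (k ord0) (k (lift ord0 ord0)) (k (lift ord0 (lift ord0 ord0))) => x1 x2 x3.
  rewrite !scalerDr !scalerDl !scalerA !addrA.
  by rewrite (AC (9%AC) ((1*4*7*2*5*8*3*6*9)%AC)).
case/(free3P fr) => h1 h2 h3; rewrite !mxE !big_ord_recl big_ord0 !mxE /= addr0.
by case: j => -[|[|[|//]]] hj /=.
Qed.

Lemma comb3B u v : comb3 (vsub3 u v) = comb3 u - comb3 v.
Proof.
case: u v => [[a b] c] [[d e] f] /=; rewrite !scalerBl !opprD.
by rewrite (AC (2*2*2) ((1*3*5)*(2*4*6))).
Qed.

End FreeDet.

Section Codes.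
Variables (F : finFieldType) (hF : #|F| = 4%N) (al : F) (hal : al ^+ 2 = al + 1).

Definition q2F (x : q4) : F := match x with Q0 => 0 | Q1 => 1 | Qa => al | Qb => al ^+ 2 end.
Definition enc (x : F) : q4 := if x == 0 then Q0 else if x == 1 then Q1 else if x == al then Qa else Qb.

Lemma encK x : q2F (enc x) = x.
Proof.
rewrite /enc; case: (f4_case hF hal x) => ->; rewrite ?eqxx ?oner_eq0 //.
- by rewrite (negPf (f4_a0 hal)) (negPf (f4_a1 hF hal)).
by rewrite (negPf (f4_b0 hal)) (negPf (f4_b1 hal)) eq_sym (f4_ab hal).
Qed.

Lemma q2F_add x y : q2F (qadd x y) = q2F x + q2F y.
Proof. by case: x y => -[] /=; rewrite ?add0r ?addr0 ?(f4E hF hal). Qed.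

Lemma q2F_mul x y : q2F (qmul x y) = q2F x * q2F y.
Proof. by case: x y => -[] /=; rewrite ?mul0r ?mulr0 ?mul1r ?mulr1 ?(f4E hF hal). Qed.

Lemma qzE x : qz x = (q2F x == 0).
Proof. by case: x => /=; rewrite ?eqxx ?oner_eq0 ?(negPf (f4_a0 hal)) ?(negPf (f4_b0 hal)). Qed.

Definition vecF (p : pt) : vec3 F := let: (a, b, c) := p in (q2F a, q2F b, q2F c).

Lemma vecF_sub u v : vecF (psub u v) = vsub3 (vecF u) (vecF v).
Proof. by case: u v => [[a b] c] [[d e] f] /=; rewrite !q2F_add !(f4_opp hF hal). Qed.

Lemma vecF_det u v w : q2F (qdet u v w) = det3 (vecF u) (vecF v) (vecF w).
Proof.
case: u v w => [[a b] c] [[d e] f] [[g h] i]; rewrite /= !(q2F_add, q2F_mul) !(f4_opp hF hal).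
by rewrite !addrA.
Qed.

End Codes.

(** * Reduction of affine configurations to four base points *)

Section Merge.
Variables (F : finFieldType) (hF : #|F| = 4%N) (al : F) (hal : al ^+ 2 = al + 1).
Variables (X : vectType F) (W : vectType rat) (P : eqType) (phi : P -> X) (psi : P -> W).
Hypothesis tw : twin (fun pq : P * P => phi pq.1 - phi pq.2) (fun pq : P * P => psi pq.1 - psi pq.2).
Variables (I : finType) (bs : I -> P).
(** Affine independence of the base points: arbitrary values, up to a common constant, are realised
    by a functional on differences. *)
Hypothesis aff : forall h : I -> F,
  exists2 g : X -> F, functional g & forall i j, g (phi (bs i) - phi (bs j)) = h i - h j.
Variable cf : P -> I -> F.

Definition coefs (p : P) := \sum_i cf p i = 1 /\ phi p = \sum_i cf p i *: phi (bs i).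

(** Identifying the base points of each class of [m] contracts their differences; barycentric
    coordinates add up over a class. *)
Definition blk (m : I -> 'I_4) (p : P) (k : 'I_4) : F := \sum_(i | m i == k) cf p i.

Definition o1 : 'I_4 := Ordinal (isT : (1 < 4)%N).
Definition o2 : 'I_4 := Ordinal (isT : (2 < 4)%N).
Definition o3 : 'I_4 := Ordinal (isT : (3 < 4)%N).

Definition code m p : pt := (enc al (blk m p o1), enc al (blk m p o2), enc al (blk m p o3)).

Lemma sum4 (V : zmodType) (f : 'I_4 -> V) : \sum_k f k = f ord0 + f o1 + f o2 + f o3.
Proof.
rewrite !big_ord_recl big_ord0 addr0 !addrA; congr (_ + f _ + f _ + f _); exact: val_inj.
Qed.

Lemma blk_sum m p : \sum_k blk m p k = \sum_i cf p i.
Proof. by rewrite [RHS](partition_big m predT) //=; apply: eq_bigr. Qed.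

(** Contracting corresponding differences on both sides preserves twins, so the merged configuration
    on four base points again has a rational counterpart and cannot be [bad]. *)
Lemma merge_nobad (m : I -> 'I_4) (s : seq P) : (forall k, exists i, m i = k) ->
  (forall p, p \in s -> coefs p) -> nobad [seq code m p | p <- s].
Proof.
move=> msur hs; have [t mt] := fin_all_exists msur.
pose vf (pq : P * P) := phi pq.1 - phi pq.2; pose vp (pq : P * P) := psi pq.1 - psi pq.2.
pose c0 := [seq (bs i, bs (t (m i))) | i <- enum I].
pose f := kil <<map vf c0>>; pose g := kil <<map vp c0>>.
pose phi' p := f (phi p); pose psi' p := g (psi p).
have tw' : twin (fun pq : P * P => phi' pq.1 - phi' pq.2) (fun pq : P * P => psi' pq.1 - psi' pq.2).
  apply: eq_twin (twin_contract_kil tw (lker_kil <<map vf c0>>%VS)) => pq; by rewrite /= linearB.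
have mrg i : phi' (bs i) = phi' (bs (t (m i))).
  apply/eqP; rewrite -subr_eq0 -linearB kil_eq0.
  apply: memv_span; apply/mapP; exists (bs i, bs (t (m i))) => //.
  by apply: map_f; rewrite mem_enum.
pose b k := bs (t k).
have hg k : exists2 h : X -> F, functional h & forall l l' : 'I_4, h (phi' (b l) - phi' (b l')) = (l == k)%:R - (l' == k)%:R.
  have [h hh hE] := aff (fun i => (m i == k)%:R); exists h => // l l'.
  rewrite -linearB functional_kil // => [|u]; first by rewrite hE !mt.
  by apply: functional_span => // _ /mapP[_ /mapP[i _ ->] ->]; rewrite /vf hE mt subrr.
have [h1 f1 e1] := hg o1; have [h2 f2 e2] := hg o2; have [h3 f3 e3] := hg o3.
have frF : free [:: phi' (b o1) - phi' (b ord0); phi' (b o2) - phi' (b ord0); phi' (b o3) - phi' (b ord0)].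
  by apply: (free3_tri f1 f2 f3); rewrite ?e1 ?e2 ?e3 /= ?subr0 ?oner_eq0.
have frQ : free [:: psi' (b o1) - psi' (b ord0); psi' (b o2) - psi' (b ord0); psi' (b o3) - psi' (b ord0)].
  by have := twin_free [:: (b o1, b ord0); (b o2, b ord0); (b o3, b ord0)] tw' => /= <-.
pose N n := nth (b ord0) ([:: b ord0; b o1; b o2; b o3] ++ s) n.
pose cd := conf4 [seq code m p | p <- s].
have vE p : coefs p -> phi' p - phi' (b ord0) = comb3 (phi' (b o1) - phi' (b ord0))
    (phi' (b o2) - phi' (b ord0)) (phi' (b o3) - phi' (b ord0)) (vecF al (code m p)).
  case=> s1 hp; rewrite /= !(encK hF hal).
  have -> : phi' p = \sum_k blk m p k *: phi' (b k).
    rewrite /phi' hp linear_sum (partition_big m predT) //=; apply: eq_bigr => k _.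
    rewrite /blk scaler_suml; apply: eq_bigr => i /eqP <-; rewrite linearZ /=; congr (_ *: _).
    exact: mrg.
  rewrite -[phi' (b ord0) in LHS]scale1r -s1 -(blk_sum m) scaler_suml -sumrB sum4 /= -!scalerBr subrr scaler0 add0r.
  by [].
have cN n : phi' (N n) - phi' (b ord0) = comb3 (phi' (b o1) - phi' (b ord0))
    (phi' (b o2) - phi' (b ord0)) (phi' (b o3) - phi' (b ord0)) (vecF al (cd n)).
  have z0 : 0 = comb3 (phi' (b o1) - phi' (b ord0)) (phi' (b o2) - phi' (b ord0)) (phi' (b o3) - phi' (b ord0)) (vecF al (Q0, Q0, Q0)).
    by rewrite /= !scale0r !addr0.
  rewrite /N /cd /conf4; case: n => [|[|[|[|n]]]] /=; rewrite ?subrr ?scale0r ?scale1r ?add0r ?addr0 //.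
  case: (ltnP n (size s)) => ns.
    by rewrite (nth_map (b ord0)) //; apply/vE/hs/mem_nth.
  by rewrite !nth_default ?size_map //= subrr !scale0r !addr0.
pose D := [tuple psi' (b o1) - psi' (b ord0); psi' (b o2) - psi' (b ord0); psi' (b o3) - psi' (b ord0)].
pose x n : vec3 rat := let v := psi' (N n) - psi' (b ord0) in
  (coord D ord0 v, coord D (lift ord0 ord0) v, coord D (lift ord0 (lift ord0 ord0)) v).
have xN n : psi' (N n) - psi' (b ord0) = comb3 (psi' (b o1) - psi' (b ord0))
    (psi' (b o2) - psi' (b ord0)) (psi' (b o3) - psi' (b ord0)) (x n).
  have : psi' (N n) - psi' (b ord0) \in <<D>>%VS.
    have := tw' (N n, b ord0) [:: (b o1, b ord0); (b o2, b ord0); (b o3, b ord0)]; rewrite /= => <-.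
    rewrite cN; case: (vecF al (cd n)) => [[a1 a2] a3] /=.
    by rewrite !memvD ?memvZ ?memv_span ?inE ?eqxx ?orbT.
  by move/coord_span => {1}->; rewrite !big_ord_recl big_ord0 addr0 /= addrA.
apply: (@badP _ _ x) => i j k l n n'.
have dF a a' : phi' (N a) - phi' (N a') = comb3 (phi' (b o1) - phi' (b ord0))
    (phi' (b o2) - phi' (b ord0)) (phi' (b o3) - phi' (b ord0)) (vecF al (psub (cd a) (cd a'))).
  by rewrite (vecF_sub hF hal) comb3B -!cN -sub_subr.
have dQ a a' : psi' (N a) - psi' (N a') = comb3 (psi' (b o1) - psi' (b ord0))
    (psi' (b o2) - psi' (b ord0)) (psi' (b o3) - psi' (b ord0)) (vsub3 (x a) (x a')).
  by rewrite comb3B -!xN -sub_subr.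
have := twin_free [:: (N i, N j); (N k, N l); (N n, N n')] tw'; rewrite /= !dF !dQ !free_comb3 // => /(congr1 negb).
by rewrite !negbK => <-; rewrite (qzE hal) (vecF_det hF hal).
Qed.

Definition S p : {set I} := [set i | cf p i != 0].

Lemma supp_code m p : coefs p ->
  supp (code m p) = [:: blk m p ord0 != 0; blk m p o1 != 0; blk m p o2 != 0; blk m p o3 != 0].
Proof.
case=> s1 _; have sE x y z : supp (x, y, z) = [:: ~~ qz (qadd Q1 (qadd x (qadd y z))); ~~ qz x; ~~ qz y; ~~ qz z] by [].
rewrite /code sE !(qzE hal) !(q2F_add hF hal) !(encK hF hal).
congr (_ :: _); congr (_ != _); rewrite -[q2F al Q1]/(1 : F) -s1 -(blk_sum m) sum4.
rewrite -!addrA [blk m p o1 + (blk m p o2 + _)]addrC.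
move: (blk m p ord0) (blk m p o1) (blk m p o2) (blk m p o3) => z0 z1 z2 z3.
transitivity (z0 + ((z1 + z1) + (z2 + z2) + (z3 + z3))); first by ring.
by rewrite !(f4_add hF hal) !addr0.
Qed.

(** [i] and [j] get classes of their own; [k] goes to class [d3] and every other index to class
    [d0]. Exchanging [d0] and [d3] decides whether the remainder joins the origin. *)
Definition mk3 (d0 d3 : 'I_4) (i j k : I) (x : I) : 'I_4 :=
  if x == i then o1 else if x == j then o2 else if x == k then d3 else d0.

Lemma blk_mk1 d0 d3 i j k p : d0 \in [:: ord0; o3] -> d3 \in [:: ord0; o3] -> blk (mk3 d0 d3 i j k) p o1 = cf p i.
Proof.
move=> h0 h3; rewrite /blk (big_pred1 i) // => x; rewrite /mk3 /=; case: (eqVneq x i) => [_|_] //.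
case: (eqVneq x j) => [_|_] //; case: (eqVneq x k) => [_|_];
  by move: h0 h3; rewrite !inE => /orP[] /eqP h0 /orP[] /eqP h3; rewrite ?h0 ?h3.
Qed.

Lemma blk_mk2 d0 d3 i j k p : i != j -> d0 \in [:: ord0; o3] -> d3 \in [:: ord0; o3] -> blk (mk3 d0 d3 i j k) p o2 = cf p j.
Proof.
move=> ij h0 h3; rewrite /blk (big_pred1 j) // => x; rewrite /mk3 /=.
case: (eqVneq x i) => [->|_] /=; first by rewrite (negPf ij).
case: (eqVneq x j) => [_|_] //; case: (eqVneq x k) => [_|_];
  by move: h0 h3; rewrite !inE => /orP[] /eqP h0 /orP[] /eqP h3; rewrite ?h0 ?h3.
Qed.

Lemma blk_mk3 i j k p : i != k -> j != k -> blk (mk3 ord0 o3 i j k) p o3 = cf p k.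
Proof.
move=> ik jk; rewrite /blk (big_pred1 k) // => x; rewrite /mk3 /=.
case: (eqVneq x i) => [->|_] /=; first by rewrite (negPf ik).
by case: (eqVneq x j) => [->|_] /=; [rewrite (negPf jk)|case: (eqVneq x k)].
Qed.

Lemma mk3_sur d0 d3 i j k l : perm_eq [:: d0; d3] [:: ord0; o3] -> uniq [:: i; j; k; l] -> forall z, exists x, mk3 d0 d3 i j k x = z.
Proof.
move=> /perm_mem hd /=; rewrite !inE !negb_or => /and4P[/and3P[ij ik il] /andP[jk jl] kl _] z.
have e1 : mk3 d0 d3 i j k i = o1 by rewrite /mk3 eqxx.
have e2 : mk3 d0 d3 i j k j = o2 by rewrite /mk3 eq_sym (negPf ij) eqxx.
have e3 : mk3 d0 d3 i j k k = d3 by rewrite /mk3 eq_sym (negPf ik) eq_sym (negPf jk) eqxx.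
have e4 : mk3 d0 d3 i j k l = d0 by rewrite /mk3 eq_sym (negPf il) eq_sym (negPf jl) eq_sym (negPf kl).
have : z \in [:: o1; o2; ord0; o3] by case: z => -[|[|[|[|//]]]] hz; rewrite !inE -!val_eqE.
rewrite inE => /orP[/eqP ->|]; first by exists i.
rewrite inE => /orP[/eqP ->|]; first by exists j.
rewrite -hd !inE => /orP[] /eqP ->; [by exists l|by exists k].
Qed.

(** Suppose four coordinates are nonzero. Merging the remaining indices with any one of the four
    must kill that class, so any three of the four sum to 1. Hence all four equal 1, which a second
    merge excludes. *)
Lemma supp_le3 p : coefs p -> (#|S p| <= 3)%N.
Proof.
move=> hp; rewrite leqNgt; apply/negP => h4.
have nb m : (forall k, exists i, m i = k) -> (1 < wt (supp (code m p)))%N -> has (peq (code m p)) good1.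
  by move=> hm w; apply: class1 => //; apply: (@merge_nobad m [:: p]) => // q; rewrite inE => /eqP ->.
have tri i j k l : uniq [:: i; j; k; l] -> {subset [:: i; j; k; l] <= S p} -> cf p i + cf p j + cf p k = 1.
  move=> u sub; apply/eqP/negPn/negP => n1.
  pose m := mk3 ord0 o3 i j k.
  have : uniq [:: i; j; k; l] by []. rewrite /= !inE !negb_or => /and4P[/and3P[ij ik il] /andP[jk jl] kl _].
  have z1 : blk m p o1 = cf p i by apply: blk_mk1.
  have z2 : blk m p o2 = cf p j by apply: blk_mk2.
  have z3 : blk m p o3 = cf p k by apply: blk_mk3.
  have z0 : blk m p ord0 != 0.
    apply: contra n1 => /eqP z0; have := blk_sum m p; rewrite sum4 z0 add0r z1 z2 z3.
    by case: hp => -> _ ->.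
  have nz x : x \in [:: i; j; k; l] -> cf p x != 0 by move/sub; rewrite inE.
  have sE : supp (code m p) = [:: true; true; true; true].
    by rewrite supp_code // z0 z1 z2 z3 !nz ?inE ?eqxx ?orbT.
  have h := nb m (mk3_sur (perm_refl _) u); rewrite sE in h.
  by have /good1_wt := h isT; rewrite sE.
have [s [su ss sz]] : exists s : seq I, [/\ uniq s, {subset s <= S p} & size s = 4%N].
  exists (take 4 (enum (S p))); split; first by rewrite take_uniq ?enum_uniq.
    by move=> x /mem_take; rewrite mem_enum.
  by rewrite size_takel // -cardE.
case: s su ss sz => [|i [|j [|k [|l [|//]]]]] // u sub _.
have t1 := tri i j k l u sub.
have t2 : cf p i + cf p j + cf p l = 1.
  apply: (tri i j l k); last by move=> x hx; apply: sub; move: hx; rewrite !inE; case: (x == i); case: (x == j); case: (x == k); case: (x == l).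
  by rewrite -(perm_uniq (_ : perm_eq [:: i; j; k; l] _)) // !perm_cons (perm_catC [:: k] [:: l]).
have t3 : cf p i + cf p k + cf p l = 1.
  apply: (tri i k l j); last by move=> x hx; apply: sub; move: hx; rewrite !inE; case: (x == i); case: (x == j); case: (x == k); case: (x == l).
  by rewrite -(perm_uniq (_ : perm_eq [:: i; j; k; l] _)) // perm_cons (perm_catC [:: j] [:: k; l]).
have t4 : cf p j + cf p k + cf p l = 1.
  apply: (tri j k l i); last by move=> x hx; apply: sub; move: hx; rewrite !inE; case: (x == i); case: (x == j); case: (x == k); case: (x == l).
  by rewrite -(perm_uniq (_ : perm_eq [:: i; j; k; l] _)) // (perm_catC [:: i] [:: j; k; l]).
have kl : cf p k = cf p l by apply: (addrI (cf p i + cf p j)); rewrite t1 t2.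
have jk : cf p j = cf p k by apply: (addrI (cf p i)); apply: (addIr (cf p l)); rewrite t2 t3.
have ij : cf p i = cf p j by apply: (addIr (cf p k)); apply: (addIr (cf p l)); rewrite t3 t4.
have c1 : cf p i = 1 by move: t1; rewrite -jk -ij (f4_add hF hal) add0r.
(* [i] and [j] keep coordinate 1 in the first two classes, and [good1_ones] forbids this whatever
   the other classes contain. *)
pose m := mk3 o3 ord0 i j k.
have : uniq [:: i; j; k; l] by []. rewrite /= !inE !negb_or => /and4P[/and3P[ij' _ _] _ _ _].
have z1 : blk m p o1 = 1 by rewrite -c1; apply: blk_mk1.
have z2 : blk m p o2 = 1 by rewrite -c1 ij; apply: blk_mk2.
have h := nb m (mk3_sur (_ : perm_eq [:: o3; ord0] [:: ord0; o3]) u).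
have {h} /good1_ones : has (peq (code m p)) good1.
  apply: h; first by rewrite (perm_catC [:: o3] [:: ord0]).
  rewrite supp_code // z1 z2 oner_eq0 /wt /= !add1n; by case: (_ != _); case: (_ != _).
by rewrite /= z1 z2 /enc oner_eq0 eqxx.
Qed.

Lemma ext4 (A : {set I}) : (#|A| <= 4)%N -> (4 <= #|I|)%N -> exists2 U : {set I}, A \subset U & #|U| = 4%N.
Proof.
move=> hA hI; have [n] := ubnP (4 - #|A|)%N; elim: n A hA => // n IH A hA hn.
case: (ltnP #|A| 4) => h; last by exists A => //; apply/eqP; rewrite eqn_leq hA.
have [x xA] : exists x, x \notin A.
  apply/existsP; rewrite -negb_forall; apply/negP => /forallP hx.
  have : A = [set: I] by apply/setP => x; rewrite inE hx.
  by move=> AT; move: h; rewrite AT cardsT ltnNge hI.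
have [||U sU cU] := IH (x |: A); rewrite ?cardsU1 ?xA //=; first by move: hn h; clear; lia.
by exists U => //; apply: subset_trans sU; apply: subsetUr.
Qed.

Lemma inj4 (U : {set I}) : #|U| = 4%N -> exists2 m : I -> 'I_4, {in U &, injective m} & forall k, exists2 i, i \in U & m i = k.
Proof.
move=> cU; exists (fun x => inord (index x (enum U))).
  have hi x : x \in U -> (index x (enum U) < 4)%N by move=> xU; rewrite -cU cardE index_mem mem_enum.
  move=> x y xU yU /(congr1 val); rewrite /= !inordK ?hi // => /(congr1 (nth x (enum U))).
  by rewrite !nth_index ?mem_enum.
move=> k; have hk : (k < size (enum U))%N by rewrite -cardE cU.
have [i0 iU] : exists i, i \in U by apply/card_gt0P; rewrite cU.
exists (nth i0 (enum U) k); first by rewrite -mem_enum mem_nth.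
by apply: val_inj; rewrite /= index_uniq ?enum_uniq // inordK.
Qed.

(* Repeatedly identify an index of [A :\: B] with one of [B :\: A]. *)
Lemma inj_pair (A B : {set I}) : (#|A| <= 3)%N -> (#|B| <= 3)%N -> (4 <= #|A :|: B|)%N ->
  exists m : I -> 'I_4, [/\ {in A &, injective m}, {in B &, injective m} & forall k, exists2 i, i \in A :|: B & m i = k].
Proof.
have [n] := ubnP #|A :|: B|; elim: n A B => // n IH A B hn hA hB h4.
case: (leqP #|A :|: B| 4) => h5.
  have [|m mi ms] := @inj4 (A :|: B); first by apply/eqP; rewrite eqn_leq h5.
  by exists m; split=> // x y xA yA; apply: mi; rewrite inE ?xA ?yA ?orbT.
have [i iA iB] : exists2 i, i \in A & i \notin B.
  case: (boolP [exists i in A, i \notin B]) => [/exists_inP//|]; rewrite negb_exists_in => /forall_inP h.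
  have : (#|A :|: B| <= #|B|)%N.
    by apply: subset_leq_card; rewrite subUset subxx andbT; apply/subsetP => x /h; rewrite negbK.
  by move: h5 hB; clear; lia.
have [j jB jA] : exists2 j, j \in B & j \notin A.
  case: (boolP [exists j in B, j \notin A]) => [/exists_inP//|]; rewrite negb_exists_in => /forall_inP h.
  have : (#|A :|: B| <= #|A|)%N.
    by apply: subset_leq_card; rewrite subUset subxx /=; apply/subsetP => x /h; rewrite negbK.
  by move: h5 hA; clear; lia.
have ij : i != j by apply: contraNneq iB => ->.
pose B' := i |: B :\ j.
have cB : #|B'| = #|B| by rewrite cardsU1 !inE (negPf iB) andbF /= [in RHS](cardsD1 j) jB.
have UE : A :|: B' = (A :|: B) :\ j.
  apply/setP => x; rewrite !inE; case: (eqVneq x j) => [->|xj] /=; first by rewrite (negPf jA) eq_sym (negPf ij).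
  by case: (eqVneq x i) => [->|_] //=; rewrite iA.
have cU : (#|A :|: B'| < #|A :|: B|)%N by rewrite UE [in ltnRHS](cardsD1 j) inE jB orbT.
have cU' : (#|A :|: B'|.+1 = #|A :|: B|)%N by rewrite UE [in RHS](cardsD1 j) inE jB orbT.
have [||||m [mA mB ms]] := IH A B'; rewrite ?cB //; first by move: hn cU; clear; lia.
  by move: cU' h5; clear; lia.
exists (fun x => if x == j then m i else m x); split.
- move=> x y xA yA; case: (eqVneq x j) => [xj|_]; first by rewrite -xj xA in jA.
  by case: (eqVneq y j) => [yj|_]; [rewrite -yj yA in jA|apply: mA].
- have iB' : i \in B' by rewrite !inE eqxx.
  move=> x y xB yB; case: (eqVneq x j) => [->|xj]; case: (eqVneq y j) => [->|yj] // h.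
  + have yB' : y \in B' by rewrite !inE yj yB orbT.
    by have := mB _ _ iB' yB' h => iy; rewrite iy yB in iB.
  + have xB' : x \in B' by rewrite !inE xj xB orbT.
    by have := mB _ _ xB' iB' h => ix; rewrite -ix xB in iB.
  by apply: mB; rewrite ?inE ?xj ?yj ?xB ?yB ?orbT.
move=> k; have [x xU <-] := ms k; exists x; first by move: xU; rewrite UE inE => /andP[].
by move: xU; rewrite UE !inE => /andP[/negPf ->].
Qed.

Lemma blk_inj m p k : {in S p &, injective m} -> (blk m p k != 0) = (k \in m @: S p).
Proof.
move=> mi; apply/idP/imsetP => [h|[i iS ->]].
  case: (boolP [exists x in S p, k == m x]) => [/exists_inP[x xS /eqP ->]|]; first by exists x.
  rewrite negb_exists_in => /forall_inP h'; case/eqP: h.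
  rewrite /blk big1 // => i /eqP mik; apply/eqP/negPn/negP => ci.
  by have := h' i; rewrite inE ci mik eqxx => /(_ isT).
rewrite /blk (bigD1 i) //= big1 ?addr0 => [|x /andP[/eqP mx xi]]; first by move: iS; rewrite inE.
apply/eqP/negPn/negP => cx; case/eqP: xi; apply: mi => //; by rewrite inE.
Qed.

Lemma blk_val m p i : {in S p &, injective m} -> i \in S p -> blk m p (m i) = cf p i.
Proof.
move=> mi iS; rewrite /blk (bigD1 i) //= big1 ?addr0 // => x /andP[/eqP mx xi].
apply/eqP/negPn/negP => cx; case/eqP: xi; apply: mi => //; by rewrite inE.
Qed.

Lemma wt_card (f : 'I_4 -> bool) : wt [:: f ord0; f o1; f o2; f o3] = #|[set k | f k]|.
Proof.
rewrite -sum1dep_card big_mkcond /= !big_ord_recl big_ord0 /wt /= !addn0.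
have e1 : lift ord0 ord0 = o1 by apply: val_inj.
have e2 : lift ord0 (lift ord0 ord0) = o2 by apply: val_inj.
have e3 : lift ord0 (lift ord0 (lift ord0 ord0)) = o3 by apply: val_inj.
by rewrite e3 e2 e1; case: (f ord0); case: (f o1); case: (f o2); case: (f o3).
Qed.

Lemma wt_code m p : coefs p -> {in S p &, injective m} -> wt (supp (code m p)) = #|S p|.
Proof.
move=> hp mi; rewrite supp_code // (wt_card (fun k => blk m p k != 0)) -(card_in_imset mi).
by apply: eq_card => k; rewrite inE blk_inj.
Qed.

Lemma wt_code2 m p q : coefs p -> coefs q -> {in S p &, injective m} -> {in S q &, injective m} ->
  wt (orb2 (supp (code m p)) (supp (code m q))) = #|m @: (S p :|: S q)|.
Proof.
move=> hp hq mp mq; transitivity #|[set k | (blk m p k != 0) || (blk m q k != 0)]|.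
  by rewrite !supp_code // -wt_card.
by apply: eq_card => k; rewrite inE !blk_inj // imsetU inE.
Qed.

Hypothesis hI : (4 <= #|I|)%N.

Lemma merge2 m p q : (forall k, exists i, m i = k) -> coefs p -> coefs q -> code m p <> code m q ->
  (1 < wt (supp (code m p)))%N -> (1 < wt (supp (code m q)))%N -> GT (code m p) (code m q).
Proof.
move=> ms hp hq ne wp wq.
have nb (s : seq P) : {subset s <= [:: p; q]} -> nobad [seq code m p | p <- s].
  by move=> hs; apply: merge_nobad => // x /hs; rewrite !inE => /orP[] /eqP ->.
have np : nobad [:: code m p] by apply: (nb [:: p]) => x; rewrite !inE => ->.
have nq : nobad [:: code m q] by apply: (nb [:: q]) => x; rewrite !inE => ->; rewrite orbT.
have npq : nobad [:: code m p; code m q] by apply: (nb [:: p; q]).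
have nqp : nobad [:: code m q; code m p] by apply: (nb [:: q; p]) => x; rewrite !inE orbC.
have [//|h] := class2 wp wq ne np nq npq nqp.
by apply: GT_sym h; apply: class1.
Qed.

(** If the union had four elements, [inj_pair] would merge it onto all four classes while keeping
    each support injective; but two compatible points span at most three classes. *)
Lemma pair_supp p q : coefs p -> coefs q -> (1 < #|S p|)%N -> (1 < #|S q|)%N -> (#|S p :|: S q| <= 3)%N.
Proof.
move=> hp hq cp cq; rewrite leqNgt; apply/negP => h4.
have [m [mp mq ms]] := inj_pair (supp_le3 hp) (supp_le3 hq) h4.
have mT : m @: (S p :|: S q) = [set: 'I_4].
  by apply/setP => k; rewrite inE; have [i iU <-] := ms k; apply: imset_f.
have w4 : wt (orb2 (supp (code m p)) (supp (code m q))) = 4%N by rewrite wt_code2 // mT cardsT card_ord.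
have : GT (code m p) (code m q).
  apply: merge2; rewrite ?wt_code //; first by move=> k; have [i _ <-] := ms k; exists i.
  move=> e; move: w4; rewrite e wt_code2 // setUid (card_in_imset mq) => h.
  by have := supp_le3 hq; rewrite h.
by rewrite /GT w4.
Qed.

Lemma S_ext p q : coefs p -> coefs q -> S p = S q -> {in S p, cf p =1 cf q} -> phi p = phi q.
Proof.
case=> _ -> [_ ->] SE h; apply: eq_bigr => i _; case: (boolP (i \in S p)) => iS; first by rewrite h.
by move: (iS); rewrite {2}SE in iS *; move: iS; rewrite !inE !negbK => /eqP -> /eqP ->.
Qed.

Lemma code_inj m p q : coefs p -> coefs q -> {in S p :|: S q &, injective m} -> code m p = code m q -> phi p = phi q.
Proof.
move=> hp hq mi E.
have mp : {in S p &, injective m} by move=> x y xS yS; apply: mi; rewrite inE ?xS ?yS.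
have mq : {in S q &, injective m} by move=> x y xS yS; apply: mi; rewrite inE ?xS ?yS orbT.
have z k : blk m p k = blk m q k.
  case: (E) => /(congr1 (q2F al)) + /(congr1 (q2F al)) + /(congr1 (q2F al)); rewrite !(encK hF hal) => e1 e2 e3.
  have : \sum_k blk m p k = \sum_k blk m q k by rewrite !blk_sum; case: hp => -> _; case: hq => ->.
  rewrite !sum4 e1 e2 e3 => /addIr/addIr/addIr e0.
  by case: k => -[|[|[|[|//]]]] hk; [rewrite (_ : Ordinal hk = ord0)|rewrite (_ : Ordinal hk = o1)|rewrite (_ : Ordinal hk = o2)|rewrite (_ : Ordinal hk = o3)] => //; apply: val_inj.
have cE i : i \in S p :|: S q -> cf p i = cf q i.
  move=> iU; have := z (m i).
  have cz r : coefs r -> r \in [:: p; q] -> blk m r (m i) = cf r i.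
    move=> hr rpq; have mr : {in S r &, injective m} by move: rpq; rewrite !inE => /orP[] /eqP ->.
    case: (boolP (i \in S r)) => iS; first exact: blk_val.
    have : blk m r (m i) == 0.
      apply/negPn; rewrite blk_inj //; apply/imsetP => -[j jS] /mi ij; case/negP: iS.
      have jU : j \in S p :|: S q by move: rpq jS; rewrite !inE => /orP[] /eqP -> ->; rewrite ?orbT.
      by rewrite (ij iU jU).
    by move: iS; rewrite inE negbK => /eqP -> /eqP.
  by rewrite !cz ?inE ?eqxx ?orbT.
have SE : S p = S q.
  apply/setP => i; case: (boolP (i \in S p :|: S q)) => iU; first by rewrite !inE cE.
  by move: iU; rewrite inE negb_or => /andP[/negPf -> /negPf ->].
by apply: S_ext => // i iS; apply: cE; rewrite inE iS.
Qed.

(** By [pair_supp] the three supports together have at most 3 + 3 - 2 = 4 elements, so a single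
    merge that is injective on them reduces to [tab3]. *)
Lemma no_triple p q e : coefs p -> coefs q -> coefs e -> (1 < #|S p|)%N -> (1 < #|S q|)%N -> (1 < #|S e|)%N ->
  phi p <> phi q -> phi p <> phi e -> phi q <> phi e -> False.
Proof.
move=> hp hq he cp cq ce pq pe qe.
have c3 : (#|S p :|: S q :|: S e| <= 4)%N.
  have h1 := pair_supp hp hq cp cq; have h2 := pair_supp hp he cp ce.
  have := cardsUI (S p :|: S q) (S e); have := cardsUI (S p) (S e).
  have : (#|S p :&: S e| <= #|(S p :|: S q) :&: S e|)%N.
    by apply: subset_leq_card; apply: setSI; apply: subsetUl.
  move: h1 h2 cp; clear; lia.
have [U sU cU] := ext4 c3 hI; have [m mi ms] := inj4 cU.
have ms' k : exists i, m i = k by have [i _ <-] := ms k; exists i.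
have sub r : r \in [:: p; q; e] -> S r \subset U.
  move=> rr; apply: subset_trans sU; move: rr; rewrite !inE => /or3P[] /eqP ->.
  - by rewrite -setUA subsetUl.
  - by rewrite setUAC subsetUr.
  exact: subsetUr.
have minj r r' : r \in [:: p; q; e] -> r' \in [:: p; q; e] -> {in S r :|: S r' &, injective m}.
  move=> hr hr' x y xS yS; apply: mi; [move: xS|move: yS]; apply: subsetP; by rewrite subUset !sub.
have mS r : r \in [:: p; q; e] -> {in S r &, injective m}.
  by move=> hr x y xS yS; apply: (minj r r hr hr); rewrite inE ?xS ?yS.
have pi : p \in [:: p; q; e] by rewrite !inE eqxx.
have qi : q \in [:: p; q; e] by rewrite !inE eqxx orbT.
have ei : e \in [:: p; q; e] by rewrite !inE eqxx !orbT.
have cn r : r \in [:: p; q; e] -> coefs r by rewrite !inE => /or3P[] /eqP ->.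
have w1 r : r \in [:: p; q; e] -> (1 < wt (supp (code m r)))%N.
  move=> hr; rewrite wt_code; [|exact: cn|exact: mS].
  by move: hr; rewrite !inE => /or3P[] /eqP ->.
have g1 r : r \in [:: p; q; e] -> has (peq (code m r)) good1.
  move=> hr; apply: class1; first exact: w1.
  by apply: (@merge_nobad m [:: r]) => // x; rewrite inE => /eqP ->; apply: cn.
have gt r r' : r \in [:: p; q; e] -> r' \in [:: p; q; e] -> phi r <> phi r' -> GT (code m r) (code m r').
  move=> hr hr' ne; apply: (merge2 ms' (cn r hr) (cn r' hr') _ (w1 r hr) (w1 r' hr')) => E; apply: ne.
  by apply: (code_inj (cn r hr) (cn r' hr') (minj r r' hr hr') E).
have ne r r' : r \in [:: p; q; e] -> r' \in [:: p; q; e] -> phi r <> phi r' -> code m r <> code m r'.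
  by move=> hr hr' n E; apply: n; apply: (code_inj (cn r hr) (cn r' hr') (minj r r' hr hr') E).
have nb a b c : a \in [:: p; q; e] -> b \in [:: p; q; e] -> c \in [:: p; q; e] ->
    ~ bad 7 (conf4 [:: code m a; code m b; code m c]).
  move=> ha hb hc; apply: (@merge_nobad m [:: a; b; c]) => // x; rewrite !inE => /or3P[] /eqP ->; exact: cn.
have fin a b c : a \in [:: p; q; e] -> b \in [:: p; q; e] -> c \in [:: p; q; e] -> phi a <> phi b -> phi a <> phi c -> phi b <> phi c ->
    (~~ GT (code m a) (code m b) ||| (~~ GT (code m a) (code m c) ||| (~~ GT (code m b) (code m c) |||
      bad 7 (conf4 [:: code m a; code m b; code m c])))) -> False.
  by move=> ha hb hc n1 n2 n3; rewrite !gt //= => h; apply: (nb a b c).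
have sy (x y : X) : x <> y -> y <> x by move=> n E; apply: n.
have [[]|[]] := pw3P tab3T (g1 p pi) (g1 q qi) (g1 e ei) (ne _ _ pi qi pq) (ne _ _ pi ei pe) (ne _ _ qi ei qe);
  apply: fin => //; exact: sy.
Qed.

Definition T2rel o t s s' := [/\ phi t <> phi o, phi s - phi o = al *: (phi t - phi o) &
  phi s' - phi o = al ^+ 2 *: (phi t - phi o)].

Definition Grel o t s t' s' := [/\ phi t <> phi o, phi s - phi o = al *: (phi t - phi o),
  phi s' - phi o = al *: (phi t' - phi o) & forall k, phi t' - phi o <> k *: (phi t - phi o)].

Lemma pair_struct p q : coefs p -> coefs q -> (1 < #|S p|)%N -> (1 < #|S q|)%N -> phi p <> phi q ->
  exists2 L : seq P, {subset L <= [:: p; q] ++ map bs (enum I)} &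
  (exists o t s s', [/\ {subset [:: o; t; s; s'] <= L} & T2rel o t s s']) \/
  (exists o t s t' s', [/\ {subset [:: o; t; s; t'; s'] <= L} & Grel o t s t' s']).
Proof.
move=> hp hq cp cq pq.
have [U sU cU] := ext4 (leq_trans (pair_supp hp hq cp cq) (isT : 3 <= 4)%N) hI.
have [m mi ms] := inj4 cU; have [tt tU mt] := fin_all_exists2 ms.
have tm i : i \in U -> tt (m i) = i by move=> iU; apply: mi; rewrite ?tU ?mt.
have sp : {subset S p <= U} by apply/subsetP; apply: subset_trans sU; apply: subsetUl.
have sq : {subset S q <= U} by apply/subsetP; apply: subset_trans sU; apply: subsetUr.
have m2 : {in S p :|: S q &, injective m} by move=> x y xS yS; apply: mi; apply: (subsetP sU).
have mp : {in S p &, injective m} by move=> x y xS yS; apply: mi; apply: sp.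
have mq : {in S q &, injective m} by move=> x y xS yS; apply: mi; apply: sq.
have ms' k : exists i, m i = k by exists (tt k).
have gt : GT (code m p) (code m q).
  apply: merge2; rewrite ?wt_code // => E; apply: pq; exact: (code_inj hp hq m2 E).
pose b k := bs (tt k).
have hg k : exists2 h : X -> F, functional h & forall l l' : 'I_4, h (phi (b l) - phi (b l')) = (l == k)%:R - (l' == k)%:R.
  by have [h hh hE] := aff (fun i => (m i == k)%:R); exists h => // l l'; rewrite hE !mt.
have [h1 f1 e1] := hg o1; have [h2 f2 e2] := hg o2; have [h3 f3 e3] := hg o3.
pose d1 := phi (b o1) - phi (b ord0); pose d2 := phi (b o2) - phi (b ord0); pose d3 := phi (b o3) - phi (b ord0).
have fr : free [:: d1; d2; d3].
  by apply: (free3_tri f1 f2 f3); rewrite ?e1 ?e2 ?e3 /= ?subr0 ?oner_eq0.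
pose c := conf4 [:: code m p; code m q]; pose L := [:: b ord0; b o1; b o2; b o3; p; q].
pose N n := nth (b ord0) L n.
have vE r : coefs r -> {subset S r <= U} -> phi r - phi (b ord0) = comb3 d1 d2 d3 (vecF al (code m r)).
  case=> s1 hr sr; rewrite /= !(encK hF hal).
  have -> : phi r = \sum_k blk m r k *: phi (b k).
    rewrite hr (partition_big m predT) //=; apply: eq_bigr => k _.
    rewrite /blk scaler_suml; apply: eq_bigr => i /eqP <-.
    case: (boolP (i \in S r)) => iS; first by rewrite /b tm ?sr.
    by move: iS; rewrite inE negbK => /eqP ->; rewrite !scale0r.
  by rewrite -[phi (b ord0) in LHS]scale1r -s1 -(blk_sum m) scaler_suml -sumrB sum4 /= -!scalerBr subrr scaler0 add0r.
have cN n : phi (N n) - phi (b ord0) = comb3 d1 d2 d3 (vecF al (c n)).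
  rewrite /N /c /conf4; case: n => [|[|[|[|[|[|n]]]]]]; rewrite /= ?subrr ?scale0r ?scale1r ?add0r ?addr0 //.
  - exact: vE.
  - exact: vE.
  by rewrite !nth_nil /= subrr !scale0r !addr0.
have dN i j : phi (N i) - phi (N j) = comb3 d1 d2 d3 (vecF al (psub (c i) (c j))).
  by rewrite (vecF_sub hF hal) comb3B -!cN -sub_subr.
have sc k u : comb3 d1 d2 d3 (vecF al (pscal k u)) = q2F al k *: comb3 d1 d2 d3 (vecF al u).
  by case: u => [[u1 u2] u3]; rewrite /= !(q2F_mul hF hal) !scalerDr !scalerA.
have ci u v : comb3 d1 d2 d3 (vecF al u) = comb3 d1 d2 d3 (vecF al v) -> peq u v.
  move/eqP; rewrite -subr_eq0 -comb3B -(vecF_sub hF hal) => /eqP; case: u v => [[u1 u2] u3] [[v1 v2] v3].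
  by case/(free3P fr) => /eqP x1 /eqP x2 /eqP x3; rewrite /peq /qeq !(qzE hal) x1 x2 x3.
have onE k o t s : onl k (c o) (c t) (c s) -> phi (N s) - phi (N o) = q2F al k *: (phi (N t) - phi (N o)).
  by move=> /peqE E; rewrite !dN E sc.
have neE t o : ~~ peq (c t) (c o) -> phi (N t) <> phi (N o).
  by move/negP=> h E; apply: h; apply: ci; rewrite -!cN E.
have NL n : N n \in L.
  by rewrite /N; case: n => [|[|[|[|[|[|n]]]]]] /=; rewrite ?nth_nil !inE eqxx ?orbT.
have subL s : {subset map N s <= L} by move=> x /mapP[n _ ->].
exists L.
  move=> x; rewrite !inE; have bI k : b k \in map bs (enum I) by apply: map_f; rewrite mem_enum.
  by case/or4P=> [/eqP ->|/eqP ->|/eqP ->|/or3P[] /eqP ->]; rewrite ?bI ?eqxx ?orbT.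
move: gt => /andiP[_ /oriP[]].
  case/anynP=> o /anynP[t /andiP[h0 /anynP[s /andiP[hs /anynP[s' hs']]]]]; left.
  exists (N o), (N t), (N s), (N s'); split; first exact: (subL [:: o; t; s; s']).
  by split; [apply: neE|apply: (onE Qa)|apply: (onE Qb)].
case/anynP=> o /anynP[t /andiP[h0 /anynP[s /andiP[hs /anynP[t' /andiP[ho /anynP[s' hs']]]]]]]; right.
exists (N o), (N t), (N s), (N t'), (N s'); split; first exact: (subL [:: o; t; s; t'; s']).
split; [exact: neE|exact: (onE Qa)|exact: (onE Qa)|].
move=> k E; case/andiP: ho => n0 /andiP[n1 /andiP[n2 n3]].
have hE x : k = q2F al x -> onl x (c o) (c t) (c t').
  by move=> kx; apply: ci; rewrite sc -!dN E kx.
case: (f4_case hF hal k) => kE.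
- by apply: (neE _ _ n0); apply/eqP; rewrite -subr_eq0 E kE scale0r.
- by move/negP: n1; apply; apply: hE.
- by move/negP: n2; apply; apply: hE.
by move/negP: n3; apply; apply: hE.
Qed.

End Merge.

Section Points.
Variables (F : finFieldType) (hF : #|F| = 4%N) (al : F) (hal : al ^+ 2 = al + 1).
Variables (X : vectType F) (W : vectType rat) (P : eqType) (phi : P -> X) (psi : P -> W).
Hypothesis tw : twin (fun pq : P * P => phi pq.1 - phi pq.2) (fun pq : P * P => psi pq.1 - psi pq.2).

Lemma sub_basis (v : P -> X) (s : seq P) : exists s1, [/\ {subset s1 <= s}, free (map v s1) & <<map v s1>>%VS = <<map v s>>%VS].
Proof.
elim: s => [|x s [s1 [h1 h2 h3]]]; first by exists [::]; split=> //; apply: nil_free.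
case: (boolP (v x \in <<map v s>>%VS)) => hx.
  exists s1; split=> //; first by move=> y /h1; rewrite inE orbC => ->.
  rewrite h3 /= span_cons; apply/esym/addv_idPr; by rewrite -memvE.
exists (x :: s1); split.
- by move=> y; rewrite !inE => /orP[->//|/h1 ->]; rewrite orbT.
- by rewrite /= free_cons h3 hx.
by rewrite /= !span_cons h3.
Qed.

(** An affine basis uses d + 1 of the points. Any other point has at least two nonzero barycentric
    coordinates, so [no_triple] allows at most two of them, and two yield a configuration by
    [pair_struct]. The bound 3 <= d supplies four base points. *)
Theorem points_structure (o : P) (L : seq P) : o \in L -> uniq (map phi L) ->
  let d := \dim <<[seq phi p - phi o | p <- L]>> in (3 <= d)%N ->
  (size L <= d + 3)%N /\ (size L = d + 3 ->
  (exists o t s s', [/\ {subset [:: o; t; s; s'] <= L} & T2rel al phi o t s s']) \/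
  (exists o t s t' s', [/\ {subset [:: o; t; s; t'; s'] <= L} & Grel al phi o t s t' s']))%N.
Proof.
move=> oL uL d d3; have [s1 [s1L fr1 sp1]] := sub_basis (fun p => phi p - phi o) L.
pose n := size s1.
have nd : n = d by rewrite /d -sp1; move/eqP: fr1 => ->; rewrite size_map.
pose T : n.-tuple X := [tuple of [seq phi p - phi o | p <- in_tuple s1]].
have TE : T = [seq phi p - phi o | p <- s1] :> seq X.
  by [].
have frT : free T by rewrite TE.
pose bs (i : option 'I_n) : P := if i is Some j then tnth (in_tuple s1) j else o.
have TN (i : 'I_n) : T`_i = phi (bs (Some i)) - phi o by rewrite /= (nth_map o) // (tnth_nth o).
have aff (h : option 'I_n -> F) : exists2 g : X -> F, functional g & forall i j, g (phi (bs i) - phi (bs j)) = h i - h j.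
  pose g x := \sum_i coord T i x * (h (Some i) - h None).
  have hg : functional g.
    move=> k x y; rewrite /g mulr_sumr -big_split; apply: eq_bigr => i _.
    by rewrite linearP /= mulrDl mulrA.
  have gS i : g (phi (bs i) - phi o) = h i - h None.
    case: i => [i|]; last by rewrite /= subrr functional0 // subrr.
    rewrite /g (bigD1 i) //= -TN coord_free // eqxx mul1r big1 ?addr0 // => j ji.
    by rewrite coord_free // eq_sym (negPf ji) mul0r.
  exists g => // i j; rewrite (sub_subr _ _ (phi o)) functionalB // !gS -sub_subr //.
pose cf p (i : option 'I_n) : F := if i is Some j then coord T j (phi p - phi o) else 1 - \sum_j coord T j (phi p - phi o).
have hc p : p \in L -> coefs phi bs cf p.
  move=> pL; have pT : phi p - phi o \in <<T>>%VS by rewrite TE sp1; apply: memv_span; apply: map_f.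
  have osum (V : zmodType) (f : option 'I_n -> V) : \sum_i f i = f None + \sum_j f (Some j).
    rewrite (bigD1 None) //=; congr (_ + _); rewrite (reindex_omap Some id) => [|[]//].
    by apply: eq_bigl => j; rewrite /= eqxx.
  split; first by rewrite osum /= subrK.
  rewrite osum /= scalerBl scale1r scaler_suml -addrA -[LHS](subrK (phi o)) addrC; congr (_ + _).
  rewrite {1}(coord_span pT) addrC -sumrB; apply: eq_bigr => j _; by rewrite TN scalerBr.
have cI : (4 <= #|{: option 'I_n}|)%N by rewrite card_option card_ord nd.
pose E := [seq p <- L | phi p \notin map phi (o :: s1)].
have sE : (size L <= size E + d.+1)%N.
  rewrite -(count_predC (fun p => phi p \notin map phi (o :: s1)) L) -size_filter leq_add2l.
  rewrite -nd -[n.+1]/(size (o :: s1)) -(size_map phi (o :: s1)) -size_filter -(size_map phi).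
  apply: uniq_leq_size; first by rewrite (subseq_uniq _ uL) // map_subseq // filter_subseq.
  by move=> x /mapP[p]; rewrite mem_filter /= negbK => /andP[h _] ->.
have eS p : p \in E -> (1 < #|S cf p|)%N.
  rewrite mem_filter => /andP[pn pL]; have [c1 c2] := hc p pL.
  rewrite ltnNge; apply/negP; rewrite leq_eqVlt => /orP[/cards1P[i Si]|].
    have z j : j != i -> cf p j = 0.
      by move=> ji; apply/eqP/negPn; have /setP/(_ j) := Si; rewrite !inE (negPf ji) => ->.
    have ci : cf p i = 1 by rewrite -c1 (bigD1 i) //= big1 ?addr0.
    case/negP: pn; rewrite c2 (bigD1 i) //= big1 ?addr0 => [|j ji]; last by rewrite z // scale0r.
    rewrite ci scale1r -[_ :: _]/(map phi (o :: s1)); apply: (map_f phi); case: i {Si z ci} => [i|] /=; last by rewrite mem_head.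
    by rewrite inE mem_tnth orbT.
  rewrite ltnS leqn0 cards_eq0 => /eqP S0; move/eqP: c1; rewrite big1 ?(eq_sym 0) ?oner_eq0 // => i _.
  by apply/eqP/negPn; have /setP/(_ i) := S0; rewrite !inE => ->.
have EL p : p \in E -> p \in L by rewrite mem_filter => /andP[].
have uE : uniq (map phi E) by rewrite (subseq_uniq _ uL) // map_subseq // filter_subseq.
split.
  rewrite leqNgt; apply/negP => big.
  have : (2 < size E)%N by move: sE big; clear; lia.
  case: E eS EL uE {sE} => [|p [|q [|e E]]] //= eS EL; rewrite !inE !negb_or -!andbA => /and4P[/eqP pq /eqP pe _ /andP[/eqP qe _]] _.
  have pE : p \in [:: p, q, e & E] by rewrite inE eqxx. have qE : q \in [:: p, q, e & E] by rewrite !inE eqxx orbT.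
  have eE : e \in [:: p, q, e & E] by rewrite !inE eqxx !orbT.
  exact: (no_triple hF hal tw aff cI (hc p (EL p pE)) (hc q (EL q qE)) (hc e (EL e eE)) (eS p pE) (eS q qE) (eS e eE) pq pe qe).
move=> szL; have : (1 < size E)%N by move: sE szL; clear; lia.
case: E eS EL uE {sE} => [|p [|q E]] //= eS EL; rewrite !inE !negb_or -!andbA => /andP[/eqP pq _] _.
have pE : p \in [:: p, q & E] by rewrite inE eqxx. have qE : q \in [:: p, q & E] by rewrite !inE eqxx orbT.
have [L1 sL1 H] := pair_struct hF hal tw aff cI (hc p (EL p pE)) (hc q (EL q qE)) (eS p pE) (eS q qE) pq.
have L1L : {subset L1 <= L}.
  move=> x /sL1; rewrite !inE => /or3P[/eqP ->|/eqP ->|/mapP[i _ ->]]; [exact: EL|exact: EL|].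
  by case: i => [i|] //=; apply: s1L; apply: mem_tnth.
case: H => [[o' [t [s [s' [h1 h2]]]]]|[o' [t [s [t' [s' [h1 h2]]]]]]]; [left|right].
  by exists o', t, s, s'; split=> // x /h1/L1L.
by exists o', t, s, t', s'; split=> // x /h1/L1L.
Qed.

End Points.

(** * Growth rates from the vertically connected members *)

Definition ext_size (r : nat) : nat := 'C(r + 3, 2) - 5.

Lemma ext_sizeE r : (2 * ext_size r + 4 = r * r + 5 * r)%N \/ (r = 0)%N.
Proof.
case: r => [|r]; first by right.
left; rewrite /ext_size bin2; have := mulnC (r.+1 + 3)%N (r.+1 + 3).-1.
have : ~~ odd ((r.+1 + 3) * (r.+1 + 3).-1) by rewrite oddM /= !oddD /=; case: (odd r).
move/even_halfK; rewrite -divn2 -muln2; move: (_ %/ 2)%N => h; nia.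
Qed.

Lemma ext_le r : (2 * ext_size r <= r * r + 5 * r)%N.
Proof. by have [h|->] := ext_sizeE r; [rewrite -h leq_addr|]. Qed.

Lemma ext_ge r : (r * r + 5 * r <= 2 * ext_size r + 4)%N.
Proof. by have [->|->] := ext_sizeE r. Qed.

(** Convexity: under these constraints the sum of squares is largest when one term is as large as
    possible. *)
Lemma sum_sq a b m k : (a <= m)%N -> (b <= m)%N -> (a + b <= m + k)%N -> (a * a + b * b <= m * m + k * k)%N.
Proof.
move=> am bm abm; case: (leqP a k) => ak; first by rewrite addnC leq_add ?leq_mul.
have [i aE] : exists i, (a = k + i)%N by exists (a - k)%N; move: ak; clear; lia.
have [j mE] : exists j, (m = a + j)%N by exists (m - a)%N; move: am; clear; lia.
have bj : (b <= k + j)%N by move: abm; rewrite mE; clear; lia.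
have := leq_mul bj bj; rewrite mE aE; clear; nia.
Qed.

Lemma ext_save D k r a b : (a < r)%N -> (b < r)%N -> (a + b < r + k)%N -> (k * k + 5 * k + 2 * D + 10 <= r)%N ->
  (ext_size a + ext_size b + D <= ext_size r)%N.
Proof.
case: r => // r; rewrite !ltnS => ar br abr0 rk'; have abr : (a + b <= r + k)%N := abr0.
have := sum_sq ar br abr; have := ext_le a; have := ext_le b; have := ext_ge r.+1.
by move: ar br abr rk'; clear; lia.
Qed.

Lemma ext_save2 k E r a b : (k + E + 2 < a)%N -> (k + E + 2 < b)%N -> (a + b < r + k)%N ->
  ((k + E + 2) * (k + E + 2) + (E + 2) * (E + 2) + 5 * k + 2 * E * k + 10 * E + 20 <= r)%N ->
  (ext_size a + E * a.+1 + (ext_size b + E * b.+1) < ext_size r)%N.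
Proof.
move=> ha hb hab hr.
have [m rm] : exists m, (r = m + (E + 2))%N by exists (r - (E + 2))%N; move: hr; clear; move: (_ * _)%N; lia.
have am : (a <= m)%N by move: ha hb hab; rewrite rm; clear; lia.
have bm : (b <= m)%N by move: ha hb hab; rewrite rm; clear; lia.
have abm : (a + b <= m + (k + E + 2))%N by move: hab; rewrite rm; clear; lia.
have := sum_sq am bm abm.
have := ext_le a; have := ext_le b; have := ext_ge r.
have : (E * (a + b) <= E * (r + k))%N by rewrite leq_mul2l ltnW ?orbT.
by move: ha hb hab hr; rewrite rm; clear; lia.
Qed.

(** Raising the rank by one gains about r elements, which pays for the drop of [Q - r] and for a
    bounded remainder [c]. *)
Lemma ext_step c Q a r : (a < r)%N -> (2 * c + 4 <= r)%N -> (ext_size a + (Q - a) + c <= ext_size r + (Q - r))%N.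
Proof.
move=> ar hr; have [d rE] : exists d, (r = a + d.+1)%N by exists (r - a - 1)%N; move: ar; clear; lia.
have := ext_le a; have := ext_ge r; have h : (Q - a <= Q - r + d.+1)%N by rewrite rE; clear; lia.
have : (d.+1 * (2 * c + 4) <= d.+1 * r)%N by rewrite leq_mul2l hr orbT.
have : (0 <= a * d)%N by [].
by move: h hr; rewrite rE; move: (Q - a)%N (Q - (a + d.+1))%N => x y; clear; lia.
Qed.

Lemma linear_le E r R2 : (r < R2)%N -> (E * r.+1 <= R2 + E.+1 * R2 + E - r)%N.
Proof.
move=> rR; have : (E * r.+1 <= E * R2)%N by rewrite leq_mul2l rR orbT.
by rewrite mulSn; move: rR; clear; lia.
Qed.

Section Flats.
Variable M : matroid.
Hypothesis sM : simple M.

Lemma rk1 (x : M) : rk [set x] = 1%N.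
Proof. by rewrite sM cards1. Qed.

Lemma rk2 (x y : M) : x != y -> rk [set x; y] = 2%N.
Proof. by move=> xy; rewrite sM cards2 xy. Qed.

Lemma rk0 : rk (set0 : {set M}) = 0%N.
Proof. by rewrite sM cards0. Qed.

Lemma simple_flats : num_rank1_flats M = #|M|.
Proof.
rewrite /num_rank1_flats -cardsT -(card_imset _ (@set1_inj M)); apply: eq_card => X.
rewrite inE; apply/andP/imsetP => [[/forallP fX /eqP rX]|[x _ ->]].
  case: (set_0Vmem X) => [X0|[x xX]]; first by move: rX; rewrite X0 rk0.
  exists x => //; apply/setP => y; rewrite inE; apply/idP/eqP => [yX|-> //].
  apply/eqP/negPn/negP => yx; have : (rk [set y; x] <= rk X)%N.
    by apply: rkS; apply/subsetP => z; rewrite !inE => /orP[] /eqP ->.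
  by rewrite rk2 // rX.
split; last by rewrite rk1.
apply/forallP => y; apply/implyP; rewrite inE => yx.
by rewrite rk1 [_ |: _]/([set y; x]) rk2.
Qed.

End Flats.

Definition restrict (M : matroid) (X : {set M}) : matroid := minor set0 (~: X).

Section Restrict.
Variables (M : matroid) (X : {set M}).

Lemma val_restrict (x : restrict X) : val x \in X.
Proof. by have := valP x; rewrite in_setU in_set0 in_setC negbK. Qed.

Lemma rk_restrict (Y : {set restrict X}) : simple M -> rk Y = rk (val @: Y).
Proof. by move=> sM; rewrite /rk /= /minor_rk setU0 rk0 // subn0. Qed.

Lemma card_restrict : #|restrict X| = #|X|.
Proof. by rewrite card_sig; apply: eq_card => x; rewrite !inE negbK. Qed.

Lemma simple_restrict : simple M -> simple (restrict X).
Proof. by move=> sM Y hY; rewrite rk_restrict // sM card_imset //; apply: val_inj. Qed.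

Lemma rank_restrict : simple M -> rank (restrict X) = rk X.
Proof.
move=> sM; rewrite /rank rk_restrict //; congr rk; apply/setP => x; apply/imsetP/idP => [[y _ ->]|xX].
  exact: val_restrict.
have h : x \notin set0 :|: ~: X by rewrite set0U inE negbK.
by exists (exist _ x h : restrict X).
Qed.

Lemma representable_restrict (F : fieldType) : simple M -> representable F M -> representable F (restrict X).
Proof.
move=> sM [B [A hA]]; exists B, (fun b x => A b (val x)) => Y; rewrite rk_restrict // hA.
rewrite /column_rk; congr (\dim _); apply: eq_span => v; apply/mapP/mapP => -[x].
  by rewrite mem_enum => /imsetP[y yY ->] ->; exists y; rewrite ?mem_enum //; apply/ffunP => b; rewrite !ffunE.
rewrite mem_enum => xY ->; exists (val x); first by rewrite mem_enum imset_f.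
by apply/ffunP => b; rewrite !ffunE.
Qed.

End Restrict.

Section Growth.
Variable P : matroid -> Prop.
Hypothesis P_restrict : forall (M : matroid) (X : {set M}), simple M -> P M -> P (restrict X).
Hypothesis P_expo : forall M, simple M -> P M -> (#|M| <= 4 ^ rank M)%N.
Variables k R : nat.
Hypothesis vc : forall M, P M -> simple M -> vertically_connected k M -> (R <= rank M)%N -> (#|M| <= ext_size (rank M))%N.

Lemma split_bound M : P M -> simple M -> ~ vertically_connected k M ->
  exists N1 N2 : matroid, [/\ P N1 /\ simple N1, P N2 /\ simple N2, (#|M| = #|N1| + #|N2|)%N,
    (rank N1 < rank M)%N /\ (rank N2 < rank M)%N & (rank N1 + rank N2 < rank M + k)%N].
Proof.
move=> PM sM nv.
have [X [h1 h2 h3]] : exists X : {set M}, [/\ (rk X + rk (~: X) - rank M < k)%N, rk X != rank M & rk (~: X) != rank M].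
  case: (boolP [exists X : {set M}, [&& (rk X + rk (~: X) - rank M < k)%N, rk X != rank M & rk (~: X) != rank M]]).
    by case/existsP=> X /and3P[h1 h2 h3]; exists X.
  move=> /existsPn h; case: nv => X hX.
  by have := h X; rewrite hX /= negb_and !negbK => /orP[] /eqP; [left|right].
exists (restrict X), (restrict (~: X)); rewrite !rank_restrict // !card_restrict.
have r1 : (rk X <= rank M)%N by apply: rkS; apply: subsetT.
have r2 : (rk (~: X) <= rank M)%N by apply: rkS; apply: subsetT.
split; first by split; [apply: P_restrict|apply: simple_restrict].
- by split; [apply: P_restrict|apply: simple_restrict].
- by rewrite cardsC.
- by rewrite !ltn_neqAle h2 h3 r1 r2.
by move: h1; clear; lia.
Qed.

Lemma vc_dec M : vertically_connected k M \/ ~ vertically_connected k M.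
Proof.
pose b := [forall X : {set M}, (rk X + rk (~: X) - rank M < k)%N ==> ((rk X == rank M) || (rk (~: X) == rank M))].
case: (boolP b) => [/forallP h|nb]; [left|right].
  by move=> X hX; have := h X; rewrite hX => /orP[] /eqP; [left|right].
by move=> h; case/negP: nb; apply/forallP => X; apply/implyP => /h[] ->; rewrite eqxx ?orbT.
Qed.

(** A first crude bound, by splitting along low order separations. Small ranks are handled by the
    exponential bound, and in large rank the quadratic saving of a split pays for the duplicated
    constant. *)
Lemma growth_linear : exists E, forall M, P M -> simple M -> (#|M| <= ext_size (rank M) + E * (rank M).+1)%N.
Proof.
pose D := (4 ^ k)%N; pose R0 := (R + k * k + 10 * k + 2 * D + 20)%N; pose L := (4 ^ R0)%N.
have D1 : (1 <= D)%N by rewrite expn_gt0.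
(* The linear term starts at rank [k]: for parts of ranks a, b with a + b < r + k, the truncated
   differences a - k and b - k then add up to at most r - k. Ranks up to [k] are covered by [D]. *)
suff h r : forall M, P M -> simple M -> rank M = r -> (#|M| <= ext_size r + D + L * (r - k))%N.
  exists (D + L)%N => M PM sM; apply: leq_trans (h _ M PM sM erefl) _.
  rewrite -addnA leq_add2l mulnDl leq_add ?leq_pmulr // leq_mul2l; apply/orP; right.
  by rewrite leqW ?leq_subr.
have [m] := ubnP r; elim: m r => // m IH r rm M PM sM rE.
have hE := P_expo sM PM; rewrite rE in hE.
case: (leqP r k) => rk'.
  by apply: leq_trans hE _; rewrite -addnA addnCA; apply: leq_trans (leq_addr _ _); rewrite leq_exp2l.
case: (leqP r R0) => rR.
  apply: leq_trans hE _; apply: leq_trans (leq_addl _ _); apply: leq_trans (leq_pmulr _ _); last by rewrite subn_gt0.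
  by rewrite leq_exp2l.
case: (vc_dec M) => [vM|nv].
  rewrite -addnA; apply: leq_trans (leq_addr _ _); rewrite -rE; apply: vc => //; rewrite rE.
  by move: rR; rewrite /R0; clear; lia.
have [N1 [N2 [[P1 s1] [P2 s2] cE [r1 r2] r12]]] := split_bound PM sM nv.
rewrite rE in r1 r2 r12.
have h1 := IH _ (leq_trans r1 rm) N1 P1 s1 erefl; have h2 := IH _ (leq_trans r2 rm) N2 P2 s2 erefl.
have sv := @ext_save D k _ _ _ r1 r2 r12.
have {}sv : (ext_size (rank N1) + ext_size (rank N2) + D <= ext_size r)%N.
  by apply: sv; move: rR; rewrite /R0; clear; lia.
have lin : (L * (rank N1 - k) + L * (rank N2 - k) <= L * (r - k))%N.
  by rewrite -mulnDr leq_mul2l; apply/orP; right; move: r1 r2 r12; clear; lia.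
by rewrite cE; move: h1 h2 sv lin; clear; lia.
Qed.

(** The linear error is replaced by [Q - r], which decreases with the rank and vanishes from [Q] on.
    A split with a part of small rank is paid for by [ext_step]; one with both ranks large saves
    more than the linear error. *)
Lemma growth : exists r1, forall M, P M -> simple M -> forall r, (r1 <= r)%N -> (rank M <= r)%N ->
  (#|M| <= ext_size r)%N /\ (rank M = r -> #|M| = ext_size r -> vertically_connected k M).
Proof.
have [E hE] := growth_linear.
pose s := (k + E + 2)%N; pose c := (s * s + 5 * s + E * s.+1 + 1)%N.
pose R2 := (R + 2 * c + s * s + (E + 2) * (E + 2) + 10 * k + 2 * E * k + 10 * E + 20)%N; pose Q := (R2 + (E.+1) * R2 + E)%N.
have step M : P M -> simple M -> (R2 <= rank M)%N -> ~ vertically_connected k M ->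
    (forall N, P N -> simple N -> (rank N < rank M)%N -> (#|N| <= ext_size (rank N) + (Q - rank N))%N) ->
    (#|M| < ext_size (rank M) + (Q - rank M))%N.
  move=> PM sM rM nv IH.
  have [N1 [N2 [[P1 s1] [P2 s2] cE [r1 r2] r12]]] := split_bound PM sM nv.
  have sm N : P N -> simple N -> (rank N <= s)%N -> (#|N| < c)%N.
    move=> PN sN rs; have := hE N PN sN; have := ext_le (rank N); have := leq_mul rs rs.
    have : (E * (rank N).+1 <= E * s.+1)%N by rewrite leq_mul2l ltnS rs orbT.
    by move: rs; rewrite /c; clear; lia.
  have cR : (2 * c + 4 <= rank M)%N by apply: leq_trans rM; rewrite /R2; clear; lia.
  case: (leqP (rank N1) s) => [l1|g1].
    have := sm _ P1 s1 l1; have := IH N2 P2 s2 r2; have := ext_step Q r2 cR; rewrite cE; clear; lia.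
  case: (leqP (rank N2) s) => [l2|g2].
    have := sm _ P2 s2 l2; have := IH N1 P1 s1 r1; have := ext_step Q r1 cR; rewrite cE; clear; lia.
  have := hE N1 P1 s1; have := hE N2 P2 s2.
  have rM' : (s * s + (E + 2) * (E + 2) + 5 * k + 2 * E * k + 10 * E + 20 <= rank M)%N.
    by apply: leq_trans rM; rewrite /R2; clear; lia.
  by have := ext_save2 g1 g2 r12 rM'; rewrite cE; clear; lia.
have main r : forall M, P M -> simple M -> rank M = r -> (#|M| <= ext_size r + (Q - r))%N.
  have [m] := ubnP r; elim: m r => // m IH r rm M PM sM rE.
  case: (leqP R2 r) => rR; last first.
    rewrite -rE; apply: leq_trans (hE M PM sM) _; rewrite leq_add2l rE.
    exact: linear_le.
  case: (vc_dec M) => [vM|nv].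
    apply: leq_trans (leq_addr _ _); rewrite -rE; apply: vc => //; rewrite rE; apply: leq_trans rR.
    by rewrite /R2; clear; lia.
  rewrite -rE; apply/ltnW/step => //; rewrite rE // => N PN sN rN; apply: (IH (rank N)) => //.
  exact: leq_trans rN rm.
exists (Q + 4)%N => M PM sM r rQ rM; split.
  move: rM; rewrite leq_eqVlt => /orP[/eqP rE|rM].
    by have := main _ M PM sM rE; move: rQ; clear; lia.
  have := main _ M PM sM erefl; have := @ext_step 0 Q _ _ rM; move: rQ; clear; lia.
move=> rE cE; case: (vc_dec M) => // nv.
have : (#|M| < ext_size (rank M) + (Q - rank M))%N.
  apply: step => //; last by move=> N PN sN _; apply: main.
  by rewrite rE; move: rQ; rewrite /Q; clear; lia.
by rewrite rE cE; move: rQ; clear; lia.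
Qed.

End Growth.

(** * Counting elements of a matroid conforming to a template *)

Section Arith.
Variables (I : finType) (R0 : {set I}) (a : I -> nat).
Hypothesis a1 : forall i, i \in R0 -> (1 <= a i)%N.

Lemma bin2x (n : nat) : (2 * 'C(n, 2) = n * (n - 1))%N.
Proof.
rewrite bin2; have : ~~ odd (n * n.-1) by rewrite oddM; case: n => //= n; case: (odd n).
by move/even_halfK; rewrite -mul2n subn1.
Qed.

Lemma sum_pairs1 N0 : (forall i, i \in R0 -> (a i <= N0)%N) ->
  (2 * \sum_(i in R0) 'C(a i, 2) <= N0 * \sum_(i in R0) (a i - 1))%N.
Proof.
move=> h; rewrite !big_distrr /=; apply: leq_sum => i iR; rewrite bin2x.
by apply: leq_mul => //; apply: h.
Qed.

Lemma sum_pairs2 i0 T : i0 \in R0 -> (\sum_(i in R0) (a i - 1) = a i0 - 1 + T)%N ->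
  (2 * \sum_(i in R0) 'C(a i, 2) <= a i0 * (a i0 - 1) + T.+1 * T)%N.
Proof.
move=> i0R; rewrite (bigD1 i0) //= => /addnI hT.
rewrite (bigD1 i0) //= mulnDr bin2x leq_add2l -{2}hT !big_distrr /=; apply: leq_sum => i /andP[iR ii0].
rewrite bin2x leq_mul2r; apply/orP; right.
have : (a i - 1 <= T)%N by rewrite -hT (bigD1 i) ?iR //= leq_addr.
by have := a1 iR; clear; lia.
Qed.

End Arith.

Lemma count_arith1 n y d x m m1 T c r : (2 * c <= n * T)%N -> (n + d < r)%N -> (m1 <= c)%N -> (m <= m1 + y)%N ->
  (x <= m)%N -> (2 * x + 4 = r * r + 5 * r)%N -> (d * d * 8 + d * 20 + y * 2 + 30 <= r)%N -> (n * T <= n * (r + d))%N -> False.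
Proof.
move=> h1 h2 h3 h4 h5 h6 h7 h8.
have [k rE] : exists k, (r = n + d + 1 + k)%N by exists (r - (n + d + 1))%N; move: h2; clear; lia.
have h9 : (r * r + 5 * r <= n * (r + d) + 2 * y + 4)%N by move: h1 h3 h4 h5 h6 h8; clear; lia.
have h10 : (2 * y + 30 <= r)%N by move: h7; move: (d * d)%N; clear; lia.
have h11 : (n * (r + d) <= r * r)%N by rewrite rE; clear; nia.
by move: h9 h10 h11; clear; lia.
Qed.

Lemma count_arith2 y d x m m1 c r z1 z2 : (2 * c <= z1 + z2)%N -> (z1 <= (r + 2) * (r + 1))%N ->
  (z2 <= (2 * d + 2) * (2 * d + 1))%N -> (m1 <= c)%N -> (m <= m1 + y)%N ->
  (x <= m)%N -> (2 * x + 4 = r * r + 5 * r)%N -> (d * d * 8 + d * 20 + y * 2 + 30 <= r)%N -> False.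
Proof. by move=> *; nia. Qed.

Lemma count_arith3 y d r : (d * d * 8 + d * 20 + y * 2 + 30 <= r)%N -> (30 <= r)%N /\ (3 <= r + 2 - d)%N.
Proof. by move: (d * d)%N; lia. Qed.

Section Count.
Variables (F : finFieldType) (hF : #|F| = 4%N) (al : F) (hal : al ^+ 2 = al + 1).
Variable (Phi : template F).
Local Notation K := (tC Phi + tY0 Phi + tY1 Phi)%type.
Variables (B' E' : finType) (A : tX Phi + B' -> K + E' -> F).
Let P : finType := (option B' + tY1 Phi)%type.
Let Q := kil (Cspan A).
Let phi (p : P) := Q (phi0 A p).
Let S := {ffun tX Phi + B' -> F^o}.

Lemma dim_dl (s : seq B') : uniq s -> \dim <<[seq dl Phi b | b <- s]>> = size s.
Proof.
elim: s => [|b s IH] /=; first by rewrite span_nil dimv0.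
case/andP=> bs us; have h : dl Phi b \notin <<[seq dl Phi b | b <- s]>>%VS.
  apply/negP => /(functional_span (functional_ev (inr b))) h.
  have : dl Phi b (inr b) = 0 :> F.
    by apply: h => _ /mapP[b' b's ->]; rewrite dl_inr; case: eqP => // e; rewrite e b's in bs.
  by rewrite dl_inr eqxx => /eqP; rewrite oner_eq0.
by rewrite dim_span_cons IH // h.
Qed.

Lemma dim_Cspan : (\dim (Cspan A) <= #|tC Phi|)%N.
Proof.
apply: leq_trans (dim_span _) _; rewrite size_map -cardE.
exact: leq_trans (leq_imset_card _ _) (max_card _).
Qed.

Section Classes.
Variables (U : {vspace S}) (Rp : {set P}).

Definition near (p q : P) := phi p - phi q \in U.

Lemma near_refl p : near p p. Proof. by rewrite /near subrr mem0v. Qed.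
Lemma near_sym p q : near p q = near q p. Proof. by rewrite /near -memvN opprB. Qed.
Lemma near_trans q p r : near p q -> near q r -> near p r.
Proof. by move=> h1 h2; rewrite /near -(subrK (phi q) (phi p)) -addrA memvD. Qed.

Definition root (p : P) := odflt p [pick q in Rp | near p q].

Lemma root_in p : p \in Rp -> root p \in Rp.
Proof. by rewrite /root; case: pickP => //= q /andP[]. Qed.

Lemma near_root p : near p (root p).
Proof. by rewrite /root; case: pickP => /= [q /andP[]|_] //; rewrite near_refl. Qed.

Lemma eq_root p q : p \in Rp -> near p q -> root p = root q.
Proof.
move=> pR pq; rewrite /root (eq_pick (_ : _ =1 (fun x => (x \in Rp) && near q x))); last first.
  move=> x /=; congr (_ && _); apply/idP/idP; last exact: near_trans.
  by apply: near_trans; rewrite near_sym.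
by case: pickP => // /(_ p) /=; rewrite pR near_sym pq.
Qed.

Definition roots := root @: Rp.
Definition fib r := [set p in Rp | root p == r].

Lemma card_fib : #|Rp| = (\sum_(r in roots) #|fib r|)%N.
Proof.
rewrite -sum1_card (partition_big root (mem roots)) /=; last by move=> p pR; apply: imset_f.
by apply: eq_bigr => r _; rewrite -sum1_card; apply: eq_bigl => p; rewrite inE.
Qed.

Lemma fib_gt0 r : r \in roots -> (1 <= #|fib r|)%N.
Proof. by case/imsetP=> p pR ->; apply/card_gt0P; exists p; rewrite inE pR eqxx. Qed.

(** The unit vectors among the points are independent. Subtracting from each non-root its root gives
    vectors that lie in [U] after contracting [C]; the constant accounts for [C], for the [Y1]
    points occurring as points and as roots, and for the origin. *)
Lemma excess : (\sum_(r in roots) (#|fib r| - 1) <= \dim U + (#|tC Phi| + 2 * #|tY1 Phi| + 1))%N.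
Proof.
have sR : roots \subset Rp by apply/subsetP => _ /imsetP[p pR ->]; apply: root_in.
have -> : (\sum_(r in roots) (#|fib r| - 1) = #|Rp :\: roots|)%N.
  have := cardsD Rp roots; rewrite (setIidPr sR) card_fib => ->.
  have : (\sum_(r in roots) (#|fib r| - 1) + \sum_(r in roots) 1 = \sum_(r in roots) #|fib r|)%N.
    by rewrite -big_split /=; apply: eq_bigr => r rR; rewrite subnK // fib_gt0.
  by rewrite sum1_card => <-; rewrite addnK.
pose NB := [set b | inl (Some b) \in Rp :\: roots]; pose RB := [set b | (inl (Some b) : P) \in roots].
have c1 : (#|Rp :\: roots| <= #|NB| + (1 + #|tY1 Phi|))%N.
  rewrite -(card_imset (mem NB) (_ : injective (fun b => inl (Some b) : P))); last by move=> b b' [].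
  apply: leq_trans (_ : #|[set (inl (Some b) : P) | b in NB] :|: (inl None |: [set (inr y : P) | y : tY1 Phi])| <= _)%N.
    apply: subset_leq_card; apply/subsetP => -[[b|]|y] h; rewrite !inE ?eqxx ?orbT //.
      by apply/orP; left; apply/imsetP; exists b => //; rewrite inE.
    by apply/or3P; constructor 3; apply/imsetP; exists y.
  apply: leq_trans (leq_card_setU _ _) _; rewrite leq_add2l; apply: leq_trans (leq_card_setU _ _) _.
  by rewrite cards1 leq_add2l; apply: leq_trans (leq_imset_card _ _) (max_card _).
pose w b := phi0 A (inl (Some b)) - phi0 A (root (inl (Some b))).
pose Wv := <<[seq w b | b <- enum NB]>>%VS.
have dW : (\dim Wv <= \dim U + #|tC Phi|)%N.
  rewrite -(limg_ker_dim Q Wv) addnC leq_add //; last first.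
    by apply: leq_trans dim_Cspan; rewrite -(lker_kil (Cspan A)); apply/dimvS/capvSr.
  apply: dimvS; rewrite limg_span; apply/span_subvP => _ /mapP[_ /mapP[b _ ->] ->].
  by have := near_root (inl (Some b)); rewrite /near /phi -linearB.
pose Z := <<[seq phi0 A (inr y) | y <- enum (tY1 Phi)]>>%VS.
have dZ : (\dim Z <= #|tY1 Phi|)%N by apply: leq_trans (dim_span _) _; rewrite size_map -cardE.
pose D := <<[seq dl Phi b | b <- enum RB]>>%VS.
have dD : (\dim D <= #|RB|)%N by apply: leq_trans (dim_span _) _; rewrite size_map -cardE.
have dis : [disjoint NB & RB].
  by rewrite disjoints_subset; apply/subsetP => b; rewrite !inE => /andP[].
have : (#|NB| + #|RB| <= \dim (Wv + Z + D))%N.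
  have -> : (#|NB| + #|RB| = #|NB :|: RB|)%N by have := (leq_card_setU NB RB).2; rewrite dis => /eqP.
  rewrite cardE -dim_dl ?enum_uniq //; apply: dimvS; apply/span_subvP => _ /mapP[b + ->].
  rewrite mem_enum inE => /orP[bN|bR]; last first.
    by apply: subvP (addvSr _ _) _ _; apply/memv_span/map_f; rewrite mem_enum.
  have -> : dl Phi b = w b + phi0 A (root (inl (Some b))) by rewrite /w subrK.
  have wW : w b \in Wv by apply/memv_span/map_f; rewrite mem_enum.
  have wA : w b \in (Wv + Z + D)%VS by apply: subvP (addvSl _ _) _ (subvP (addvSl _ _) _ wW).
  rewrite memvD //; have : root (inl (Some b)) \in roots.
    by apply: imset_f; move: bN; rewrite !inE => /andP[].
  case: (root (inl (Some b))) => [[b'|]|y] h.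
  - by apply: subvP (addvSr _ _) _ _; apply/memv_span/map_f; rewrite mem_enum inE.
  - exact: mem0v.
  apply: subvP (addvSl _ _) _ (subvP (addvSr _ _) _ _).
  by apply: memv_span; apply: (map_f (fun y => phi0 A (inr y))); rewrite mem_enum.
move=> h; have h2 : (\dim (Wv + Z + D) <= \dim Wv + \dim Z + \dim D)%N.
  by apply: leq_trans (dimv_add_leqif _ _).1 _; rewrite leq_add2r (dimv_add_leqif _ _).1.
move: c1 dW dZ dD h h2; clear; lia.
Qed.

End Classes.
End Count.

Section Template.
Variables (F : finFieldType) (hF : #|F| = 4%N) (al : F) (hal : al ^+ 2 = al + 1).
Variable (Phi : template F).
Hypothesis hP : forall M, conforms Phi M -> ratrep M.

(* [u] represents M by multiples of differences of r + 3 points spanning an r-dimensional space. *)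
Definition difference_rep (M : matroid) (X : vectType F) (u : M -> X) (P : finType) (phi : P -> X) (L : seq P) : Prop :=
  [/\ forall Y : {set M}, rk Y = \dim <<[seq u e | e in Y]>>, uniq (map phi L), size L = (rank M + 3)%N,
     forall o, o \in L -> \dim <<[seq phi p - phi o | p <- L]>> = rank M &
     (forall e, exists p q c, [/\ p \in L, q \in L, c != 0 & u e = c *: (phi p - phi q)]) /\
     ((exists o t s s', [/\ {subset [:: o; t; s; s'] <= L} & T2rel al phi o t s s']) \/
      (exists o t s t' s', [/\ {subset [:: o; t; s; t'; s'] <= L} & Grel al phi o t s t' s']))].

Let D := (#|tC Phi| + 2 * #|tY1 Phi| + 1)%N.
Let R := (D * D * 8 + D * 20 + #|tY0 Phi| * 2 + 30)%N.

(** Elements correspond to pairs of points in a common class modulo [U], up to the boundedly many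
    from [Y0]. By [excess] the class sizes have bounded total, so the quadratic count forces one
    class of at least r + 3 points, and [points_structure] forbids more. *)
Lemma template_extremal (M : matroid) (B0 : finType) (A0 : B0 -> M -> F) :
  (forall X, rk X = column_rk A0 X) -> simple M -> conforms Phi (rmat A0) -> (R <= rank M)%N ->
  (ext_size (rank M) <= #|M|)%N ->
  exists (X : vectType F) (u : M -> X) (P : finType) (phi : P -> X) (L : seq P), difference_rep u phi L.
Proof.
move=> hA0 sM cM; set r := rank M => hR big.
have [B' [E' [A [g [hA gi tw0]]]]] := template_embed (@Rep_rmat _ _ _ A0) cM.
pose P : finType := (option B' + tY1 Phi)%type.
pose phi (p : P) := kil (Cspan A) (phi0 A p).
pose u (e : M) := telt A (g e).
have hu (Y : {set M}) : rk Y = \dim <<[seq u e | e in Y]>> by rewrite hA0; apply: (twin_dim (enum Y) tw0).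
have [W [psi [xi tw]]] := template_points hF hal hP hA.
have u0 e : u e != 0.
  apply/negP => /eqP e0; have := hu [set e]; rewrite (rk1 sM) => h.
  have : (\dim <<[seq u e | e in [set e]]>> <= 0)%N.
    rewrite leqn0 dimv_eq0 -subv0; apply/span_subvP => _ /imageP[x + ->].
    by rewrite inE => /eqP ->; rewrite e0 mem0v.
  by rewrite -h.
have upar e e' c : u e = c *: u e' -> e = e'.
  move=> ec; apply/eqP/negPn/negP => ne; have := hu [set e; e']; rewrite (rk2 sM) // => h.
  have : (\dim <<[seq u e | e in [set e; e']]>> <= \dim <[u e']>)%N.
    apply: dimvS; apply/span_subvP => _ /imageP[x + ->]; rewrite !inE => /orP[] /eqP ->; last exact: memv_line.
    by rewrite ec memvZ ?memv_line.
  by rewrite -h dim_vline; case: (_ != _).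
pose U := <<[seq u e | e in [set: M]]>>%VS.
have dU : \dim U = r by rewrite -hu.
have uU e : u e \in U by apply/memv_span/image_f; rewrite inE.
pose rp p := odflt p [pick q | phi q == phi p].
have rpE p : phi (rp p) = phi p by rewrite /rp; case: pickP => //= q /eqP.
have rp_eq p q : phi p = phi q -> rp p = rp q.
  move=> pq; rewrite /rp (eq_pick (_ : _ =1 (fun x => phi x == phi q))); last by move=> x /=; rewrite pq.
  by case: pickP => // /(_ p); rewrite pq eqxx.
pose Rp := rp @: [set: P].
have Rp_inj p q : p \in Rp -> q \in Rp -> phi p = phi q -> p = q.
  by case/imsetP=> a _ -> /imsetP[b _ ->]; rewrite !rpE => /rp_eq.
pose isr (x : tY0 Phi + E') := if x is inr _ then true else false.
have pqex (e : M) : exists pq : P * P, isr (g e) -> [/\ pq.1 \in Rp, pq.2 \in Rp & u e = phi pq.1 - phi pq.2].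
  rewrite /u; case: (g e) => [z|e'] /=; first by exists (inl None, inl None).
  have [p [q h]] := telt_phi hF hal hP e' hA; exists (rp p, rp q) => _.
  by split; rewrite /= ?rpE ?h //; apply: imset_f; rewrite inE.
have [pq hpq] := fin_all_exists pqex.
pose M1 : {set M} := [set e : M | isr (g e)].
have cM1 : (#|M| <= #|M1| + #|tY0 Phi|)%N.
  rewrite -cardsT -(cardsID M1) setTI leq_add2l.
  pose pj (x : tY0 Phi + E') := if x is inl z then Some z else None.
  have inj : {in [set: M] :\: M1 &, injective (pj \o g)}.
    move=> e e'; rewrite !inE /isr /=; case ge: (g e) => [z|//]; case ge': (g e') => [z'|//] _ _ [zz].
    by apply: gi; rewrite ge ge' zz.
  rewrite -(card_in_imset inj); apply: leq_trans (_ : #|[set Some z | z : tY0 Phi]| <= _)%N; last first.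
    exact: leq_trans (leq_imset_card _ _) (max_card _).
  apply: subset_leq_card; apply/subsetP => _ /imsetP[e + ->]; rewrite !inE /isr /=.
  by case: (g e) => [z|//] _; apply: imset_f.
have M1P e : e \in M1 -> [/\ (pq e).1 \in Rp, (pq e).2 \in Rp, u e = phi (pq e).1 - phi (pq e).2, (pq e).1 != (pq e).2 &
    near A U (pq e).1 (pq e).2].
  rewrite inE => /hpq[h1 h2 h3]; split=> //; last by rewrite /near -h3.
  by apply: contraNneq (u0 e) => h; rewrite h3 h subrr.
pose N r' := #|fib A U Rp r'|.
have c2 : (#|M1| <= \sum_(r' in roots A U Rp) 'C(N r', 2))%N.
  rewrite -sum1_card (partition_big (fun e => root A U Rp (pq e).1) (mem (roots A U Rp))) /=; last first.
    by move=> e /M1P[h _ _ _ _]; apply: imset_f.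
  apply: leq_sum => r' _; rewrite -cards_draws sum1dep_card.
  pose h e := [set (pq e).1; (pq e).2].
  have hi : {in [set e | (e \in M1) && (root A U Rp (pq e).1 == r')] &, injective h}.
    move=> e e' /setIdP[eM _] /setIdP[e'M _] he.
    have [_ _ ue ne _] := M1P e eM; have [_ _ ue' ne' _] := M1P e' e'M.
    have /set2P[a1|a1] : (pq e).1 \in h e' by rewrite -he set21.
      have /set2P[a2|a2] : (pq e).2 \in h e' by rewrite -he set22.
        by rewrite a1 a2 eqxx in ne.
      by apply: (@upar e e' 1); rewrite scale1r ue ue' a1 a2.
    have /set2P[a2|a2] : (pq e).2 \in h e' by rewrite -he set22.
      by apply: (@upar e e' (-1)); rewrite scaleN1r ue ue' a1 a2 opprB.
    by rewrite a1 a2 eqxx in ne.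
  rewrite -(card_in_imset hi); apply: subset_leq_card; apply/subsetP => _ /imsetP[e + ->].
  case/setIdP=> eM /eqP er; have [p1 p2 _ ne nr] := M1P e eM.
  rewrite !inE cards2 ne andbT; apply/subsetP => x; rewrite !inE => /orP[] /eqP ->; rewrite ?p1 ?p2 -er //=.
  by rewrite (eq_root p1 nr).
have fg := @fib_gt0 F Phi B' E' A U Rp.
have ex := excess A U Rp; rewrite dU in ex.
have r0R : root A U Rp (rp (inl None)) \in roots A U Rp by apply/imset_f/imset_f; rewrite inE.
have [r1 r1R r1max] : exists2 r1, r1 \in roots A U Rp & forall r', r' \in roots A U Rp -> (N r' <= N r1)%N.
  by case: (arg_maxnP N r0R) => r1 h1 h2; exists r1.
have b1 := @sum_pairs1 _ (roots A U Rp) N (N r1) r1max.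
have esz := ext_sizeE r.
pose T := (\sum_(r' in roots A U Rp) (N r' - 1))%N; pose c := (\sum_(r' in roots A U Rp) 'C(N r', 2))%N.
have exT : (T <= r + D)%N := ex.
have r_gt0 : (0 < r)%N by apply: leq_trans hR; rewrite /R addn_gt0 orbT.
have {esz} esz : (2 * ext_size r + 4 = r * r + 5 * r)%N by case: esz => // r0; move: r_gt0; rewrite r0.
(* If all classes had fewer than r - D points, the pairs would number at most about r^2 / 2, without
   the linear term. *)
have N1 : (r <= N r1 + D)%N.
  rewrite leqNgt; apply/negP => lt; have : (N r1 * T <= N r1 * (r + D))%N by rewrite leq_mul2l exT orbT.
  exact: count_arith1 b1 lt c2 cM1 big esz hR.
have Tn : (N r1 - 1 <= T)%N by rewrite /T (bigD1 r1) //= leq_addr.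
have b2 := @sum_pairs2 _ (roots A U Rp) N fg r1 (T - (N r1 - 1)) r1R (esym (subnKC Tn)).
(* The other classes contribute only a constant, and r + 2 points give (r + 2)(r + 1) / 2 pairs,
   short of the required number by a linear amount. *)
have N3 : (r + 3 <= N r1)%N.
  rewrite leqNgt; apply/negP => lt.
  have q1 : (N r1 * (N r1 - 1) <= (r + 2) * (r + 1))%N by apply: leq_mul; move: lt; clear; lia.
  have q2 : ((T - (N r1 - 1)).+1 * (T - (N r1 - 1)) <= (2 * D + 2) * (2 * D + 1))%N.
    by apply: leq_mul; move: N1 exT; clear; lia.
  exact: count_arith2 b2 q1 q2 c2 cM1 big esz hR.
pose L := enum (fib A U Rp r1).
have LR p : p \in L -> (p \in Rp) /\ root A U Rp p = r1 by rewrite mem_enum inE => /andP[h /eqP].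
have szL : size L = N r1 by rewrite -cardE.
have [o oL] : exists o, o \in L.
  by have /card_gt0P[o oF] := fg _ r1R; exists o; rewrite mem_enum.
have uL : uniq (map phi L).
  rewrite map_inj_in_uniq ?enum_uniq // => p q /LR[pR _] /LR[qR _]; exact: Rp_inj.
have nearL p q : p \in L -> q \in L -> phi p - phi q \in U.
  move=> /LR[_ hp] /LR[_ hq]; apply: (@near_trans _ _ _ _ A U r1); first by rewrite -hp near_root.
  by rewrite near_sym -hq near_root.
pose Dv := <<[seq phi p - phi o | p <- L]>>%VS.
have DU : (Dv <= U)%VS by apply/span_subvP => _ /mapP[p pL ->]; apply: nearL.
have inD p : p \in L -> phi p - phi o \in Dv by move=> pL; apply: memv_span; apply: (map_f (fun p => phi p - phi o)).
(* [excess] is used a second time, with the span [Dv] of the class in place of [U]; the resulting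
   dimension is large enough for [points_structure]. *)
have d3 : (r + 2 - D <= \dim Dv)%N.
  have exD : (_ <= \dim Dv + D)%N := excess A Dv Rp; have oR := (LR o oL).1.
  have rD : root A Dv Rp o \in roots A Dv Rp by apply: imset_f.
  have sub : (N r1 <= #|fib A Dv Rp (root A Dv Rp o)|)%N.
    apply: subset_leq_card; apply/subsetP => p pF; have pL : p \in L by rewrite mem_enum.
    by rewrite inE (LR p pL).1 /= (eq_root (LR p pL).1 (inD p pL)) eqxx.
  have : (#|fib A Dv Rp (root A Dv Rp o)| - 1 <= \sum_(r' in roots A Dv Rp) (#|fib A Dv Rp r'| - 1))%N.
    by rewrite (bigD1 _ rD) /= leq_addr.
  by move: exD sub N3; clear; lia.
have d3' : (3 <= \dim Dv)%N by apply: leq_trans d3; case: (count_arith3 hR).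
have tw1 : twin (fun pq : P * P => phi pq.1 - phi pq.2) (fun pq : P * P => psi pq.1 - psi pq.2).
  exact: (twin_sub inl tw).
have [hsz hst] := points_structure hF hal tw1 oL uL d3'.
have dD : \dim Dv = r.
  by apply/eqP; rewrite eqn_leq -{1}dU dimvS //=; move: hsz N3; rewrite szL -/Dv; clear; lia.
have NE : N r1 = (r + 3)%N by apply/eqP; rewrite eqn_leq N3 -{1}dD -szL hsz.
have DE : Dv = U by apply/eqP; rewrite eqEdim DU dD dU /=.
exists _, u, P, phi, L; split=> //; first by rewrite szL NE.
  move=> o' o'L; rewrite -[rank M]/r -dD; congr (\dim _); apply/eqP; rewrite eqEsubv; apply/andP; split; apply/span_subvP => _ /mapP[p pL ->].
    by rewrite (sub_subr _ _ (phi o)) memvB ?inD.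
  have in' q : q \in L -> phi q - phi o' \in <<[seq phi p - phi o' | p <- L]>>%VS.
    by move=> qL; apply: memv_span; apply: (map_f (fun p => phi p - phi o')).
  by rewrite (sub_subr _ _ (phi o')) memvB ?in'.
split; last by apply: hst; rewrite szL NE -dD.
move=> e; case: (boolP [exists p : P, exists q : P, exists k : F, [&& p \in L, q \in L, k != 0 & u e == k *: (phi p - phi q)]]).
  by case/existsP=> p /existsP[q /existsP[k /and4P[h1 h2 h3 /eqP h4]]]; exists p, q, k.
(* Contract an element that is parallel to no difference: the r + 3 points stay distinct in rank r -
   1, against the bound of [points_structure]. This also covers the elements of [Y0]. *)
move=> H; exfalso.
have [i ie] : exists i, dfam phi (fun z => telt A (inl z)) i = u e.
  case: (boolP (isr (g e))) => [h|]; first by exists (inl (pq e)); rewrite /= -(let: And3 _ _ h' := hpq e h in h').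
  by rewrite /u; case: (g e) => [z|//] _; exists (inr z).
pose f := kil <<map (dfam phi (fun z => telt A (inl z))) [:: i]>>.
have kf : lker f = <[u e]>%VS by rewrite lker_kil /= ie span_seq1.
have tw2 := twin_contract_kil tw (lker_kil <<map (dfam phi (fun z => telt A (inl z))) [:: i]>>%VS).
pose phi' p := f (phi p); pose psi' p := kil <<map (dfam psi xi) [:: i]>> (psi p).
have tw3 : twin (fun pq : P * P => phi' pq.1 - phi' pq.2) (fun pq : P * P => psi' pq.1 - psi' pq.2).
  by apply: eq_twin (twin_sub inl tw2) => pq'; rewrite /= linearB.
have uL' : uniq (map phi' L).
  rewrite map_inj_in_uniq ?enum_uniq // => p q pL qL /eqP; rewrite -subr_eq0 -linearB -memv_ker kf => /vlineP[k hk].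
  apply: (Rp_inj p q (LR p pL).1 (LR q qL).1); apply/eqP; rewrite -subr_eq0 hk.
  case: (eqVneq k 0) => [->|k0]; first by rewrite scale0r.
  case/negP: H; apply/existsP; exists p; apply/existsP; exists q; apply/existsP; exists k^-1.
  by rewrite pL qL invr_eq0 k0 hk scalerA mulVf // scale1r eqxx.
have dD' : (\dim <<[seq phi' p - phi' o | p <- L]>>).+1 = r.
  have -> : <<[seq phi' p - phi' o | p <- L]>>%VS = (f @: Dv)%VS.
    by rewrite limg_span -map_comp; congr (<<_>>%VS); apply: eq_map => p; rewrite /= linearB.
  have := limg_ker_dim f Dv; rewrite kf dD => <-.
  by rewrite (capv_idPr _) ?dim_vline ?u0 // -memvE DE uU.
have [|+ _] := points_structure hF hal tw3 oL uL' _.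
  have [r30 _] := count_arith3 hR.
  by rewrite -ltnS dD'; apply: leq_trans r30.
by rewrite szL NE -dD'; move: (\dim _); clear; lia.
Qed.

End Template.

(** * The two extremal families *)

Lemma representable_twin (F K : fieldType) (B : finType) (M : matroid) (A : B -> M -> F) (W : vectType K) (w : M -> W) :
  (forall X, rk X = column_rk A X) -> twin (column A) w -> representable K M.
Proof.
move=> hA tw; pose bW := vbasis {:W}; exists 'I_(\dim {:W}), (fun i e => coord bW i (w e)) => X.
rewrite hA /column_rk /column_span (twin_dim (enum X) tw).
pose f (x : W) : {ffun 'I_(\dim {:W}) -> K^o} := [ffun i => coord bW i x].
have flin : linear f by move=> k x y; apply/ffunP => i; rewrite !ffunE linearP.
pose fm := GRing.isLinear.Build K W {ffun 'I_(\dim {:W}) -> K^o} _ f flin.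
pose f' := linfun (HB.pack f fm : {linear W -> {ffun 'I_(\dim {:W}) -> K^o}}).
have -> : [seq column (fun i e => coord bW i (w e)) e | e in X] = map f' (map w (enum X)).
  by rewrite -map_comp; apply: eq_map => e; rewrite /= lfunE; apply/ffunP => i; rewrite !ffunE.
rewrite -limg_span; have := limg_ker_dim f' <<map w (enum X)>>%VS.
have -> : lker f' = 0%VS.
  apply/eqP/lker0P => x y; rewrite !lfunE => /ffunP h.
  rewrite (coord_vbasis (memvf x)) (coord_vbasis (memvf y)); apply: eq_bigr => i _; congr (_ *: _).
  by have := h i; rewrite !ffunE.
by rewrite capv0 dimv0 add0n => ->.
Qed.

(** * Matroids of all differences, independently of the field *)

Section Transport.
Variables (F K : fieldType) (k : nat) (G J : finType).
Variables (gF : G -> 'I_k -> F) (gK : G -> 'I_k -> K).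

(* Points: the gain points in the first k coordinates, and one new coordinate for each element of J. *)
Definition gpt (L : fieldType) (g : G -> 'I_k -> L) (x : G + J) : {ffun 'I_k + J -> L^o} :=
  match x with inl y => [ffun i => match i with inl a => g y a | inr _ => 0 end]
             | inr j => [ffun i => (i == inr j)%:R] end.

Definition gdiff (L : fieldType) (g : G -> 'I_k -> L) (e : (G + J) * (G + J)) := gpt g e.1 - gpt g e.2.

Definition gval (L : fieldType) (g : G -> 'I_k -> L) (mu : 'I_k -> L) y : L := \sum_a mu a * g y a.

(** [mu] is the part of a functional acting on the gain coordinates. A pair of distinct values has
    to be kept apart by a map [h] between the fields that carries the values on the gain points
    again to values of a linear form. *)
Definition separated (L L' : fieldType) (g : G -> 'I_k -> L) (g' : G -> 'I_k -> L') := forall mu (u v : L), u != v ->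
  exists mu' : 'I_k -> L', exists2 h : L -> L', forall y, h (gval g mu y) = gval g' mu' y & h u != h v.

(** A functional on differences is a potential on the points. Applying [h] to all potentials keeps
    equal values equal, remains linear on the gain points by [separated], and is unrestricted on the
    points of [J], each of which has its own coordinate. *)
Lemma gdiff_mem (L L' : fieldType) (g : G -> 'I_k -> L) (g' : G -> 'I_k -> L') e s : separated g' g ->
  gdiff g e \in <<map (gdiff g) s>>%VS -> gdiff g' e \in <<map (gdiff g') s>>%VS.
Proof.
move=> sep /span_annP h; apply/span_annP => f hf fs.
pose mu a := f (delta L' (inl a)); pose lam j := f (delta L' (inr j)).
pose val' (x : G + J) := match x with inl y => gval g' mu y | inr j => lam j end.
have fE x : f (gpt g' x) = val' x.
  rewrite (functional_delta _ hf) big_sumType /=; case: x => [y|j] /=.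
    rewrite [X in _ + X]big1 ?addr0 => [|j _]; last by rewrite ffunE mul0r.
    by apply: eq_bigr => a _; rewrite ffunE mulrC.
  rewrite [X in X + _]big1 ?add0r => [|a _]; last by rewrite ffunE mul0r.
  rewrite (bigD1 j) //= ffunE eqxx mul1r big1 ?addr0 // => j' jj'.
  by rewrite ffunE (_ : (inr j' == inr j) = (j' == j)) // (negPf jj') mul0r.
have fd e' : f (gdiff g' e') = val' e'.1 - val' e'.2.
  by rewrite /gdiff functionalD // -scaleN1r functionalZ // mulN1r !fE.
rewrite fd; apply/eqP; rewrite subr_eq0; apply/negPn/negP => ne.
have [mu' [hh hE hne]] := sep mu _ _ ne.
pose f' (x : {ffun 'I_k + J -> L^o}) : L := \sum_a (x (inl a) : L) * mu' a + \sum_j (x (inr j) : L) * hh (lam j).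
have hf' : functional f'.
  move=> c x y; rewrite /f' mulrDr addrACA !mulr_sumr -!big_split /=; congr (_ + _); apply: eq_bigr => i _.
    by rewrite !ffunE mulrDl mulrA.
  by rewrite !ffunE mulrDl mulrA.
have fE' x : f' (gpt g x) = hh (val' x).
  rewrite /f'; case: x => [y|j] /=.
    rewrite [X in _ + X]big1 ?addr0 => [|j _]; last by rewrite ffunE mul0r.
    by rewrite hE; apply: eq_bigr => a _; rewrite ffunE mulrC.
  rewrite [X in X + _]big1 ?add0r => [|a _]; last by rewrite ffunE mul0r.
  rewrite (bigD1 j) //= ffunE eqxx mul1r big1 ?addr0 // => j' jj'.
  by rewrite ffunE (_ : (inr j' == inr j) = (j' == j)) // (negPf jj') mul0r.
have fd' e' : f' (gdiff g e') = hh (val' e'.1) - hh (val' e'.2).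
  by rewrite /gdiff functionalD // -scaleN1r functionalZ // mulN1r !fE'.
have := h f' hf'; rewrite fd' => H; case/eqP: hne; apply/eqP; rewrite -subr_eq0; apply/eqP/H.
move=> _ /mapP[e' e's ->]; rewrite fd'; apply/eqP; rewrite subr_eq0; apply/eqP; congr hh.
by apply/eqP; rewrite -subr_eq0 -fd fs // map_f.
Qed.

Lemma gdiff_twin : separated gF gK -> separated gK gF -> twin (gdiff gF) (gdiff gK).
Proof. by move=> s1 s2 e s; apply/idP/idP; apply: gdiff_mem. Qed.

End Transport.

Lemma separate_values (L L' : fieldType) (G : finType) (val : G -> L) (val' : G -> L') (u v : L) :
  (forall y z, val y = val z -> val' y = val' z) -> u != v ->
  (forall y z, u = val y -> v = val z -> val' y != val' z) ->
  exists2 h : L -> L', forall y, h (val y) = val' y & h u != h v.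
Proof.
move=> hc uv hs; pose pk x := [pick y | val y == x].
(* If [u] or [v] is not attained, its image is free and is placed one away from the image of the
   other. *)
pose hu : L' := if pk v is Some z then val' z + 1 else 0.
pose hv : L' := if pk u is Some y then val' y + 1 else 1.
pose h x : L' := if pk x is Some y then val' y else if x == u then hu else hv.
have hy y : h (val y) = val' y.
  by rewrite /h /pk; case: pickP => [z /eqP|/(_ y)]; [apply: hc|rewrite eqxx].
have n1 (x : L') : x != x + 1 by rewrite -subr_eq0 opprD addrA subrr sub0r oppr_eq0 oner_eq0.
have vu : (v == u) = false by rewrite eq_sym (negPf uv).
exists h => //; rewrite /h /hu /hv /pk.
case: (pickP (fun y => val y == u)) => [y /eqP yu|nu]; case: (pickP (fun y => val y == v)) => [z /eqP zv|nv].
- exact: hs.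
- by rewrite vu n1.
- by rewrite eqxx eq_sym n1.
by rewrite eqxx vu eq_sym oner_eq0.
Qed.

Lemma separate_lists (L L' : fieldType) (G : finType) (idx : G -> nat) (s : seq L) (s' : seq L') (u v : L) :
  uniq s -> uniq s' -> size s = size s' -> (forall y, (idx y < size s)%N) -> u != v ->
  exists2 h : L -> L', forall y, h (s`_(idx y)) = s'`_(idx y) & h u != h v.
Proof.
move=> us us' ss hi uv; apply: separate_values => // [y z /eqP|y z uE vE].
  by rewrite nth_uniq ?hi // => /eqP ->.
by rewrite nth_uniq -?ss ?hi //; apply: contraNneq uv => i; rewrite uE vE i.
Qed.

Section GainMatroid.
Variables (L : fieldType) (k n : nat) (G Tp : finType) (g : G -> 'I_k -> L) (tau : Tp -> 'I_k -> L).

(** Directions between gain points, differences of a free point and a gain point, and differences of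
    two free points. *)
Definition gidx : finType := (Tp + 'I_n * G + edge n)%type.

Definition gvec (x : gidx) : {ffun 'I_k + 'I_n -> L^o} := match x with
  | inl (inl a) => [ffun i => match i with inl b => tau a b | inr _ => 0 end]
  | inl (inr (j, y)) => gpt g (inr j) - gpt g (inl y)
  | inr e => gpt g (inr (sval e).1) - gpt g (inr (sval e).2) end.

Definition gmx (i : 'I_k + 'I_n) (x : gidx) : L := gvec x i.

Definition GM : matroid := column_matroid gmx.

Lemma column_GM x : column gmx x = gvec x.
Proof. by apply/ffunP => i; rewrite ffunE. Qed.

Lemma rk_GM (X : {set GM}) : rk X = \dim <<[seq gvec x | x in X]>>.
Proof.
have -> : [seq gvec x | x in X] = [seq column gmx x | x in X].
  by apply: eq_map => x; rewrite column_GM.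
by [].
Qed.

Lemma card_edge : #|edge n| = 'C(n, 2).
Proof.
rewrite card_sig -bin2_sum big_mkord -sum1_card.
rewrite -(pair_big_dep xpredT (fun i j : 'I_n => (i < j)%N) (fun _ _ => 1%N)) /=.
rewrite (exchange_big_dep xpredT) //=; apply: eq_bigr => j _.
have inj : injective (widen_ord (ltnW (ltn_ord j))) by move=> x y /(congr1 val) /= /val_inj.
rewrite sum1dep_card -[RHS](card_ord j) -(card_imset _ inj).
apply: eq_card => i; rewrite !inE; apply/idP/imsetP => [ij|[i' _ ->]]; last exact: (ltn_ord i').
by exists (Ordinal ij) => //; apply: val_inj.
Qed.

Lemma card_GM : #|GM| = (#|Tp| + n * #|G| + 'C(n, 2))%N.
Proof. by rewrite !card_sum card_prod card_ord card_edge. Qed.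

Lemma gvec_inr x j : gvec x (inr j) = match x with inl (inl _) => 0 | inl (inr (j', _)) => (j == j')%:R
   | inr e => (j == (sval e).1)%:R - (j == (sval e).2)%:R end :> L.
Proof. by case: x => [[a|[j' y]]|e]; rewrite /= !ffunE ?subr0. Qed.

Hypothesis tau_par : forall a a' c, (forall b, tau a b = c * tau a' b) -> a = a'.
Hypothesis tau_nz : forall a, exists b, tau a b != 0.
Hypothesis g_inj : forall y y', g y =1 g y' -> y = y'.

Lemma gvec_par x y c : gvec x = c *: gvec y -> x = y.
Proof.
move=> h; have hr j : gvec x (inr j) = c * gvec y (inr j) :> L by rewrite h ffunE.
have hl b : gvec x (inl b) = c * gvec y (inl b) :> L by rewrite h ffunE.
have ene (e : edge n) : (sval e).1 != (sval e).2 by apply/negP => /eqP E; have := valP e; rewrite /= E ltnn.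
have nz (e : edge n) j : (j == (sval e).1)%:R - (j == (sval e).2)%:R != 0 :> L = ((j == (sval e).1) || (j == (sval e).2)).
  case: (eqVneq j (sval e).1) => [->|_] /=; first by rewrite (negPf (ene e)) subr0 oner_eq0.
  by rewrite sub0r oppr_eq0; case: (j =P (sval e).2) => _ /=; rewrite ?oner_eq0 ?eqxx.
case: x y h hr hl => [[a|[j y]]|e] [[a'|[j' y']]|e'] h hr hl.
- congr (inl (inl _)); apply: (tau_par (c := c)) => b; by have := hl b; rewrite !ffunE.
- have := hr j'; rewrite !gvec_inr eqxx mulr1 => c0; have [b] := tau_nz a.
  by have := hl b; rewrite -c0 mul0r ffunE => ->; rewrite eqxx.
- have := hr (sval e').1; rewrite !gvec_inr eqxx (negPf (ene e')) subr0 mulr1 => c0; have [b] := tau_nz a.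
  by have := hl b; rewrite -c0 mul0r ffunE => ->; rewrite eqxx.
- by have := hr j; rewrite !gvec_inr eqxx mulr0 => /eqP; rewrite oner_eq0.
- have := hr j; rewrite !gvec_inr eqxx; case: eqP => [<-|_]; last by rewrite mulr0 => /eqP; rewrite oner_eq0.
  rewrite mulr1 => c1; congr (inl (inr (_, _))); apply: g_inj => b.
  by have := hl b; rewrite -c1 mul1r !ffunE /= !sub0r => /oppr_inj.
- have ne' : ((sval e').2 == (sval e').1) = false by rewrite eq_sym; apply: negPf; apply: ene.
  have := hr (sval e').1; have := hr (sval e').2; rewrite !gvec_inr !eqxx (negPf (ene e')).
  rewrite ne' subr0 sub0r mulr1 mulrN1 => h2 h1.
  case: (eqVneq (sval e').2 j) h2 => [e2|_] h2; case: (eqVneq (sval e').1 j) h1 => [e1|_] h1.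
  + by move: (ene e'); rewrite e1 e2 eqxx.
  + by move: h2; rewrite -h1 oppr0 => /eqP; rewrite oner_eq0.
  + by move: h2; rewrite -h1 => /esym/eqP; rewrite oppr_eq0 oner_eq0.
  have := hr j; rewrite gvec_inr eqxx -h1 mul0r => /eqP; by rewrite oner_eq0.
- have := hr (sval e).1; rewrite !gvec_inr eqxx (negPf (ene e)) subr0 mulr0 => /eqP; by rewrite oner_eq0.
- have h1 := hr (sval e).1; have h2 := hr (sval e).2; rewrite !gvec_inr !eqxx (negPf (ene e)) subr0 in h1.
  have ne' : ((sval e).2 == (sval e).1) = false by rewrite eq_sym; apply: negPf; apply: ene.
  rewrite !gvec_inr eqxx ne' sub0r in h2.
  case: (eqVneq (sval e).1 j') h1 => [e1|_] h1; last by move/eqP: h1; rewrite mulr0 oner_eq0.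
  case: (eqVneq (sval e).2 j') h2 => [e2|_] h2; last by move/eqP: h2; rewrite mulr0 oppr_eq0 oner_eq0.
  by move: (ene e); rewrite e1 e2 eqxx.
congr inr; have c0 : c != 0.
  apply/negP => /eqP c0; have := hr (sval e).1; rewrite !gvec_inr eqxx (negPf (ene e)) subr0 c0 mul0r => /eqP.
  by rewrite oner_eq0.
have sE j : ((j == (sval e).1) || (j == (sval e).2)) = ((j == (sval e').1) || (j == (sval e').2)).
  by have := hr j; rewrite -!nz !gvec_inr => ->; rewrite mulf_eq0 (negPf c0).
apply: val_inj; have := sE (sval e).1; have := sE (sval e).2; rewrite !eqxx orbT /=.
have := valP e; have := valP e'; rewrite /=; case: (sval e) (sval e') => [i j] [i' j'] /= l' l.
case/esym/orP=> /eqP e2 /esym/orP[] /eqP e1; move: l; rewrite e1 e2 ?ltnn // => l.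
by have := ltn_trans l l'; rewrite ltnn.
Qed.

Lemma GM_simple : simple GM.
Proof.
have g0 x : gvec x != 0.
  apply/negP => /eqP h; case: x h => [[a|[j y]]|e] h.
  - have [b /negP] := tau_nz a; apply; have := congr1 (fun f : {ffun 'I_k + 'I_n -> L^o} => f (inl b)) h.
    by rewrite !ffunE => ->.
  - have := gvec_inr (inl (inr (j, y))) j; rewrite h ffunE eqxx => /eqP; by rewrite eq_sym oner_eq0.
  have ne : ((sval e).1 == (sval e).2) = false by apply/negP => /eqP E; have := valP e; rewrite /= E ltnn.
  have := gvec_inr (inr e) (sval e).1; rewrite h ffunE eqxx ne subr0 => /eqP.
  by rewrite eq_sym oner_eq0.
move=> X; rewrite leq_eqVlt => /orP[/cards2P[x [y [xy ->]]]|].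
  rewrite rk_GM cards2 xy.
  have -> : <<[seq gvec x0 | x0 in [set x; y]]>>%VS = <<[:: gvec x; gvec y]>>%VS.
    apply: eq_span => v; rewrite !inE; apply/imageP/orP => [[z]|].
      by rewrite !inE => /orP[] /eqP -> ->; [left|right].
    by case=> /eqP ->; [exists x|exists y]; rewrite ?inE ?eqxx ?orbT.
  rewrite dim_span_cons span_seq1 dim_vline g0 (_ : _ \notin _) //; apply/negP => /vlineP[c /gvec_par E].
  by rewrite E eqxx in xy.
rewrite ltnS leq_eqVlt => /orP[/cards1P[x ->]|].
  rewrite rk_GM cards1 (_ : [seq _ | _ in _] = [:: gvec x]) ?span_seq1 ?dim_vline ?g0 //.
  by rewrite /image_mem enum_set1.
rewrite ltnS leqn0 cards_eq0 => /eqP ->; rewrite rk_GM cards0 (_ : [seq _ | _ in _] = [::]) ?span_nil ?dimv0 //.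
by rewrite /image_mem enum_set0.
Qed.

Lemma GM_rank (y0 : G) (tp0 : 'I_k -> Tp) : (forall b, g y0 b = 0) -> (forall b b', tau (tp0 b) b' = (b' == b)%:R) ->
  rank GM = (k + n)%N.
Proof.
move=> h0 ht; rewrite /rank rk_GM.
have -> : <<[seq gvec x | x in [set: GM]]>>%VS = fullv.
  apply/eqP; rewrite eqEsubv subvf /=; apply/subvP => f _; rewrite [f]ffun_delta; apply: memv_suml => i _; apply: memvZ.
  case: i => [b|j].
    have -> : delta L (inl b) = gvec (inl (inl (tp0 b))).
      by apply/ffunP => -[b'|j]; rewrite !ffunE ?ht.
    by apply/memv_span/image_f; rewrite inE.
  have -> : delta L (inr j) = gvec (inl (inr (j, y0))).
    by apply/ffunP => -[b'|j']; rewrite !ffunE ?h0 subr0.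
  by apply/memv_span/image_f; rewrite inE.
by rewrite dimvf /dim /= card_sum !card_ord muln1.
Qed.

End GainMatroid.

Lemma GM_representable (F K : fieldType) (k n : nat) (G Tp : finType) (gF : G -> 'I_k -> F) (gK : G -> 'I_k -> K)
  (tau : Tp -> 'I_k -> F) : separated gF gK -> separated gK gF ->
  (forall a, exists y z c, c != 0 /\ forall b, tau a b = c * (gF y b - gF z b)) -> representable K (GM n gF tau).
Proof.
move=> s1 s2 ht.
have hx (x : gidx n G Tp) : exists pq : (G + 'I_n) * (G + 'I_n), exists2 c, c != 0 & gvec gF tau x = c *: gdiff gF pq.
  case: x => [[a|[j y]]|e].
  - have [y [z [c [c0 h]]]] := ht a; exists (inl y, inl z), c => //.
    by apply/ffunP => -[b|j]; rewrite !ffunE /= ?h // subrr scaler0.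
  - by exists (inr j, inl y), 1; rewrite ?oner_neq0 // scale1r.
  by exists (inr (sval e).1, inr (sval e).2), 1; rewrite ?oner_neq0 // scale1r.
have [pq hpq] := fin_all_exists hx.
apply: (@representable_twin F K _ (GM n gF tau) (gmx gF tau) _ (fun x => gdiff gK (pq x)) (fun _ => erefl)).
apply: (twin_scaleE _ _ (twin_sub pq (gdiff_twin s1 s2))) => x; last exact: scale1P.
by have [c c0 h] := hpq x; exists c => //; rewrite column_GM h.
Qed.

(** Choosing for each element of [M] a parallel vector of [N] is injective by simplicity and
    preserves ranks since [h] has no kernel; equal sizes make it bijective. *)
Lemma embed_iso (F : fieldType) (M N : matroid) (V W : vectType F) (u : M -> V) (w : N -> W) (h : 'Hom(W, V)) :
  (forall X : {set M}, rk X = \dim <<[seq u e | e in X]>>) -> (forall X : {set N}, rk X = \dim <<[seq w e | e in X]>>) ->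
  simple M -> lker h = 0%VS -> (forall e, exists x c, c != 0 /\ u e = c *: h (w x)) ->
  (#|M| <= #|N|)%N /\ ((#|N| <= #|M|)%N -> isomorphic M N).
Proof.
move=> hM hN sM k0 hx.
have [f hf] := fin_all_exists hx.
have fi : injective f.
  move=> e e' ee; apply/eqP/negPn/negP => ne.
  have := hM [set e; e']; rewrite (rk2 sM) // => h2.
  have : (\dim <<[seq u e | e in [set e; e']]>> <= \dim <[h (w (f e))]>)%N.
    apply: dimvS; apply/span_subvP => _ /imageP[x + ->]; rewrite !inE => /orP[] /eqP ->.
      by have [c [_ ->]] := hf e; rewrite memvZ ?memv_line.
    by have [c [_ ->]] := hf e'; rewrite -ee memvZ ?memv_line.
  by rewrite -h2 dim_vline; case: (_ != _).
split; first exact: leq_card fi.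
move=> le; exists f; first exact: inj_card_bij.
move=> X; rewrite hM hN.
have -> : <<[seq w x | x in [set f e | e in X]]>>%VS = <<[seq w (f e) | e in X]>>%VS.
  apply: eq_span => v; apply/mapP/mapP => -[x].
    by rewrite mem_enum => /imsetP[e eX ->] ->; exists e; rewrite ?mem_enum.
  by rewrite mem_enum => eX ->; exists (f x); rewrite ?mem_enum ?imset_f.
have -> : <<[seq u e | e in X]>>%VS = (h @: <<[seq w (f e) | e in X]>>)%VS.
  rewrite limg_span -map_comp; apply/eqP; rewrite eqEsubv; apply/andP.
  split; apply/span_subvP => _ /mapP[e eX ->]; have [c [c0 E]] := hf e.
    by rewrite E memvZ // memv_span // (map_f (fun e => h (w (f e)))).
  have hE : h (w (f e)) = c^-1 *: u e by rewrite E scalerA mulVf ?scale1r.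
  by rewrite /= hE memvZ // memv_span // map_f.
by have := limg_ker_dim h <<[seq w (f e) | e in X]>>%VS; rewrite k0 capv0 dimv0 add0n => ->.
Qed.

Section Config.
Variables (F : fieldType) (k n : nat) (G Tp : finType) (g : G -> 'I_k -> F) (tau : Tp -> 'I_k -> F).
Hypothesis g_tau : forall y y', y != y' -> exists a c, c != 0 /\ forall b, g y b - g y' b = c * tau a b.

Lemma gdiff_gvec (x x' : G + 'I_n) : x != x' ->
  exists z c, c != 0 /\ gpt g x - gpt g x' = c *: gvec g tau z.
Proof.
case: x x' => [y|j] [y'|j'] ne.
- have [|a [c [c0 h]]] := g_tau (y := y) (y' := y'); first by apply: contraNneq ne => ->.
  by exists (inl (inl a)), c; split=> //; apply/ffunP => -[b|j]; rewrite !ffunE ?h // subrr scaler0.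
- by exists (inl (inr (j', y))), (-1); rewrite oppr_eq0 oner_eq0 scaleN1r opprB.
- by exists (inl (inr (j, y'))), 1; rewrite oner_eq0 scale1r.
case: (ltngtP j j') => [lt|lt|/val_inj E]; last by rewrite E eqxx in ne.
  by exists (inr (exist _ (j, j') lt : edge n)), 1; rewrite oner_eq0 scale1r.
by exists (inr (exist _ (j', j) lt : edge n)), (-1); rewrite oppr_eq0 oner_eq0 scaleN1r opprB.
Qed.

Variables (M : matroid) (X : vectType F) (u : M -> X) (P : finType) (phi : P -> X) (L : seq P).
Hypothesis hu : forall Y : {set M}, rk Y = \dim <<[seq u e | e in Y]>>.
Hypothesis sM : simple M.
Hypothesis uL : uniq (map phi L).
Hypothesis huL : forall e, exists p q c, [/\ p \in L, q \in L, c != 0 & u e = c *: (phi p - phi q)].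
Variables (cfg : G -> P) (tv : 'I_k -> X) (o : P).
Hypothesis cfg_inj : injective cfg.
Hypothesis cfg_L : forall y, cfg y \in L.
Hypothesis cfg_g : forall y, phi (cfg y) - phi o = \sum_b g y b *: tv b.
Hypothesis szL : size L = (#|G| + n)%N.
Hypothesis dimL : \dim <<[seq phi p - phi o | p <- L]>> = (k + n)%N.

(** The points of [L] outside the configuration serve as the [n] free points. The dimension of [L]
    makes the induced linear map injective, and every element of [M] is then parallel to a vector of
    [GM n g tau]. *)
Lemma config_embed : (#|M| <= #|GM n g tau|)%N /\ ((#|GM n g tau| <= #|M|)%N -> isomorphic M (GM n g tau)).
Proof.
pose S := {ffun 'I_k + 'I_n -> F^o}.
have uL0 : uniq L := map_uniq uL.
pose Rr := [seq p <- L | p \notin codom cfg].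
have szR : size Rr = n.
  have : perm_eq [seq p <- L | p \in codom cfg] (codom cfg).
    apply: uniq_perm; rewrite ?filter_uniq ?(map_inj_uniq cfg_inj) ?enum_uniq // => p.
    by rewrite mem_filter andb_idr // => /codomP[y ->].
  move/perm_size; rewrite size_codom size_filter => c1.
  have := count_predC (fun p => p \in codom cfg) L; rewrite c1 szL => /addnI.
  by rewrite -size_filter.
pose vr j := phi (nth o Rr j) - phi o.
pose h (f : S) : X := \sum_b (f (inl b) : F) *: tv b + \sum_(j < n) (f (inr j) : F) *: vr j.
have hlin : linear h.
  move=> c x y; rewrite /h scalerDr addrACA !scaler_sumr -!big_split /=; congr (_ + _); apply: eq_bigr => i _.
    by rewrite !ffunE scalerDl scalerA.
  by rewrite !ffunE scalerDl scalerA.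
pose hm := GRing.isLinear.Build F S X _ h hlin.
pose h' := linfun (HB.pack h hm : {linear S -> X}).
have h'E x : h' x = h x by rewrite lfunE.
have hg y : h (gpt g (inl y)) = phi (cfg y) - phi o.
  rewrite cfg_g /h [X in _ + X]big1 ?addr0 => [|j _]; last by rewrite ffunE scale0r.
  by apply: eq_bigr => b _; rewrite ffunE.
have hj (j : 'I_n) : h (gpt g (inr j)) = vr j.
  rewrite /h [X in X + _]big1 ?add0r => [|b _]; last by rewrite ffunE scale0r.
  rewrite (bigD1 j) //= ffunE eqxx scale1r big1 ?addr0 // => j' jj'.
  by rewrite ffunE (_ : (inr j' == inr j) = (j' == j)) // (negPf jj') scale0r.
have hp p : p \in L -> exists x : G + 'I_n, h (gpt g x) = phi p - phi o.
  move=> pL; case: (boolP (p \in codom cfg)) => [/codomP[y ->]|np]; first by exists (inl y).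
  have pR : p \in Rr by rewrite mem_filter np.
  have lt : (index p Rr < n)%N by rewrite -szR index_mem.
  by exists (inr (Ordinal lt)); rewrite hj /vr nth_index.
have k0 : lker h' = 0%VS.
  have dS : \dim {:S} = (k + n)%N by rewrite dimvf /dim /= card_sum !card_ord muln1.
  have := limg_ker_dim h' fullv; rewrite capfv dS.
  have : (k + n <= \dim (h' @: fullv))%N.
    rewrite -dimL; apply: dimvS; apply/span_subvP => _ /mapP[p pL ->]; have [x <-] := hp p pL.
    by rewrite -h'E memv_img // memvf.
  by move=> le E; apply/eqP; rewrite -dimv_eq0; move: le E; clear; lia.
have H := @embed_iso F M (GM n g tau) X S u (gvec g tau) h' hu (fun Y => rk_GM Y) sM k0; apply: H => e.
have [p [q [c [pL qL c0 ue]]]] := huL e.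
have [x hx] := hp p pL; have [x' hx'] := hp q qL.
have ne : x != x'.
  apply/negP => /eqP E; have u0 : u e = 0.
    by rewrite ue (sub_subr _ _ (phi o)) -hx -hx' E subrr scaler0.
  have := hu [set e]; rewrite (rk1 sM) (_ : [seq _ | _ in _] = [:: u e]) ?span_seq1 ?dim_vline ?u0 ?eqxx //.
  by rewrite /image_mem enum_set1 /= u0.
have [z [c' [c'0 E]]] := gdiff_gvec ne.
exists z, (c * c'); split; first by rewrite mulf_neq0.
by rewrite ue (sub_subr _ _ (phi o)) -hx -hx' -!h'E -linearB E linearZ scalerA.
Qed.

End Config.

Section Gains.
Variable L : fieldType.

Definition T2gain (a b : L) (y : 'I_4) (_ : 'I_1) : L := [:: 0; 1; a; b]`_y.
Definition T2top (_ : 'I_1) (_ : 'I_1) : L := 1.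
Definition Ggain (a : L) (y : 'I_5) (i : 'I_2) : L :=
  (nth [::] [:: [:: 0; 0]; [:: 1; 0]; [:: a; 0]; [:: 0; 1]; [:: 0; a]] y)`_i.
Definition Gtop (a : L) (y : 'I_5) (i : 'I_2) : L :=
  (nth [::] [:: [:: 1; 0]; [:: 0; 1]; [:: 1; 1]; [:: 1; a]; [:: 1; a ^+ 2]] y)`_i.

Lemma gval2 (G : finType) (g : G -> 'I_2 -> L) mu y : gval g mu y = mu ord0 * g y ord0 + mu ord_max * g y ord_max.
Proof.
rewrite /gval big_ord_recr big_ord1 /= (_ : widen_ord _ _ = ord0) //; exact: val_inj.
Qed.

Lemma gval1 (G : finType) (g : G -> 'I_1 -> L) mu y : gval g mu y = mu ord0 * g y ord0.
Proof. by rewrite /gval big_ord1. Qed.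

End Gains.

(** On a line a linear form is either constant or injective on the four points, so only their
    distinctness matters. *)
Lemma T2_separated (L L' : fieldType) (a b : L) (a' b' : L') : uniq [:: 0; 1; a; b] -> uniq [:: 0; 1; a'; b'] ->
  separated (T2gain a b) (T2gain a' b').
Proof.
move=> us us' mu u v uv; case: (eqVneq (mu ord0) 0) => [m0|m0].
  exists (fun=> 0); apply: (separate_values (val := gval (T2gain a b) mu)) => // [y z|y z].
    by rewrite !gval1 !mul0r.
  by move=> u0 v0; move: uv; rewrite u0 v0 !gval1 m0 !mul0r eqxx.
have [||h hE huv] := @separate_lists L L' 'I_4 (fun y => val y) [seq mu ord0 * x | x <- [:: 0; 1; a; b]] [:: 0; 1; a'; b'] u v _ us' erefl _ uv.
- by rewrite map_inj_uniq //; apply: mulfI.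
- by move=> y; rewrite size_map; apply: ltn_ord.
exists (fun=> 1); exists h => // y; rewrite !gval1 mul1r /T2gain -hE; congr h.
by rewrite (nth_map 0) // ltn_ord.
Qed.

Lemma uniq_pow (L : fieldType) (a m : L) : a != 0 -> a != 1 -> a != -1 -> m != 0 ->
  uniq [seq m * x | x <- [:: 0; 1; a; a ^+ 2]].
Proof.
move=> a0 a1 a2 m0; rewrite map_inj_uniq; last exact: mulfI.
rewrite /= !inE !negb_or !(eq_sym 0) oner_eq0 a0 expf_eq0 /= a0 !(eq_sym 1) a1 sqrf_eq1 (negPf a1) (negPf a2) /=.
by rewrite expr2 -{1}(mulr1 a) (inj_eq (mulfI a0)) eq_sym a1.
Qed.

(** The values are 0, m1, m1 a, m2, m2 a. Coincidences occur only if some m vanishes or if m1 = m2,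
    m2 = m1 a or m1 = m2 a; in each case the values are multiples of 0, 1, a, a^2, and the same form
    with [a'] has the same pattern. *)
Lemma G_separated (L L' : fieldType) (a : L) (a' : L') : a != 0 -> a != 1 -> a != -1 -> a' != 0 -> a' != 1 -> a' != -1 ->
  separated (Ggain a) (Ggain a').
Proof.
move=> a0 a1 a2 a0' a1' a2' mu u v uv.
have sep idx mu' m : m != 0 -> (forall y : 'I_5, (nth 0 idx y < 4)%N) ->
    (forall y, gval (Ggain a) mu y = m * [:: 0; 1; a; a ^+ 2]`_(nth 0%N idx y)) ->
    (forall y, gval (Ggain a') mu' y = [:: 0; 1; a'; a' ^+ 2]`_(nth 0%N idx y)) ->
    exists mu' : 'I_2 -> L', exists2 h : L -> L', forall y, h (gval (Ggain a) mu y) = gval (Ggain a') mu' y & h u != h v.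
  move=> m0 hi h1 h2.
  have us := uniq_pow a0 a1 a2 m0; have := uniq_pow a0' a1' a2' (oner_neq0 _).
  rewrite (eq_map (_ : _ =1 id)) ?map_id => [us'|x]; last by rewrite mul1r.
  have [h hE huv] := @separate_lists L L' 'I_5 (fun y => nth 0%N idx y) _ _ u v us us' erefl hi uv.
  by exists mu', h => // y; rewrite h2 -hE h1; congr h; rewrite (nth_map 0) // hi.
pose mk (x y : L') : 'I_2 -> L' := fun i => [:: x; y]`_i.
have c5 (Q : 'I_5 -> Prop) : Q (Ordinal (isT : 0 < 5)%N) -> Q (Ordinal (isT : 1 < 5)%N) -> Q (Ordinal (isT : 2 < 5)%N) ->
    Q (Ordinal (isT : 3 < 5)%N) -> Q (Ordinal (isT : 4 < 5)%N) -> forall y, Q y.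
  by move=> q0 q1 q2 q3 q4 [[|[|[|[|[|//]]]]] i]; rewrite (bool_irrelevance i isT).
set m1 := mu ord0; set m2 := mu ord_max.
have slv : ((m1 == 0) && (m2 == 0)) || ((m1 == 0) && (m2 != 0)) || ((m1 != 0) && (m2 == 0)) || ((m1 != 0) && (m2 != 0)).
  by case: (m1 == 0); case: (m2 == 0).
case: (eqVneq m1 0) => [z1|z1]; case: (eqVneq m2 0) => [z2|z2].
- exists (mk 0 0); apply: (separate_values (val := gval (Ggain a) mu)) => // y z.
    by rewrite !gval2 /= !mul0r.
  by rewrite !gval2 -/m1 -/m2 z1 z2 !mul0r addr0 => E1 E2; move: uv; rewrite E1 E2 eqxx.
- apply: (sep [:: 0; 0; 0; 1; 2]%N (mk 0 1) m2 z2); first by apply: c5.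
    by apply: c5; rewrite gval2 -/m1 -/m2 z1 /Ggain /=; ring.
  by apply: c5; rewrite gval2 /mk /Ggain /=; ring.
- apply: (sep [:: 0; 1; 2; 0; 0]%N (mk 1 0) m1 z1); first by apply: c5.
    by apply: c5; rewrite gval2 -/m1 -/m2 z2 /Ggain /=; ring.
  by apply: c5; rewrite gval2 /mk /Ggain /=; ring.
case: (eqVneq m1 m2) => [e12|e12].
  apply: (sep [:: 0; 1; 2; 1; 2]%N (mk 1 1) m1 z1); first by apply: c5.
    by apply: c5; rewrite gval2 -/m1 -/m2 -e12 /Ggain /=; ring.
  by apply: c5; rewrite gval2 /mk /Ggain /=; ring.
case: (eqVneq m2 (m1 * a)) => [e2|e2].
  apply: (sep [:: 0; 1; 2; 2; 3]%N (mk 1 a') m1 z1); first by apply: c5.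
    by apply: c5; rewrite gval2 -/m1 -/m2 e2 /Ggain /=; ring.
  by apply: c5; rewrite gval2 /mk /Ggain /=; ring.
case: (eqVneq m1 (m2 * a)) => [e1|e1].
  apply: (sep [:: 0; 2; 3; 1; 2]%N (mk a' 1) m2 z2); first by apply: c5.
    by apply: c5; rewrite gval2 -/m1 -/m2 e1 /Ggain /=; ring.
  by apply: c5; rewrite gval2 /mk /Ggain /=; ring.
(* Without coincidences any [mu'] is compatible; it only has to separate the two points where [u]
   and [v] are attained, and one of the two coordinate forms does. *)
have vi : injective (gval (Ggain a) mu).
  pose s := [:: 0; m1; m1 * a; m2; m2 * a].
  have us : uniq s.
    rewrite /s /= !inE !negb_or !(eq_sym 0) !mulf_eq0 (negPf z1) (negPf z2) (negPf a0) /= e12 e1.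
    rewrite (inj_eq (mulIf a0)) e12 (eq_sym (m1 * a)) e2 -{1}(mulr1 m1) (inj_eq (mulfI z1)) eq_sym a1 /=.
    by rewrite -{1}(mulr1 m2) (inj_eq (mulfI z2)) eq_sym a1.
  have vE y : gval (Ggain a) mu y = s`_y.
    by move: y; apply: c5; rewrite gval2 -/m1 -/m2 /Ggain /=; ring.
  by move=> y z; rewrite !vE => /eqP; rewrite nth_uniq // => /eqP/val_inj.
have gen (mu' : 'I_2 -> L') : (forall y z, u = gval (Ggain a) mu y -> v = gval (Ggain a) mu z -> gval (Ggain a') mu' y != gval (Ggain a') mu' z) ->
    exists mu' : 'I_2 -> L', exists2 h : L -> L', forall y, h (gval (Ggain a) mu y) = gval (Ggain a') mu' y & h u != h v.
  move=> hs; exists mu'; apply: (separate_values (val := gval (Ggain a) mu)) => // y z /vi -> //.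
case: (pickP (fun y => gval (Ggain a) mu y == u)) => [y /eqP yu|nu]; last first.
  by apply: (gen (mk 0 0)) => y z uE; have := nu y; rewrite uE eqxx.
case: (pickP (fun y => gval (Ggain a) mu y == v)) => [z /eqP zv|nv]; last first.
  by apply: (gen (mk 0 0)) => y' z _ vE; have := nv z; rewrite vE eqxx.
have yz : y != z by apply: contraNneq uv => E; rewrite -yu -zv E.
have U y' z' mu' : gval (Ggain a') mu' y != gval (Ggain a') mu' z -> u = gval (Ggain a) mu y' -> v = gval (Ggain a) mu z' ->
    gval (Ggain a') mu' y' != gval (Ggain a') mu' z'.
  by rewrite -yu -zv => H /vi <- /vi <-.
case: (eqVneq (gval (Ggain a') (mk 1 0) y) (gval (Ggain a') (mk 1 0) z)) => [E1|ne]; last by apply: (gen (mk 1 0)) => y' z'; apply: U.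
apply: (gen (mk 0 1)) => y' z'; apply: U; move: yz E1.
have n0 : (0 == 1 :> L') = false by rewrite eq_sym oner_eq0.
have n1 : (0 == a' :> L') = false by rewrite eq_sym (negPf a0').
have n2 : (1 == a' :> L') = false by rewrite eq_sym (negPf a1').
clear zv yu; move: z; apply: (c5 _); move: y; apply: (c5 _); rewrite !gval2 /mk /Ggain /= ?eqxx // ?(mul0r, mulr0, mul1r, mulr1, add0r, addr0) => _ /eqP;
  by rewrite ?n0 ?n1 ?n2 ?(negPf a0') ?(negPf a1') ?oner_eq0 // => _; rewrite ?n0 ?n1 ?n2 ?(negPf a0') ?(negPf a1') ?oner_eq0.
Qed.

Lemma iso_sym M N : isomorphic M N -> isomorphic N M.
Proof.
case=> f [g fK gK] hf; exists g; first by exists f.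
move=> Y; rewrite -hf -imset_comp; congr rk.
by rewrite (eq_imset (g := id)) ?imset_id // => y /=; rewrite gK.
Qed.

Lemma iso_trans M N Q : isomorphic M N -> isomorphic N Q -> isomorphic M Q.
Proof.
case=> f bf hf [g bg hg]; exists (g \o f); first exact: bij_comp.
by move=> X; rewrite imset_comp hg hf.
Qed.

Lemma iso_card M N : isomorphic M N -> #|M| = #|N|.
Proof. by case=> f bf _; apply: bij_eq_card bf. Qed.

Lemma iso_rank M N : isomorphic M N -> rank M = rank N.
Proof.
case=> f [g fK gK] hf; rewrite /rank -hf; congr rk; apply/setP => y; rewrite inE.
by apply/imsetP; exists (g y); rewrite ?gK.
Qed.

Lemma iso_simple M N : isomorphic M N -> simple M -> simple N.
Proof.
case/iso_sym=> g bg hg sM Y hY; have ig := bij_inj bg.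
by rewrite -hg sM card_imset.
Qed.

Lemma iso_representable (K : fieldType) M N : isomorphic M N -> representable K M -> representable K N.
Proof.
case/iso_sym=> g bg hg [B [A hA]]; exists B, (fun b x => A b (g x)) => Y; rewrite -hg hA.
rewrite /column_rk; congr (\dim _); apply: eq_span => v; apply/mapP/mapP => -[x].
  by rewrite mem_enum => /imsetP[y yY ->] ->; exists y; rewrite ?mem_enum //; apply/ffunP => b; rewrite !ffunE.
rewrite mem_enum => xY ->; exists (g x); first by rewrite mem_enum imset_f.
by apply/ffunP => b; rewrite !ffunE.
Qed.

Lemma at_least_notin (K : eqType) q (s : seq K) : at_least q K -> (size s < q)%N -> exists x, x \notin s.
Proof.
case=> l [ul <-] lt; case: (boolP (all (mem s) l)) => [/allP h|/allPn[x _ xs]]; last by exists x.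
by move: lt; rewrite ltnNge (uniq_leq_size ul h).
Qed.

Section Families.
Variables (F : finFieldType) (hF : #|F| = 4%N) (al : F) (hal : al ^+ 2 = al + 1).

Let a0 : al != 0 := f4_a0 hal.
Let a1 : al != 1 := f4_a1 hF hal.
Let opp (x : F) : - x = x := f4_opp hF hal x.
Let aN1 : al != -1. Proof. by rewrite opp. Qed.
Let a3 : al * al ^+ 2 = 1.
Proof.
have dbl : al + al = 0 by rewrite -{1}(opp al) addNr.
by rewrite hal mulrDr mulr1 -expr2 hal addrAC dbl add0r.
Qed.
Let us4 : uniq [:: 0; 1; al; al ^+ 2].
Proof.
have := uniq_pow a0 a1 aN1 (oner_neq0 F); rewrite (eq_map (_ : _ =1 id)) ?map_id // => x.
exact: mul1r.
Qed.

Let fs : (((0 == 1 :> F) = false) * ((1 == 0 :> F) = false) * ((0 == al) = false) * ((al == 0) = false) *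
  ((0 == al ^+ 2) = false) * ((al ^+ 2 == 0) = false) * ((1 == al) = false) * ((al == 1) = false) *
  ((1 == al ^+ 2) = false) * ((al ^+ 2 == 1) = false) * ((al == al ^+ 2) = false) * ((al ^+ 2 == al) = false))%type.
Proof.
move: us4; rewrite /= !inE !negb_or !andbT => /and3P[/and3P[n1 n2 n3] /andP[n4 n5] n6].
by rewrite ![(1 == 0)]eq_sym ![(al == 0)]eq_sym ![(al ^+ 2 == 0)]eq_sym ![(al == 1)]eq_sym ![(al ^+ 2 == 1)]eq_sym ![(al ^+ 2 == al)]eq_sym
  !(negPf n1, negPf n2, negPf n3, negPf n4, negPf n5, negPf n6).
Qed.

Definition T2gm n : matroid := GM n (T2gain al (al ^+ 2)) (@T2top F).
Definition GG n : matroid := GM n (Ggain al) (Gtop al).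

Lemma ne_edge n (e : edge n) : ((sval e).1 == (sval e).2) = false.
Proof. by apply/negP => /eqP E; have := valP e; rewrite /= E ltnn. Qed.

Lemma edge_col n (e : edge n) (j : 'I_n) : (j == (sval e).1)%:R - (j == (sval e).2)%:R = Dmx F j e.
Proof.
rewrite /Dmx; case: (eqVneq j (sval e).1) => [->|_] /=; first by rewrite ne_edge subr0.
by case: (j == _); rewrite ?sub0r ?subrr.
Qed.

Lemma T2gain_inj y y' : T2gain al (al ^+ 2) y =1 T2gain al (al ^+ 2) y' -> y = y'.
Proof. by move=> /(_ ord0)/eqP; rewrite /T2gain nth_uniq // => /eqP/val_inj. Qed.

Lemma GT_simple n : simple (T2gm n).
Proof.
apply: GM_simple; first by move=> a a' _ _; rewrite (ord1 a) (ord1 a').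
  by move=> a; exists ord0; rewrite oner_eq0.
exact: T2gain_inj.
Qed.

Lemma GT_rank n : rank (T2gm n) = n.+1.
Proof.
rewrite (GM_rank n (y0 := ord0) (tp0 := id)) //.
by move=> b b'; rewrite (ord1 b) (ord1 b') eqxx.
Qed.

Lemma GT_card n : #|T2gm n| = ext_size n.+1.
Proof.
rewrite /T2gm card_GM !card_ord; have := bin2x n; have [h|//] := ext_sizeE n.+1.
by move: h; case: n => [|n]; rewrite ?subSS ?subn0; move: (ext_size _) 'C(_, _) => x y; clear; lia.
Qed.

Lemma GT_AF4 n : AF4 (T2gm n).
Proof.
move=> K hK; have [|a ha] := at_least_notin (s := [:: 0; 1]) hK; first by [].
have [|b hb] := at_least_notin (s := [:: 0; 1; a]) hK; first by [].
have us : uniq [:: 0; 1; a; b].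
  move: ha hb; rewrite /= !inE !negb_or => /andP[h1 h2] /and3P[h3 h4 h5].
  by rewrite (eq_sym 0) oner_eq0 (eq_sym 0) h1 (eq_sym 0) h3 (eq_sym 1) h2 (eq_sym 1) h4 eq_sym h5.
apply: (@GM_representable F K 1 n 'I_4 'I_1 (T2gain al (al ^+ 2)) (T2gain a b) (@T2top F)); try exact: T2_separated.
move=> t; exists (Ordinal (isT : 1 < 4)%N), ord0, 1; split; first exact: oner_neq0.
by move=> b'; rewrite /T2gain /= subr0 mulr1.
Qed.

Lemma lker_id (V : vectType F) : lker (\1%VF : 'End(V)) = 0%VS.
Proof. by apply/eqP/lker0P => x y; rewrite !id_lfunE. Qed.

Lemma GT_T2 n : isomorphic (T2gm n) (T2 al n.+1).
Proof.
have cT : #|T2 al n.+1| = (1 + (n.+1 - 1) + ('C(n.+1 - 1, 2) + ((n.+1 - 1) + ((n.+1 - 1) + (n.+1 - 1)))))%N.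
  by rewrite !card_sum !card_ord card_edge.
have E : (n.+1 - 1 = n)%N by rewrite subn1.
have G : isomorphic (T2gm (n.+1 - 1)) (T2 al n.+1); last by move: G; rewrite E.
have H := @embed_iso F (T2gm (n.+1 - 1)) (T2 al n.+1) _ _ (gvec (T2gain al (al ^+ 2)) (@T2top F)) (column (@T2mx F al n.+1)) \1%VF
  (fun X => rk_GM X) (fun X => erefl) (@GT_simple _) (lker_id _).
have [|_] := H; last by apply; rewrite cT /T2gm card_GM !card_ord; move: (n.+1 - 1)%N 'C(_, _); clear; lia.
move=> x; suff [e he] : exists e : T2 al n.+1, gvec (T2gain al (al ^+ 2)) (@T2top F) x = column (@T2mx F al n.+1) e.
  by exists e, 1; rewrite oner_eq0 scale1r id_lfunE.
case: x => [[a|[j y]]|e].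
- exists (inl (inl a)); apply/ffunP => -[b|j]; rewrite !ffunE /ident_mat //=.
  by rewrite /ident_mat (ord1 a) (ord1 b) eqxx.
- case: y => -[|[|[|[|//]]]] i.
  + exists (inl (inr j)); apply/ffunP => -[b|j']; rewrite !ffunE /ident_mat /T2gain /= ?subr0 //.
  + exists (inr (inr (inl j))); apply/ffunP => -[b|j']; rewrite !ffunE /ident_mat /T2gain /cst /= ?subr0 ?sub0r ?opp //.
  + exists (inr (inr (inr (inl j)))); apply/ffunP => -[b|j']; rewrite !ffunE /ident_mat /T2gain /cst /= ?subr0 ?sub0r ?opp //.
  exists (inr (inr (inr (inr j)))); apply/ffunP => -[b|j']; rewrite !ffunE /ident_mat /T2gain /cst /= ?subr0 ?sub0r ?opp //.
by exists (inr (inl e)); apply/ffunP => -[b|j]; rewrite !ffunE /cst /= ?subr0 // -edge_col.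
Qed.

Let o2 (b : 'I_2) : b = ord0 \/ b = ord_max.
Proof. by case: b => -[|[|//]] i; [left|right]; apply: val_inj. Qed.

Lemma Ggain_inj y y' : Ggain al y =1 Ggain al y' -> y = y'.
Proof.
move=> h; have h0 := h ord0; have h1 := h ord_max; apply: val_inj.
case: y y' h0 h1 {h} => -[|[|[|[|[|//]]]]] i [[|[|[|[|[|//]]]]] i']; rewrite /Ggain /= => /eqP h0 /eqP h1 //;
  by move: h0 h1; rewrite ?fs.
Qed.

Lemma Gtop_par a a' c : (forall b, Gtop al a b = c * Gtop al a' b) -> a = a'.
Proof.
move=> h; have : Gtop al a ord0 * Gtop al a' ord_max = Gtop al a ord_max * Gtop al a' ord0 by rewrite !h; ring.
move=> {h} h; apply: val_inj.
case: a a' h => -[|[|[|[|[|//]]]]] i [[|[|[|[|[|//]]]]] i']; rewrite /Gtop /= ?(mulr0, mul0r, mulr1, mul1r) => /eqP;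
  by rewrite ?fs.
Qed.

Lemma GG_simple n : simple (GG n).
Proof.
apply: GM_simple; first exact: Gtop_par; last exact: Ggain_inj.
move=> a; case: a => -[|[|[|[|[|//]]]]] i; first [by exists ord0; rewrite /Gtop /= oner_eq0|by exists ord_max; rewrite /Gtop /= oner_eq0].
Qed.

Lemma GG_rank n : rank (GG n) = n.+2.
Proof.
pose tp (b : 'I_2) : 'I_5 := widen_ord (isT : 2 <= 5)%N b.
rewrite /GG (GM_rank n (y0 := ord0) (tp0 := tp)) //; first by move=> b; have [->|->] := o2 b.
by move=> b b'; have [->|->] := o2 b; have [->|->] := o2 b'.
Qed.

Lemma GG_card n : #|GG n| = ext_size n.+2.
Proof.
rewrite /GG card_GM !card_ord; have := bin2x n; have [h|//] := ext_sizeE n.+2.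
by move: h; case: n => [|n]; rewrite ?subSS ?subn0; move: (ext_size _) 'C(_, _) => x y; clear; lia.
Qed.

(** Over GF(4) the ten differences of the five points fall into the five directions listed in
    [Gtop]; signs disappear in characteristic two. *)
Lemma Gain_top y y' : y != y' -> exists a c, c != 0 /\ forall b, Ggain al y b - Ggain al y' b = c * Gtop al a b.
Proof.
wlog lt : y y' / (y < y')%N => [W|] ne.
  case: (ltngtP y y') => [lt|lt|/val_inj E]; [exact: W| |by rewrite E eqxx in ne].
  have [|a [c [c0 h]]] := W y' y lt; first by rewrite eq_sym.
  by exists a, c; split=> // b; rewrite -h -[RHS]opp opprB.
have n1 : 1 - al != 0 by rewrite subr_eq0 eq_sym a1.
have o1 := oner_neq0 F.
pose t i (h : (i < 5)%N) : 'I_5 := Ordinal h.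
have fin a c : c != 0 -> Ggain al y ord0 - Ggain al y' ord0 = c * Gtop al a ord0 ->
   Ggain al y ord_max - Ggain al y' ord_max = c * Gtop al a ord_max ->
   exists a c, c != 0 /\ forall b, Ggain al y b - Ggain al y' b = c * Gtop al a b.
  by move=> c0 h1 h2; exists a, c; split=> // b; have [->|->] := o2 b.
have S x z : x = z -> x = z :> F by [].
case: y y' lt {ne} fin => -[|[|[|[|[|//]]]]] i [[|[|[|[|[|//]]]]] i'] //= _ fin.
- by apply: (fin (@t 0 isT) 1) => //; rewrite /Ggain /Gtop /= opp; ring.
- by apply: (fin (@t 0 isT) al) => //; rewrite /Ggain /Gtop /= opp; ring.
- by apply: (fin (@t 1 isT) 1) => //; rewrite /Ggain /Gtop /= opp; ring.
- by apply: (fin (@t 1 isT) al) => //; rewrite /Ggain /Gtop /= opp; ring.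
- by apply: (fin (@t 0 isT) (1 - al)) => //; rewrite /Ggain /Gtop /=; ring.
- by apply: (fin (@t 2 isT) 1) => //; rewrite /Ggain /Gtop /= opp; ring.
- by apply: (fin (@t 3 isT) 1) => //; rewrite /Ggain /Gtop /= opp; ring.
- apply: (fin (@t 4 isT) al) => //; rewrite /Ggain /Gtop /= ?opp; first ring.
  by rewrite a3 add0r.
- by apply: (fin (@t 2 isT) al) => //; rewrite /Ggain /Gtop /= opp; ring.
by apply: (fin (@t 1 isT) (1 - al)) => //; rewrite /Ggain /Gtop /=; ring.
Qed.

Lemma GG_AF4 n : AF4 (GG n).
Proof.
move=> K hK; have [|a] := at_least_notin (s := [:: 0; 1; -1]) hK; first by [].
rewrite !inE !negb_or => /and3P[h0 h1 h2].
apply: (@GM_representable F K 2 n 'I_5 'I_5 (Ggain al) (Ggain a) (Gtop al)); try exact: G_separated.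
pose t i (h : (i < 5)%N) : 'I_5 := Ordinal h.
have fin x y z c : c != 0 -> Gtop al x ord0 = c * (Ggain al y ord0 - Ggain al z ord0) ->
   Gtop al x ord_max = c * (Ggain al y ord_max - Ggain al z ord_max) ->
   exists y z c, c != 0 /\ forall b, Gtop al x b = c * (Ggain al y b - Ggain al z b).
  by move=> c0 e1 e2; exists y, z, c; split=> // b; have [->|->] := o2 b.
have o1 := oner_neq0 F.
move=> x; have [c [y [z [c0 e1 e2]]]] : exists c y z, [/\ c != 0, Gtop al x ord0 = c * (Ggain al y ord0 - Ggain al z ord0) &
   Gtop al x ord_max = c * (Ggain al y ord_max - Ggain al z ord_max)]; last exact: fin e1 e2.
case: x {fin} => -[|[|[|[|[|//]]]]] i.
- by exists 1, (@t 1 isT), (@t 0 isT); split=> //; rewrite /Ggain /Gtop /=; ring.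
- by exists 1, (@t 3 isT), (@t 0 isT); split=> //; rewrite /Ggain /Gtop /=; ring.
- by exists 1, (@t 1 isT), (@t 3 isT); split=> //; rewrite /Ggain /Gtop /= opp; ring.
- by exists 1, (@t 1 isT), (@t 4 isT); split=> //; rewrite /Ggain /Gtop /= opp; ring.
exists (al ^+ 2), (@t 2 isT), (@t 3 isT); split; first by rewrite expf_neq0.
  by rewrite /Ggain /Gtop /= subr0 mulrC a3.
by rewrite /Ggain /Gtop /= sub0r opp mulr1.
Qed.

Lemma GG_Gr n : isomorphic (GG n) (Gr al n.+2).
Proof.
set m := (n.+2 - 2)%N; have E : m = n by rewrite /m subn2.
have cT : #|Gr al n.+2| = (1 + (1 + m) + ('C(m, 2) + (m + (m + (m + (m + (1 + (1 + 1))))))))%N.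
  by rewrite !card_sum !card_ord card_edge.
have G : isomorphic (GG m) (Gr al n.+2); last by move: G; rewrite E.
pose S := {ffun 'I_1 + ('I_1 + 'I_m) -> F^o}; pose T := {ffun 'I_2 + 'I_m -> F^o}.
pose h (f : S) : T := [ffun i => match i with inl b => if b == ord0 then f (inl ord0) else f (inr (inl ord0)) | inr j => f (inr (inr j)) end].
have hlin : linear h.
  by move=> c x y; apply/ffunP => -[b|j]; rewrite !ffunE //; case: (b == ord0); rewrite ?ffunE.
pose hm := GRing.isLinear.Build F S T _ h hlin.
pose h' := linfun (HB.pack h hm : {linear S -> T}).
have h'E x : h' x = h x by rewrite lfunE.
have k0 : lker h' = 0%VS.
  apply/eqP/lker0P => x y; rewrite !h'E => /ffunP e; apply/ffunP => -[b|[b|j]].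
  - by have := e (inl ord0); rewrite !ffunE /= (ord1 b).
  - by have := e (inl ord_max); rewrite !ffunE /= (ord1 b).
  by have := e (inr j); rewrite !ffunE.
have H := @embed_iso F (GG m) (Gr al n.+2) T S (gvec (Ggain al) (Gtop al)) (column (@Gmx F al n.+2)) h'
  (fun X => rk_GM X) (fun X => erefl) (@GG_simple _) k0.
have [|_] := H; last by apply; rewrite cT /GG card_GM !card_ord; move: 'C(_, _); clear; lia.
move=> x; suff [e he] : exists e : Gr al n.+2, gvec (Ggain al) (Gtop al) x = h (column (@Gmx F al n.+2) e).
  by exists e, 1; rewrite oner_eq0 scale1r h'E.
have fin (z : T) (y : S) : z (inl ord0) = y (inl ord0) -> z (inl ord_max) = y (inr (inl ord0)) ->
    (forall j, z (inr j) = y (inr (inr j))) -> z = h y.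
  by move=> h0 h1 h2; apply/ffunP => -[b|j]; rewrite !ffunE //; have [->|->] := o2 b.
case: x => [[a|[j y]]|e].
- case: a => -[|[|[|[|[|//]]]]] i.
  + by exists (inl (inl ord0)); apply: fin => [||j]; rewrite !ffunE.
  + by exists (inl (inr (inl ord0))); apply: fin => [||j]; rewrite !ffunE.
  + by exists (inr (inr (inr (inr (inr (inr (inl ord0))))))); apply: fin => [||j]; rewrite !ffunE.
  + by exists (inr (inr (inr (inr (inr (inr (inr (inl ord0)))))))); apply: fin => [||j]; rewrite !ffunE.
  by exists (inr (inr (inr (inr (inr (inr (inr (inr ord0)))))))); apply: fin => [||j]; rewrite !ffunE.
- case: y => -[|[|[|[|[|//]]]]] i.
  + by exists (inl (inr (inr j))); apply: fin => [||j']; rewrite !ffunE /Ggain /= subr0.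
  + by exists (inr (inr (inl j))); apply: fin => [||j']; rewrite !ffunE /Ggain /= ?subr0 ?sub0r ?opp.
  + by exists (inr (inr (inr (inr (inl j))))); apply: fin => [||j']; rewrite !ffunE /Ggain /= ?subr0 ?sub0r ?opp.
  + by exists (inr (inr (inr (inl j)))); apply: fin => [||j']; rewrite !ffunE /Ggain /= ?subr0 ?sub0r ?opp.
  by exists (inr (inr (inr (inr (inr (inl j)))))); apply: fin => [||j']; rewrite !ffunE /Ggain /= ?subr0 ?sub0r ?opp.
by exists (inr (inl e)); apply: fin => [||j]; rewrite !ffunE /= ?subr0 // -edge_col.
Qed.

Lemma difference_iso (M : matroid) (X : vectType F) (u : M -> X) (P : finType) (phi : P -> X) L : simple M -> (2 <= rank M)%N -> difference_rep al u phi L ->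
  (#|M| <= ext_size (rank M))%N /\ ((ext_size (rank M) <= #|M|)%N -> isomorphic M (T2 al (rank M)) \/ isomorphic M (Gr al (rank M))).
Proof.
move=> sM r2 [hu uL szL dL [huL cf]].
have [n rE] : exists n, rank M = n.+2 by exists (rank M - 2)%N; move: r2; clear; lia.
rewrite rE in szL dL *.
case: cf => [[o [t [s [s' [sub [n1 e1 e2]]]]]]|[o [t [s [t' [s' [sub [n1 e1 e2 n2]]]]]]]].
  have oL : o \in L by apply: sub; rewrite mem_head.
  pose cfg (y : 'I_4) := nth o [:: o; t; s; s'] y; pose tv (_ : 'I_1) := phi t - phi o.
  have tv0 : phi t - phi o != 0 by rewrite subr_eq0; apply/eqP.
  have cL y : cfg y \in L by apply: sub; apply: mem_nth; apply: ltn_ord.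
  have cg y : phi (cfg y) - phi o = \sum_b T2gain al (al ^+ 2) y b *: tv b.
    rewrite big_ord1 /cfg /T2gain /tv; case: y => -[|[|[|[|//]]]] i /=.
    - by rewrite subrr scale0r.
    - by rewrite scale1r.
    - by rewrite e1.
    by rewrite e2.
  have ci : injective cfg.
    move=> y y' E; have := cg y; rewrite E cg !big_ord1 => /eqP; rewrite -subr_eq0 -scalerBl scaler_eq0 (negPf tv0) orbF.
    by rewrite subr_eq0 => /eqP E'; apply: T2gain_inj => b; rewrite (ord1 b).
  have tau y y' : y != y' -> exists a c, c != 0 /\ forall b : 'I_1, T2gain al (al ^+ 2) y b - T2gain al (al ^+ 2) y' b = c * T2top F a b.
    move=> ne; exists ord0, (T2gain al (al ^+ 2) y ord0 - T2gain al (al ^+ 2) y' ord0); split.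
      by rewrite subr_eq0; apply: contraNneq ne => E; apply/eqP; apply: T2gain_inj => b; rewrite (ord1 b).
    by move=> b; rewrite (ord1 b) mulr1.
  have [|c1 c2] := @config_embed F 1 n.+1 'I_4 'I_1 (T2gain al (al ^+ 2)) (@T2top F) tau M X u P phi L hu sM uL huL cfg tv o ci cL cg _ (dL o oL).
    by rewrite szL card_ord; clear; lia.
  by rewrite -GT_card; split=> // le; left; apply: iso_trans (c2 le) (GT_T2 _).
have oL : o \in L by apply: sub; rewrite mem_head.
pose cfg (y : 'I_5) := nth o [:: o; t; s; t'; s'] y.
pose tv (b : 'I_2) := if b == ord0 then phi t - phi o else phi t' - phi o.
have sumE (c : 'I_2 -> F) : \sum_b c b *: tv b = c ord0 *: (phi t - phi o) + c ord_max *: (phi t' - phi o).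
  by rewrite big_ord_recr big_ord1 /= (_ : widen_ord _ _ = ord0) //; apply: val_inj.
have tv0 : phi t - phi o != 0 by rewrite subr_eq0; apply/eqP.
have cL y : cfg y \in L by apply: sub; apply: mem_nth; apply: ltn_ord.
have cg y : phi (cfg y) - phi o = \sum_b Ggain al y b *: tv b.
  rewrite sumE /cfg /Ggain; case: y => -[|[|[|[|[|//]]]]] i /=; rewrite ?scale0r ?scale1r ?addr0 ?add0r ?subrr //.
have ci : injective cfg.
  move=> y y' E; have := cg y; rewrite E cg !sumE => /eqP; rewrite -subr_eq0 opprD addrACA -!scalerBl.
  set x := (Ggain al y' ord0 - Ggain al y ord0); set z := (Ggain al y' ord_max - Ggain al y ord_max) => /eqP h.
  have z0 : z = 0.
    apply/eqP/negPn/negP => z0; apply: (n2 (- (z^-1 * x))).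
    have := congr1 (fun v => z^-1 *: v) h; rewrite scaler0 scalerDr !scalerA mulVf // scale1r => /eqP.
    by rewrite addrC addr_eq0 => /eqP ->; rewrite scaleNr.
  move: h; rewrite z0 scale0r addr0 => /eqP; rewrite scaler_eq0 (negPf tv0) orbF => /eqP x0.
  apply: Ggain_inj => b; apply/eqP; rewrite eq_sym -subr_eq0; apply/eqP.
  by have [->|->] := o2 b.
have [|c1 c2] := @config_embed F 2 n 'I_5 'I_5 (Ggain al) (Gtop al) Gain_top M X u P phi L hu sM uL huL cfg tv o ci cL cg _ (dL o oL).
  by rewrite szL card_ord; clear; lia.
by rewrite -GG_card; split=> // le; right; apply: iso_trans (c2 le) (GG_Gr _).
Qed.

End Families.

(** * From the structural hypothesis to the extremal matroids *)

Lemma span_setU1 (F : fieldType) (V : vectType F) (E : finType) (v : E -> V) e (X : {set E}) :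
  <<[seq v x | x in e |: X]>>%VS = <<v e :: [seq v x | x in X]>>%VS.
Proof.
apply: eq_span => y; rewrite inE; apply/imageP/orP => [[x]|].
  by rewrite !inE => /orP[/eqP ->|xX] ->; [left|right; apply: image_f].
case=> [/eqP ->|/imageP[x xX ->]]; first by exists e; rewrite ?setU11.
by exists x => //; rewrite inE xX orbT.
Qed.

Lemma rank_twin (F K : fieldType) (V : vectType F) (W : vectType K) (E : finType) (v : E -> V) (w : E -> W) :
  (forall X : {set E}, \dim <<[seq v x | x in X]>> = \dim <<[seq w x | x in X]>>) -> twin v w.
Proof.
move=> h e s.
have aux (L : fieldType) (U : vectType L) (u : E -> U) : <<map u s>>%VS = <<[seq u x | x in [set x in s]]>>%VS.
  apply: eq_span => y; apply/mapP/imageP => -[x].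
    by move=> xs ->; exists x; rewrite ?inE.
  by rewrite inE => xs ->; exists x.
rewrite !aux; have := h (e |: [set x in s]); rewrite !span_setU1 !dim_span_cons h => /eqP.
by rewrite eqn_add2r; case: (v e \in _); case: (w e \in _).
Qed.

Lemma twin_inj (F : fieldType) (V W : vectType F) (E : Type) (u : E -> V) (h : 'Hom(V, W)) :
  lker h = 0%VS -> twin u (fun e => h (u e)).
Proof.
move=> k0 e s; rewrite (map_comp h u) -limg_span.
have inj : injective h by apply/lker0P; rewrite k0.
apply/idP/idP => [|/memv_imgP[y ys /inj ->] //]; exact: memv_img.
Qed.

Lemma row_twin (F : fieldType) (V : vectType F) (E : Type) (u : E -> V) : exists d, exists v : E -> 'rV[F]_d, twin u v.
Proof.
exists (\dim {:V}); pose f (x : V) : 'rV[F]_(\dim {:V}) := \row_i coord (vbasis {:V}) i x.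
have flin : linear f by move=> c x y; apply/rowP => i; rewrite !mxE linearP.
pose fm := GRing.isLinear.Build F V 'rV[F]_(\dim {:V}) _ f flin.
exists (fun e => linfun (HB.pack f fm : {linear V -> 'rV[F]_(\dim {:V})}) (u e)).
apply: twin_inj; apply/eqP/lker0P => x y; rewrite !lfunE => /rowP h.
rewrite (coord_vbasis (memvf x)) (coord_vbasis (memvf y)); apply: eq_bigr => i _; congr (_ *: _).
by have := h i; rewrite !mxE.
Qed.

Section SimpleVectors.
Variables (F : fieldType) (V : vectType F) (M : matroid) (u : M -> V).
Hypothesis hu : forall X : {set M}, rk X = \dim <<[seq u e | e in X]>>.
Hypothesis sM : simple M.

Lemma simple_nz e : u e != 0.
Proof.
apply/negP => /eqP e0; have := hu [set e]; rewrite (rk1 sM) => h.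
have : (\dim <<[seq u e | e in [set e]]>> <= 0)%N.
  rewrite leqn0 dimv_eq0 -subv0; apply/span_subvP => _ /imageP[x + ->].
  by rewrite inE => /eqP ->; rewrite e0 mem0v.
by rewrite -h.
Qed.

Lemma simple_par e e' c : u e = c *: u e' -> e = e'.
Proof.
move=> ec; apply/eqP/negPn/negP => ne; have := hu [set e; e']; rewrite (rk2 sM) // => h.
have : (\dim <<[seq u e | e in [set e; e']]>> <= \dim <[u e']>)%N.
  apply: dimvS; apply/span_subvP => _ /imageP[x + ->]; rewrite !inE => /orP[] /eqP ->; last exact: memv_line.
  by rewrite ec memvZ ?memv_line.
by rewrite -h dim_vline; case: (_ != _).
Qed.

End SimpleVectors.

Lemma simple_card_le (F : finFieldType) (M : matroid) : representable F M -> simple M -> (#|M| <= #|F| ^ rank M)%N.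
Proof.
move=> [B [A hA]] sM; pose U := <<[seq column A e | e in [set: M]]>>%VS.
have uU e : column A e \in U by apply/memv_span/image_f; rewrite inE.
pose f (e : M) : {ffun 'I_(\dim U) -> F} := [ffun i => coord (vbasis U) i (column A e)].
have fi : injective f.
  move=> e e' /ffunP E; apply: (simple_par hA sM (c := 1)); rewrite scale1r.
  rewrite (coord_vbasis (uU e)) (coord_vbasis (uU e')); apply: eq_bigr => i _; congr (_ *: _).
  by have := E i; rewrite !ffunE.
by have := leq_card f fi; rewrite card_ffun card_ord /rank hA.
Qed.

Lemma at_least_rat q : at_least q rat.
Proof.
exists [seq (i%:R : rat) | i <- iota 0 q]; rewrite size_map size_iota; split=> //.
by rewrite map_inj_uniq ?iota_uniq // => i j /eqP; rewrite eqr_nat => /eqP.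
Qed.

Section Final.
Variables (F : finFieldType) (hF : #|F| = 4%N) (al : F) (hal : al ^+ 2 = al + 1).

Lemma AF4_SL4 M : AF4 M -> SL4 F M.
Proof.
move=> h; split; last by exists 4%N => //; exists 2%N, 2%N.
by apply: h; exists (enum F); rewrite enum_uniq -cardE.
Qed.

Lemma Nv_card (d : nat) (M : matroid) (v : M -> 'rV[F]_d) :
  (forall X : {set M}, rk X = \dim <<[seq v e | e in X]>>) -> simple M -> (3 * #|M| <= #|Nv v :\ 0%R|)%N.
Proof.
move=> hv sM; have v0 := simple_nz hv sM.
pose f (ce : F * M) := ce.1 *: v ce.2; pose A := setX [set~ (0 : F)] [set: M].
have fi : {in A &, injective f}.
  move=> [c e] [c' e']; rewrite !inE /f /= !andbT => c0 c0' E.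
  have ee : e = e'.
    apply: (simple_par hv sM (c := c^-1 * c')); rewrite -scalerA -E scalerA mulVf ?scale1r //.
  subst e'; congr (_, _); apply/eqP; rewrite -subr_eq0.
  by move/eqP: E; rewrite -subr_eq0 -scalerBl scaler_eq0 (negPf (v0 e)) orbF.
have -> : (3 * #|M| = #|[set f x | x in A]|)%N by rewrite card_in_imset // cardsX cardsC1 hF cardsT.
apply: subset_leq_card; apply/subsetP => _ /imsetP[[c e] + ->]; rewrite !inE /f /= andbT => c0.
rewrite scaler_eq0 (negPf c0) (negPf (v0 e)) /=.
by apply/existsP; exists e; apply/existsP; exists c; rewrite c0 eqxx.
Qed.

Lemma spn_Nv (d : nat) (M : matroid) (v : M -> 'rV[F]_d) :
  (forall X : {set M}, rk X = \dim <<[seq v e | e in X]>>) -> (\dim (spn (Nv v)) <= rank M)%N.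
Proof.
move=> hv; rewrite /rank hv; apply: dimvS; apply/span_subvP => x; rewrite mem_enum => /NvP[e [c c0 ->]].
by apply/memvZ/memv_span/image_f; rewrite inE.
Qed.

Lemma clique_arith r K x y d : (2 * x + 4 = r * r + 5 * r)%N -> (K + 20 <= r)%N -> (x <= y)%N -> (d <= r)%N -> (d * d + K <= 3 * y)%N.
Proof. by move=> h1 h2 h3 h4; have := leq_mul h4 h4; move: h1 h2 h3; clear; nia. Qed.

(** The clique minor is available because 3 / 2 r^2 + O(r) vectors exceed the r^2 + K required by
    [clique_minor]; matroids below the extremal size satisfy the claim trivially. *)
Lemma SL4_connected : HypothesisB -> exists k R, forall M, SL4 F M -> simple M -> vertically_connected k M -> (R <= rank M)%N ->
  (#|M| <= ext_size (rank M))%N /\ ((ext_size (rank M) <= #|M|)%N -> isomorphic M (T2 al (rank M)) \/ isomorphic M (Gr al (rank M))).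
Proof.
move=> hB; have p2 : 2%N \in [pchar F] by rewrite inE /= (f4_two hF hal) eqxx.
(* Characteristic 2 and [m = 3]: the excluded geometry is PG(2,2), the Fano plane, which no
   rationally represented matroid has as a minor. *)
have [k [n [s [t [Phi [Psi [k0 [n0 [h1 _ h3 _]]]]]]]]] := hB F 2%N p2 3%N isT _ (@ratrep_minor_closed F).
have [K hK] := clique_minor hF hal n0.
pose Ri i := ((#|tC (Phi i)| + 2 * #|tY1 (Phi i)| + 1) * (#|tC (Phi i)| + 2 * #|tY1 (Phi i)| + 1) *
       8 + (#|tC (Phi i)| + 2 * #|tY1 (Phi i)| + 1) * 20 + #|tY0 (Phi i)| * 2 + 30)%N.
exists k, (\sum_i Ri i + (K + 20))%N => M [[B [A hA]] [q pq hq]] sM vM rM.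
case: (ltnP #|M| (ext_size (rank M))) => [lt|big].
  by split=> //; apply: ltnW.
have [B' [A' hA']] := hq rat (at_least_rat q).
have tw : twin (column A) (column A') by apply: rank_twin => X; have := hA X; rewrite hA' => /esym.
have RA := @Rep_rmat _ _ _ A.
have rep : ratrep (rmat A) by exists _, (column A'); apply: (Rep_twin RA tw).
have rkE (X : {set abs (rmat A)}) : rk X = @rk M X by rewrite (rk_abs X RA) hA.
have sM' : simple (abs (rmat A)) by move=> X hX; rewrite rkE; apply: sM.
have vM' : vertically_connected k (abs (rmat A)) by move=> X; rewrite /rank !rkE; apply: vM.
have [d [v tv]] := row_twin (column A).
have hv (X : {set M}) : rk X = \dim <<[seq v e | e in X]>> by rewrite hA; apply: (twin_dim (enum X) tv).
have tw' : twin v (column A') by move=> e l; rewrite -tv tw.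
have r20 : (K + 20 <= rank M)%N by apply: leq_trans rM; apply: leq_addl.
have hm : has_minor (abs (rmat A)) (MK n).
  apply: (@Kminor_has_minor F d n (abs (rmat A)) v); first by move=> X; rewrite rkE; apply: hv.
  apply: hK; [exact: Nv_scl|apply: (Nv_FFree (f4_two hF hal) _ tw'); by []|].
  have [h|r0] := ext_sizeE (rank M); last by move: r20; rewrite r0; clear; lia.
  by apply: leq_trans (Nv_card hv sM); apply: clique_arith h r20 big (spn_Nv hv).
have [i ci] := h3 _ rep sM' vM' hm (ratrep_no_fano rep).
have [|X [u [P [phi [L dr]]]]] := template_extremal hF hal (h1 i) hA sM ci _ big.
  by apply: leq_trans rM; apply: leq_trans (leq_addr _ _); rewrite (bigD1 i) //= leq_addr.
have r2 : (2 <= rank M)%N by apply: leq_trans r20; clear; lia.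
have [d1 d2] := difference_iso hF hal sM r2 dr.
by split=> // _; apply: d2.
Qed.

End Final.

Theorem theorem14p14 (F4 : finFieldType) (hF4 : #|F4| = 4%N)
    (alpha : F4) (halpha : alpha ^+ 2 = alpha + 1) (hB : HypothesisB) :
  exists r0 : nat, forall r : nat, (r0 <= r)%N ->
    [/\ forall M : matroid, extremal (SL4 F4) r M <->
          (isomorphic M (T2 alpha r) \/ isomorphic M (Gr alpha r)),
        forall M : matroid, extremal AF4 r M <->
          (isomorphic M (T2 alpha r) \/ isomorphic M (Gr alpha r)),
        is_h (SL4 F4) r ('C(r + 3, 2) - 5)%N &
        is_h AF4 r ('C(r + 3, 2) - 5)%N].
Proof.
have [k [R cl]] := SL4_connected hF4 halpha hB.
have Sr (M : matroid) (X : {set M}) : simple M -> SL4 F4 M -> SL4 F4 (restrict X).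
  move=> sM [h1 [q pq h2]]; split; first exact: representable_restrict.
  by exists q => // K hK; apply: representable_restrict => //; apply: h2.
have Se M : simple M -> SL4 F4 M -> (#|M| <= 4 ^ rank M)%N.
  by move=> sM [h1 _]; rewrite -hF4; apply: simple_card_le.
have [r1 gr] := growth Sr Se (fun M PM sM vM rM => (cl M PM sM vM rM).1).
exists (r1 + R + 2)%N => r rr.
have [n rE] : exists n, r = n.+2 by exists (r - 2)%N; move: rr; clear; lia.
have rr1 : (r1 <= r)%N by apply: leq_trans rr; rewrite -addnA leq_addr.
have rR : (R <= r)%N by apply: leq_trans rr; rewrite addnAC leq_addl.
have fam M : isomorphic M (T2 alpha r) \/ isomorphic M (Gr alpha r) ->
    [/\ AF4 M, simple M, rank M = r & #|M| = ext_size r].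
  case=> iM.
    have {}iM : isomorphic (T2gm alpha n.+1) M by apply: iso_trans (iso_sym iM); rewrite rE; apply: GT_T2.
    split; first by move=> K hK; apply: (iso_representable iM); apply: GT_AF4.
    - exact (iso_simple iM (@GT_simple F4 hF4 alpha halpha n.+1)).
    - by rewrite -(iso_rank iM) GT_rank rE.
    by rewrite -(iso_card iM) GT_card rE.
  have {}iM : isomorphic (GG alpha n) M by apply: iso_trans (iso_sym iM); rewrite rE; apply: GG_Gr.
  split; first by move=> K hK; apply: (iso_representable iM); apply: GG_AF4.
  - exact (iso_simple iM (@GG_simple F4 hF4 alpha halpha n)).
  - by rewrite -(iso_rank iM) GG_rank rE.
  by rewrite -(iso_card iM) GG_card rE.
have iT : isomorphic (T2 alpha r) (T2 alpha r).
  by apply: iso_trans (iso_sym _) _; last first; rewrite rE; apply: GT_T2.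
have [AT sT rT cT] := fam _ (or_introl iT).
have S4 M := @AF4_SL4 F4 hF4 M.
(* Any class between [AF4] and [SL4] is treated at once: the examples lie in the smaller class and
   the upper bound holds for the larger one. *)
have isQ (Q : matroid -> Prop) : (forall M, AF4 M -> Q M) -> (forall M, Q M -> SL4 F4 M) -> is_h Q r (ext_size r).
  move=> q1 q2; split.
    by exists (T2 alpha r); split=> //; [apply: q1|rewrite rT].
  by move=> M /q2 SM sM rM; have [] := gr M SM sM r rr1 rM.
have exQ (Q : matroid -> Prop) M : (forall M, AF4 M -> Q M) -> (forall M, Q M -> SL4 F4 M) -> extremal Q r M <->
    (isomorphic M (T2 alpha r) \/ isomorphic M (Gr alpha r)).
  move=> q1 q2; have hQ := isQ Q q1 q2; split.
    case=> QM sM rM; rewrite simple_flats // => -[_ hM].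
    have SM := q2 M QM; have le : (ext_size r <= #|M|)%N by rewrite -cT; apply: hM => //; [apply: q1|rewrite rT].
    have [|bM vM] := gr M SM sM r rr1; first by rewrite rM.
    (* Attaining the bound forces vertical connectivity, which is what makes the classification [cl]
       applicable. *)
    have vM' := vM rM (anti_leq (introT andP (conj bM le))).
    have [|_] := cl M SM sM vM'; rewrite rM //; exact.
  by move=> /fam[AM sM rM cM]; split=> //; [apply: q1|rewrite simple_flats // cM].
split; first by move=> M; apply: exQ.
- by move=> M; apply: exQ.
- exact: isQ.
exact: isQ.
Qed.
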